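(* Let $a\in\mathbb{R}$, let $\mathbf{A}(x)=\frac{a}{|x|^{2}}(x_{2},-x_{1})$ on $\mathbb{R}^2\setminus\{0\}$, $\nabla_{\mathbf{A}}=\nabla+i\mathbf{A}$, and let $\lambda>-\min_{n\in\mathbb{Z}}(n-a)^{2}$. For $p>2$ let $\mu_p(\lambda)$ be the optimal (largest) constant for which $$\int_{\mathbb{R}^{2}}|\nabla_{\mathbf{A}}u|^{2}\,dx+\lambda\int_{\mathbb{R}^{2}}\frac{|u|^{2}}{|x|^{2}}\,dx\geq \mu_{p}(\lambda)\left(\int_{\mathbb{R}^{2}}\frac{|u|^{p}}{|x|^{2}}\,dx\right)^{\frac{2}{p}}\qquad\text{for all } u\in \mathrm{H}_{\mathbf{A}}(\mathbb{R}^{2}).$$ Then $$\lim_{p\rightarrow\infty}p\,\mu_{p}(\lambda)=8\pi e.$$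
   Context: $\mathrm{H}_{\mathbf{A}}(\mathbb{R}^{2})=\{\psi\in L^{2}(\mathbb{R}^{2}): \nabla_{\mathbf{A}}\psi\in L^{2}(\mathbb{R}^{2})\}$ (complex-valued functions; $\nabla_{\mathbf{A}}\psi$ is understood in the distributional sense on $\mathbb{R}^2\setminus\{0\}$). It is known (Bonheure, Dolbeault, Esteban, Laptev, Loss) that for $\lambda>-\min_{n\in\mathbb{Z}}(n-a)^2$ and $p>2$ the displayed inequality holds with a positive optimal constant $\mu_p(\lambda)$. *)

(* Defs.v *)
From mathcomp Require Import all_boot all_order all_algebra.
From mathcomp Require Import all_classical all_reals all_analysis.
From mathcomp Require Import complex.
Set Implicit Arguments.
Unset Strict Implicit.
Unset Printing Implicit Defensive.
Import Order.TTheory GRing.Theory Num.Theory.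
Import numFieldNormedType.Exports.
Local Open Scope classical_set_scope.
Local Open Scope ring_scope.
Local Open Scope complex_scope.

Section magnetic.
Context {R : realType}.

Local Notation plane := (R * R)%type.

(* [plane] with the Borel sigma-algebra: the carrier is that of [plane]. *)
Local Notation mplane := (measurableTypeR R * measurableTypeR R)%type.

Local Notation leb2 := (@lebesgue_measure R \x @lebesgue_measure R)%E.

(* The library norm on [R * R] is the sup norm; this is the square of the
   Euclidean one. *)
Definition enorm2 (x : plane) : R := x.1 ^+ 2 + x.2 ^+ 2.

Definition cmod (z : R[i]) : R := Normc.normc z.

Definition cintegral (f : plane -> R[i]) : R[i] :=
  Rintegral leb2 setT (fun x => complex.Re (f x))
    +i* Rintegral leb2 setT (fun x => complex.Im (f x)).

Definition cmeasurable (f : plane -> R[i]) : Prop :=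
  measurable_fun [set: mplane] (fun x => complex.Re (f x)) /\
  measurable_fun [set: mplane] (fun x => complex.Im (f x)).

Definition L2 (f : plane -> R[i]) : Prop :=
  cmeasurable f /\ (\int[leb2]_x ((cmod (f x) ^+ 2)%:E) < +oo)%E.

Definition iter_derive (s : seq plane) (phi : plane -> R) : plane -> R :=
  foldr (fun v f x => 'D_v f x) phi s.

Definition smooth (phi : plane -> R) : Prop :=
  forall (s : seq plane) (x : plane), differentiable (iter_derive s phi) x.

Definition support_of (phi : plane -> R) : set plane :=
  closure [set x | phi x != 0].

(* C_c^oo of the punctured plane. Real-valued test functions determine a
   complex-valued distribution, by linearity. *)
Definition test_function (phi : plane -> R) : Prop :=
  [/\ smooth phi, compact (support_of phi) & ~ support_of phi (0, 0)].

Definition e1 : plane := (1, 0).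
Definition e2 : plane := (0, 1).

Definition potential (a : R) (x : plane) : plane :=
  (a / enorm2 x * x.2, a / enorm2 x * - x.1).

(* [G] represents the distribution (d_v + i b) u on the punctured plane, that is
   <G, phi> = - <u, d_v phi> + <i b u, phi> for every test function [phi]. *)
Definition is_magnetic_partial (v : plane) (b : plane -> R)
    (u G : plane -> R[i]) : Prop :=
  forall phi : plane -> R, test_function phi ->
    cintegral (fun x => G x * (phi x)%:C) =
    cintegral (fun x => - (u x * ('D_v phi x)%:C)
                        + 'i%C * (b x)%:C * u x * (phi x)%:C).

Definition is_magnetic_gradient (a : R) (u G1 G2 : plane -> R[i]) : Prop :=
  is_magnetic_partial e1 (fun x => (potential a x).1) u G1 /\
  is_magnetic_partial e2 (fun x => (potential a x).2) u G2.

Definition H_A (a : R) : set (plane -> R[i]) :=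
  [set u | L2 u /\
     exists G1 G2, [/\ L2 G1, L2 G2 & is_magnetic_gradient a u G1 G2]].

(* The square-integrable magnetic gradient (G1, G2) of [u \in H_A a] is unique
   up to a null set, so quantifying over all its representatives is harmless. *)
Definition interpolation_constants (a lambda p : R) : set R :=
  [set C | forall u G1 G2 : plane -> R[i],
     H_A a u -> L2 G1 -> L2 G2 -> is_magnetic_gradient a u G1 G2 ->
     (C%:E * (\int[leb2]_x ((cmod (u x) `^ p / enorm2 x)%:E)) `^ (2 / p)
      <= \int[leb2]_x ((cmod (G1 x) ^+ 2 + cmod (G2 x) ^+ 2)%:E)
         + lambda%:E * \int[leb2]_x ((cmod (u x) ^+ 2 / enorm2 x)%:E))%E].

(* The supremum is the largest admissible constant: it is attained. *)
Definition mu_opt (a lambda p : R) : \bar R :=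
  ereal_sup (EFin @` interpolation_constants a lambda p).

End magnetic.

(* Main.v *)
(* In log-polar coordinates x = e^s (cos t, sin t) the weights disappear and the
   form becomes |d_s v|^2 + |(d_t - i a) v|^2 + lambda |v|^2 on the cylinder
   R x (R / 2 pi Z). Multiplying by e^(- i a t) gives the plain Dirichlet form of
   a pair w of real functions that is rotated by the angle - 2 pi a around the
   cylinder; Hardy's inequality |d_t w| >= dist(a, Z) |w| (in L^2) makes the form
   Q coercive.

   Lower bound for p = 2 n, with the integral of |w|^p equal to 1: put
   h = k * (|w|^(p-2) w), where k(z) = (|z|^2 - 1 - ln |z|^2) / (4 pi) on the unit
   disc and 0 outside. Since - Laplace k is a Dirac mass up to a bounded error,
   Q(w, h) = 1 + O(sqrt(Q(w))) and Q(h) <= ||k||_n + O(1), the latter by Young's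
   inequality, and ||k||_n ~ n / (4 pi e). Cauchy-Schwarz then gives
   Q(w) >= (1 + o(1)) 8 pi e / p. An arbitrary u is reached by averaging along
   rotations and dilations, which decreases Q, and by Fatou's lemma; an arbitrary
   p by interpolation between consecutive even exponents.

   Upper bound: test with the logarithm truncated at scale d = e^(- p / 4) around
   the point (2, 0), where the magnetic potential is bounded. *)
Require Import Defs.
From HB Require Import structures.
From mathcomp Require Import finmap.
From mathcomp Require Import all_boot all_order all_algebra.
From mathcomp Require Import all_classical all_reals all_analysis.
From mathcomp Require Import measurable_realfun measurable_fun_approximation.
From mathcomp Require Import simple_functions.
From mathcomp Require Import complex.
From mathcomp Require Import ring lra.
Set Implicit Arguments.
Unset Strict Implicit.
Unset Printing Implicit Defensive.
Import Order.TTheory GRing.Theory Num.Theory.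
Import numFieldNormedType.Exports.
Local Open Scope classical_set_scope.
Local Open Scope ring_scope.

(** * Change of variables and polar coordinates *)

(** In the lower bound only the term [<f, h>] grows with [p]: every other constant is independent of
    [p], so it disappears against [n / (4 pi e)]. In the upper bound, truncating at [d = e^(-l)]
    gives energy about [l / (2 pi)], height about [l / (2 pi)] and a core of area of order [d^2];
    the quotient [(2 pi / l) e^(4 l / p)] is smallest at [l = p / 4], with value [8 pi e / p].
    Regularity is the obstacle. The kernel identities come from calculus on lines and need C^1
    functions, while [u] has only a weak gradient off the origin. A mollifier of fixed scale would
    interfere with the singular potential and with the weight; averaging over rotations and
    dilations is a convolution on the cylinder and respects both. Two degenerate cases shape the
    limit. The integral of [|u|^2 / |x|^2] may be infinite, which Hardy's inequality permits only
    for integer flux. And [lambda] may be negative, so Fatou's lemma must also bound the mass of the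
    averages from below. *)

Section density.
Local Open Scope ereal_scope.
Context d1 d2 (X : measurableType d1) (Y : measurableType d2) (R : realType).
Variables (mu : {measure set X -> \bar R}) (m : {measure set Y -> \bar R}).
Variables (g : X -> Y) (k : X -> R).
Hypotheses (mg : measurable_fun setT g) (mk : measurable_fun setT k).
Hypothesis k0 : forall x, (0 <= k x)%R.
Hypothesis mE : forall A, measurable A ->
  m A = \int[mu]_x ((k x)%:E * (\1_A (g x))%:E).
Import HBNNSimple.

(** The hypothesis on sets says that [m] is the image under [g] of the measure with density [k];
    simple functions and monotone convergence carry it to nonnegative functions. *)
Lemma ge0_integral_density (F : Y -> \bar R) :
  measurable_fun setT F -> (forall y, 0 <= F y) ->
  \int[m]_y F y = \int[mu]_x ((k x)%:E * F (g x)).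
Proof.
move=> mF F0; pose f_ := nnsfun_approx measurableT mF.
have mfk n : measurable_fun setT (fun x => (k x)%:E * (f_ n (g x))%:E).
  apply: emeasurable_funM; apply/measurable_EFinP => //.
  exact: (measurableT_comp (measurable_funP (f_ n)) mg).
have cvf y : (f_ n y)%:E @[n --> \oo] --> F y.
  exact: cvg_nnsfun_approx.
transitivity (limn (fun n => \int[m]_y (f_ n y)%:E)).
  rewrite -monotone_convergence//.
  - by apply: eq_integral => y _; apply/esym/cvg_lim.
  - by move=> n; apply/measurable_EFinP.
  - by move=> n y _; rewrite lee_fin.
  - by move=> y _ a b ab; rewrite lee_fin; exact/lefP/nd_nnsfun_approx.
transitivity (limn (fun n => \int[mu]_x ((k x)%:E * (f_ n (g x))%:E))); last first.
  rewrite -monotone_convergence//.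
  - apply: eq_integral => x _; apply/cvg_lim => //.
    exact: cvgeZl (cvf _).
  - by move=> n x _; rewrite mule_ge0// lee_fin.
  - move=> x _ a b ab; apply: lee_wpmul2l; rewrite lee_fin//.
    exact/lefP/nd_nnsfun_approx.
congr (limn _); apply/funext => n.
under eq_integral do rewrite fimfunE -fsumEFin//.
rewrite ge0_integral_fsum//; last 2 first.
  - by move=> r; exact/measurable_EFinP/measurableT_comp.
  - by move=> r x _; rewrite EFinM nnfun_muleindic_ge0.
transitivity (\int[mu]_x \sum_(r \in range (f_ n))
    (r%:E * ((k x)%:E * (\1_(f_ n @^-1` [set r]) (g x))%:E))); last first.
  apply: eq_integral => x _; rewrite [in RHS]fimfunE -fsumEFin//.
  rewrite ge0_mule_fsumr; last by move=> r; rewrite EFinM nnfun_muleindic_ge0.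
  by apply: eq_fsbigr => r _; rewrite EFinM muleCA.
have mrk r : measurable_fun setT
    (fun x => (k x)%:E * (\1_(f_ n @^-1` [set r]) (g x))%:E).
  apply: emeasurable_funM; apply/measurable_EFinP => //.
  by apply: (measurableT_comp _ mg) => //; exact: measurable_indic.
have rk r x : 0 <= r%:E * ((k x)%:E * (\1_(f_ n @^-1` [set r]) (g x))%:E).
  rewrite muleCA mule_ge0 ?lee_fin//.
  exact: nnfun_muleindic_ge0.
rewrite ge0_integral_fsum//; last by move=> r; exact: measurable_funeM.
apply: eq_fsbigr => r; rewrite inE => -[y _ <-].
rewrite ge0_integralZl//.
- rewrite -mE//.
  under eq_integral do rewrite EFinM.
  rewrite ge0_integralZl//.
  + by rewrite integral_indic// setIT.
  + exact/measurable_EFinP/measurable_indic.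
  + by rewrite lee_fin.
- by move=> x _; rewrite mule_ge0// lee_fin.
- by rewrite lee_fin.
Qed.
End density.

Section restriction.
Local Open Scope ereal_scope.
Context d (T : measurableType d) (R : realType).
Variables (mu : {measure set T -> \bar R}) (D : set T) (mD : measurable D).

Lemma integral_indicM (F : T -> \bar R) :
  \int[mu]_x ((\1_D x)%:E * F x) = \int[mu]_(x in D) F x.
Proof.
rewrite [RHS]integral_mkcond; apply: eq_integral => x _.
by rewrite patchE indicE; case: ifP => xD; rewrite ?mul1e ?mul0e.
Qed.

Lemma ge0_integral_mrestr (F : T -> \bar R) :
  measurable_fun setT F -> (forall y, 0 <= F y) ->
  \int[mrestr mu mD]_y F y = \int[mu]_(x in D) F x.
Proof.
move=> mF F0.
rewrite (@ge0_integral_density _ _ _ _ _ mu (mrestr mu mD) idfun (\1_D))//.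
- exact: integral_indicM.
- exact: measurable_id.
- by move=> A mA; rewrite (integral_indicM (EFin \o \1_A)) integral_indic.
Qed.

End restriction.

(** * Substitution on the real line *)

Section change_of_variables.
Context {R : realType}.
Notation mu := (@lebesgue_measure R).
Variables (D E : set R) (g g' : R -> R).
Hypotheses (mD : measurable D) (mE : measurable E).
Hypotheses (mg : measurable_fun D g) (mg' : measurable_fun D g').
Hypothesis g'0 : forall x, D x -> 0 <= g' x.
Hypothesis gE : forall x, D x -> E (g x).
Hypothesis itvE : forall a b, (a <= b)%R ->
  (\int[mu]_(x in D `&` g @^-1` `]a, b]) (g' x)%:E = mu (`]a, b] `&` E))%E.

(** The weighted image measure only sees [E]. Lebesgue measure outside [E] is added back, so that
    the uniqueness of Lebesgue measure, which compares measures of the whole line on half-open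
    intervals, identifies the sum. *)
Definition cov_measure (A : set (measurableTypeR R)) : \bar R :=
  (\int[mu]_(x in D `&` g @^-1` A) (g' x)%:E + mu (A `&` ~` E))%E.

Let cov0 : cov_measure set0 = 0%E.
Proof.
by rewrite /cov_measure preimage_set0 setI0 integral_set0 set0I measure0 adde0.
Qed.

Let cov_ge0 A : (0 <= cov_measure A)%E.
Proof.
apply: adde_ge0 => //; apply: integral_ge0 => x [Dx _].
by rewrite lee_fin g'0.
Qed.

Let mpre A : measurable A -> measurable (D `&` g @^-1` A).
Proof. by move=> mA; exact: mg. Qed.

Let cov_sigma_additive : semi_sigma_additive cov_measure.
Proof.
move=> /= F mF tF mUF; rewrite /cov_measure.
under eq_fun do rewrite big_split/=.
apply: cvgeD => //.
- by apply: ge0_adde_def; rewrite inE ?measure_ge0//;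
    apply: integral_ge0 => x [Dx _]; rewrite lee_fin g'0.
- rewrite preimage_bigcup setI_bigcupr.
  rewrite ge0_integral_bigcup.
  + apply: is_cvg_nneseries => n _ _; apply: integral_ge0 => x [Dx _].
    by rewrite lee_fin g'0.
  + by move=> k; apply: mpre; exact: mF.
  + apply/measurable_EFinP; apply: measurable_funS mg' => //.
    by move=> x [k _ []].
  + by move=> x [k _ [] Dx _]; rewrite lee_fin g'0.
  + apply/trivIsetP => i j _ _ ij; rewrite setIACA -(preimage_setI g) setIid.
    by move/trivIsetP : tF => -> //; rewrite preimage_set0 setI0.
- rewrite setI_bigcupl; apply: measure_semi_sigma_additive => //.
  + by move=> k; apply: measurableI; [exact: mF|exact: measurableC].
  + apply/trivIsetP => i j _ _ ij; rewrite setIACA.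
    by move/trivIsetP : tF => -> //; rewrite set0I.
  + by apply: bigcup_measurable => k _; apply: measurableI; [exact: mF|exact: measurableC].
Qed.

HB.instance Definition _ := isMeasure.Build _ _ _ cov_measure
  cov0 cov_ge0 cov_sigma_additive.

Let cov_lebesgue A : measurable A -> mu A = cov_measure A.
Proof.
apply: lebesgue_measure_unique => X [[a b]/= _] <-.
have [ab|/ltW ba] := leP a b; last first.
  by rewrite set_itv_ge ?bnd_simp -?leNgt// measure0 cov0.
rewrite /cov_measure itvE//.
by rewrite -setDE addeC -(measureDI _ _).
Qed.

Lemma ge0_change_of_variables (F : R -> \bar R) :
  measurable_fun setT F -> (forall x, 0 <= F x)%E ->
  (\int[mu]_(x in E) F x = \int[mu]_(x in D) ((g' x)%:E * F (g x)))%E.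
Proof.
move=> mF F0; rewrite -(ge0_integral_mrestr mu mE)//.
rewrite (@ge0_integral_density _ _ (measurableTypeR R) (measurableTypeR R) R mu (mrestr mu mE) (g \_ D) (g' \_ D))//.
- rewrite -[RHS]integral_indicM; apply: eq_integral => x _.
  by rewrite indicE !patchE; case: ifP => _; rewrite ?mul1e ?mul0e.
- exact/(measurable_restrictT _ _).1.
- exact/(measurable_restrictT _ _).1.
- by move=> x; rewrite patchE; case: ifP => //; rewrite inE; exact: g'0.
- move=> A mA.
  rewrite [LHS](_ : _ = cov_measure (A `&` E)); last by rewrite -cov_lebesgue//; exact: measurableI.
  rewrite /cov_measure -setIA setICr setI0 measure0 adde0.
  have -> : D `&` g @^-1` (A `&` E) = D `&` g @^-1` A.
    by apply/seteqP; split => x /= [Dx]; [case|split=> //; split => //; exact: gE].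
  rewrite [LHS]integral_mkcond; apply: eq_integral => x _.
  rewrite !patchE in_setI indicE.
  case: ifP => [/andP[xD xA]|]; rewrite ?xD.
    by rewrite (_ : g x \in A = true) ?mule1//; move: xA; rewrite !inE.
  case: ifP => [xD /= xA|]; last by rewrite mul0e.
  rewrite (_ : g x \in A = false) ?mule0//; move: xA; apply: contraFF.
Qed.

End change_of_variables.

Section FTC.
Context {R : realType}.
Notation mu := (@lebesgue_measure R).
Implicit Types (f F : R -> R) (a b : R).

Lemma FTC_is_derive f F a b : a <= b ->
  (forall x, x \in `[a, b] -> is_derive x (1 : R) F (f x)) ->
  (forall x, x \in `[a, b] -> {for x, continuous f}) ->
  (\int[mu]_(x in `[a, b]) (f x)%:E = (F b - F a)%:E)%E.
Proof.
rewrite le_eqVlt => /predU1P[<- _ _|ab dF cf].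
  by rewrite set_itv1 integral_set1 subrr.
have cF x : x \in `[a, b] -> {for x, continuous F}.
  move=> /dF dFx; apply: differentiable_continuous.
  exact/derivable1_diffP.
rewrite (@continuous_FTC2 _ f F)//.
- by apply: continuous_in_subspaceT => x; rewrite inE; exact: cf.
- split.
  + by move=> x xab; have /dF [] := subset_itv_oo_cc xab.
  + by apply: cvg_at_right_filter; apply: cF; rewrite in_itv/= lexx ltW.
  + by apply: cvg_at_left_filter; apply: cF; rewrite in_itv/= lexx ltW.
- move=> x xab; rewrite derive1E; apply: derive_val.
  exact/dF/subset_itv_oo_cc.
Qed.
End FTC.

Section lebesgue_maps.
Context {R : realType}.
Notation mu := (@lebesgue_measure R).
Implicit Types (F : R -> \bar R) (a b c d : R).

Lemma ge0_integral_affine c d F : 0 < c ->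
  measurable_fun setT F -> (forall x, 0 <= F x)%E ->
  (\int[mu]_x F x = \int[mu]_x (c%:E * F (c * x + d)%R))%E.
Proof.
move=> c0 mF F0.
rewrite (@ge0_change_of_variables _ setT setT (fun x => c * x + d) (cst c))//.
- by apply: measurable_funD => //; exact: mulrl_measurable.
- by move=> x _; exact: ltW.
- move=> a b ab; rewrite !setTI setIT.
  rewrite (_ : _ @^-1` _ = `](a - d) / c, (b - d) / c]%classic).
    rewrite [LHS](eq_integral (cst c%:E))// integral_cst//=.
    rewrite !lebesgue_measure_itv/= !lte_fin.
    rewrite ltr_pM2r ?invr_gt0// ltrD2r; case: ifP => _; last by rewrite mule0.
    by rewrite -!EFinB -EFinM; congr EFin; field; rewrite gt_eqF.
  apply/seteqP; split => x /=; rewrite !in_itv/= ltr_pdivrMr// ler_pdivlMr//.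
    by rewrite ltrBlDr lerBrDr mulrC.
  by rewrite ltrBlDr lerBrDr mulrC.
Qed.

Lemma ge0_integral_translate d F :
  measurable_fun setT F -> (forall x, 0 <= F x)%E ->
  (\int[mu]_x F (x + d)%R = \int[mu]_x F x)%E.
Proof.
move=> mF F0; rewrite [RHS](@ge0_integral_affine 1 d)//.
by apply: eq_integral => x _; rewrite mul1e mul1r.
Qed.

Lemma ge0_integral_opp F :
  measurable_fun setT F -> (forall x, 0 <= F x)%E ->
  (\int[mu]_x F (- x)%R = \int[mu]_x F x)%E.
Proof.
move=> mF F0.
transitivity (\int[pushforward mu (-%R : _ -> measurableTypeR R)]_x F x)%E.
  rewrite (@ge0_integral_pushforward _ _ (measurableTypeR R)
    (measurableTypeR R) R -%R (@oppr_measurable R setT) mu)//.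
apply: eq_measure_integral => A mA _; exact: lebesgue_measureN.
Qed.

(** The improper case of the substitution by [expR]: an interval []a, b]] with [a <= 0 < b] pulls
    back to a half-line. *)
Lemma integral_expR_Ny b :
  (\int[mu]_(x in `]-oo, b]) (expR x)%:E = (expR b)%:E)%E.
Proof.
rewrite -(integral_indicM mu) -ge0_integral_opp; last 2 first.
- by apply: emeasurable_funM; apply/measurable_EFinP => //; exact: measurable_indic.
- by move=> x; rewrite mule_ge0// lee_fin ?indicE// expR_ge0.
transitivity (\int[mu]_(x in `[(- b)%R, +oo[) (expR (- x))%:E)%E.
  rewrite -[RHS]integral_indicM; apply: eq_integral => x _.
  congr (_%:E * _)%E; rewrite !indicE; congr (_%:R); congr nat_of_bool.
  by apply/idP/idP; rewrite !inE/= !in_itv/= andbT lerNl.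
rewrite (@ge0_continuous_FTC2y _ _ (fun x => - expR (- x)) _ 0).
- by rewrite opprK -EFinB sub0r opprK.
- by move=> x _; exact: expR_ge0.
- apply: continuous_subspaceT => x.
  apply: continuous_comp; [exact: opp_continuous|exact: continuous_expR].
- rewrite -oppr0; apply: cvgN; exact: cvgr_expR.
- by move=> x _; apply: ex_derive.
- apply: cvg_at_right_filter; apply: cvgN.
  by apply: continuous_comp; [exact: opp_continuous|exact: continuous_expR].
- move=> x _; rewrite derive1E; apply: derive_val.
  by apply: is_derive_eq; rewrite mulrN1 opprK.
Qed.

Lemma ge0_integral_expR F :
  measurable_fun setT F -> (forall x, 0 <= F x)%E ->
  (\int[mu]_(x in `]0%R, +oo[) F x = \int[mu]_x ((expR x)%:E * F (expR x)))%E.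
Proof.
move=> mF F0.
rewrite (@ge0_change_of_variables _ setT _ expR expR)//.
- by move=> x _; rewrite /= in_itv/= expR_gt0.
- move=> a b ab; rewrite !setTI.
  have [b0|b0] := leP b 0.
    rewrite (_ : _ @^-1` _ = set0) ?integral_set0; last first.
      apply/seteqP; split => // x /=; rewrite in_itv/= => /andP[_].
      by rewrite leNgt (le_lt_trans b0 (expR_gt0 _)).
    rewrite (_ : _ `&` _ = set0) ?measure0//.
    apply/seteqP; split => // x /= []; rewrite !in_itv/= andbT => /andP[_ xb].
    by rewrite ltNge (le_trans xb b0).
  have [a0|a0] := leP a 0.
    rewrite (_ : _ @^-1` _ = `]-oo, ln b]%classic); last first.
      apply/seteqP; split => x /=; rewrite !in_itv/=.
        by move=> /andP[_]; rewrite -{1}(lnK b0) ler_expR.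
      by rewrite (le_lt_trans a0 (expR_gt0 _))/= -{2}(lnK b0) ler_expR.
    rewrite integral_expR_Ny lnK//.
    rewrite (_ : _ `&` _ = `]0, b]%classic); last first.
      apply/seteqP; split => x /=; rewrite !in_itv/= ?andbT.
        by move=> [/andP[_ ->]] ->.
      by move=> /andP[x0 ->]; rewrite x0 (le_lt_trans a0 x0).
    by rewrite lebesgue_measure_itv/= lte_fin b0 -EFinB subr0.
  rewrite (_ : _ @^-1` _ = `]ln a, ln b]%classic); last first.
    apply/seteqP; split => x /=; rewrite !in_itv/=.
      by rewrite -{1}(lnK a0) -{1}(lnK b0) ler_expR ltr_expR.
    by rewrite -{2}(lnK a0) -{2}(lnK b0) ler_expR ltr_expR.
  rewrite (_ : _ `&` _ = `]a, b]%classic); last first.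
    apply/seteqP; split => x /=; rewrite !in_itv/= ?andbT; first by case.
    by move=> /andP[ax ->]; rewrite ax (lt_trans a0 ax).
  rewrite lebesgue_measure_itv/= lte_fin.
  rewrite integral_itv_obnd_cbnd; last exact/measurable_EFinP/measurable_funTS.
  rewrite (@FTC_is_derive _ expR expR).
  + rewrite !lnK// -EFinB; case: ifPn => //; rewrite -leNgt => ba.
    by rewrite (@le_anti _ _ a b) ?subrr// ab.
  + by rewrite ler_ln.
  + by move=> x _; exact: continuous_expR.
Qed.

Lemma ge0_integral_tan F :
  measurable_fun setT F -> (forall x, 0 <= F x)%E ->
  (\int[mu]_x F x = \int[mu]_(t in `](- (pi / 2))%R, (pi / 2)%R[)
     ((1 + tan t ^+ 2)%R%:E * F (tan t)))%E.
Proof.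
move=> mF F0.
have ct (x : R) : x \in `](- (pi / 2)), (pi / 2)[ -> cos x != 0 :> R.
  by move=> xD; rewrite gt_eqF// cos_gt0_pihalf.
have ctan (x : R) : x \in `](- (pi / 2)), (pi / 2)[ -> {for x, continuous (@tan R)}.
  by move=> xD; apply: continuous_tan; exact: ct.
have mtan : measurable_fun `](- (pi / 2)), (pi / 2)[ (@tan R).
  apply: open_continuous_measurable_fun => // x.
  by rewrite inE => /ctan.
have ct2 (x : R) : x \in `](- (pi / 2)), (pi / 2)[ ->
    {for x, continuous (fun x : R => 1 + tan x ^+ 2)}.
  move=> xD; apply: (@cvgD _ R^o); first exact: cvg_cst.
  apply: (@continuous_comp _ _ _ (@tan R) (fun y => y ^+ 2)); first exact: ctan.
  exact: exprn_continuous.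
rewrite (@ge0_change_of_variables _ `](- (pi / 2)), (pi / 2)[ setT (@tan R)
  (fun x => 1 + tan x ^+ 2))//.
- by apply: measurable_funD => //; exact: measurable_funX.
- by move=> x _; rewrite addr_ge0// sqr_ge0.
- move=> a b ab; rewrite setIT.
  have letan (x y : R) : x \in `](- (pi / 2)), (pi / 2)[ ->
      y \in `](- (pi / 2)), (pi / 2)[ -> (tan x <= tan y) = (x <= y).
    by move=> xD yD; rewrite leNgt ltr_tan// -leNgt.
  have atan_in (x : R) : atan x \in `](- (pi / 2)), (pi / 2)[.
    by rewrite in_itv/= atan_gtNpi2 atan_ltpi2.
  rewrite (_ : _ `&` _ = `]atan a, atan b]%classic); last first.
    apply/seteqP; split => x /=; rewrite !in_itv/=.
      move=> [xD]; rewrite -{1}(atanK a) -{1}(atanK b) letan ?ltr_tan//.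
    move=> /andP[ax xb]; have xD : x \in `](- (pi / 2)), (pi / 2)[.
      by rewrite in_itv/= (lt_trans (atan_gtNpi2 a) ax) (le_lt_trans xb (atan_ltpi2 b)).
    split; first by rewrite in_itv in xD.
    by rewrite -{1}(atanK a) -(atanK b) letan ?ltr_tan// ax/=.
  have sub x : x \in `[atan a, atan b] -> x \in `](- (pi / 2)), (pi / 2)[.
    rewrite !in_itv/= => /andP[ax xb].
    by rewrite (lt_le_trans (atan_gtNpi2 a) ax) (le_lt_trans xb (atan_ltpi2 b)).
  rewrite integral_itv_obnd_cbnd; last first.
    apply/measurable_EFinP; apply: measurable_funD => //.
    apply: measurable_funX; apply: measurable_funS mtan => // x /=.
    by move=> xab; apply: sub; apply: subset_itv xab; rewrite bnd_simp.
  have dtan (x : R) : x \in `[atan a, atan b] -> is_derive x 1 (@tan R) (1 + tan x ^+ 2).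
    by move=> /sub /ct xD; rewrite -cos2_tan2//; exact: is_derive_tan.
  have ctan2 (x : R) : x \in `[atan a, atan b] ->
    {for x, continuous (fun x : R => 1 + tan x ^+ 2)} by move=> /sub; exact: ct2.
  rewrite (FTC_is_derive (le_atan ab) dtan ctan2).
  + rewrite !atanK lebesgue_measure_itv/= lte_fin -EFinB.
    case: ifPn => //; rewrite -leNgt => ba.
    by rewrite (@le_anti _ _ a b) ?subrr// ab.
Qed.

End lebesgue_maps.

Section tonelli_domains.
Local Open Scope ereal_scope.
Context d1 d2 (X : measurableType d1) (Y : measurableType d2) (R : realType).
Variables (m1 : {sigma_finite_measure set X -> \bar R}).
Variables (m2 : {sigma_finite_measure set Y -> \bar R}).

Lemma tonelli_domains (A : set X) (B : set Y) (f : X * Y -> \bar R) :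
  measurable A -> measurable B ->
  measurable_fun setT f -> (forall z, 0 <= f z) ->
  \int[m1]_(x in A) \int[m2]_(y in B) f (x, y) =
  \int[m2]_(y in B) \int[m1]_(x in A) f (x, y).
Proof.
move=> mA mB mf f0.
pose h z := (\1_A z.1)%:E * ((\1_B z.2)%:E * f z) : \bar R.
have mh : measurable_fun setT h.
  apply: emeasurable_funM.
    apply/measurable_EFinP; apply: (measurableT_comp _ measurable_fst).
    exact: measurable_indic.
  apply: emeasurable_funM => //.
  apply/measurable_EFinP; apply: (measurableT_comp _ measurable_snd).
  exact: measurable_indic.
have h0 z : 0 <= h z by rewrite !mule_ge0// lee_fin indicE.
have m2f x : measurable_fun setT (fun y => (\1_B y)%:E * f (x, y)).
  apply: emeasurable_funM; first exact/measurable_EFinP/measurable_indic.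
  exact: measurableT_comp.
have m1f y : measurable_fun setT (fun x => (\1_A x)%:E * f (x, y)).
  apply: emeasurable_funM; first exact/measurable_EFinP/measurable_indic.
  exact: measurableT_comp.
transitivity (\int[m1]_x \int[m2]_y h (x, y)).
  rewrite -(integral_indicM m1 A); apply: eq_integral => x _.
  rewrite -(integral_indicM m2 B) -ge0_integralZl//.
  by move=> y _; rewrite mule_ge0// lee_fin indicE.
rewrite (fubini_tonelli _ mh h0).
rewrite -(integral_indicM m2 B); apply: eq_integral => y _.
rewrite -(integral_indicM m1 A) -ge0_integralZl//.
- by apply: eq_integral => x _; rewrite /h/= muleCA.
- by move=> x _; rewrite mule_ge0// lee_fin indicE.
Qed.

End tonelli_domains.

Ltac mfun := repeat first
  [ match goal with
    | H : measurable_fun _ ?f |- measurable_fun _ ?f => exact: H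
    | |- measurable_fun _ (fun x => EFin _) => apply/measurable_EFinP
    | |- measurable_fun _ (fun x => (_, _)) => apply: measurable_fun_pair
    | H : measurable_fun setT ?f |- measurable_fun _ (fun x => ?f _) =>
        apply: (measurableT_comp H)
    | |- measurable_fun _ (fun x => (_ * _)%E) => apply: emeasurable_funM
    | |- measurable_fun _ (fun x => (_ + _)%E) => apply: emeasurable_funD
    | |- measurable_fun _ (fun x => (_ * _)%R) => apply: measurable_funM
    | |- measurable_fun _ (fun x => (_ - _)%R) => apply: measurable_funB
    | |- measurable_fun _ (fun x => (_ + _)%R) => apply: measurable_funD
    | |- measurable_fun _ (fun x => (- _)%R) => apply: measurable_funN
    | |- measurable_fun _ (fun x => (_ ^+ _)%R) => apply: measurable_funX
    | |- measurable_fun _ (fun x => expR _) =>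
        apply: (measurableT_comp (@measurable_expR _))
    | |- measurable_fun _ (fun x => cos _) =>
        apply: (measurableT_comp (continuous_measurable_fun (@continuous_cos _)))
    | |- measurable_fun _ (fun x => sin _) =>
        apply: (measurableT_comp (continuous_measurable_fun (@continuous_sin _)))
    | |- measurable_fun _ (fun x => `|_|%R) =>
        apply: (measurableT_comp (@normr_measurable _ setT))
    | |- measurable_fun _ (fun x => \1__ _) =>
        apply: (measurableT_comp (measurable_indic _))
    end
  | assumption | exact: measurable_cst | exact: measurable_id
  | exact: measurable_fst | exact: measurable_snd
  | apply: emeasurable_funM | apply: emeasurable_funD
  | apply: measurable_funM | apply: measurable_funD | apply: measurable_funB
  | apply: measurable_funX ].

(** * Polar coordinates *)

Section polar.
Context {R : realType}.
Notation mu := (@lebesgue_measure R).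
Notation plane := (measurableTypeR R * measurableTypeR R)%type.
Local Notation leb2 := (mu \x mu)%E.
Local Notation D := (`](- (pi / 2)), (pi / 2)[%classic : set R).

Lemma measurable_integral_snd (H : plane -> \bar R) :
  measurable_fun setT H -> (forall z, 0 <= H z)%E ->
  measurable_fun setT (fun x => \int[mu]_y H (x, y))%E.
Proof. by move=> mH H0; exact: measurable_fun_fubini_tonelli_F. Qed.

Let measurable_tan : measurable_fun setT (@tan R \_ D).
Proof.
apply/(measurable_restrictT _ _).1 => //.
apply: open_continuous_measurable_fun => // x.
rewrite inE => xD; apply: continuous_tan.
by rewrite gt_eqF// cos_gt0_pihalf.
Qed.

(** Two one-dimensional substitutions separated by Tonelli: [y = x tan t] at fixed [x], then
    [x = r cos t] at fixed [t]. The factors [x (1 + tan^2 t)] and [cos t] multiply to [r]. *)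
Let half_plane (F : plane -> \bar R) :
  measurable_fun setT F -> (forall x, 0 <= F x)%E ->
  (\int[mu]_(x in `]0%R, +oo[) \int[mu]_y F (x, y) =
   \int[mu]_(t in D) \int[mu]_(r in `]0%R, +oo[)
     (r%:E * F (r * cos t, r * sin t)%R))%E.
Proof.
move=> mF F0.
(* Extending [tan] by zero and taking absolute values make [H] measurable and nonnegative on the
   whole plane, as Tonelli requires. *)
pose T := @tan R \_ D.
pose H (z : plane) : \bar R := ((`|z.1| * (1 + T z.2 ^+ 2))%:E *
     F (z.1, z.1 * T z.2)%R)%E.
have mH : measurable_fun setT H by rewrite /H; mfun.
have H0 z : (0 <= H z)%E.
  by rewrite mule_ge0// lee_fin mulr_ge0// addr_ge0// sqr_ge0.
transitivity (\int[mu]_(x in `]0%R, +oo[) \int[mu]_(t in D) H (x, t))%E.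
  apply: eq_integral => x; rewrite inE/= in_itv/= andbT => x0.
  have mFx : measurable_fun setT (fun y => F (x, y)) by mfun.
  rewrite (@ge0_integral_affine _ x 0)//.
  rewrite ge0_integral_tan//.
  - apply: eq_integral => t tD; rewrite addr0 /H/= /T patchE tD muleA -EFinM.
    by rewrite mulrC gtr0_norm.
  - by mfun.
  - by move=> y; rewrite mule_ge0// lee_fin ltW.
have -> : (\int[mu]_(x in `]0%R, +oo[) \int[mu]_(t in D) H (x, t) =
    \int[mu]_(t in D) \int[mu]_(x in `]0%R, +oo[) H (x, t))%E.
  clearbody H.
  apply: (@tonelli_domains _ _ _ _ R mu mu _ _ H).
  exact: measurable_itv.
  exact: measurable_itv.
  exact: mH.
  exact: H0.
apply: eq_integral => t tD.
have ct : 0 < cos t by apply: cos_gt0_pihalf; rewrite inE in tD.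
have mHt : measurable_fun setT (fun x => H (x, t)) by mfun.
rewrite -[LHS]integral_indicM -[RHS]integral_indicM.
rewrite (@ge0_integral_affine _ (cos t) 0)//; last 2 first.
- by mfun.
- by move=> x; rewrite mule_ge0// lee_fin indicE.
apply: eq_integral => r _; rewrite addr0.
have -> : \1_`]0%R, +oo[ (cos t * r) = \1_`]0%R, +oo[ r :> R.
  rewrite !indicE; congr (_%:R); congr nat_of_bool.
  by apply/idP/idP; rewrite !inE/= !in_itv/= !andbT pmulr_rgt0.
rewrite indicE; case: (boolP (r \in _)) => [|_]; last by rewrite !mul0e mule0.
rewrite inE/= in_itv/= andbT => r0; rewrite !mul1e /H/= muleA -EFinM.
rewrite gtr0_norm ?mulr_gt0// /T patchE tD /tan.
congr (_%:E * F (_, _))%E.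
- transitivity (r * (cos t ^+ 2 + sin t ^+ 2)); last by rewrite cos2Dsin2 mulr1.
  by field; rewrite gt_eqF.
- by rewrite mulrC.
- by field; rewrite gt_eqF.
Qed.

(** The left half-plane is the image of the right one under the reflection through the origin,
    whence the sum over a point and its antipode. *)
Lemma ge0_integral_polar_half (F : plane -> \bar R) :
  measurable_fun setT F -> (forall x, 0 <= F x)%E ->
  (\int[leb2]_x F x = \int[mu]_(t in D) \int[mu]_(r in `]0%R, +oo[)
     (r%:E * (F (r * cos t, r * sin t)%R + F (- (r * cos t), - (r * sin t))%R)))%E.
Proof.
move=> mF F0.
rewrite (fubini_tonelli1 _ mF F0).
pose G x := (\int[mu]_y F (x, y))%E.
have mG : measurable_fun setT G by exact: measurable_fun_fubini_tonelli_F.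
have G0 x : (0 <= G x)%E by exact: integral_ge0.
have mneg : measurable_fun setT (-%R : R -> R) by exact: oppr_measurable.
pose F' (z : plane) := F (- z.1, - z.2).
have mF' : measurable_fun setT F' by rewrite /F'; mfun; exact: (measurableT_comp mneg).
have F'0 z : (0 <= F' z)%E by exact: F0.
have -> : (\int[mu]_x G x = \int[mu]_(x in `]0%R, +oo[) G x +
    \int[mu]_(x in `]0%R, +oo[) G (- x)%R)%E.
  rewrite -[in LHS](setUv (`]-oo, 0%R] : set R)) ge0_integral_setU//.
  - rewrite addeC setCitvl; congr (_ + _)%E.
    rewrite -(integral_indicM mu `]-oo, 0%R]) -ge0_integral_opp.
    + rewrite [LHS](_ : _ = \int[mu]_(x in `[0%R, +oo[) G (- x)%R)%E.
        by rewrite integral_itv_obnd_cbnd//; apply: measurable_funTS;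
          apply: measurableT_comp.
      rewrite -(integral_indicM mu `[0%R, +oo[).
      apply: eq_integral => x _; congr (_%:E * _)%E.
      rewrite !indicE; congr (_%:R); congr nat_of_bool.
      by apply/idP/idP; rewrite !inE/= !in_itv/= andbT oppr_le0.
    + by mfun; exact: measurable_indic.
    + by move=> x; rewrite mule_ge0// lee_fin indicE.
  - exact: measurableC.
  - exact: measurable_funTS.
  - by apply/disj_setPCl.
rewrite half_plane//.
have -> : (\int[mu]_(x in `]0%R, +oo[) G (- x)%R =
   \int[mu]_(x in `]0%R, +oo[) \int[mu]_y F' (x, y))%E.
  apply: eq_integral => x _; rewrite /G /F' -ge0_integral_opp//.
  exact: measurableT_comp.
rewrite half_plane//.
pose K (F : plane -> \bar R) (z : plane) : \bar R :=
  ((`|z.2|)%:E * F (z.2 * cos z.1, z.2 * sin z.1)%R)%E.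
have mK F0' : measurable_fun setT F0' -> measurable_fun setT (K F0').
  by move=> mF0'; rewrite /K; mfun.
have mKt F0' t : measurable_fun setT F0' -> measurable_fun setT (fun r => K F0' (t, r)).
  by move=> /mK mF0'; mfun.
have KE F0' t : (\int[mu]_(r in `]0%R, +oo[) (r%:E * F0' (r * cos t, r * sin t)%R) =
    \int[mu]_(r in `]0%R, +oo[) K F0' (t, r))%E.
  apply: eq_integral => r; rewrite inE/= in_itv/= andbT => r0.
  by rewrite /K/= gtr0_norm.
have mKi F0' : measurable_fun setT F0' -> (forall z, 0 <= F0' z)%E ->
    measurable_fun setT (fun t => \int[mu]_r ((\1_`]0%R, +oo[ r)%:E * K F0' (t, r)))%E.
  move=> mF0' F0'0; pose H z := ((\1_`]0%R, +oo[ z.2)%:E * K F0' z)%E.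
  apply: (@measurable_integral_snd H); rewrite /H.
  - by have mKF := mK _ mF0'; mfun.
  - by move=> z; rewrite !mule_ge0// lee_fin ?indicE.
rewrite -ge0_integralD//; last 4 first.
- by move=> t _; apply: integral_ge0 => r /=; rewrite in_itv/= andbT => r0;
    rewrite mule_ge0// lee_fin ltW.
- apply: measurable_funTS.
  under eq_fun do rewrite KE.
  under eq_fun do rewrite -(integral_indicM mu).
  exact: mKi.
- by move=> t _; apply: integral_ge0 => r /=; rewrite in_itv/= andbT => r0;
    rewrite mule_ge0// lee_fin ltW.
- apply: measurable_funTS.
  under eq_fun do rewrite KE.
  under eq_fun do rewrite -(integral_indicM mu).
  exact: mKi.
apply: eq_integral => t tD.
rewrite !KE -ge0_integralD//.
- apply: eq_integral => r; rewrite inE/= in_itv/= andbT => r0.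
  by rewrite /K /F'/= gtr0_norm// ge0_muleDr.
- by move=> r _; rewrite !mule_ge0// lee_fin.
- apply: measurable_funTS; exact: mKt.
- by move=> r _; rewrite !mule_ge0// lee_fin.
- apply: measurable_funTS; exact: mKt.
Qed.
End polar.

(** * The log-polar cylinder *)

Section periodic.
Context {R : realType}.
Notation mu := (@lebesgue_measure R).
Implicit Types (F : R -> \bar R) (a b c d P : R).

Lemma ge0_integral_itv_translate a b d F :
  measurable_fun setT F -> (forall x, 0 <= F x)%E ->
  (\int[mu]_(t in `](a + d)%R, (b + d)%R]) F t =
   \int[mu]_(t in `]a, b]) F (t + d)%R)%E.
Proof.
move=> mF F0.
rewrite -(integral_indicM mu `](a + d)%R, (b + d)%R]).
rewrite -(ge0_integral_translate d); last 2 first.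
- by mfun.
- by move=> x; rewrite mule_ge0// lee_fin indicE.
rewrite -(integral_indicM mu `]a, b]); apply: eq_integral => x _.
congr (_%:E * _)%E; rewrite !indicE; congr (_%:R); congr nat_of_bool.
by apply/idP/idP; rewrite !inE/= !in_itv/= ltrD2r lerD2r.
Qed.

Lemma ge0_integral_itv_cat a b c F : a <= b -> b <= c ->
  measurable_fun setT F -> (forall x, 0 <= F x)%E ->
  (\int[mu]_(t in `]a, c]) F t =
   \int[mu]_(t in `]a, b]) F t + \int[mu]_(t in `]b, c]) F t)%E.
Proof.
move=> ab bc mF F0.
have -> : (`]a, c] = `]a, b] `|` `]b, c])%classic.
  apply/seteqP; split => x /=; rewrite !in_itv/=.
    by move=> /andP[ax xc]; have [xb|bx] := leP x b; [left|right]; rewrite ?ax ?xb ?bx.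
  by move=> [/andP[-> xb]|/andP[bx ->]];
    [rewrite (le_trans xb bc)|rewrite (le_lt_trans ab bx)].
rewrite ge0_integral_setU//.
- exact: measurable_funTS.
- apply/disj_setPS => x /=; rewrite !in_itv/= => -[/andP[_ xb] /andP[bx _]].
  by have := le_lt_trans xb bx; rewrite ltxx.
Qed.

(** The starting point is reduced modulo [P] into [[0, P]]; the part of the interval beyond [P] is
    then moved back by one period. *)
Lemma ge0_integral_periodic P c F : 0 < P ->
  measurable_fun setT F -> (forall x, 0 <= F x)%E ->
  (forall x, F (x + P) = F x) ->
  (\int[mu]_(t in `]c, (c + P)%R]) F t = \int[mu]_(t in `]0%R, P]) F t)%E.
Proof.
move=> P0 mF F0 FP.
have FPn n x : F (x + n%:R * P) = F x.
  elim: n x => [|n ih] x; first by rewrite mul0r addr0.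
  by rewrite -natr1 mulrDl mul1r addrA FP ih.
have FPz (n : int) x : F (x + n%:~R * P) = F x.
  case: n => n; first exact: FPn.
  rewrite NegzE mulrNz mulNr -[in RHS](subrK (n.+1%:R * P) x).
  by rewrite FPn.
pose k : int := Num.floor (c / P).
pose c' := c - k%:~R * P.
have c'0 : 0 <= c'.
  by rewrite subr_ge0 -ler_pdivlMr// /k floor_le.
have c'P : c' <= P.
  rewrite lerBlDr -[X in X + _]mul1r -mulrDl -ler_pdivrMr// addrC ltW//.
  by have := floorD1_gt (c / P); rewrite intrD.
rewrite (_ : c = c' + k%:~R * P); last by rewrite subrK.
rewrite [c' + k%:~R * P + P]addrAC ge0_integral_itv_translate//.
under eq_integral do rewrite FPz.
rewrite (@ge0_integral_itv_cat _ P)//; last by rewrite lerDr.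
rewrite [X in (_ + X)%E](_ : _ = \int[mu]_(t in `]0%R, c']) F t)%E; last first.
  rewrite -{1}(add0r P) ge0_integral_itv_translate//.
  by apply: eq_integral => x _; rewrite FP.
by rewrite addeC -(@ge0_integral_itv_cat 0 c' P).
Qed.

End periodic.

Section cylinder.
Context {R : realType}.
Notation mu := (@lebesgue_measure R).
Notation plane := (measurableTypeR R * measurableTypeR R)%type.
Local Notation leb2 := (mu \x mu)%E.

Definition circle : set (measurableTypeR R) := `]0, 2 * pi]%classic.

Lemma measurable_circle : measurable circle.
Proof. exact: measurable_itv. Qed.

Lemma lebesgue_circle : mu circle = (2 * pi)%:E.
Proof.
rewrite /circle lebesgue_measure_itv/= lte_fin mulr_gt0 ?pi_gt0//.
by rewrite -EFinB subr0.
Qed.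

Lemma lebesgue_circle_lty : (mu circle < +oo)%E.
Proof. by rewrite lebesgue_circle ltry. Qed.

Lemma circle_measure_spec :
  {m : {finite_measure set (measurableTypeR R) -> \bar R} |
    forall F : R -> \bar R, measurable_fun setT F -> (forall x, 0 <= F x)%E ->
    (\int[m]_t F t = \int[mu]_(t in circle) F t)%E}.
Proof.
exists (mfrestr measurable_circle lebesgue_circle_lty) => F mF F0.
exact: (ge0_integral_mrestr mu measurable_circle).
Qed.

(* Kept opaque: the restricted measure otherwise unfolds during unification. *)
Definition muT := sval circle_measure_spec.

Local Notation mS := (mu \x muT)%E.

Lemma integral_muT (F : R -> \bar R) : measurable_fun setT F ->
  (forall x, 0 <= F x)%E ->
  (\int[muT]_t F t = \int[mu]_(t in circle) F t)%E.
Proof. exact: (svalP circle_measure_spec). Qed.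

Lemma integral_mS (F : plane -> \bar R) : measurable_fun setT F ->
  (forall x, 0 <= F x)%E ->
  (\int[mS]_z F z = \int[mu]_s \int[mu]_(t in circle) F (s, t))%E.
Proof.
move=> mF F0; rewrite (fubini_tonelli1 _ mF F0); apply: eq_integral => s _.
by apply: integral_muT => //; mfun.
Qed.

Lemma measurable_translate2 (c : R * R) :
  measurable_fun setT (fun z : plane => (z + c)%R : plane).
Proof.
change (measurable_fun setT (fun z : plane => (z.1 + c.1, z.2 + c.2) : plane)).
by mfun.
Qed.

Lemma ge0_integral_leb2_translate (F : plane -> \bar R) (c : R * R) :
  measurable_fun setT F -> (forall x, 0 <= F x)%E ->
  (\int[leb2]_z F (z + c)%R = \int[leb2]_z F z)%E.
Proof.
move=> mF F0.
have mFc : measurable_fun setT (fun z : plane => F (z + c)%R).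
  exact: (measurableT_comp mF (measurable_translate2 c)).
rewrite (fubini_tonelli1 _ mFc (fun z => F0 _)) (fubini_tonelli1 _ mF F0).
rewrite -[RHS](ge0_integral_translate c.1).
- apply: eq_integral => x _.
  by rewrite -[RHS](ge0_integral_translate c.2)//; mfun.
- exact: measurable_fun_fubini_tonelli_F.
- by move=> x; exact: integral_ge0.
Qed.

Definition periodic2 T (F : R * R -> T) := forall s t, F (s, t + 2 * pi) = F (s, t).

Lemma ge0_integral_mS_translate (F : plane -> \bar R) (c : R * R) :
  measurable_fun setT F -> (forall x, 0 <= F x)%E -> periodic2 F ->
  (\int[mS]_z F (z + c)%R = \int[mS]_z F z)%E.
Proof.
move=> mF F0 pF.
have mFc : measurable_fun setT (fun z : plane => F (z + c)%R).
  exact: (measurableT_comp mF (measurable_translate2 c)).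
have P0 : 0 < 2 * pi :> R by rewrite mulr_gt0 ?pi_gt0.
rewrite (integral_mS mFc (fun z => F0 _)) (integral_mS mF F0).
pose G s := (\int[mu]_(t in circle) F (s, t))%E.
have GE s : G s = (\int[muT]_t F (s, t))%E by rewrite integral_muT//; mfun.
rewrite -[RHS](ge0_integral_translate c.1).
- apply: eq_integral => x _.
  rewrite -[RHS](ge0_integral_periodic c.2)//; last first.
    by mfun.
  have mFx : measurable_fun setT (fun t : R => F (x + c.1, t)) by mfun.
  have := @ge0_integral_itv_translate _ 0 (2 * pi) c.2 _ mFx (fun t => F0 _).
  by rewrite add0r [2 * pi + _]addrC => ->.
- change (measurable_fun setT G); rewrite (funext GE).
  exact: measurable_fun_fubini_tonelli_F.
- by move=> x; exact: integral_ge0.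
Qed.

(** Any strip of height [2 pi] is a fundamental domain. This is how a kernel that lives on the plane
    is compared with functions on the cylinder: the strip is centred at the point [y] where the
    convolution is evaluated. *)
Lemma ge0_integral_strip (F : plane -> \bar R) (y : R * R) :
  measurable_fun setT F -> (forall x, 0 <= F x)%E -> periodic2 F ->
  (\int[leb2]_z ((\1_`](- pi)%R, pi] z.2)%:E * F (y + z)%R) = \int[mS]_z F z)%E.
Proof.
move=> mF F0 pF.
have P0 : 0 < 2 * pi :> R by rewrite mulr_gt0 ?pi_gt0.
have m1 : measurable_fun setT (fun z : plane => \1_(`](- pi)%R, pi] : set R) z.2 : R).
  by mfun.
have mFy : measurable_fun setT (fun z : plane => F (y + z)%R).
  by under eq_fun do rewrite addrC; exact: (measurableT_comp mF (measurable_translate2 y)).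
rewrite -(ge0_integral_mS_translate y mF F0 pF).
rewrite fubini_tonelli1; last 2 first.
- by mfun.
- by move=> z; rewrite mule_ge0// lee_fin indicE.
have mFy' : measurable_fun setT (fun z : plane => F (z + y)%R).
  exact: (measurableT_comp mF (measurable_translate2 y)).
rewrite (integral_mS mFy' (fun z => F0 _)).
apply: eq_integral => s _; rewrite /fubini_F/=.
have mFs : measurable_fun setT (fun t : R => F (((s : R), t) + y)%R).
  apply: (measurableT_comp mF); apply: (measurableT_comp (measurable_translate2 y)).
  by mfun.
rewrite (integral_indicM mu `](- pi)%R, pi]).
under eq_integral do rewrite addrC.
rewrite [X in `](- pi)%R, X]](_ : _ = - pi + 2 * pi); last by ring.
rewrite (@ge0_integral_periodic _ _ _ (fun t => F (((s : R), t) + y)%R))// => t.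
by rewrite /GRing.add/= /add_pair/= addrAC pF.
Qed.

Definition logpolar (z : R * R) : R * R := (expR z.1 * cos z.2, expR z.1 * sin z.2).

Lemma measurable_logpolar : measurable_fun setT (logpolar : plane -> plane).
Proof. by rewrite /logpolar; mfun. Qed.

Lemma cosDpi2 (t : R) : cos (t + 2 * pi) = cos t.
Proof. by rewrite mulrC mulr_natr cosD2pi. Qed.

Lemma sinDpi2 (t : R) : sin (t + 2 * pi) = sin t.
Proof. by rewrite mulrC mulr_natr sinD2pi. Qed.

Lemma periodic_logpolar : periodic2 logpolar.
Proof. by move=> s t; rewrite /logpolar/= cosDpi2 sinDpi2. Qed.

(** The antipodal term of the half-plane formula is the radial integral at the angle [t + pi], so
    the two half turns glue to a full one, whose start periodicity moves to 0. *)
Lemma ge0_integral_polar (F : plane -> \bar R) :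
  measurable_fun setT F -> (forall x, 0 <= F x)%E ->
  (\int[leb2]_x F x = \int[muT]_t \int[mu]_(r in `]0%R, +oo[)
     (r%:E * F (r * cos t, r * sin t)%R))%E.
Proof.
move=> mF F0; rewrite ge0_integral_polar_half//.
pose K (z : plane) : \bar R := ((`|z.2|)%:E * F (z.2 * cos z.1, z.2 * sin z.1)%R)%E.
have mK : measurable_fun setT K by rewrite /K; mfun.
have K0 z : (0 <= K z)%E by rewrite mule_ge0// lee_fin.
pose G t := (\int[mu]_(r in `]0%R, +oo[) (r%:E * F (r * cos t, r * sin t)%R))%E.
have GE t : G t = (\int[mu]_r ((\1_`]0%R, +oo[ r)%:E * K (t, r)))%E.
  rewrite (integral_indicM mu `]0%R, +oo[).
  apply: eq_integral => r; rewrite inE/= in_itv/= andbT => r0.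
  by rewrite /K/= gtr0_norm.
have mG : measurable_fun setT G.
  rewrite (funext GE).
  pose H z := ((\1_`]0%R, +oo[ z.2)%:E * K z)%E.
  apply: (@measurable_integral_snd _ H); rewrite /H; first by mfun.
  by move=> z; rewrite !mule_ge0// lee_fin ?indicE.
have G0 t : (0 <= G t)%E.
  by rewrite GE; apply: integral_ge0 => r _; rewrite mule_ge0// lee_fin indicE.
have GP t : G (t + 2 * pi) = G t.
  by rewrite /G; apply: eq_integral => r _; rewrite cosDpi2 sinDpi2.
have P0 : 0 < 2 * pi :> R by rewrite mulr_gt0 ?pi_gt0.
rewrite (integral_muT mG G0) -/G /circle -(ge0_integral_periodic (- (pi / 2)) P0 mG G0 GP).
rewrite (_ : - (pi / 2) + 2 * pi = pi / 2 + pi); last by field.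
rewrite (@ge0_integral_itv_cat _ _ (pi / 2))//; last 2 first.
- by rewrite (@le_trans _ _ 0) ?oppr_le0 ?divr_ge0 ?pi_ge0.
- by rewrite lerDl pi_ge0.
rewrite [X in (_ + X)%E](_ : _ =
    \int[mu]_(t in `](- (pi / 2))%R, (pi / 2)%R]) G (t + pi)%R)%E; last first.
  rewrite -ge0_integral_itv_translate//.
  by rewrite (_ : - (pi / 2) + pi = pi / 2)//; field.
have mGpi : measurable_fun setT (fun t : R => G (t + pi)) by mfun.
rewrite -ge0_integralD//; last 2 first.
- exact: measurable_funTS.
- exact: measurable_funTS.
rewrite -integral_itv_bndo_bndc; last first.
  by apply: measurable_funTS; mfun.
have mKt t : measurable_fun setT (fun r => K (t, r)) by mfun.
have KE t : G t = (\int[mu]_(r in `]0%R, +oo[) K (t, r))%E.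
  by rewrite GE (integral_indicM mu `]0%R, +oo[).
apply: eq_integral => t _; rewrite !KE -ge0_integralD//; last 2 first.
- exact: measurable_funTS.
- exact: measurable_funTS.
apply: eq_integral => r; rewrite inE/= in_itv/= andbT => r0.
by rewrite /K/= gtr0_norm// cosDpi sinDpi !mulrN ge0_muleDr.
Qed.

Lemma ge0_integral_logpolar (F : plane -> \bar R) :
  measurable_fun setT F -> (forall x, 0 <= F x)%E ->
  (\int[leb2]_x F x =
   \int[mu \x muT]_z ((expR z.1 ^+ 2)%:E * F (logpolar z)))%E.
Proof.
move=> mF F0; rewrite ge0_integral_polar//.
pose H (z : plane) := ((expR z.1 ^+ 2)%:E * F (logpolar z))%E.
have mH : measurable_fun setT H.
  rewrite /H; mfun; exact: measurable_logpolar.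
have H0 z : (0 <= H z)%E by rewrite mule_ge0// lee_fin sqr_ge0.
rewrite (fubini_tonelli2 _ mH H0); apply: eq_integral => t _.
pose K r : \bar R := ((`|r|)%:E * F (r * cos t, r * sin t)%R)%E.
have mK : measurable_fun setT K by rewrite /K; mfun.
have K0 z : (0 <= K z)%E by rewrite mule_ge0// lee_fin.
transitivity (\int[mu]_(r in `]0%R, +oo[) K r)%E.
  apply: eq_integral => r; rewrite inE/= in_itv/= andbT => r0.
  by rewrite /K/= gtr0_norm.
rewrite ge0_integral_expR//; apply: eq_integral => s _.
by rewrite /K /H/= gtr0_norm ?expR_gt0// muleA -EFinM expr2.
Qed.

End cylinder.
Notation mS := (lebesgue_measure \x muT)%E.

(** * The magnetic Wirtinger inequality *)

Section itv_integral.
Context {R : realType}.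
Notation mu := (@lebesgue_measure R).
Implicit Types (f g F : R -> R) (a b : R).

(** Two-sided continuity at every point of the closed interval, endpoints included: it is stable
    under algebra without any subspace topology. *)
Definition cont_itv a b f := forall x, x \in `[a, b] -> {for x, continuous f}.

Lemma cont_itvD a b f g : cont_itv a b f -> cont_itv a b g ->
  cont_itv a b (fun x => f x + g x).
Proof. by move=> cf cg x xab; apply: (@cvgD _ R^o); [exact: cf|exact: cg]. Qed.

Lemma cont_itvM a b f g : cont_itv a b f -> cont_itv a b g ->
  cont_itv a b (fun x => f x * g x).
Proof. by move=> cf cg x xab; apply: (@cvgM R); [exact: cf|exact: cg]. Qed.

Lemma cont_itvN a b f : cont_itv a b f -> cont_itv a b (fun x => - f x).
Proof. by move=> cf x xab; apply: (@cvgN _ R^o); exact: cf. Qed.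

Lemma cont_itvB a b f g : cont_itv a b f -> cont_itv a b g ->
  cont_itv a b (fun x => f x - g x).
Proof. by move=> cf cg; apply: cont_itvD => //; exact: cont_itvN. Qed.

Lemma cont_itvX a b f n : cont_itv a b f -> cont_itv a b (fun x => f x ^+ n).
Proof.
move=> cf x xab; apply: (@continuous_comp _ _ _ f (fun y => y ^+ n)).
  exact: cf.
exact: exprn_continuous.
Qed.

Lemma cont_itv_cst a b c : cont_itv a b (fun=> c).
Proof. by move=> x _; exact: cvg_cst. Qed.

Lemma cont_itv_integrable a b f : cont_itv a b f ->
  mu.-integrable `[a, b] (EFin \o f).
Proof.
move=> cf; apply: continuous_compact_integrable; first exact: segment_compact.
by apply: continuous_in_subspaceT => x; rewrite inE; exact: cf.
Qed.

Lemma is_derive_cont f (x d : R) : is_derive x 1 f d -> {for x, continuous f}.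
Proof.
move=> dFx; apply: differentiable_continuous.
exact/derivable1_diffP.
Qed.

Lemma RintegralFTC a b f F : a <= b ->
  (forall x, x \in `[a, b] -> is_derive x (1 : R) F (f x)) -> cont_itv a b f ->
  \int[mu]_(x in `[a, b]) f x = F b - F a.
Proof. by move=> ab dF cf; rewrite /Rintegral (FTC_is_derive ab dF cf). Qed.

End itv_integral.

Section wirtinger.
Context {R : realType}.
Notation mu := (@lebesgue_measure R).
Implicit Types (f g : R -> R) (a b c v : R).

(* The square completed is that of a Riccati solution of the Jacobi
   equation; [k < 1] keeps the tangent finite on the closed interval. *)
Lemma wirtinger_dirichlet_lt f f' c v k : 0 < k < 1 ->
  (forall x, is_derive x (1 : R) f (f' x)) -> continuous f' ->
  f c = v -> f (c + pi) = v ->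
  k ^+ 2 * \int[mu]_(t in `[c, c + pi]) (f t - v) ^+ 2 <=
    \int[mu]_(t in `[c, c + pi]) f' t ^+ 2.
Proof.
move=> /andP[k0 k1] df cf' fc fcpi.
have pi0 : 0 < pi :> R by exact: pi_gt0.
have ccpi : c <= c + pi by rewrite lerDl ltW.
pose h t := k * (t - c - pi / 2).
have hD (t : R) : t \in `[c, c + pi] -> h t \in `](- (pi / 2)), (pi / 2)[.
  rewrite !in_itv/= => /andP[ct tc].
  have : `|h t| < pi / 2.
    rewrite /h normrM gtr0_norm// (@le_lt_trans _ _ (k * (pi / 2)))//.
      rewrite ler_pM2l// ler_norml; apply/andP; split; lra.
    by rewrite gtr_pMl// divr_gt0.
  by rewrite ltr_norml.
have ch (t : R) : t \in `[c, c + pi] -> cos (h t) != 0.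
  by move=> /hD tD; rewrite gt_eqF// cos_gt0_pihalf.
pose T t := tan (h t).
have dT (t : R) : t \in `[c, c + pi] -> is_derive t (1 : R) T (k * (1 + T t ^+ 2)).
  move=> /ch cht; have := is_derive_tan cht => dtan.
  have dh : is_derive t (1 : R) h k.
    by rewrite /h; apply: is_derive_eq; rewrite !(mulr0, addr0, subr0, mulr1, add0r, scaler0)
      -?[k *: _]/(k * _) ?mulr1.
  have := is_derive1_comp dtan dh.
  by rewrite cos2_tan2// mulrC.
have cT : cont_itv c (c + pi) T by move=> t tc; exact: (is_derive_cont (dT t tc)).
have cf : cont_itv c (c + pi) f by move=> t _; exact: (is_derive_cont (df t)).
have cf'i : cont_itv c (c + pi) f' by move=> t _; exact: cf'.
have cc := @cont_itv_cst R c (c + pi).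
(* An exact derivative: the function [k * T * (f - v) ^+ 2] vanishes at both ends, so [g] integrates
   to 0 and can be added to complete the square. *)
pose g t := k * (k * (1 + T t ^+ 2)) * (f t - v) ^+ 2
            + k * T t * (2 * (f t - v) * f' t).
have cg : cont_itv c (c + pi) g.
  apply: cont_itvD; apply: cont_itvM; apply: cont_itvM => //; try exact: cc.
  - by apply: cont_itvM; [exact: cc|apply: cont_itvD; [exact: cc|exact: cont_itvX]].
  - by apply: cont_itvB => //; exact: cc.
  - by apply: cont_itvB => //; exact: cc.
  - by apply: cont_itvM; [exact: cc|apply: cont_itvB => //; exact: cc].
have dg (t : R) : t \in `[c, c + pi] ->
    is_derive t (1 : R) (fun t => k * T t * (f t - v) ^+ 2) (g t).
  move=> tc; have dTt := dT t tc; have dft := df t.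
  apply: is_derive_eq; rewrite /g -!/(_ * _) /GRing.scale/=; ring.
have g0 : \int[mu]_(t in `[c, c + pi]) g t = 0.
  by rewrite (RintegralFTC ccpi dg cg) fc fcpi !subrr expr0n/= !mulr0 subrr.
have c1 : cont_itv c (c + pi) (fun t => (f t - v) ^+ 2).
  by apply: cont_itvX; apply: cont_itvB => //; exact: cc.
have c2 : cont_itv c (c + pi) (fun t => f' t ^+ 2) by apply: cont_itvX.
rewrite -RintegralZl//; last exact: cont_itv_integrable.
rewrite -[leRHS]addr0 -g0 -RintegralD//; last 2 first.
- exact: cont_itv_integrable.
- exact: cont_itv_integrable.
apply: le_Rintegral => //.
- by apply: cont_itv_integrable; apply: cont_itvM => //; exact: cc.
- by apply: cont_itv_integrable; apply: cont_itvD.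
- move=> t _; rewrite -subr_ge0 (_ : _ - _ = (f' t + k * T t * (f t - v)) ^+ 2).
    exact: sqr_ge0.
  by rewrite /g; ring.
Qed.

Lemma wirtinger_dirichlet f f' c v :
  (forall x, is_derive x (1 : R) f (f' x)) -> continuous f' ->
  f c = v -> f (c + pi) = v ->
  \int[mu]_(t in `[c, c + pi]) (f t - v) ^+ 2 <=
    \int[mu]_(t in `[c, c + pi]) f' t ^+ 2.
Proof.
move=> df cf' fc fcpi; rewrite leNgt; apply/negP => BA.
set B := \int[mu]_(t in _) _ in BA; set A := \int[mu]_(t in _) _ in BA.
have B0 : 0 <= B by apply: Rintegral_ge0 => t _; exact: sqr_ge0.
have A0 : 0 < A by exact: le_lt_trans B0 BA.
(* Limit [k -> 1] by contradiction: [e * A] is a quarter of the gap [A - B], so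
   [(1 - e)^2 * A >= A - 2 e A = (A + B) / 2] still exceeds [B]. *)
pose e := (A - B) / (4 * A).
have e0 : 0 < e by rewrite divr_gt0// ?subr_gt0// mulr_gt0.
have e1 : e < 1 by rewrite /e ltr_pdivrMr ?mulr_gt0// mul1r; lra.
have k01 : 0 < 1 - e < 1 by apply/andP; split; lra.
have := wirtinger_dirichlet_lt k01 df cf' fc fcpi; rewrite -/A -/B.
have eA : e * A = (A - B) / 4 by rewrite /e; field; rewrite gt_eqF.
nra.
Qed.

Lemma Rintegral_itv_cat a b c f : a <= b -> b <= c -> cont_itv a c f ->
  \int[mu]_(t in `[a, c]) f t =
  \int[mu]_(t in `[a, b]) f t + \int[mu]_(t in `[b, c]) f t.
Proof.
move=> ab bc cf.
have iac := cont_itv_integrable cf.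
rewrite -[X in _ = _ + X]Rintegral_itv_obnd_cbnd; last first.
  apply: (integrableS _ _ _ iac) => // x /=; rewrite !in_itv/= => /andP[bx ->].
  by rewrite (le_trans ab (ltW bx)).
rewrite -Rintegral_setU//.
- congr (Rintegral _ _ _); apply/seteqP; split => x /=; rewrite !in_itv/=.
    by move=> /andP[-> ->]; case: (leP x b) => xb; [left|right].
  move=> [/andP[-> xb]|/andP[bx ->]]; first by rewrite (le_trans xb bc).
  by rewrite (le_trans ab (ltW bx)).
- apply: (integrableS _ _ _ iac) => //; first exact: measurableU.
  move=> x /= [|]; rewrite !in_itv/=.
    by move=> /andP[-> xb]; rewrite (le_trans xb bc).
  by move=> /andP[bx ->]; rewrite (le_trans ab (ltW bx)).
- apply/disj_setPS => x /=; rewrite !in_itv/= => -[/andP[_ xb] /andP[bx _]].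
  by have := le_lt_trans xb bx; rewrite ltxx.
Qed.

(** The difference [f t - f (t + pi)] changes sign over half a period, so [f] takes one value [v] at
    two antipodal points. The Dirichlet inequality on the two half circles then gives the periodic
    one, with [v] in place of the mean. *)
Lemma wirtinger_periodic f f' :
  (forall x, is_derive x (1 : R) f (f' x)) -> continuous f' ->
  (forall x, f (x + 2 * pi) = f x) ->
  exists c v, \int[mu]_(t in `[c, c + 2 * pi]) (f t - v) ^+ 2 <=
    \int[mu]_(t in `[c, c + 2 * pi]) f' t ^+ 2.
Proof.
move=> df cf' fP.
have pi0 : 0 < pi :> R by exact: pi_gt0.
have cf : continuous f by move=> x; exact: (is_derive_cont (df x)).
pose g t := f t - f (t + pi).
have cg : continuous g.
  move=> x; apply: (@cvgB _ R^o); first exact: cf.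
  apply: (@continuous_comp _ _ _ (fun t => t + pi) f); last exact: cf.
  by apply: (@cvgD _ R^o); [exact: cvg_id|exact: cvg_cst].
have gpi : g pi = - g 0.
  by rewrite /g add0r (_ : pi + pi = 0 + 2 * pi) ?fP ?opprB//; ring.
have [c _ gc] : exists2 c, c \in `[0, pi] & g c = 0.
  apply: (@IVT _ g 0 pi 0); first exact: ltW.
    exact: continuous_subspaceT.
  rewrite gpi; case: (leP 0 (g 0)) => g0.
    rewrite min_r ?max_l; lra.
  rewrite min_l ?max_r; lra.
exists c, (f c).
have cpi : f (c + pi) = f c by apply/eqP; rewrite eq_sym -subr_eq0; apply/eqP.
have c2pi : f (c + pi + pi) = f c by rewrite -addrA (_ : pi + pi = 2 * pi) ?fP//; ring.
have cfv : cont_itv c (c + 2 * pi) (fun t => (f t - f c) ^+ 2).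
  apply: cont_itvX; apply: cont_itvB; last exact: cont_itv_cst.
  by move=> x _; exact: cf.
have cf'2 : cont_itv c (c + 2 * pi) (fun t => f' t ^+ 2).
  by apply: cont_itvX => x _; exact: cf'.
rewrite !(@Rintegral_itv_cat c (c + pi) (c + 2 * pi))//; try lra.
rewrite (_ : c + 2 * pi = c + pi + pi); last by ring.
by apply: lerD; apply: wirtinger_dirichlet.
Qed.

(* The magnetic Wirtinger inequality. With [v = e^{i al t} w] it reads
   [2 al * area <= int |v'|^2], which is Hurwitz' isoperimetric argument. *)
Lemma wirtinger_flux (al : R) (w1 w2 w1' w2' : R -> R) :
  `|al| <= 1 / 2 ->
  (forall x, is_derive x (1 : R) w1 (w1' x)) -> continuous w1' ->
  (forall x, is_derive x (1 : R) w2 (w2' x)) -> continuous w2' ->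
  (forall t, w1 (t + 2 * pi) =
     cos (2 * pi * al) * w1 t + sin (2 * pi * al) * w2 t) ->
  (forall t, w2 (t + 2 * pi) =
     cos (2 * pi * al) * w2 t - sin (2 * pi * al) * w1 t) ->
  exists c, al ^+ 2 * \int[mu]_(t in `[c, c + 2 * pi]) (w1 t ^+ 2 + w2 t ^+ 2) <=
    \int[mu]_(t in `[c, c + 2 * pi]) (w1' t ^+ 2 + w2' t ^+ 2).
Proof.
move=> al12 dw1 cw1' dw2 cw2' P1 P2.
pose C t := cos (al * t); pose S t := sin (al * t).
have dC (t : R) : is_derive t (1 : R) C (- al * S t).
  rewrite /C; apply: is_derive_eq; rewrite /GRing.scale/= /S; ring.
have dS (t : R) : is_derive t (1 : R) S (al * C t).
  rewrite /S; apply: is_derive_eq; rewrite /GRing.scale/= /C; ring.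
have CS t : C t ^+ 2 + S t ^+ 2 = 1 by exact: cos2Dsin2.
have aP t : al * (t + 2 * pi) = al * t + 2 * pi * al by ring.
pose x t := C t * w1 t - S t * w2 t; pose y t := S t * w1 t + C t * w2 t.
have xP t : x (t + 2 * pi) = x t.
  rewrite /x P1 P2 /C /S aP cosD sinD -/(C t) -/(S t).
  have := cos2Dsin2 (2 * pi * al); set c := cos _; set s := sin _ => cs.
  transitivity ((c ^+ 2 + s ^+ 2) * (C t * w1 t - S t * w2 t)); first by ring.
  by rewrite cs mul1r.
have yP t : y (t + 2 * pi) = y t.
  rewrite /y P1 P2 /C /S aP cosD sinD -/(C t) -/(S t).
  have := cos2Dsin2 (2 * pi * al); set c := cos _; set s := sin _ => cs.
  transitivity ((c ^+ 2 + s ^+ 2) * (S t * w1 t + C t * w2 t)); first by ring.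
  by rewrite cs mul1r.
pose x' t := - al * y t + (C t * w1' t - S t * w2' t).
pose y' t := al * x t + (S t * w1' t + C t * w2' t).
have dx (t : R) : is_derive t (1 : R) x (x' t).
  have d1 := dC t; have d2 := dS t; have d3 := dw1 t; have d4 := dw2 t.
  rewrite /x; apply: is_derive_eq; rewrite /GRing.scale/= /x' /y; ring.
have dy (t : R) : is_derive t (1 : R) y (y' t).
  have d1 := dC t; have d2 := dS t; have d3 := dw1 t; have d4 := dw2 t.
  rewrite /y; apply: is_derive_eq; rewrite /GRing.scale/= /y' /x; ring.
have cC t : {for t, continuous C} by exact: (is_derive_cont (dC t)).
have cS t : {for t, continuous S} by exact: (is_derive_cont (dS t)).
have cw1 t : {for t, continuous w1} by exact: (is_derive_cont (dw1 t)).
have cw2 t : {for t, continuous w2} by exact: (is_derive_cont (dw2 t)).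
have cx t : {for t, continuous x} by exact: (is_derive_cont (dx t)).
have cy t : {for t, continuous y} by exact: (is_derive_cont (dy t)).
pose ci f := forall a b, cont_itv a b f.
have ciW f : (forall t, {for t, continuous f}) -> ci f by move=> cf a b t _; exact: cf.
have [iC iS] : ci C /\ ci S by split; exact: ciW.
have [ix iy] : ci x /\ ci y by split; exact: ciW.
have [iw1 iw2] : ci w1 /\ ci w2 by split; exact: ciW.
have [iw1' iw2'] : ci w1' /\ ci w2' by split; exact: ciW.
have ix' : ci x'.
  move=> a b; apply: cont_itvD.
    by apply: cont_itvM; [exact: cont_itv_cst|exact: iy].
  by apply: cont_itvB; apply: cont_itvM; [exact: iC|exact: iw1'|exact: iS|exact: iw2'].
have iy' : ci y'.
  move=> a b; apply: cont_itvD.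
    by apply: cont_itvM; [exact: cont_itv_cst|exact: ix].
  by apply: cont_itvD; apply: cont_itvM; [exact: iS|exact: iw1'|exact: iC|exact: iw2'].
have cx' : continuous x' by move=> t; apply: (ix' t t); rewrite in_itv/= lexx.
have [c [v wir]] := wirtinger_periodic dx cx' xP.
exists c.
(* The derivative of the periodic function [2 v y - x y]. Adding it with the factor [2 al] replaces
   [x] by [x - v] in the area term. *)
pose q t := 2 * v * y' t - (x t * y' t + x' t * y t).
have iq : ci q.
  move=> a b; apply: cont_itvB.
    by apply: cont_itvM; [exact: cont_itv_cst|exact: iy'].
  by apply: cont_itvD; apply: cont_itvM; [exact: ix|exact: iy'|exact: ix'|exact: iy].
have c2pi : c <= c + 2 * pi by rewrite lerDl mulr_ge0// pi_ge0.
have q0 : \int[mu]_(t in `[c, c + 2 * pi]) q t = 0.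
  rewrite (@RintegralFTC _ _ _ _ (fun t => 2 * v * y t - x t * y t) c2pi _ (iq _ _)).
    by rewrite xP yP subrr.
  move=> t _; have d1 := dx t; have d2 := dy t.
  apply: is_derive_eq; rewrite /GRing.scale/= /q; ring.
pose I := `[c, c + 2 * pi].
have inI f : ci f -> mu.-integrable [set` I] (EFin \o f).
  by move=> cf; apply: cont_itv_integrable; exact: cf.
have i1 : ci (fun t => w1 t ^+ 2 + w2 t ^+ 2).
  by move=> a b; apply: cont_itvD; apply: cont_itvX; [exact: iw1|exact: iw2].
have i2 : ci (fun t => (x t - v) ^+ 2).
  by move=> a b; apply: cont_itvX; apply: cont_itvB; [exact: ix|exact: cont_itv_cst].
have i3 : ci (fun t => x' t ^+ 2) by move=> a b; apply: cont_itvX; exact: ix'.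
have i4 : ci (fun t => w1' t ^+ 2 + w2' t ^+ 2).
  by move=> a b; apply: cont_itvD; apply: cont_itvX; [exact: iw1'|exact: iw2'].
have iM k f : ci f -> ci (fun t => k * f t).
  by move=> cf a b; apply: cont_itvM; [exact: cont_itv_cst|exact: cf].
have iD f g : ci f -> ci g -> ci (fun t => f t + g t).
  by move=> cf cg a b; apply: cont_itvD; [exact: cf|exact: cg].
(* The difference of the two sides is a combination of two squares with coefficients [1/2 - al] and
   [1/2 + al]: here [|al| <= 1/2] enters. The terms [x'^2] and [(x - v)^2] are afterwards compared
   by the periodic inequality. *)
have key t : al ^+ 2 * (w1 t ^+ 2 + w2 t ^+ 2) + x' t ^+ 2 <=
    w1' t ^+ 2 + w2' t ^+ 2 + (x t - v) ^+ 2 + (- 2 * al) * - q t.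
  have -> : w1 t ^+ 2 + w2 t ^+ 2 = x t ^+ 2 + y t ^+ 2.
    rewrite -[LHS]mul1r -(CS t) /x /y; ring.
  have -> : w1' t ^+ 2 + w2' t ^+ 2 = (x' t + al * y t) ^+ 2 + (y' t - al * x t) ^+ 2.
    rewrite -[LHS]mul1r -(CS t) /x' /y'; ring.
  rewrite /q; move: al12; rewrite ler_norml => /andP[al1 al2].
  set X := x t; set Y := y t; set X' := x' t; set Y' := y' t.
  have h1 : 0 <= (1 / 2 - al) * (X - v + Y') ^+ 2 by rewrite mulr_ge0 ?sqr_ge0//; lra.
  have h2 : 0 <= (1 / 2 + al) * (X - v - Y') ^+ 2 by rewrite mulr_ge0 ?sqr_ge0//; lra.
  rewrite -subr_ge0.
  rewrite [leRHS](_ : _ = (1 / 2 - al) * (X - v + Y') ^+ 2 + (1 / 2 + al) * (X - v - Y') ^+ 2).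
    exact: addr_ge0.
  by field.
have iNq : ci (fun t => - q t) by move=> a b; apply: cont_itvN; exact: iq.
have := @le_Rintegral _ _ _ mu [set` I] _ _ (measurable_itv _)
  (inI _ (iD _ _ (iM (al ^+ 2) _ i1) i3))
  (inI _ (iD _ _ (iD _ _ i4 i2) (iM (- 2 * al) _ iNq))) (fun t _ => key t).
rewrite (RintegralD _ (inI _ (iM (al ^+ 2) _ i1)) (inI _ i3))//.
rewrite (RintegralD _ (inI _ (iD _ _ i4 i2)) (inI _ (iM (- 2 * al) _ iNq)))//.
rewrite (RintegralD _ (inI _ i4) (inI _ i2))//.
rewrite (@RintegralZl _ _ _ mu _ _ _ (measurable_itv _) (inI _ i1)).
rewrite (@RintegralZl _ _ _ mu _ _ _ (measurable_itv _) (inI _ iNq)).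
have -> : \int[mu]_(t in [set` I]) - q t = 0.
  under eq_Rintegral do rewrite -mulN1r.
  rewrite (@RintegralZl _ _ _ mu _ _ _ (measurable_itv _) (inI _ iq)).
  by rewrite q0 mulr0.
rewrite mulr0 addr0 => h; rewrite -(lerD2r (\int[mu]_(t in [set` I]) x' t ^+ 2)).
by apply: (le_trans h); rewrite lerD2l.
Qed.
End wirtinger.

(** * Hardy inequality on the cylinder *)

Section signed_change_of_variables.
Local Open Scope ereal_scope.
Context d1 d2 (X : measurableType d1) (Y : measurableType d2) (R : realType).
Variables (mu : {measure set X -> \bar R}) (m : {measure set Y -> \bar R}).
Variables (phi : X -> Y) (k : X -> R).
Hypothesis k0 : forall x, (0 <= k x)%R.
Hypothesis ge0_cov : forall F : Y -> \bar R, measurable_fun setT F ->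
  (forall y, 0 <= F y) -> \int[m]_y F y = \int[mu]_x ((k x)%:E * F (phi x)).

Lemma integral_cov (F : Y -> \bar R) : measurable_fun setT F ->
  \int[m]_y F y = \int[mu]_x ((k x)%:E * F (phi x)).
Proof.
move=> mF; rewrite [LHS]integralE [RHS]integralE; congr (_ - _).
- rewrite ge0_cov//; last exact: measurable_funepos.
  apply: eq_integral => x _; rewrite !funeposE.
  by rewrite maxe_pMr ?lee_fin ?k0// mule0.
- rewrite ge0_cov//; last exact: measurable_funeneg.
  apply: eq_integral => x _; rewrite !funenegE.
  by rewrite -muleN maxe_pMr ?lee_fin ?k0// mule0.
Qed.

End signed_change_of_variables.

(** * Square-integrable functions *)

Section square_integrable.
Context d (T : measurableType d) (R : realType) (mu : {measure set T -> \bar R}).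
Implicit Types a b f g : T -> R.

Definition sq_int f := measurable_fun setT f /\
  (\int[mu]_x (f x ^+ 2)%:E < +oo)%E.

Definition ip f g := \int[mu]_x (f x * g x).

Lemma sq_int_integrable f : sq_int f -> mu.-integrable setT (EFin \o (fun x => f x ^+ 2)).
Proof.
move=> [mf fy]; apply/integrableP; split; first by apply/measurable_EFinP; mfun.
rewrite (eq_integral (fun x => (f x ^+ 2)%:E))// => x _ /=.
by rewrite ger0_norm ?sqr_ge0.
Qed.

Lemma integrable_le f g : measurable_fun setT f -> (forall x, `|f x| <= g x) ->
  mu.-integrable setT (EFin \o g) -> mu.-integrable setT (EFin \o f).
Proof.
move=> mf fg; apply: le_integrable => //; first exact/measurable_EFinP.
by move=> x _ /=; rewrite lee_fin (le_trans (fg x))// ler_norm.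
Qed.

Lemma integrableDr f g : mu.-integrable setT (EFin \o f) ->
  mu.-integrable setT (EFin \o g) -> mu.-integrable setT (EFin \o (fun x => f x + g x)).
Proof. by move=> hf hg; exact: (integrableD measurableT hf hg). Qed.

Lemma integrableZr_real c f : mu.-integrable setT (EFin \o f) ->
  mu.-integrable setT (EFin \o (fun x => c * f x)).
Proof. by move=> hf; exact: (integrableZl measurableT c hf). Qed.

Lemma mul_le_sq (x y : R) : `|x * y| <= x ^+ 2 + y ^+ 2.
Proof.
rewrite ler_norml; apply/andP; split.
  have : 0 <= (x + y) ^+ 2 by exact: sqr_ge0.
  have : 0 <= x ^+ 2 by exact: sqr_ge0.
  have : 0 <= y ^+ 2 by exact: sqr_ge0.
  nra.
have : 0 <= (x - y) ^+ 2 by exact: sqr_ge0.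
have : 0 <= x ^+ 2 by exact: sqr_ge0.
have : 0 <= y ^+ 2 by exact: sqr_ge0.
nra.
Qed.

Lemma sq_int_mul f g : sq_int f -> sq_int g ->
  mu.-integrable setT (EFin \o (fun x => f x * g x)).
Proof.
move=> hf hg; apply: (@integrable_le _ (fun x => f x ^+ 2 + g x ^+ 2)).
- by apply: measurable_funM; [exact: hf.1|exact: hg.1].
- by move=> x; exact: mul_le_sq.
- by apply: integrableDr; exact: sq_int_integrable.
Qed.

Lemma sq_int_le f g : measurable_fun setT f -> (forall x, f x ^+ 2 <= g x) ->
  mu.-integrable setT (EFin \o g) -> sq_int f.
Proof.
move=> mf fg ig; split => //.
have /integrableP[mg] := ig; apply: le_lt_trans.
apply: ge0_le_integral => //.
- by move=> x _; rewrite lee_fin sqr_ge0.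
- by apply/measurable_EFinP; mfun.
- by apply: measurableT_comp => //.
- by by move=> x _ /=; rewrite lee_fin (le_trans (fg x))// ler_norm.
Qed.

Lemma sq_intD f g : sq_int f -> sq_int g -> sq_int (fun x => f x + g x).
Proof.
move=> hf hg; apply: (@sq_int_le _ (fun x => 2 * (f x ^+ 2 + g x ^+ 2))).
- by apply: measurable_funD; [exact: hf.1|exact: hg.1].
- move=> x; have : 0 <= (f x - g x) ^+ 2 by exact: sqr_ge0.
  nra.
- by apply: integrableZr_real; apply: integrableDr; exact: sq_int_integrable.
Qed.

Lemma sq_intZ c f : sq_int f -> sq_int (fun x => c * f x).
Proof.
move=> hf; apply: (@sq_int_le _ (fun x => c ^+ 2 * (f x ^+ 2))).
- by have mf := hf.1; mfun.
- by move=> x; rewrite exprMn.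
- by apply: integrableZr_real; exact: sq_int_integrable.
Qed.

Lemma ipC f g : ip f g = ip g f.
Proof. by rewrite /ip; apply: eq_Rintegral => x _; rewrite mulrC. Qed.

Lemma ipDl f g h : sq_int f -> sq_int g -> sq_int h ->
  ip (fun x => f x + g x) h = ip f h + ip g h.
Proof.
move=> hf hg hh; rewrite /ip -RintegralD//; try exact: sq_int_mul.
by apply: eq_Rintegral => x _; rewrite mulrDl.
Qed.

Lemma ipZl c f h : sq_int f -> sq_int h -> ip (fun x => c * f x) h = c * ip f h.
Proof.
move=> hf hh; rewrite /ip -RintegralZl//; last exact: sq_int_mul.
by apply: eq_Rintegral => x _; rewrite mulrA.
Qed.

Lemma ipDZ f g c : sq_int f -> sq_int g ->
  ip (fun x => f x + c * g x) (fun x => f x + c * g x) =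
  ip f f + 2 * c * ip f g + c ^+ 2 * ip g g.
Proof.
move=> hf hg; have hcg := sq_intZ c hg.
rewrite ipDl//; last exact: sq_intD.
rewrite (ipC f) (ipC (fun x => c * g x)) !ipDl//.
rewrite !(ipC _ (fun x => c * g x)) !ipZl// (ipC _ (fun x => c * g x)) ipZl//.
by rewrite (ipC g f); ring.
Qed.

Lemma ip_ge0 f : 0 <= ip f f.
Proof. by apply: Rintegral_ge0 => x _; rewrite -expr2 sqr_ge0. Qed.

Lemma ipE f : sq_int f -> (ip f f)%:E = (\int[mu]_x (f x ^+ 2)%:E)%E.
Proof.
move=> hf; rewrite /ip /Rintegral fineK.
  by apply: eq_integral => x _; rewrite expr2.
have -> : (\int[mu]_x (f x * f x)%:E)%E = (\int[mu]_x (f x ^+ 2)%:E)%E.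
  by apply: eq_integral => x _; rewrite expr2.
rewrite ge0_fin_numE ?hf.2//; apply: integral_ge0 => x _.
by rewrite lee_fin sqr_ge0.
Qed.

Lemma discriminant (A B C : R) : 0 <= A -> 0 <= C ->
  (forall c, 0 <= A + 2 * c * B + c ^+ 2 * C) -> B ^+ 2 <= A * C.
Proof.
move=> A0 C0 h; have [C00|C00] := eqVneq C 0.
  have [-> | B0] := eqVneq B 0; first by rewrite expr0n/= mulr_ge0.
  (* At this [c] the polynomial, affine because [C = 0], takes the value -1. *)
  have := h (- (A + 1) / (2 * B)); rewrite C00 mulr0 addr0.
  rewrite (_ : 2 * _ * B = - (A + 1)); last by field.
  by lra.
have Cp : 0 < C by rewrite lt_neqAle eq_sym C00.
have := h (- B / C).
rewrite (_ : _ + _ = (A * C - B ^+ 2) / C); last by field.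
by rewrite pmulr_lge0 ?invr_gt0// subr_ge0.
Qed.

(** Cauchy-Schwarz for the measure with density [k], from the pointwise bound
    [b <= c / 2 + b^2 / (2 c)] integrated against [k]. Finiteness of the left-hand side is a
    consequence, obtained with [c = 1]. *)
Lemma ge0_jensen_sq (k b : T -> R) (K : R) : 0 < K ->
  measurable_fun setT k -> measurable_fun setT b ->
  (forall x, 0 <= k x) -> (forall x, 0 <= b x) ->
  (\int[mu]_x (k x)%:E <= K%:E)%E ->
  ((\int[mu]_x (k x * b x)%:E) ^+ 2 <= K%:E * \int[mu]_x (k x * b x ^+ 2)%:E)%E.
Proof.
move=> K0 mk mb k0 b0 kK.
set B := (\int[mu]_x (k x * b x ^+ 2)%:E)%E.
have B0 : (0 <= B)%E.
  by apply: integral_ge0 => x _; rewrite lee_fin mulr_ge0// sqr_ge0.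
have [->|Bfin] := eqVneq B +oo%E.
  by rewrite gt0_muley ?leey// lte_fin.
have {}Bfin : B \is a fin_num by rewrite ge0_fin_numE// lt_neqAle Bfin leey.
have bnd c : 0 < c -> (\int[mu]_x (k x * b x)%:E <=
    (c / 2 * K + (2 * c)^-1 * fine B)%:E)%E.
  move=> c0; rewrite EFinD !EFinM fineK//.
  apply: (@le_trans _ _ ((c / 2)%:E * \int[mu]_x (k x)%:E + (2 * c)^-1%:E * B)%E); last first.
    by rewrite leeD2r// lee_wpmul2l// lee_fin divr_ge0// ltW.
  rewrite -!ge0_integralZl//; last 6 first.
  - by apply/measurable_EFinP; mfun.
  - by move=> x _; rewrite lee_fin mulr_ge0// sqr_ge0.
  - by rewrite lee_fin invr_ge0 mulr_ge0// ltW.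
  - by apply/measurable_EFinP.
  - by move=> x _; rewrite lee_fin.
  - by rewrite lee_fin divr_ge0// ltW.
  rewrite -ge0_integralD//; last 4 first.
  - by move=> x _; rewrite mule_ge0// lee_fin// divr_ge0// ltW.
  - by mfun.
  - by move=> x _; rewrite mule_ge0// lee_fin ?mulr_ge0 ?sqr_ge0// invr_ge0 mulr_ge0// ltW.
  - by mfun.
  apply: ge0_le_integral => //.
  - by move=> x _; rewrite lee_fin mulr_ge0.
  - by apply/measurable_EFinP; mfun.
  - by mfun.
  - move=> x _; rewrite -!EFinM -EFinD lee_fin.
    rewrite -subr_ge0 [leRHS](_ : _ = k x * ((b x - c) ^+ 2 / (2 * c))).
      by rewrite mulr_ge0// divr_ge0 ?sqr_ge0// mulr_ge0// ltW.
    by field; rewrite gt_eqF.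
have If : (\int[mu]_x (k x * b x)%:E)%E \is a fin_num.
  rewrite ge0_fin_numE; first exact: le_lt_trans (bnd 1 ltr01) (ltry _).
  by apply: integral_ge0 => x _; rewrite lee_fin mulr_ge0.
have I0 : (0 <= \int[mu]_x (k x * b x)%:E)%E.
  by apply: integral_ge0 => x _; rewrite lee_fin mulr_ge0.
move: bnd; rewrite -(fineK If) -(fineK Bfin).
move: (fine_ge0 I0) (fine_ge0 B0).
set I := fine _; set b' := fine _ => I0' b'0 bnd.
rewrite -EFin_expe -EFinM lee_fin.
have [I00|Ip] := eqVneq I 0; first by rewrite I00 expr0n/= mulr_ge0// ltW.
have {}Ip : 0 < I by rewrite lt_neqAle eq_sym Ip.
(* The choice of [c] is the average of [b] relative to the mass bound [K]. *)
have := bnd (I / K) (divr_gt0 Ip K0); rewrite lee_fin.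
rewrite (_ : I / K / 2 * K = I / 2); last by field; rewrite gt_eqF.
rewrite (_ : (2 * (I / K))^-1 * b' = K * b' / (2 * I)); last by field; rewrite !gt_eqF.
rewrite -lerBlDl (_ : I - I / 2 = I / 2); last by field.
rewrite ler_pdivlMr ?mulr_gt0// (_ : I / 2 * (2 * I) = I ^+ 2)//.
by field.
Qed.

End square_integrable.

Section cylinder_signed.
Context {R : realType}.
Notation mu := (@lebesgue_measure R).
Notation plane := (measurableTypeR R * measurableTypeR R)%type.
Local Notation leb2 := (mu \x mu)%E.
Implicit Types F : plane -> \bar R.

Lemma integral_mS_translate F (c : R * R) : measurable_fun setT F -> periodic2 F ->
  (\int[mS]_z F (z + c)%R = \int[mS]_z F z)%E.
Proof.
move=> mF pF; rewrite [LHS]integralE [RHS]integralE; congr (_ - _)%E.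
- rewrite -[RHS](ge0_integral_mS_translate c)//.
  + by apply: eq_integral => z _; rewrite !funeposE.
  + exact: measurable_funepos.
  + by move=> s t; rewrite !funeposE pF.
- rewrite -[RHS](ge0_integral_mS_translate c)//.
  + by apply: eq_integral => z _; rewrite !funenegE.
  + exact: measurable_funeneg.
  + by move=> s t; rewrite !funenegE pF.
Qed.

Lemma ge0_integral_leb2_opp F : measurable_fun setT F -> (forall z, 0 <= F z)%E ->
  (\int[leb2]_z F (- z)%R = \int[leb2]_z F z)%E.
Proof.
move=> mF F0.
have mopp : measurable_fun setT (fun z : plane => (- z)%R : plane).
  change (measurable_fun setT (fun z : plane => (- z.1, - z.2)%R : plane)).
  by mfun; exact: (measurableT_comp (@oppr_measurable R setT)).
have mFo : measurable_fun setT (fun z : plane => F (- z)%R) by exact: (measurableT_comp mF).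
rewrite (fubini_tonelli1 _ mFo)// (fubini_tonelli1 _ mF F0).
have mG : measurable_fun setT (fun x => \int[mu]_y F (x, y))%E.
  exact: measurable_fun_fubini_tonelli_F.
rewrite -[RHS](ge0_integral_opp mG (fun x => integral_ge0 _ (fun y _ => F0 (x, y)))).
apply: eq_integral => x _; rewrite /fubini_F -[RHS]ge0_integral_opp//.
by mfun.
Qed.

Lemma integral_leb2_opp F : measurable_fun setT F ->
  (\int[leb2]_z F (- z)%R = \int[leb2]_z F z)%E.
Proof.
move=> mF; rewrite [LHS]integralE [RHS]integralE; congr (_ - _)%E.
- rewrite -[RHS]ge0_integral_leb2_opp//.
  + by apply: eq_integral => z _; rewrite !funeposE.
  + exact: measurable_funepos.
- rewrite -[RHS]ge0_integral_leb2_opp//.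
  + by apply: eq_integral => z _; rewrite !funenegE.
  + exact: measurable_funeneg.
Qed.

Lemma integral_logpolar F : measurable_fun setT F ->
  (\int[leb2]_x F x =
   \int[mS]_z ((expR z.1 ^+ 2)%:E * F (logpolar z)))%E.
Proof.
apply: integral_cov; first by move=> z; exact: sqr_ge0.
exact: ge0_integral_logpolar.
Qed.

(** The radial density [r], extended by zero to negative radii so that Fubini applies on a full
    product. *)
Definition polar_weight (z : R * R) : R := \1_(`]0%R, +oo[ : set R) z.2 * `|z.2|.

Lemma integral_polar F : measurable_fun setT F ->
  (\int[leb2]_x F x = \int[muT \x mu]_z
     ((polar_weight z)%:E * F (z.2 * cos z.1, z.2 * sin z.1)%R))%E.
Proof.
apply: (@integral_cov _ _ plane plane R (muT \x mu)%E leb2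
  (fun z : plane => (z.2 * cos z.1, z.2 * sin z.1) : plane) polar_weight).
  by move=> z; rewrite /polar_weight mulr_ge0// indicE.
move=> {}F mF F0; rewrite ge0_integral_polar//.
have mH : measurable_fun setT (fun z : plane =>
    (polar_weight z)%:E * F (z.2 * cos z.1, z.2 * sin z.1)%R)%E.
  by rewrite /polar_weight; mfun.
have H0 (z : plane) :
    (0 <= (polar_weight z)%:E * F (z.2 * cos z.1, z.2 * sin z.1)%R)%E.
  by rewrite mule_ge0// lee_fin /polar_weight mulr_ge0// indicE.
rewrite (fubini_tonelli1 _ mH H0).
apply: eq_integral => t _; rewrite /fubini_F -(integral_indicM mu `]0%R, +oo[).
apply: eq_integral => r _; rewrite /polar_weight/= EFinM -muleA.
rewrite indicE; case: (boolP (r \in _)) => [|_]; last by rewrite !mul0e.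
by rewrite inE/= in_itv/= andbT => r0; rewrite gtr0_norm.
Qed.

End cylinder_signed.

(** * Functions that are regular along lines *)

Section C1_functions.
Context {R : realType}.
Notation mu := (@lebesgue_measure R).
Notation plane := (measurableTypeR R * measurableTypeR R)%type.
Local Notation leb2 := (mu \x mu)%E.
Implicit Types (w a b k : R * R -> R) (y z d : R * R).

Definition line y d (t : R) : R * R := (y.1 + t * d.1, y.2 + t * d.2).

Definition mfun2 w := measurable_fun [set: plane] (w : plane -> R).

Definition bounded2 w := exists2 M : R, 0 <= M & forall z, `|w z| <= M.

(** Regularity is required along straight lines only: this is what one-variable calculus uses, and
    it passes through integrals by dominated convergence. Joint measurability is kept as a separate
    condition. *)
Definition line_continuous w := forall y d, continuous (fun t => w (line y d t)).

Record bfun w : Prop := BFun {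
  bfun_meas : mfun2 w ; bfun_bounded : bounded2 w ; bfun_cont : line_continuous w }.

Record C1b w w1 w2 : Prop := MkC1b {
  C1b_fun : bfun w ; C1b_d1 : bfun w1 ; C1b_d2 : bfun w2 ;
  C1b_derive : forall y d t, is_derive t (1 : R) (fun t => w (line y d t))
    (d.1 * w1 (line y d t) + d.2 * w2 (line y d t)) }.

Lemma bfunD a b : bfun a -> bfun b -> bfun (fun z => a z + b z).
Proof.
move=> [ma [M M0 aM] ca] [mb [N N0 bN] cb]; split.
- by rewrite /mfun2; mfun.
- exists (M + N); first exact: addr_ge0.
  by move=> z; rewrite (le_trans (ler_normD _ _))// lerD.
- by move=> y d t; apply: (@cvgD _ R^o); [exact: ca|exact: cb].
Qed.

Lemma bfunM a b : bfun a -> bfun b -> bfun (fun z => a z * b z).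
Proof.
move=> [ma [M M0 aM] ca] [mb [N N0 bN] cb]; split.
- by rewrite /mfun2; mfun.
- exists (M * N); first exact: mulr_ge0.
  by move=> z; rewrite normrM ler_pM.
- by move=> y d t; apply: (@cvgM R); [exact: ca|exact: cb].
Qed.

Lemma bfun_cst (c : R) : bfun (fun=> c).
Proof.
split; first exact: measurable_cst.
- by exists `|c|.
- by move=> y d t; exact: cvg_cst.
Qed.

Lemma bfunX a n : bfun a -> bfun (fun z => a z ^+ n).
Proof.
move=> ba; elim: n => [|n ih]; first exact: (bfun_cst 1).
rewrite (_ : (fun z => _) = (fun z => a z * a z ^+ n)); first exact: bfunM.
by apply/funext => z; rewrite exprS.
Qed.

Lemma C1bD a a1 a2 b b1 b2 : C1b a a1 a2 -> C1b b b1 b2 ->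
  C1b (fun z => a z + b z) (fun z => a1 z + b1 z) (fun z => a2 z + b2 z).
Proof.
move=> [fa fa1 fa2 da] [fb fb1 fb2 db]; split; try exact: bfunD.
move=> y d t; have da' := da y d t; have db' := db y d t.
by apply: is_derive_eq; ring.
Qed.

Lemma C1bM a a1 a2 b b1 b2 : C1b a a1 a2 -> C1b b b1 b2 ->
  C1b (fun z => a z * b z) (fun z => a1 z * b z + a z * b1 z)
    (fun z => a2 z * b z + a z * b2 z).
Proof.
move=> [fa fa1 fa2 da] [fb fb1 fb2 db]; split; try exact: bfunM.
- by apply: bfunD; exact: bfunM.
- by apply: bfunD; exact: bfunM.
move=> y d t; have da' := da y d t; have db' := db y d t.
by apply: is_derive_eq; rewrite /GRing.scale/=; ring.
Qed.

Lemma C1b_cst (c : R) : C1b (fun=> c) (fun=> 0) (fun=> 0).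
Proof.
split; try exact: bfun_cst.
by move=> y d t; apply: is_derive_eq; rewrite !mulr0 addr0.
Qed.

Lemma C1bX a a1 a2 n : C1b a a1 a2 ->
  C1b (fun z => a z ^+ n.+1) (fun z => n.+1%:R * a z ^+ n * a1 z)
    (fun z => n.+1%:R * a z ^+ n * a2 z).
Proof.
move=> Ca; elim: n => [|n ih].
  have := Ca; congr C1b; apply/funext => z;
    by rewrite ?expr1// expr0 !mul1r.
have := C1bM Ca ih; congr C1b; apply/funext => z;
  by rewrite -?exprS// [_ ^+ n.+1]exprS -[n.+2%:R]natr1; ring.
Qed.

Definition equivariant (al : R) a1 a2 := forall s t,
  a1 (s, t + 2 * pi) =
    cos (2 * pi * al) * a1 (s, t) + sin (2 * pi * al) * a2 (s, t) /\
  a2 (s, t + 2 * pi) =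
    cos (2 * pi * al) * a2 (s, t) - sin (2 * pi * al) * a1 (s, t).

(** Both pairs turn by the same angle, so their scalar product does not change: such products are
    functions on the cylinder although the pairs are not. *)
Lemma equivariant_dot al a1 a2 b1 b2 y :
  equivariant al a1 a2 -> equivariant al b1 b2 ->
  periodic2 (fun z => a1 z * b1 (z + y) + a2 z * b2 (z + y)).
Proof.
move=> ea eb s t.
have -> : (s, t + 2 * pi) + y = (s + y.1, (t + y.2) + 2 * pi) :> R * R.
  by rewrite /GRing.add/= /add_pair/= addrAC.
have -> : (s, t) + y = (s + y.1, t + y.2) :> R * R by [].
have [-> ->] := ea s t; have [-> ->] := eb (s + y.1) (t + y.2).
have := cos2Dsin2 (2 * pi * al); set c := cos _; set s' := sin _ => cs.
transitivity ((c ^+ 2 + s' ^+ 2) * (a1 (s, t) * b1 (s + y.1, t + y.2) +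
  a2 (s, t) * b2 (s + y.1, t + y.2))); first by ring.
by rewrite cs mul1r.
Qed.

Lemma equivariant_sq al a1 a2 : equivariant al a1 a2 ->
  periodic2 (fun z => a1 z ^+ 2 + a2 z ^+ 2).
Proof.
move=> ea s t; have := equivariant_dot 0 ea ea s t.
by rewrite /= !addr0.
Qed.

Lemma line0 y d : line y d 0 = y.
Proof. by rewrite /line !mul0r !addr0; case: y. Qed.

(** The variants without bounds. Hardy's inequality is applied to averages before these are known to
    be bounded or square integrable. *)
Record lfun w : Prop := LFun { lfun_meas : mfun2 w ; lfun_cont : line_continuous w }.

Record C1l w w1 w2 : Prop := MkC1l {
  C1l_fun : lfun w ; C1l_d1 : lfun w1 ; C1l_d2 : lfun w2 ;
  C1l_derive : forall y d t, is_derive t (1 : R) (fun t => w (line y d t))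
    (d.1 * w1 (line y d t) + d.2 * w2 (line y d t)) }.

Lemma bfun_lfun w : bfun w -> lfun w.
Proof. by move=> [m _ c]. Qed.

Lemma C1b_C1l w w1 w2 : C1b w w1 w2 -> C1l w w1 w2.
Proof. by move=> [f f1 f2 d]; split => //; exact: bfun_lfun. Qed.

Lemma lfunD a b : lfun a -> lfun b -> lfun (fun z => a z + b z).
Proof.
move=> [ma ca] [mb cb]; split; first by rewrite /mfun2; mfun.
by move=> y d t; apply: (@cvgD _ R^o); [exact: ca|exact: cb].
Qed.

Lemma lfunM a b : lfun a -> lfun b -> lfun (fun z => a z * b z).
Proof.
move=> [ma ca] [mb cb]; split; first by rewrite /mfun2; mfun.
by move=> y d t; apply: (@cvgM R); [exact: ca|exact: cb].
Qed.

(** The one-dimensional inequality on each circle [s] constant, integrated over [s]. Its period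
    starts at a point [c] that depends on [s]; this is harmless because the squared lengths are
    periodic. *)
Lemma hardy_mS al w1 w2 w11 w12 w21 w22 : `|al| <= 1 / 2 ->
  C1l w1 w11 w12 -> C1l w2 w21 w22 ->
  equivariant al w1 w2 -> equivariant al w12 w22 ->
  ((al ^+ 2)%:E * \int[mS]_z (w1 z ^+ 2 + w2 z ^+ 2)%:E <=
   \int[mS]_z (w12 z ^+ 2 + w22 z ^+ 2)%:E)%E.
Proof.
move=> al12 C1 C2 ew ew'.
have m1 := lfun_meas (C1l_fun C1); have m2 := lfun_meas (C1l_fun C2).
have m12 := lfun_meas (C1l_d2 C1); have m22 := lfun_meas (C1l_d2 C2).
rewrite /mfun2 in m1 m2 m12 m22.
pose F (z : plane) := w1 z ^+ 2 + w2 z ^+ 2.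
pose F' (z : plane) := w12 z ^+ 2 + w22 z ^+ 2.
have mF : measurable_fun setT (fun z => (F z)%:E) by rewrite /F; mfun.
have mF' : measurable_fun setT (fun z => (F' z)%:E) by rewrite /F'; mfun.
have F0 z : (0 <= (F z)%:E)%E by rewrite lee_fin addr_ge0 ?sqr_ge0.
have F'0 z : (0 <= (F' z)%:E)%E by rewrite lee_fin addr_ge0 ?sqr_ge0.
suff : ((al ^+ 2)%:E * \int[mS]_z (F z)%:E <= \int[mS]_z (F' z)%:E)%E by [].
have alF0 z : (0 <= (al ^+ 2)%:E * (F z)%:E)%E by rewrite mule_ge0// lee_fin sqr_ge0.
have malF : measurable_fun setT (fun z : plane => (al ^+ 2)%:E * (F z)%:E)%E.
  exact: measurable_funeM.
have al20 : (0 <= (al ^+ 2)%:E)%E by rewrite lee_fin sqr_ge0.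
rewrite -ge0_integralZl//; rewrite (integral_mS malF alF0) (integral_mS mF' F'0).
have mI (G : plane -> \bar R) : measurable_fun setT G -> (forall z, 0 <= G z)%E ->
    measurable_fun setT (fun s : R => \int[mu]_(t in circle) G (s, t))%E.
  move=> mG G0.
  have -> : (fun s : R => \int[mu]_(t in circle) G (s, t))%E =
            (fun s : R => \int[muT]_t G (s, t))%E.
    by apply/funext => s; rewrite integral_muT//; mfun.
  exact: measurable_fun_fubini_tonelli_F.
apply: ge0_le_integral => //.
- by move=> s _; exact: integral_ge0.
- exact: (mI (fun z => (al ^+ 2)%:E * (F z)%:E)%E malF alF0).
- exact: (mI (fun z => (F' z)%:E) mF' F'0).
move=> s _.
have lineE t : line (s, 0) (0, 1) t = (s, t).
  by rewrite /line/= mulr0 mulr1 addr0 add0r.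
have dw w w1' w2' (C : C1l w w1' w2') (t : R) :
    is_derive t (1 : R) (fun t => w (s, t)) (w2' (s, t)).
  have := C1l_derive C (s, 0) (0, 1) t.
  rewrite /= mul0r mul1r add0r lineE; congr is_derive.
  by apply/funext => r; rewrite lineE.
have cw w (C : lfun w) : continuous (fun t => w (s, t)).
  have lc : line_continuous w := lfun_cont C.
  have := lc ((s : R), 0) (0, 1).
  by rewrite (_ : (fun t => w _) = (fun t => w (s, t)))//; apply/funext => r; rewrite lineE.
have [c wir] := wirtinger_flux al12 (dw _ _ _ C1) (cw _ (C1l_d2 C1))
  (dw _ _ _ C2) (cw _ (C1l_d2 C2)) (fun t => (ew s t).1) (fun t => (ew s t).2).
have P0 : 0 < 2 * pi :> R by rewrite mulr_gt0 ?pi_gt0.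
have intE (G : R * R -> R) : continuous (fun t => G (s, t)) -> (forall z, 0 <= G z) -> periodic2 G ->
    (\int[mu]_(t in circle) (G (s, t))%:E =
     (\int[mu]_(t in `[c, c + 2 * pi]) G (s, t))%:E)%E.
  move=> cG G0 pG.
  have mG : measurable_fun setT (fun t => (G (s, t))%:E).
    by apply/measurable_EFinP; exact: continuous_measurable_fun.
  rewrite /circle -(@ge0_integral_periodic _ _ c (fun t => (G (s, t))%:E) P0)//.
  - rewrite integral_itv_obnd_cbnd; last exact: measurable_funTS.
    rewrite /Rintegral fineK//; apply: integrable_fin_num => //.
    by apply: cont_itv_integrable => x _; exact: cG.
  - by move=> t; rewrite lee_fin.
  - by move=> t; rewrite pG.
have csq (w v : R * R -> R) : lfun w -> lfun v -> continuous (fun t => w (s, t) ^+ 2 + v (s, t) ^+ 2).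
  move=> bw bv; have := cw _ (lfunD (lfunM bw bw) (lfunM bv bv)); exact.
rewrite ge0_integralZl//; last by apply: measurable_funTS; mfun.
rewrite (intE F); last 3 first.
- by apply: csq; [exact: C1l_fun C1|exact: C1l_fun C2].
- by move=> z; rewrite addr_ge0 ?sqr_ge0.
- exact: equivariant_sq ew.
rewrite (intE F'); last 3 first.
- by apply: csq; [exact: C1l_d2 C1|exact: C1l_d2 C2].
- by move=> z; rewrite addr_ge0 ?sqr_ge0.
- exact: equivariant_sq ew'.
by rewrite -EFinM lee_fin.
exact: measurable_circle.
Qed.

End C1_functions.

(** * Convolution on the cylinder *)

Section product_sigma_finite.
Context d1 d2 (T1 : measurableType d1) (T2 : measurableType d2) (R : realType).
Variable m1 : {sigma_finite_measure set T1 -> \bar R}.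
Variable m2 : {sigma_finite_measure set T2 -> \bar R}.
Lemma sigma_finite_product : sigma_finite setT (m1 \x m2)%E.
Proof.
have /sigma_finiteP[F [TF ndF Foo]] := sigma_finiteT m1.
have /sigma_finiteP[G [TG ndG Goo]] := sigma_finiteT m2.
exists (fun n => F n `*` G n).
 rewrite -setXTT TF TG predeqE => -[x y]; split.
    move=> [/= [n _ Fnx] [k _ Gky]]; exists (maxn n k) => //; split.
    - by move: x Fnx; exact/subsetPset/ndF/leq_maxl.
    - by move: y Gky; exact/subsetPset/ndG/leq_maxr.
  by move=> [n _ []/= ? ?]; split; exists n.
move=> k; have [? ?] := Foo k; have [? ?] := Goo k.
split; first exact: measurableX.
by rewrite product_measure1E// lte_mul_pinfty// ge0_fin_numE.
Qed.
Lemma product_sigma_finite_spec :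
  {L : {sigma_finite_measure set (T1 * T2)%type -> \bar R} |
    (L : set (T1 * T2)%type -> \bar R) = (m1 \x m2)%E}.
Proof.
pose H := Measure_isSigmaFinite.Build _ _ _ (product_measure1 m1 m2) sigma_finite_product.
pose P : {sigma_finite_measure set (T1 * T2)%type -> \bar R} := HB.pack (product_measure1 m1 m2) H.
by exists P.
Qed.
End product_sigma_finite.

Section planar_measures.
Context {R : realType}.
Notation mu := (@lebesgue_measure R).
Notation plane := (measurableTypeR R * measurableTypeR R)%type.

(* The product measures with their sigma-finite structure, kept opaque so that
   unification does not unfold them. *)
Definition leb2s : {sigma_finite_measure set plane -> \bar R} :=
  sval (product_sigma_finite_spec mu mu).

Lemma leb2sE : (leb2s : set plane -> \bar R) = (mu \x mu)%E.
Proof. exact: svalP (product_sigma_finite_spec mu mu). Qed.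

Definition mSs : {sigma_finite_measure set plane -> \bar R} :=
  sval (product_sigma_finite_spec mu muT).

Lemma mSsE : (mSs : set plane -> \bar R) = mS.
Proof. exact: svalP (product_sigma_finite_spec mu muT). Qed.

Lemma integral_leb2s (f : plane -> \bar R) :
  (\int[leb2s]_z f z = \int[(mu \x mu)]_z f z)%E.
Proof. by apply: eq_measure_integral => A _ _; exact: (congr1 (@^~ A) leb2sE). Qed.

Lemma integral_mSs (f : plane -> \bar R) :
  (\int[mSs]_z f z = \int[mS]_z f z)%E.
Proof. by apply: eq_measure_integral => A _ _; exact: (congr1 (@^~ A) mSsE). Qed.

Lemma Rintegral_leb2s (f : plane -> R) :
  \int[leb2s]_z f z = \int[(mu \x mu)%E]_z f z.
Proof. by rewrite /Rintegral integral_leb2s. Qed.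

Lemma Rintegral_mSs (f : plane -> R) : \int[mSs]_z f z = \int[mS]_z f z.
Proof. by rewrite /Rintegral integral_mSs. Qed.

Lemma integrable_leb2s (f : plane -> \bar R) :
  leb2s.-integrable setT f <-> (mu \x mu)%E.-integrable setT f.
Proof.
by split => /integrableP[mf fy]; apply/integrableP; split => //;
  [rewrite -integral_leb2s|rewrite integral_leb2s].
Qed.

Lemma integrable_mSs (f : plane -> \bar R) :
  mSs.-integrable setT f <-> mS.-integrable setT f.
Proof.
by split => /integrableP[mf fy]; apply/integrableP; split => //;
  [rewrite -integral_mSs|rewrite integral_mSs].
Qed.

End planar_measures.

Section parametric_Rintegral.
Context d1 d2 (T1 : measurableType d1) (T2 : measurableType d2) (R : realType).
Variable m2 : {sigma_finite_measure set T2 -> \bar R}.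

Lemma measurable_Rintegral_snd (H : T1 * T2 -> R) : measurable_fun setT H ->
  measurable_fun setT (fun x => \int[m2]_y H (x, y)).
Proof.
move=> mH; rewrite /Rintegral.
have mE : measurable_fun setT (EFin \o H) by exact/measurable_EFinP.
apply: (measurableT_comp (@fine_measurable R setT measurableT)).
rewrite (_ : (fun x => _) = (fun x => \int[m2]_y ((EFin \o H)^\+ (x, y)) -
    \int[m2]_y ((EFin \o H)^\- (x, y)))%E); last first.
  apply/funext => x; rewrite integralE; congr (_ - _)%E.
    by apply: eq_integral => y _; rewrite !funeposE.
  by apply: eq_integral => y _; rewrite !funenegE.
apply: emeasurable_funB.
- by apply: measurable_fun_fubini_tonelli_F => //; exact: measurable_funepos.
- by apply: measurable_fun_fubini_tonelli_F => //; exact: measurable_funeneg.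
Qed.

End parametric_Rintegral.

Lemma Rintegral_lin disp (T : measurableType disp) (R : realType)
    (m : {measure set T -> \bar R}) (c e : R) (f g : T -> R) :
  m.-integrable setT (EFin \o f) -> m.-integrable setT (EFin \o g) ->
  \int[m]_x (c * f x + e * g x) = c * \int[m]_x f x + e * \int[m]_x g x.
Proof.
move=> hf hg; rewrite RintegralD//; try exact: integrableZr_real.
by rewrite !RintegralZl.
Qed.

Section convolution.
Context {R : realType}.
Notation mu := (@lebesgue_measure R).
Notation plane := (measurableTypeR R * measurableTypeR R)%type.
Local Notation leb2 := (mu \x mu)%E.
Implicit Types (w a b k : R * R -> R) (y z d : R * R).

Definition ikernel k := leb2.-integrable setT (EFin \o (k : plane -> R)).

(** The kernel is evaluated at [z] and the function at [y + z]: a correlation, so that passing to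
    the adjoint reflects the kernel. The kernel lives on the plane, while the function is periodic
    or equivariant. *)
Definition cconv k b y : R := \int[leb2]_z (k z * b (y + z)).

Lemma ikernel_meas k : ikernel k -> mfun2 k.
Proof. by move=> /integrableP[/measurable_EFinP]. Qed.

Lemma mfun2_shift b y : mfun2 b -> mfun2 (fun z => b (y + z)).
Proof.
move=> mb; rewrite /mfun2; under eq_fun do rewrite addrC.
exact: (measurableT_comp mb (measurable_translate2 y)).
Qed.

Lemma ikernelM k b : ikernel k -> mfun2 b -> bounded2 b -> ikernel (fun z => k z * b z).
Proof.
move=> hk mb [M M0 bM]; have mk := ikernel_meas hk.
apply: (@integrable_le _ plane R leb2 (fun z : plane => k z * b z)
  (fun z : plane => M * `|k z|)).
- by rewrite /mfun2 in mk mb *; mfun.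
- by move=> z; rewrite normrM mulrC ler_wpM2r.
- by apply: integrableZr_real; exact: integrable_norm.
Qed.

Lemma bounded2_shift b y : bounded2 b -> bounded2 (fun z => b (y + z)).
Proof. by move=> [M M0 bM]; exists M. Qed.

Lemma conv_integrable k b y : ikernel k -> mfun2 b -> bounded2 b ->
  ikernel (fun z => k z * b (y + z)).
Proof.
move=> hk mb bb; apply: (@ikernelM k (fun z => b (y + z))) => //.
  exact: mfun2_shift.
exact: bounded2_shift.
Qed.

Lemma measurable_sum2 :
  measurable_fun setT (fun p : plane * plane => (p.1 + p.2)%R : plane).
Proof.
change (measurable_fun setT (fun p : plane * plane =>
  (p.1.1 + p.2.1, p.1.2 + p.2.2)%R : plane)).
have m1 : measurable_fun setT (fun p : plane * plane => p.1.1).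
  by apply: (measurableT_comp measurable_fst); exact: measurable_fst.
have m2 : measurable_fun setT (fun p : plane * plane => p.1.2).
  by apply: (measurableT_comp measurable_snd); exact: measurable_fst.
have m3 : measurable_fun setT (fun p : plane * plane => p.2.1).
  by apply: (measurableT_comp measurable_fst); exact: measurable_snd.
have m4 : measurable_fun setT (fun p : plane * plane => p.2.2).
  by apply: (measurableT_comp measurable_snd); exact: measurable_snd.
by apply: measurable_fun_pair; exact: measurable_funD.
Qed.

Lemma conv_meas k b : mfun2 k -> mfun2 b -> mfun2 (cconv k b).
Proof.
move=> mk mb; rewrite /mfun2 /cconv.
pose H (p : plane * plane) := k p.2 * b (p.1 + p.2).
have mH : measurable_fun setT H.
  apply: measurable_funM; first exact: (measurableT_comp mk measurable_snd).
  exact: (measurableT_comp mb measurable_sum2).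
have := measurable_Rintegral_snd leb2s mH.
by under eq_fun do rewrite Rintegral_leb2s.
Qed.

Lemma le_norm_Rintegral disp (T : measurableType disp) (m : {measure set T -> \bar R})
    (f g : T -> R) : m.-integrable setT (EFin \o f) -> m.-integrable setT (EFin \o g) ->
  (forall x, `|f x| <= g x) -> `|\int[m]_x f x| <= \int[m]_x g x.
Proof.
move=> hf hg fg; apply: (le_trans (le_normr_Rintegral measurableT hf)).
by apply: le_Rintegral => //; exact: integrable_norm.
Qed.

Lemma conv_bounded k b : ikernel k -> mfun2 b -> bounded2 b -> bounded2 (cconv k b).
Proof.
move=> hk mb [M M0 bM].
have hkM : ikernel (fun z => M * `|k z|) by apply: integrableZr_real; exact: integrable_norm.
exists (\int[leb2]_z (M * `|k z|)).
  by apply: Rintegral_ge0 => z _; rewrite mulr_ge0.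
move=> y; apply: le_norm_Rintegral => //.
  by apply: conv_integrable => //; exists M.
by move=> z; rewrite normrM mulrC ler_wpM2r.
Qed.

Lemma line_add y d t z : line y d t + z = line (y + z) d t.
Proof.
by apply: injective_projections; rewrite /= addrAC.
Qed.

Lemma conv_cont k b : ikernel k -> bfun b -> line_continuous (cconv k b).
Proof.
move=> hk [mb [M M0 bM] cb] y d t.
have hkM : ikernel (fun z => M * `|k z|) by apply: integrableZr_real; exact: integrable_norm.
have := @continuity_under_integral R _ plane leb2 (fun t z => k z * b (line y d t + z))
  setT measurableT (t - 1) (t + 1) _ _ (fun z => M * `|k z|) hkM _.
move=> /(_ _ _ _ t); apply.
- by move=> r _; apply: conv_integrable => //; exists M.
- apply: aeW => z _ r _; apply: (@cvgM R); first exact: cvg_cst.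
  under eq_fun do rewrite line_add; rewrite line_add; exact: cb.
- by move=> r _; apply: aeW => z _; rewrite normrM mulrC ler_wpM2r.
- by rewrite inE/= in_itv/=; apply/andP; split; lra.
Qed.

Lemma conv_bfun k b : ikernel k -> bfun b -> bfun (cconv k b).
Proof.
move=> hk hb; split.
- by apply: conv_meas; [exact: ikernel_meas|exact: bfun_meas].
- by apply: conv_bounded => //; [exact: bfun_meas|exact: bfun_bounded].
- exact: conv_cont.
Qed.

(** All derivatives fall on the function; the kernel is merely integrable, and the bounds on the
    derivatives provide the domination. *)
Lemma conv_C1b k w w1 w2 : ikernel k -> C1b w w1 w2 ->
  C1b (cconv k w) (cconv k w1) (cconv k w2).
Proof.
move=> hk C; have [bw b1 b2 dw] := C; split; try exact: conv_bfun.
move=> y d t.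
pose f (r : R) z := k z * w (line y d r + z).
have df (r : R) z : is_derive r (1 : R) (f ^~ z)
    (k z * (d.1 * w1 (line y d r + z) + d.2 * w2 (line y d r + z))).
  have := dw (y + z) d r; rewrite -line_add => dwz.
  rewrite /f; under eq_fun do rewrite line_add.
  by apply: is_derive_eq; rewrite /GRing.scale/=; ring.
have [M1 M10 w1M] := bfun_bounded b1; have [M2 M20 w2M] := bfun_bounded b2.
pose c := `|d.1| * M1 + `|d.2| * M2.
have c0 : 0 <= c by rewrite addr_ge0// mulr_ge0.
have hG : ikernel (fun z => c * `|k z|) by apply: integrableZr_real; exact: integrable_norm.
have It : `]t - 1, t + 1[%classic t.
  by rewrite /= in_itv/=; apply/andP; split; lra.
have intf r : ikernel (f r).
  by apply: conv_integrable => //; [exact: bfun_meas|exact: bfun_bounded].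
have G0 z : 0 <= c * `|k z| by rewrite mulr_ge0.
have derf r z : `]t - 1, t + 1[%classic r -> setT z -> derivable (f ^~ z) r 1.
  by move=> _ _; have [] := df r z.
have Gub r z : `]t - 1, t + 1[%classic r -> setT z -> `|partial1of2 f r z| <= c * `|k z|.
  move=> _ _; rewrite partial1of2E (@derive_val _ _ _ _ _ _ _ (df r z)).
  rewrite normrM mulrC ler_wpM2r// (le_trans (ler_normD _ _))// !normrM.
  by apply: lerD; rewrite ler_wpM2l.
have D1 := @derivable_under_integral R _ plane leb2 f setT measurableT t _ _ It
  (fun r _ => intf r) derf _ G0 hG Gub.
have D2 := @differentiation_under_integral R _ plane leb2 f setT measurableT t _ _ It
  (fun r _ => intf r) derf _ G0 hG Gub.
have i1 : ikernel (fun z => k z * w1 (line y d t + z)).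
  by apply: conv_integrable => //; [exact: bfun_meas|exact: bfun_bounded].
have i2 : ikernel (fun z => k z * w2 (line y d t + z)).
  by apply: conv_integrable => //; [exact: bfun_meas|exact: bfun_bounded].
apply: DeriveDef; first exact: D1.
rewrite -derive1E D2 /cconv -(Rintegral_lin _ _ i1 i2).
apply: eq_Rintegral => z _.
rewrite partial1of2E (@derive_val _ _ _ _ _ _ _ (df t z)); ring.
Qed.

Lemma conv_equivariant k al b1 b2 : ikernel k -> bfun b1 -> bfun b2 ->
  equivariant al b1 b2 -> equivariant al (cconv k b1) (cconv k b2).
Proof.
move=> hk h1 h2 e s t.
have i1 y : ikernel (fun z => k z * b1 (y + z)).
  by apply: conv_integrable => //; [exact: bfun_meas|exact: bfun_bounded].
have i2 y : ikernel (fun z => k z * b2 (y + z)).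
  by apply: conv_integrable => //; [exact: bfun_meas|exact: bfun_bounded].
have sh z : (s, t + 2 * pi) + z = (s + z.1, (t + z.2) + 2 * pi) :> R * R.
  by rewrite /GRing.add/= /add_pair/= addrAC.
have sh' z : (s, t) + z = (s + z.1, t + z.2) :> R * R by [].
rewrite /cconv; split.
  rewrite -(Rintegral_lin _ _ (i1 _) (i2 _)).
  by apply: eq_Rintegral => z _; rewrite sh (e _ _).1 -sh'; ring.
rewrite -mulNr -(Rintegral_lin _ _ (i2 _) (i1 _)).
by apply: eq_Rintegral => z _; rewrite sh (e _ _).2 -sh'; ring.
Qed.

End convolution.

Section convolution_on_cylinder.
Context {R : realType}.
Notation mu := (@lebesgue_measure R).
Notation plane := (measurableTypeR R * measurableTypeR R)%type.
Local Notation leb2 := (mu \x mu)%E.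
Implicit Types (w a b k : R * R -> R) (y z d : R * R).

Lemma measurable_conv_integrand k b : mfun2 k -> mfun2 b ->
  measurable_fun setT (fun p : plane * plane => k p.2 * b (p.1 + p.2)).
Proof.
move=> mk mb; apply: measurable_funM; first exact: (measurableT_comp mk measurable_snd).
exact: (measurableT_comp mb measurable_sum2).
Qed.

(** Tonelli, then invariance of the cylinder measure under translations, for which [P] must be
    periodic. *)
Lemma ge0_integral_conv k P : mfun2 k -> mfun2 P ->
  (forall z, 0 <= k z) -> (forall z, 0 <= P z) -> periodic2 P ->
  (\int[mS]_y \int[leb2]_z (k z * P (y + z))%:E =
   \int[leb2]_z (k z)%:E * \int[mS]_y (P y)%:E)%E.
Proof.
move=> mk mP k0 P0 pP.
pose H (p : plane * plane) := (k p.2 * P (p.1 + p.2))%:E.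
have mH : measurable_fun setT H.
  by apply/measurable_EFinP; exact: measurable_conv_integrand.
have H0 p : (0 <= H p)%E by rewrite lee_fin mulr_ge0.
have := @fubini_tonelli _ _ plane plane R mSs leb2s H mH H0.
under eq_integral do rewrite integral_leb2s.
rewrite integral_mSs => ->.
rewrite integral_leb2s -ge0_integralZr//; last 3 first.
- exact/measurable_EFinP.
- by move=> z _; rewrite lee_fin.
- by apply: integral_ge0 => y _; rewrite lee_fin.
apply: eq_integral => z _; rewrite integral_mSs /H/=.
under eq_integral do rewrite EFinM.
have mPz : measurable_fun setT (fun y : plane => (P (y + z))%:E).
  apply/measurable_EFinP; exact: (measurableT_comp mP (measurable_translate2 z)).
rewrite ge0_integralZl//; last 2 first.
- by move=> y _; rewrite lee_fin.
- by rewrite lee_fin.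
congr (_ * _)%E.
rewrite (@ge0_integral_mS_translate _ (fun y => (P y)%:E))//.
- exact/measurable_EFinP.
- by move=> s t; rewrite pP.
Qed.

Lemma measurable_integral_conv k P : mfun2 k -> mfun2 P ->
  (forall z, 0 <= k z) -> (forall z, 0 <= P z) ->
  measurable_fun setT (fun y : plane => \int[leb2]_z (k z * P (y + z))%:E)%E.
Proof.
move=> mk mP k0 P0.
pose H (p : plane * plane) := (k p.2 * P (p.1 + p.2))%:E.
have mH : measurable_fun setT H.
  by apply/measurable_EFinP; exact: measurable_conv_integrand.
have H0 p : (0 <= H p)%E by rewrite lee_fin mulr_ge0.
rewrite (_ : (fun y => _) = fubini_F leb2s H); last first.
  by apply/funext => y; rewrite /fubini_F integral_leb2s.
exact: measurable_fun_fubini_tonelli_F.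
Qed.

(** Jensen in the kernel, then Tonelli. The two components are handled together because only
    [b1^2 + b2^2] is periodic, hence has a translation-invariant integral. *)
Lemma conv_sq_int k al b1 b2 : ikernel k -> bfun b1 -> bfun b2 ->
  equivariant al b1 b2 -> sq_int mS b1 -> sq_int mS b2 ->
  sq_int mS (cconv k b1) /\ sq_int mS (cconv k b2).
Proof.
move=> hk h1 h2 e s1 s2.
pose P z := b1 z ^+ 2 + b2 z ^+ 2.
have m1 := bfun_meas h1; have m2 := bfun_meas h2.
have mP : mfun2 P by rewrite /mfun2 /P in m1 m2 *; mfun.
have P0 z : 0 <= P z by rewrite addr_ge0 ?sqr_ge0.
have pP : periodic2 P by exact: equivariant_sq e.
have mk := ikernel_meas hk.
have mak : mfun2 (fun z => `|k z|) by rewrite /mfun2 in mk *; mfun.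
have [K K0 kK] : exists2 K : R, 0 < K & (\int[leb2]_z (`|k z|)%:E <= K%:E)%E.
  have : (\int[leb2]_z (`|k z|)%:E < +oo)%E by have /integrableP[] := hk.
  have : (0 <= \int[leb2]_z (`|k z|)%:E)%E by exact: integral_ge0.
  case: (\int[leb2]_z _)%E => // r r0 _; exists (r + 1).
    by rewrite ltr_wpDl// -lee_fin.
  by rewrite lee_fin lerDl.
have key b : mfun2 b -> bounded2 b -> (forall z, b z ^+ 2 <= P z) -> sq_int mS (cconv k b).
  move=> mb bb bP; split; first exact: conv_meas.
  apply: (@le_lt_trans _ _ (\int[mS]_y (K%:E * \int[leb2]_z (`|k z| * P (y + z))%:E))%E).
    apply: ge0_le_integral => //.
    - by move=> y _; rewrite lee_fin sqr_ge0.
    - apply/measurable_EFinP; apply: measurable_funX; exact: conv_meas.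
    - by apply: measurable_funeM; exact: measurable_integral_conv.
    - move=> y _.
      have mby : mfun2 (fun z => `|b (y + z)|).
        have := mfun2_shift y mb; rewrite /mfun2 => mbs.
        by apply: (measurableT_comp (@normr_measurable _ setT)).
      have ikb := conv_integrable y hk mb bb.
      have J := ge0_jensen_sq K0 mak mby (fun z => normr_ge0 (k z))
        (fun z => normr_ge0 (b (y + z))) kK.
      have iE : (\int[leb2]_z (`|k z| * `|b (y + z)|)%:E =
          (\int[leb2]_z `|k z * b (y + z)|)%:E)%E.
        rewrite /Rintegral fineK; first by apply: eq_integral => z _; rewrite normrM.
        by apply: integrable_fin_num => //; exact: integrable_norm.
      rewrite iE -EFin_expe in J.
      apply: (@le_trans _ _ ((\int[leb2]_z `|k z * b (y + z)|) ^+ 2)%:E).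
        by rewrite lee_fin -[leLHS](real_normK (num_real _)) ler_sqr ?nnegrE ?normr_ge0//;
          [exact: le_normr_Rintegral|apply: Rintegral_ge0 => z _].
      apply: (le_trans J); apply: lee_wpmul2l; first by rewrite lee_fin ltW.
      apply: ge0_le_integral => //.
      + by apply/measurable_EFinP; apply: measurable_funM => //; exact: measurable_funX.
      + apply/measurable_EFinP; apply: measurable_funM => //; exact: mfun2_shift.
      + by move=> z _; rewrite lee_fin ler_wpM2l// real_normK ?num_real// bP.
  rewrite ge0_integralZl//; last 3 first.
  - exact: measurable_integral_conv.
  - by move=> y _; apply: integral_ge0 => z _; rewrite lee_fin mulr_ge0.
  - by rewrite lee_fin ltW.
  rewrite (ge0_integral_conv mak mP)//.
  rewrite lte_mul_pinfty ?lee_fin ?ltW// lte_mul_pinfty//.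
  - by apply: integral_ge0.
  - by rewrite ge0_fin_numE ?(le_lt_trans kK) ?ltry//; exact: integral_ge0.
  rewrite /P; under eq_integral do rewrite EFinD.
  rewrite ge0_integralD//; try (by move=> z _; rewrite lee_fin sqr_ge0).
  - by rewrite lte_add_pinfty; [|exact: s1.2|exact: s2.2].
  - by apply/measurable_EFinP; exact: measurable_funX.
  - by apply/measurable_EFinP; exact: measurable_funX.
split; apply: key => //.
- exact: bfun_bounded.
- by move=> z; rewrite lerDl sqr_ge0.
- exact: bfun_bounded.
- by move=> z; rewrite lerDr sqr_ge0.
Qed.

(** Integrability of every slice, beyond almost every one, makes each inner real-valued integral
    equal to the extended one, with no default value of [fine] in between. *)
Lemma Rintegral_Fubini disp1 disp2 (T1 : measurableType disp1)
    (T2 : measurableType disp2)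
    (m1 : {sigma_finite_measure set T1 -> \bar R})
    (m2 : {sigma_finite_measure set T2 -> \bar R}) (H : T1 * T2 -> R) :
  (m1 \x m2)%E.-integrable setT (EFin \o H) ->
  (forall x : T1, m2.-integrable setT (EFin \o (fun y : T2 => H (x, y)))) ->
  (forall y : T2, m1.-integrable setT (EFin \o (fun x : T1 => H (x, y)))) ->
  \int[m1]_x \int[m2]_y H (x, y) = \int[m2]_y \int[m1]_x H (x, y).
Proof.
move=> hH h2 h1; rewrite /Rintegral; congr fine.
transitivity (\int[m1]_x \int[m2]_y (H (x, y))%:E)%E.
  apply: eq_integral => x _; rewrite fineK//.
  by apply: integrable_fin_num => //; exact: h2.
rewrite (Fubini hH); apply: eq_integral => y _; rewrite fineK//.
by apply: integrable_fin_num => //; exact: h1.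
Qed.

Definition pairing a1 a2 b1 b2 z : R :=
  \int[mS]_y (a1 y * b1 (y + z) + a2 y * b2 (y + z)).

Lemma sq_int_translate al b1 b2 z : mfun2 b1 -> mfun2 b2 ->
  equivariant al b1 b2 -> sq_int mS b1 -> sq_int mS b2 ->
  sq_int mS (fun y => b1 (y + z)) /\ sq_int mS (fun y => b2 (y + z)).
Proof.
move=> m1 m2 e s1 s2.
have hP : (\int[mS]_y (b1 y ^+ 2 + b2 y ^+ 2)%:E < +oo)%E.
  under eq_integral do rewrite EFinD.
  rewrite ge0_integralD//; try (by move=> y _; rewrite lee_fin sqr_ge0).
  - by rewrite lte_add_pinfty; [|exact: s1.2|exact: s2.2].
  - by apply/measurable_EFinP; exact: measurable_funX.
  - by apply/measurable_EFinP; exact: measurable_funX.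
have mP : measurable_fun setT (fun y : plane => (b1 y ^+ 2 + b2 y ^+ 2)%:E).
  by rewrite /mfun2 in m1 m2; mfun.
have mPz : measurable_fun setT (fun y : plane => (b1 (y + z) ^+ 2 + b2 (y + z) ^+ 2)%:E).
  exact: (measurableT_comp mP (measurable_translate2 z)).
rewrite -(@ge0_integral_mS_translate _ _ z mP) in hP; last 2 first.
- by move=> y; rewrite lee_fin addr_ge0 ?sqr_ge0.
- by move=> s t; rewrite (equivariant_sq e).
have key b : mfun2 b -> (forall y, b y ^+ 2 <= b1 y ^+ 2 + b2 y ^+ 2) ->
    sq_int mS (fun y => b (y + z)).
  move=> mb bP.
  have mbz : measurable_fun setT (fun y : plane => b (y + z)).
    exact: (measurableT_comp mb (measurable_translate2 z)).
  split => //; apply: le_lt_trans hP; apply: ge0_le_integral => //.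
  - by move=> y _; rewrite lee_fin sqr_ge0.
  - by apply/measurable_EFinP; exact: measurable_funX.
  - by move=> y _; rewrite lee_fin.
split; apply: key => // y; first by rewrite lerDl sqr_ge0.
by rewrite lerDr sqr_ge0.
Qed.

(** Fubini, with [|k z| * (A y + B (y + z))] as dominating function. *)
Lemma cconv_pairing k al a1 a2 b1 b2 : ikernel k ->
  bfun a1 -> bfun a2 -> bfun b1 -> bfun b2 ->
  equivariant al a1 a2 -> equivariant al b1 b2 ->
  sq_int mS a1 -> sq_int mS a2 -> sq_int mS b1 -> sq_int mS b2 ->
  ip mS a1 (cconv k b1) + ip mS a2 (cconv k b2) =
  \int[leb2]_z (k z * pairing a1 a2 b1 b2 z).
Proof.
move=> hk ha1 ha2 hb1 hb2 ea eb sa1 sa2 sb1 sb2.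
have [sc1 sc2] := conv_sq_int hk hb1 hb2 eb sb1 sb2.
rewrite /ip -(RintegralD measurableT (sq_int_mul sa1 sc1) (sq_int_mul sa2 sc2)).
have [ma1 ma2] := (bfun_meas ha1, bfun_meas ha2).
have [mb1 mb2] := (bfun_meas hb1, bfun_meas hb2).
have mk := ikernel_meas hk.
pose H (p : plane * plane) := k p.2 * (a1 p.1 * b1 (p.1 + p.2) + a2 p.1 * b2 (p.1 + p.2)).
have ms (b : plane -> R) : measurable_fun setT b ->
    measurable_fun setT (fun p : plane * plane => b (p.1 + p.2)).
  by move=> mb; exact: (measurableT_comp mb measurable_sum2).
have mfst (b : plane -> R) : measurable_fun setT b ->
    measurable_fun setT (fun p : plane * plane => b p.1).
  by move=> mb; exact: (measurableT_comp mb measurable_fst).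
have msnd (b : plane -> R) : measurable_fun setT b ->
    measurable_fun setT (fun p : plane * plane => b p.2).
  by move=> mb; exact: (measurableT_comp mb measurable_snd).
have mH : measurable_fun setT H.
  apply: measurable_funM; first exact: msnd.
  by apply: measurable_funD; apply: measurable_funM;
    [exact: mfst|exact: ms|exact: mfst|exact: ms].
pose A y := a1 y ^+ 2 + a2 y ^+ 2; pose B y := b1 y ^+ 2 + b2 y ^+ 2.
have mA : mfun2 A by rewrite /mfun2 /A in ma1 ma2 *; mfun.
have mB : mfun2 B by rewrite /mfun2 /B in mb1 mb2 *; mfun.
have A0 z : 0 <= A z by rewrite addr_ge0 ?sqr_ge0.
have B0 z : 0 <= B z by rewrite addr_ge0 ?sqr_ge0.
have mak : mfun2 (fun z => `|k z|) by rewrite /mfun2 in mk *; mfun.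
have HE y : a1 y * cconv k b1 y + a2 y * cconv k b2 y = \int[leb2s]_z H (y, z).
  rewrite Rintegral_leb2s /cconv -Rintegral_lin.
  - by apply: eq_Rintegral => z _; rewrite /H/=; ring.
  - by apply: conv_integrable => //; exact: bfun_bounded.
  - by apply: conv_integrable => //; exact: bfun_bounded.
under eq_Rintegral do rewrite HE.
have iH1 y : leb2s.-integrable setT (EFin \o (fun z => H (y, z))).
  apply/integrable_leb2s.
  have := integrableDr (integrableZr_real (a1 y) (conv_integrable y hk mb1 (bfun_bounded hb1)))
    (integrableZr_real (a2 y) (conv_integrable y hk mb2 (bfun_bounded hb2))).
  by congr (integrable _ _ _); apply/funext => z; rewrite /H/=; congr EFin; ring.
have iP z : mS.-integrable setT
    (EFin \o (fun y => a1 y * b1 (y + z) + a2 y * b2 (y + z))).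
  have [sz1 sz2] := sq_int_translate z mb1 mb2 eb sb1 sb2.
  by apply: integrableDr; exact: sq_int_mul.
have iH2 z : mSs.-integrable setT (EFin \o (fun y => H (y, z))).
  by apply/integrable_mSs; exact: (integrableZr_real (k z) (iP z)).
rewrite -[LHS]Rintegral_mSs Rintegral_Fubini//.
  rewrite Rintegral_leb2s; apply: eq_Rintegral => z _.
  by rewrite Rintegral_mSs /H/= RintegralZl.
apply/integrableP; split; first exact/measurable_EFinP.
have ltA : (\int[mS]_y (A y)%:E < +oo)%E.
  rewrite /A; under eq_integral do rewrite EFinD.
  rewrite ge0_integralD//; try (by move=> y _; rewrite lee_fin sqr_ge0).
  - by rewrite lte_add_pinfty; [|exact: sa1.2|exact: sa2.2].
  - by apply/measurable_EFinP; exact: measurable_funX.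
  - by apply/measurable_EFinP; exact: measurable_funX.
have ltB : (\int[mS]_y (B y)%:E < +oo)%E.
  rewrite /B; under eq_integral do rewrite EFinD.
  rewrite ge0_integralD//; try (by move=> y _; rewrite lee_fin sqr_ge0).
  - by rewrite lte_add_pinfty; [|exact: sb1.2|exact: sb2.2].
  - by apply/measurable_EFinP; exact: measurable_funX.
  - by apply/measurable_EFinP; exact: measurable_funX.
pose HA (p : plane * plane) := (`|k p.2| * A p.1)%:E.
pose HB (p : plane * plane) := (`|k p.2| * B (p.1 + p.2))%:E.
have mHA : measurable_fun setT HA.
  by apply/measurable_EFinP; apply: measurable_funM;
    [exact: (msnd (fun z => `|k z|) mak)|exact: (mfst A mA)].
have mHB : measurable_fun setT HB.
  by apply/measurable_EFinP; exact: (measurable_conv_integrand mak mB).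
have HA0 p : (0 <= HA p)%E by rewrite lee_fin mulr_ge0.
have HB0 p : (0 <= HB p)%E by rewrite lee_fin mulr_ge0.
have ltk : (\int[leb2]_z (`|k z|)%:E < +oo)%E by have /integrableP[] := hk.
apply: (@le_lt_trans _ _ (\int[mSs \x leb2s]_p (HA p + HB p))%E).
  apply: ge0_le_integral => //.
  - by apply: measurableT_comp => //; exact/measurable_EFinP.
  - exact: emeasurable_funD.
  - move=> p _; rewrite /HA /HB -EFinD lee_fin -mulrDr /H normrM ler_wpM2l//.
    apply: (le_trans (ler_normD _ _)).
    apply: (le_trans (lerD (mul_le_sq _ _) (mul_le_sq _ _))).
    by rewrite /A /B addrACA.
rewrite ge0_integralD// (fubini_tonelli1 _ mHA HA0) (fubini_tonelli1 _ mHB HB0).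
apply: lte_add_pinfty.
- rewrite integral_mSs (_ : fubini_F leb2s HA =
      fun y : plane => ((A y)%:E * \int[leb2]_z (`|k z|)%:E)%E); last first.
    apply/funext => y; rewrite /fubini_F integral_leb2s /HA/=.
    under eq_integral do rewrite mulrC EFinM.
    by rewrite ge0_integralZl// ?lee_fin//; exact/measurable_EFinP.
  rewrite ge0_integralZr//; last 2 first.
  + by move=> y _; rewrite lee_fin.
  + exact: integral_ge0.
  + apply: lte_mul_pinfty => //.
    * by apply: integral_ge0 => y _; rewrite lee_fin.
    * rewrite ge0_fin_numE//; by apply: integral_ge0 => y _; rewrite lee_fin.
  + exact/measurable_EFinP.
- rewrite integral_mSs (_ : fubini_F leb2s HB =
      fun y : plane => (\int[leb2]_z (`|k z| * B (y + z))%:E)%E); last first.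
    by apply/funext => y; rewrite /fubini_F integral_leb2s.
  rewrite (ge0_integral_conv mak mB)//; last exact: equivariant_sq eb.
  by rewrite lte_mul_pinfty ?integral_ge0// ge0_fin_numE ?integral_ge0.
Qed.

Lemma pairingC al a1 a2 b1 b2 z : mfun2 a1 -> mfun2 a2 -> mfun2 b1 -> mfun2 b2 ->
  equivariant al a1 a2 -> equivariant al b1 b2 ->
  pairing b1 b2 a1 a2 (- z) = pairing a1 a2 b1 b2 z.
Proof.
move=> ma1 ma2 mb1 mb2 ea eb.
have msh (c : plane -> R) y : mfun2 c -> measurable_fun setT (fun x : plane => c (x + y)).
  by move=> mc; exact: (measurableT_comp mc (measurable_translate2 y)).
rewrite /pairing /Rintegral; congr fine.
rewrite -(integral_mS_translate (F := fun y : plane =>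
  (b1 y * a1 (y - z) + b2 y * a2 (y - z))%:E) z).
- by apply: eq_integral => y _; rewrite addrK; congr EFin; ring.
- by apply/measurable_EFinP; apply: measurable_funD; apply: measurable_funM => //;
    exact: msh.
- by move=> s t; congr EFin; exact: (equivariant_dot (- z) eb ea s t).
Qed.

Lemma measurable_pairing a1 a2 b1 b2 : mfun2 a1 -> mfun2 a2 -> mfun2 b1 -> mfun2 b2 ->
  mfun2 (pairing a1 a2 b1 b2).
Proof.
move=> ma1 ma2 mb1 mb2.
pose H (p : plane * plane) := a1 p.2 * b1 (p.2 + p.1) + a2 p.2 * b2 (p.2 + p.1).
have ms (b : plane -> R) : measurable_fun setT b ->
    measurable_fun setT (fun p : plane * plane => b (p.2 + p.1)).
  move=> mb; under eq_fun do rewrite addrC.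
  exact: (measurableT_comp mb measurable_sum2).
have msnd (b : plane -> R) : measurable_fun setT b ->
    measurable_fun setT (fun p : plane * plane => b p.2).
  by move=> mb; exact: (measurableT_comp mb measurable_snd).
have mH : measurable_fun setT H.
  by apply: measurable_funD; apply: measurable_funM;
    [exact: msnd|exact: ms|exact: msnd|exact: ms].
have := measurable_Rintegral_snd mSs mH.
by under eq_fun do rewrite Rintegral_mSs.
Qed.

Lemma ikernel_opp k : ikernel k -> ikernel (k \o -%R).
Proof.
move=> hk; have mk := ikernel_meas hk.
have mopp : measurable_fun setT (fun z : plane => (- z)%R : plane).
  change (measurable_fun setT (fun z : plane => (- z.1, - z.2)%R : plane)).
  by mfun; exact: (measurableT_comp (@oppr_measurable R setT)).
have mko : measurable_fun setT (fun z : plane => k (- z)) by exact: (measurableT_comp mk mopp).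
apply/integrableP; split; first exact/measurable_EFinP.
have mE : measurable_fun setT (fun z : plane => (`|k z|)%:E).
  by apply/measurable_EFinP; exact: (measurableT_comp (@normr_measurable _ setT)).
have := ge0_integral_leb2_opp mE (fun z => normr_ge0 (k z)).
rewrite /= => ->; by have /integrableP[] := hk.
Qed.

(** Both sides integrate the correlation of the two pairs against the kernel, and exchanging the
    pairs reverses the lag [z]. *)
Lemma cconv_adjoint k al a1 a2 b1 b2 : ikernel k ->
  bfun a1 -> bfun a2 -> bfun b1 -> bfun b2 ->
  equivariant al a1 a2 -> equivariant al b1 b2 ->
  sq_int mS a1 -> sq_int mS a2 -> sq_int mS b1 -> sq_int mS b2 ->
  ip mS a1 (cconv k b1) + ip mS a2 (cconv k b2) =
  ip mS b1 (cconv (k \o -%R) a1) + ip mS b2 (cconv (k \o -%R) a2).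
Proof.
move=> hk ha1 ha2 hb1 hb2 ea eb sa1 sa2 sb1 sb2.
apply: (etrans (cconv_pairing hk ha1 ha2 hb1 hb2 ea eb sa1 sa2 sb1 sb2)); apply: esym.
apply: (etrans (cconv_pairing (ikernel_opp hk) hb1 hb2 ha1 ha2 eb ea sb1 sb2 sa1 sa2)).
apply: esym.
have ma1 := bfun_meas ha1; have ma2 := bfun_meas ha2.
have mb1 := bfun_meas hb1; have mb2 := bfun_meas hb2.
rewrite /Rintegral; congr fine.
rewrite -(integral_leb2_opp (F := fun z : plane =>
  ((k \o -%R) z * pairing b1 b2 a1 a2 z)%:E)).
  apply: eq_integral => z _; rewrite /= opprK.
  by rewrite (pairingC z ma1 ma2 mb1 mb2 ea eb).
apply/measurable_EFinP; apply: measurable_funM.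
  exact: (ikernel_meas (ikernel_opp hk)).
exact: measurable_pairing.
Qed.

End convolution_on_cylinder.

(** * The logarithmic kernel *)

Section log_kernel.
Context {R : realType}.
Notation mu := (@lebesgue_measure R).
Notation plane := (measurableTypeR R * measurableTypeR R)%type.
Local Notation leb2 := (mu \x mu)%E.
Implicit Types (w a b k : R * R -> R) (y z d : R * R).

Definition unit01 : set R := `]0, 1]%classic.

(** Radial profile of the kernel as a function of [t = |z|^2]. Both it and its derivative vanish at
    [t = 1], so the cut-off puts no mass on the unit circle. *)
Definition Kf (t : R) : R := \1_unit01 t * ((t - 1 - ln t) / (4 * pi)).

(** Derivative of the profile, with [1 / t] written as [expR (- ln t)]; thus [(kF1, kF2)] below is
    the gradient of [kk]. *)
Definition dKf (t : R) : R := \1_unit01 t * ((1 - expR (- ln t)) / (4 * pi)).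

Definition kk z : R := Kf (enorm2 z).
Definition kF1 z : R := 2 * z.1 * dKf (enorm2 z).
Definition kF2 z : R := 2 * z.2 * dKf (enorm2 z).
(** The bounded error: [- Laplace kk] is the Dirac mass at the origin minus [kg], the constant
    [1 / pi] coming from the term [|z|^2 / (4 pi)]. *)
Definition kg z : R := \1_unit01 (enorm2 z) / pi.

(** The function [|z|^(-c)] on the unit disc, integrable exactly for [c < 2]; it dominates the
    kernels and their powers. *)
Definition wt (c : R) z : R := \1_unit01 (enorm2 z) * expR (- (c / 2) * ln (enorm2 z)).

Lemma indic01_01 (t : R) : \1_unit01 t = if (0 < t <= 1) then 1 else 0 :> R.
Proof.
rewrite indicE; case: (boolP (t \in _)); rewrite ?inE /unit01/= ?in_itv/=.
  by move=> ->.
by rewrite notin_setE/= in_itv/= => /negP/negbTE ->.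
Qed.

Lemma measurable_unit01 : measurable (unit01 : set (measurableTypeR R)).
Proof. exact: measurable_itv. Qed.

Lemma mfun_enorm2 : measurable_fun setT (@enorm2 R : plane -> R).
Proof. by rewrite /enorm2; mfun. Qed.

Lemma mfun_ind01 : measurable_fun setT (fun z : plane => \1_unit01 (enorm2 z) : R).
Proof.
exact: (measurableT_comp (measurable_indic measurable_unit01) mfun_enorm2).
Qed.

Lemma mfun_ln_enorm2 : measurable_fun setT (fun z : plane => ln (enorm2 z) : R).
Proof. exact: (measurableT_comp (@measurable_ln R) mfun_enorm2). Qed.

Lemma mfun_kk : mfun2 kk.
Proof.
have m1 := mfun_ind01; have m2 := mfun_ln_enorm2; have m3 := mfun_enorm2.
by rewrite /mfun2 /kk /Kf; mfun.
Qed.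

Lemma mfun_kF1 : mfun2 kF1.
Proof.
have m1 := mfun_ind01; have m2 := mfun_ln_enorm2; have m3 := mfun_enorm2.
by rewrite /mfun2 /kF1 /dKf; mfun.
Qed.

Lemma mfun_kF2 : mfun2 kF2.
Proof.
have m1 := mfun_ind01; have m2 := mfun_ln_enorm2; have m3 := mfun_enorm2.
by rewrite /mfun2 /kF2 /dKf; mfun.
Qed.

Lemma mfun_kg : mfun2 kg.
Proof. by have m1 := mfun_ind01; rewrite /mfun2 /kg; mfun. Qed.

Lemma mfun_wt c : mfun2 (wt c).
Proof.
have m1 := mfun_ind01; have m2 := mfun_ln_enorm2.
by rewrite /mfun2 /wt; mfun.
Qed.

Lemma wt_ge0 c z : 0 <= wt c z.
Proof. by rewrite /wt mulr_ge0 ?expR_ge0// indic01_01; case: ifP. Qed.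

Lemma enorm2_logpolar z : enorm2 (logpolar z) = expR (2 * z.1).
Proof.
rewrite /enorm2 /logpolar/= !exprMn -mulrDr cos2Dsin2 mulr1.
by rewrite expRM_natl.
Qed.

Lemma enorm2_ge0 z : 0 <= enorm2 z.
Proof. by rewrite addr_ge0 ?sqr_ge0. Qed.

Lemma integral_wt (c : R) : c < 2 ->
  (\int[leb2]_z (wt c z)%:E = (2 * pi / (2 - c))%:E)%E.
Proof.
move=> c2; pose b := 2 - c; have b0 : 0 < b by rewrite /b; lra.
have mw : measurable_fun setT (fun z : plane => (wt c z)%:E).
  by apply/measurable_EFinP; exact: mfun_wt.
rewrite (ge0_integral_logpolar mw); last by move=> z; rewrite lee_fin wt_ge0.
pose G (x : R) : \bar R := ((\1_(`]-oo, 0%R] : set R) x)%:E * (expR x)%:E)%E.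
have mG : measurable_fun setT G by rewrite /G; mfun.
have G0 x : (0 <= G x)%E by rewrite mule_ge0// lee_fin ?expR_ge0// indicE.
have E z : ((expR z.1 ^+ 2)%:E * (wt c (logpolar z))%:E = G (b * z.1 + 0)%R)%E.
  rewrite /wt enorm2_logpolar expRK indic01_01 expR_gt0/= expR_le1 addr0 /G indicE.
  have -> : (b * z.1 \in (`]-oo, 0%R]%classic : set R)) = (2 * z.1 <= 0).
    by rewrite mem_setE/= in_itv/=; rewrite !pmulr_rle0.
  case: ifP => _; last by rewrite mul0r mule0 mul0e.
  by rewrite mul1r mul1e -EFinM -expRM_natl -expRD; congr (expR _)%:E; rewrite /b; field.
under eq_integral do rewrite E.
have mGb : measurable_fun setT (fun x : R => G (b * x + 0)%R).
  by apply: (measurableT_comp mG); mfun.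
rewrite integral_mS; last 2 first.
- exact: (measurableT_comp mGb measurable_fst).
- by move=> z; exact: G0.
transitivity (\int[mu]_s ((2 * pi)%:E * G (b * s + 0)%R))%E.
  apply: eq_integral => s _ /=.
  rewrite integral_cst; last exact: measurable_circle.
  by rewrite muleC; congr (_ * _)%E; exact: lebesgue_circle.
rewrite ge0_integralZl//; last by rewrite lee_fin mulr_ge0// pi_ge0.
have := ge0_integral_affine 0 b0 mG G0.
rewrite ge0_integralZl//; last by rewrite lee_fin ltW.
rewrite integral_indicM integral_expR_Ny expR0.
set I := (\int[mu]_x _)%E => h.
have -> : I = (b^-1)%:E.
  by rewrite -[I]mul1e -(mulVf (lt0r_neq0 b0)) EFinM -muleA -h mule1.
by rewrite -EFinM.
Qed.

Lemma kk_ge0 z : 0 <= kk z.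
Proof.
rewrite /kk /Kf indic01_01; case: ifP => [/andP[t0 t1]|_]; last by rewrite mul0r.
have p0 := pi_gt0 R.
rewrite mul1r divr_ge0 ?mulr_ge0 ?pi_ge0// subr_ge0.
have := @le_ln1Dx R (enorm2 z - 1); rewrite addrCA subrr addr0.
by apply; rewrite ltrBrDl subrr.
Qed.

Lemma kg_ge0 z : 0 <= kg z.
Proof. by rewrite /kg divr_ge0 ?pi_ge0// indic01_01; case: ifP. Qed.

(** The exponential lies above its tangent at 1. This is the source of the factor [e] in the lower
    bound. *)
Lemma e_le_expR (y : R) : y * expR 1 <= expR y.
Proof.
rewrite -[y in leRHS](subrK 1) expRD ler_wpM2r ?expR_ge0//.
by have := expR_ge1Dx (y - 1); rewrite addrCA subrr addr0.
Qed.

(* The constant comes from maximising [(- ln t)^n t^(c/2)] over [0 < t < 1]. *)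
Lemma kkX_le n c z : 0 < c ->
  kk z ^+ n.+1 <= (n.+1%:R / (2 * pi * expR 1 * c)) ^+ n.+1 * wt c z.
Proof.
move=> c0; rewrite /kk /Kf /wt indic01_01.
case: ifP => [/andP[t0 t1]|_]; last by rewrite !mul0r expr0n/= mulr0.
rewrite !mul1r; set t := enorm2 z in t0 t1 *.
have p0 := pi_gt0 R; have e0 := expR_gt0 (1 : R).
have l0 : ln t <= 0 by rewrite ln_le0.
have [N0 x0] : 0 < n.+1%:R :> R /\ 0 <= - ln t / 2 by rewrite ltr0n; split => //; lra.
have le1 : (t - 1 - ln t) / (4 * pi) <= - ln t / (4 * pi).
  by rewrite ler_pM2r ?invr_gt0 ?mulr_gt0//; lra.
have ge0 : 0 <= (t - 1 - ln t) / (4 * pi).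
  by have := kk_ge0 z; rewrite /kk /Kf indic01_01 -/t t0 t1 mul1r.
have -> : expR (- (c / 2) * ln t) = expR (c * (- ln t / 2) / n.+1%:R) ^+ n.+1.
  by rewrite -expRM_natl; congr expR; field; rewrite lt0r_neq0.
rewrite -exprMn; apply: lerXn2r; rewrite ?nnegrE//.
  by rewrite mulr_ge0 ?expR_ge0// divr_ge0 ?ltW// !mulr_gt0.
apply: (le_trans le1).
have := e_le_expR (c * (- ln t / 2) / n.+1%:R).
set E := expR (c * _ / _) => h.
apply: (@le_trans _ _ (n.+1%:R / (2 * pi * expR 1 * c) * (c * (- ln t / 2) / n.+1%:R * expR 1))).
  suff id (N x p e : R) : 0 < N -> 0 < p -> 0 < e ->
      x / (4 * p) = N / (2 * p * e * c) * (c * (x / 2) / N * e) by rewrite -id.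
  by move=> N0' p0' e0'; field; rewrite !lt0r_neq0.
by apply: ler_wpM2l => //; rewrite divr_ge0 ?ltW// !mulr_gt0.
Qed.

Lemma ikernel_le k (C : R) : mfun2 k -> (forall z, `|k z| <= C * wt 1 z) -> ikernel k.
Proof.
move=> mk kC; apply: (integrable_le mk kC).
apply: integrableZr_real; apply/integrableP; split.
  by apply/measurable_EFinP; exact: mfun_wt.
rewrite (_ : (fun x => _) = (fun z => (wt 1 z)%:E)); last first.
  by apply/funext => z /=; rewrite ger0_norm ?wt_ge0.
by rewrite integral_wt ?ltry// ltr1n.
Qed.

Lemma ikernel_kkX n : ikernel (fun z => kk z ^+ n.+1).
Proof.
apply: (@ikernel_le _ ((n.+1%:R / (2 * pi * expR 1 * 1)) ^+ n.+1)).
  by have m := mfun_kk; rewrite /mfun2 in m *; mfun.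
by move=> z; rewrite ger0_norm ?exprn_ge0 ?kk_ge0//; exact: kkX_le.
Qed.

Lemma ikernel_kk : ikernel kk.
Proof.
have := ikernel_kkX 0; congr ikernel; apply/funext => z; exact: expr1.
Qed.

Lemma wt1_ge1 z : \1_unit01 (enorm2 z) <= wt 1 z.
Proof.
rewrite /wt indic01_01; case: ifP => [/andP[t0 t1]|_]; last by rewrite mul0r.
rewrite !mul1r -[leLHS]expR0 ler_expR mulNr oppr_ge0 pmulr_rle0 ?ln_le0//.
Qed.

Lemma ikernel_kg : ikernel kg.
Proof.
apply: (@ikernel_le _ pi^-1); first exact: mfun_kg.
move=> z; rewrite ger0_norm ?kg_ge0// /kg mulrC ler_wpM2l ?invr_ge0 ?pi_ge0//.
exact: wt1_ge1.
Qed.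

Lemma kF_le (x : R) z : x ^+ 2 <= enorm2 z ->
  `|2 * x * dKf (enorm2 z)| <= pi^-1 * wt 1 z.
Proof.
rewrite /dKf /wt indic01_01; set t := enorm2 z => xt.
case: ifP => [/andP[t0 t1]|_]; last by rewrite !mul0r !mulr0 normr0.
rewrite !mul1r; have p0 := pi_gt0 R.
(* [q] is [1 / |z|]. *)
set q := expR (- 2^-1 * ln t).
have q2 : expR (- ln t) = q ^+ 2.
  by rewrite /q -expRM_natl; congr expR; field.
have qt : q ^+ 2 * t = 1 by rewrite -q2 expRN lnK// mulVf// lt0r_neq0.
have q0 : 0 < q by exact: expR_gt0.
have xq : `|x| * q <= 1.
  have -> : (`|x| * q <= 1) = ((`|x| * q) ^+ 2 <= 1 ^+ 2).
    by rewrite ler_pXn2r ?nnegrE ?mulr_ge0 ?normr_ge0 ?(ltW q0)//.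
  rewrite expr1n exprMn real_normK ?num_real//.
  by rewrite -qt mulrC ler_wpM2l// sqr_ge0.
have q1 : 1 <= q ^+ 2 by rewrite -q2 -[leLHS]expR0 ler_expR oppr_ge0 ln_le0.
rewrite q2 (_ : 2 * x * _ = pi^-1 * (x * (1 - q ^+ 2) * 2^-1)); last first.
  by move: (pi : R) p0 => P P0; field; rewrite lt0r_neq0.
rewrite normrM gtr0_norm ?invr_gt0// ler_pM2l ?invr_gt0// 2!normrM.
rewrite (ler0_norm (_ : 1 - q ^+ 2 <= 0)) ?subr_le0// opprB (gtr0_norm (_ : 0 < 2^-1))//.
have : `|x| * (q ^+ 2 - 1) <= q.
  rewrite mulrBr mulr1 expr2 mulrA lerBlDr.
  by apply: (le_trans (ler_wpM2r (ltW q0) xq)); rewrite mul1r lerDl.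
by lra.
Qed.

Lemma ikernel_kF1 : ikernel kF1.
Proof.
apply: (@ikernel_le _ pi^-1); first exact: mfun_kF1.
by move=> z; apply: kF_le; rewrite lerDl sqr_ge0.
Qed.

Lemma ikernel_kF2 : ikernel kF2.
Proof.
apply: (@ikernel_le _ pi^-1); first exact: mfun_kF2.
by move=> z; apply: kF_le; rewrite lerDr sqr_ge0.
Qed.

(** The profile is smooth along a line at distance [|b|] from the singularity and vanishes at the
    ends of the chord cut by the unit disc, so no boundary term remains. With [b^2 = y^2 + d^2] the
    same lemma serves the truncated kernel. *)
Lemma ibp1 (b : R) (phi phi' : R -> R) : b != 0 ->
  (forall x, is_derive x (1 : R) phi (phi' x)) -> continuous phi' ->
  (\int[mu]_x (Kf (x ^+ 2 + b ^+ 2) * phi' x +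
     2 * x * dKf (x ^+ 2 + b ^+ 2) * phi x)%:E = 0)%E.
Proof.
move=> b0 dphi cphi'.
have t0 (x : R) : 0 < x ^+ 2 + b ^+ 2.
  by rewrite ltr_wpDl ?sqr_ge0// exprn_even_gt0//= b0.
have [b1|b1] := leP 1 (b ^+ 2).
  rewrite (_ : (fun x => _) = cst 0%E) ?integral0//; apply/funext => x.
  rewrite /Kf /dKf !indic01_01 t0/=; case: leP => t1; last by rewrite !mul0r mulr0 mul0r addr0.
  have -> : x ^+ 2 + b ^+ 2 = 1.
    by apply/eqP; rewrite eq_le t1/= (le_trans b1)// lerDr sqr_ge0.
  by rewrite ln1 oppr0 expR0; congr EFin; ring.
pose rho := Num.sqrt (1 - b ^+ 2).
have rho2 : rho ^+ 2 = 1 - b ^+ 2 by rewrite sqr_sqrtr// subr_ge0 ltW.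
have rho0 : 0 <= rho by exact: sqrtr_ge0.
pose F (x : R) := (x ^+ 2 + b ^+ 2 - 1 - ln (x ^+ 2 + b ^+ 2)) / (4 * pi) * phi x.
pose f (x : R) := (x ^+ 2 + b ^+ 2 - 1 - ln (x ^+ 2 + b ^+ 2)) / (4 * pi) * phi' x +
  2 * x * ((1 - (x ^+ 2 + b ^+ 2)^-1) / (4 * pi)) * phi x.
have E (x : R) : (Kf (x ^+ 2 + b ^+ 2) * phi' x +
     2 * x * dKf (x ^+ 2 + b ^+ 2) * phi x)%:E =
     ((\1_(`[(- rho)%R, rho] : set R) x)%:E * (f x)%:E)%E.
  rewrite /Kf /dKf !indic01_01 t0/= indicE.
  have -> : (x \in (`[- rho, rho]%classic : set R)) = (x ^+ 2 + b ^+ 2 <= 1).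
    rewrite mem_setE/= in_itv/= -ler_norml -lerBrDr -rho2 -[in RHS](real_normK (num_real x)).
    by rewrite ler_pXn2r ?nnegrE.
  case: ifP => _; last by rewrite !mul0r mulr0 mul0r addr0 mul0e.
  by rewrite !mul1r mul1e expRN lnK//; exact: t0.
have dln (x : R) : is_derive x (1 : R) (fun x => ln (x ^+ 2 + b ^+ 2)) (2 * x * (x ^+ 2 + b ^+ 2)^-1).
  have dt : is_derive x (1 : R) (fun x => x ^+ 2 + b ^+ 2) (2 * x).
    by apply: is_derive_eq; rewrite /GRing.scale/=; ring.
  have dl := is_derive1_ln (t0 x).
  have := @is_derive1_comp R (@ln R) (fun x => x ^+ 2 + b ^+ 2) x _ _ dl dt.
  by rewrite mulrC.
have dF (x : R) : is_derive x (1 : R) F (f x).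
  have d1 := dln x; have d2 := dphi x.
  by apply: is_derive_eq; rewrite /GRing.scale/= /f; ring.
have dinv (x : R) : is_derive x (1 : R) (fun x => (x ^+ 2 + b ^+ 2)^-1) (- (x ^+ 2 + b ^+ 2) ^- 2 * (2 * x)).
  apply: is_deriveV; first by rewrite lt0r_neq0.
  by apply: is_derive_eq; rewrite /GRing.scale/=; ring.
under eq_integral do rewrite E.
have rr : - rho <= rho by rewrite (le_trans _ rho0)// oppr_le0.
rewrite integral_indicM (FTC_is_derive rr (fun x _ => dF x)).
  by rewrite /F sqrrN rho2 subrK subrr ln1 oppr0 addr0 mul0r !mul0r subrr.
move=> x _.
have ct : {for x, continuous (fun x : R => (x ^+ 2 + b ^+ 2 - 1 - ln (x ^+ 2 + b ^+ 2)) / (4 * pi))}.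
  have d1 := dln x.
  apply: (@is_derive_cont _ _ _ ((2 * x - 2 * x * (x ^+ 2 + b ^+ 2)^-1) / (4 * pi))).
  by apply: is_derive_eq; rewrite /GRing.scale/=; ring.
have ci : {for x, continuous (fun x : R => 2 * x * ((1 - (x ^+ 2 + b ^+ 2)^-1) / (4 * pi)))}.
  have d1 := dinv x; apply: is_derive_cont.
have cphi : {for x, continuous phi} by exact: is_derive_cont (dphi x).
apply: (@cvgD _ R^o); first by apply: (@cvgM R); [exact: ct|exact: cphi'].
by apply: (@cvgM R); [exact: ci|exact: cphi].
Qed.

Lemma ae_neq0 (P : R -> Prop) : (forall x, x != 0 -> P x) ->
  \forall x \ae mu, P x.
Proof.
move=> h; exists [set 0]; split; first exact: measurable_set1.
  exact: lebesgue_measure_set1.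
move=> x /=; apply: contra_notP => /eqP; exact: h.
Qed.

(** Integration by parts on almost every horizontal line: only the line through the singularity is
    left out. *)
Lemma cconv_kk1 w w1 w2 y : C1b w w1 w2 -> cconv kk w1 y = - cconv kF1 w y.
Proof.
move=> C.
have ik : ikernel (fun z => kk z * w1 (y + z)).
  by apply: conv_integrable; [exact: ikernel_kk|exact: bfun_meas (C1b_d1 C)|exact: bfun_bounded (C1b_d1 C)].
have iF : ikernel (fun z => kF1 z * w (y + z)).
  by apply: conv_integrable; [exact: ikernel_kF1|exact: bfun_meas (C1b_fun C)|exact: bfun_bounded (C1b_fun C)].
apply/eqP; rewrite -subr_eq0 opprK /cconv -(RintegralD measurableT ik iF).
rewrite /Rintegral -(integral21_prod_meas1 (integrableDr ik iF)).
rewrite (ae_eq_integral (cst 0%E))//; first by rewrite integral0.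
  exact: (measurable_fubini_G (integrableDr ik iF)).
apply: ae_neq0 => b b0 _ /=; rewrite /fubini_G/=.
have dw := C1b_derive C (y + (0, b)) (1, 0).
have lc : line_continuous w1 := bfun_cont (C1b_d1 C).
have cw := lc (y + (0, b)) (1, 0).
rewrite -[RHS](ibp1 b0 (phi := fun x => w (line (y + (0, b)) (1, 0) x))
  (phi' := fun x => w1 (line (y + (0, b)) (1, 0) x)))//.
- apply: eq_integral => x _; rewrite /kk /kF1 /enorm2/=.
  have -> // : y + (x, b) = line (y + (0, b)) (1, 0) x.
  by apply: injective_projections; rewrite /= ?mulr1 ?mulr0 ?addr0// addrAC addr0.
- by move=> x; have := dw x; rewrite mul1r mul0r addr0.
Qed.

Lemma cconv_kk2 w w1 w2 y : C1b w w1 w2 -> cconv kk w2 y = - cconv kF2 w y.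
Proof.
move=> C.
have ik : ikernel (fun z => kk z * w2 (y + z)).
  by apply: conv_integrable; [exact: ikernel_kk|exact: bfun_meas (C1b_d2 C)|exact: bfun_bounded (C1b_d2 C)].
have iF : ikernel (fun z => kF2 z * w (y + z)).
  by apply: conv_integrable; [exact: ikernel_kF2|exact: bfun_meas (C1b_fun C)|exact: bfun_bounded (C1b_fun C)].
apply/eqP; rewrite -subr_eq0 opprK /cconv -(RintegralD measurableT ik iF).
rewrite /Rintegral -(integral12_prod_meas1 (integrableDr ik iF)).
rewrite (ae_eq_integral (cst 0%E))//; first by rewrite integral0.
  exact: (measurable_fubini_F (integrableDr ik iF)).
apply: ae_neq0 => b b0 _ /=; rewrite /fubini_F/=.
have dw := C1b_derive C (y + (b, 0)) (0, 1).
have lc : line_continuous w2 := bfun_cont (C1b_d2 C).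
have cw := lc (y + (b, 0)) (0, 1).
rewrite -[RHS](ibp1 b0 (phi := fun x => w (line (y + (b, 0)) (0, 1) x))
  (phi' := fun x => w2 (line (y + (b, 0)) (0, 1) x)))//.
- apply: eq_integral => x _; rewrite /kk /kF2 /enorm2/= [b ^+ 2 + _]addrC.
  have -> // : y + (b, x) = line (y + (b, 0)) (0, 1) x.
  by apply: injective_projections; rewrite /= ?mulr1 ?mulr0 ?addr0// addrAC addr0.
- by move=> x; have := dw x; rewrite mul1r mul0r add0r.
Qed.

Lemma muT_setT : @muT R setT = (2 * pi)%:E.
Proof.
rewrite -[LHS]mul1e -(integral_cst (@muT R) measurableT 1) integral_muT//.
by rewrite integral_cst ?mul1e; [exact: lebesgue_circle|exact: measurable_circle].
Qed.

(** The identity [- Laplace kk = delta - kg] tested against [w]. In polar coordinates around [y] the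
    integrand is the radial derivative of [(r^2 - 1) / (2 pi) * w], which is [- w y / (2 pi)] at the
    centre and 0 at [r = 1]; the angle then contributes [2 pi]. *)
Lemma polar_representation w w1 w2 y : C1b w w1 w2 ->
  w y = cconv kg w y + (cconv kF1 w1 y + cconv kF2 w2 y).
Proof.
move=> C.
have i0 : ikernel (fun z => kg z * w (y + z)).
  by apply: conv_integrable; [exact: ikernel_kg|exact: bfun_meas (C1b_fun C)|exact: bfun_bounded (C1b_fun C)].
have i1 : ikernel (fun z => kF1 z * w1 (y + z)).
  by apply: conv_integrable; [exact: ikernel_kF1|exact: bfun_meas (C1b_d1 C)|exact: bfun_bounded (C1b_d1 C)].
have i2 : ikernel (fun z => kF2 z * w2 (y + z)).
  by apply: conv_integrable; [exact: ikernel_kF2|exact: bfun_meas (C1b_d2 C)|exact: bfun_bounded (C1b_d2 C)].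
have iG := integrableDr i0 (integrableDr i1 i2).
rewrite /cconv -(RintegralD measurableT i1 i2) -(RintegralD measurableT i0 (integrableDr i1 i2)).
set G := (fun z : plane => _) in iG *.
have mG : measurable_fun setT (fun z => (G z)%:E) by have /integrableP[] := iG.
have mG' : measurable_fun setT G by apply/measurable_EFinP.
pose Hr (p : plane) := polar_weight p * G (p.2 * cos p.1, p.2 * sin p.1).
have mHr : measurable_fun setT Hr.
  by rewrite /Hr /polar_weight; mfun.
have iH : (muT \x mu)%E.-integrable setT (EFin \o Hr).
  apply/integrableP; split; first exact/measurable_EFinP.
  have /integrableP[_] := iG.
  have mA : measurable_fun setT (fun z : plane => (`|G z|)%:E) by mfun.
  rewrite (_ : (fun x => _) = (fun z => (`|G z|)%:E))//.
  rewrite (integral_polar mA); apply: le_lt_trans.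
  rewrite le_eqVlt; apply/orP; left; apply/eqP; apply: eq_integral => p _.
  by rewrite /= /Hr normrM EFinM ger0_norm// /polar_weight mulr_ge0// indicE.
rewrite /Rintegral (integral_polar mG).
rewrite (_ : (\int[muT \x mu]_z _)%E = (\int[muT \x mu]_z (EFin \o Hr) z)%E); last first.
  by apply: eq_integral => p _; rewrite /= /Hr EFinM.
rewrite -(integral12_prod_meas1 iH).
rewrite (eq_integral (cst (w y / (2 * pi))%:E)); last first.
  move=> th _; rewrite /fubini_F.
  pose d : R * R := (cos th, sin th).
  have dw := C1b_derive C y d.
  have lc1 : line_continuous w1 := bfun_cont (C1b_d1 C).
  have lc2 : line_continuous w2 := bfun_cont (C1b_d2 C).
  have lc0 : line_continuous w := bfun_cont (C1b_fun C).
  pose phi' r := d.1 * w1 (line y d r) + d.2 * w2 (line y d r).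
  pose g (r : R) := r / pi * w (line y d r) + (r ^+ 2 - 1) / (2 * pi) * phi' r.
  pose F (r : R) := (r ^+ 2 - 1) / (2 * pi) * w (line y d r).
  have p0 : (pi : R) != 0 by rewrite lt0r_neq0// pi_gt0.
  have E (r : R) : (EFin \o Hr) (th, r) = ((\1_(`]0%R, 1%R] : set R) r)%:E * (g r)%:E)%E.
    rewrite /= -EFinM; congr EFin; rewrite /Hr /polar_weight/= !indicE.
    rewrite !mem_setE/= !in_itv/= andbT.
    case: (ltP 0 r) => r0; last by rewrite !mul0r.
    rewrite mul1r gtr0_norm// /G /kg /kF1 /kF2 /dKf.
    have e2 : enorm2 (r * cos th, r * sin th) = r ^+ 2.
      by rewrite /enorm2/= !exprMn -mulrDr cos2Dsin2 mulr1.
    have r20 : 0 < r ^+ 2 by rewrite exprn_gt0.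
    rewrite !e2 !indic01_01 r20/= (_ : (r ^+ 2 <= 1) = (r <= 1)); last first.
      exact: expr_le1 (ltW r0).
    case: ifP => r1; last by rewrite !mul0r !mulr0 !mul0r !addr0 mulr0.
    have -> : y + (r * cos th, r * sin th) = line y d r by [].
    rewrite expRN lnK// !mul1r /g /phi' /d/=.
    by move: (pi : R) p0 => P P0; field; rewrite P0 lt0r_neq0.
  rewrite (eq_integral (fun r : measurableTypeR R => (\1_(`]0%R, 1%R] : set R) r)%:E * (g r)%:E)%E); last first.
    by move=> r _; exact: E.
  rewrite integral_indicM.
  have dF (r : R) : is_derive r (1 : R) F (g r).
    have d1 := dw r; apply: is_derive_eq; rewrite /GRing.scale/= /g /phi' /d/=.
    by move: (pi : R) p0 => P P0; field.
  have cg : continuous g.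
    move=> r; apply: (@cvgD _ R^o); apply: (@cvgM R).
    + by apply: (@cvgM R); [exact: cvg_id|exact: cvg_cst].
    + exact: lc0.
    + apply: (@cvgM R); last exact: cvg_cst.
      by apply: (@cvgB _ R^o); [exact: exprn_continuous|exact: cvg_cst].
    + apply: (@cvgD _ R^o); apply: (@cvgM R); try exact: cvg_cst.
      * exact: lc1.
      * exact: lc2.
  rewrite integral_itv_obnd_cbnd; last first.
    by apply: measurable_funTS; apply/measurable_EFinP; exact: continuous_measurable_fun.
  rewrite (FTC_is_derive ler01 (fun r _ => dF r) (fun r _ => cg r)).
  by rewrite /F line0 expr1n expr0n/=; congr EFin; move: (pi : R) p0 => P P0; field.
have -> : (\int[muT]_x cst (w y / (2 * pi))%:E x = (w y / (2 * pi))%:E * (2 * pi)%:E)%E.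
  by rewrite -muT_setT; exact: integral_cst.
rewrite -EFinM/= divfK//.
by rewrite mulf_neq0// lt0r_neq0// pi_gt0.
Qed.

End log_kernel.

(** * The inequality for smooth equivariant pairs *)

Section equivariant_pairs.
Context {R : realType}.
Notation mu := (@lebesgue_measure R).
Notation plane := (measurableTypeR R * measurableTypeR R)%type.
Local Notation leb2 := (mu \x mu)%E.
Implicit Types (a b w k q : R * R -> R) (y z : R * R).

(** In [w12] and its likes the first index is the component and the second the direction of
    differentiation, 1 along the axis and 2 around the cylinder. *)
Record epair (al : R) w1 w2 w11 w12 w21 w22 : Prop := EPair {
  ep1 : C1b w1 w11 w12 ; ep2 : C1b w2 w21 w22 ;
  ep_e : equivariant al w1 w2 ; ep_e1 : equivariant al w11 w21 ;
  ep_e2 : equivariant al w12 w22 ;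
  ep_s1 : sq_int mS w1 ; ep_s2 : sq_int mS w2 ;
  ep_s11 : sq_int mS w11 ; ep_s12 : sq_int mS w12 ;
  ep_s21 : sq_int mS w21 ; ep_s22 : sq_int mS w22 }.

Definition ip2 a1 a2 b1 b2 : R := ip mS a1 b1 + ip mS a2 b2.

Definition dform a11 a12 a21 a22 b11 b12 b21 b22 : R :=
  ip2 a11 a21 b11 b21 + ip2 a12 a22 b12 b22.

Lemma epair_cconv k al w1 w2 w11 w12 w21 w22 : ikernel k ->
  epair al w1 w2 w11 w12 w21 w22 ->
  epair al (cconv k w1) (cconv k w2) (cconv k w11) (cconv k w12)
    (cconv k w21) (cconv k w22).
Proof.
move=> hk [C1 C2 e0 e1 e2 s1 s2 s11 s12 s21 s22].
have [b1 b11 b12 _] := C1; have [b2 b21 b22 _] := C2.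
have [t1 t2] := conv_sq_int hk b1 b2 e0 s1 s2.
have [t11 t21] := conv_sq_int hk b11 b21 e1 s11 s21.
have [t12 t22] := conv_sq_int hk b12 b22 e2 s12 s22.
exact: (EPair (conv_C1b hk C1) (conv_C1b hk C2) (conv_equivariant hk b1 b2 e0)
  (conv_equivariant hk b11 b21 e1) (conv_equivariant hk b12 b22 e2) t1 t2 t11 t12 t21 t22).
Qed.

Lemma sq_int_bM q a : bfun q -> sq_int mS a -> sq_int mS (fun z => q z * a z).
Proof.
move=> [mq [M M0 qM] _] sa.
apply: (@sq_int_le _ plane R mS (fun z : plane => q z * a z)
  (fun z : plane => M ^+ 2 * a z ^+ 2)).
- by apply: measurable_funM => //; exact: sa.1.
- move=> z; rewrite exprMn ler_wpM2r ?sqr_ge0// -(real_normK (num_real (q z))).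
  by apply: lerXn2r; rewrite ?nnegrE.
- by apply: integrableZr_real; exact: sq_int_integrable.
Qed.

Lemma equivariant_scale al q a1 a2 : periodic2 q -> equivariant al a1 a2 ->
  equivariant al (fun z => q z * a1 z) (fun z => q z * a2 z).
Proof. by move=> pq e s t; rewrite pq; have [-> ->] := e s t; split; ring. Qed.

Lemma equivariantD al a1 a2 b1 b2 : equivariant al a1 a2 -> equivariant al b1 b2 ->
  equivariant al (fun z => a1 z + b1 z) (fun z => a2 z + b2 z).
Proof.
by move=> e e' s t; have [-> ->] := e s t; have [-> ->] := e' s t; split; ring.
Qed.

Lemma epair_scale al q q1 q2 w1 w2 w11 w12 w21 w22 : C1b q q1 q2 ->
  periodic2 q -> periodic2 q1 -> periodic2 q2 ->
  epair al w1 w2 w11 w12 w21 w22 ->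
  epair al (fun z => q z * w1 z) (fun z => q z * w2 z)
    (fun z => q1 z * w1 z + q z * w11 z) (fun z => q2 z * w1 z + q z * w12 z)
    (fun z => q1 z * w2 z + q z * w21 z) (fun z => q2 z * w2 z + q z * w22 z).
Proof.
move=> Cq p p1 p2 [C1 C2 e0 e1 e2 s1 s2 s11 s12 s21 s22].
have [b b1 b2 _] := Cq.
exact: (EPair (C1bM Cq C1) (C1bM Cq C2) (equivariant_scale p e0)
  (equivariantD (equivariant_scale p1 e0) (equivariant_scale p e1))
  (equivariantD (equivariant_scale p2 e0) (equivariant_scale p e2))
  (sq_int_bM b s1) (sq_int_bM b s2)
  (sq_intD (sq_int_bM b1 s1) (sq_int_bM b s11)) (sq_intD (sq_int_bM b2 s1) (sq_int_bM b s12))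
  (sq_intD (sq_int_bM b1 s2) (sq_int_bM b s21)) (sq_intD (sq_int_bM b2 s2) (sq_int_bM b s22))).
Qed.

Lemma C1bZ (c : R) a a1 a2 : C1b a a1 a2 ->
  C1b (fun z => c * a z) (fun z => c * a1 z) (fun z => c * a2 z).
Proof.
move=> Ca; have := C1bM (C1b_cst c) Ca; congr C1b; apply/funext => z;
  by rewrite ?mul0r ?add0r.
Qed.

Lemma epair_lin al (c : R) w1 w2 w11 w12 w21 w22 h1 h2 h11 h12 h21 h22 :
  epair al w1 w2 w11 w12 w21 w22 -> epair al h1 h2 h11 h12 h21 h22 ->
  epair al (fun z => w1 z + c * h1 z) (fun z => w2 z + c * h2 z)
    (fun z => w11 z + c * h11 z) (fun z => w12 z + c * h12 z)
    (fun z => w21 z + c * h21 z) (fun z => w22 z + c * h22 z).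
Proof.
move=> [C1 C2 e0 e1 e2 s1 s2 s11 s12 s21 s22] [D1 D2 f0 f1 f2 t1 t2 t11 t12 t21 t22].
have pc : periodic2 (fun _ : R * R => c) by [].
exact: (EPair (C1bD C1 (C1bZ c D1)) (C1bD C2 (C1bZ c D2))
  (equivariantD e0 (equivariant_scale pc f0)) (equivariantD e1 (equivariant_scale pc f1))
  (equivariantD e2 (equivariant_scale pc f2))
  (sq_intD s1 (sq_intZ c t1)) (sq_intD s2 (sq_intZ c t2))
  (sq_intD s11 (sq_intZ c t11)) (sq_intD s12 (sq_intZ c t12))
  (sq_intD s21 (sq_intZ c t21)) (sq_intD s22 (sq_intZ c t22))).
Qed.

Definition dens w1 w2 z : R := w1 z ^+ 2 + w2 z ^+ 2.

Lemma dens_ge0 w1 w2 z : 0 <= dens w1 w2 z.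
Proof. by rewrite addr_ge0 ?sqr_ge0. Qed.

(** One component of [|w|^(2 n) w], which is [|w|^(p - 2) w] for [p = 2 n + 2]. At even exponents it
    is a polynomial in the components, hence as regular as [w]. *)
Definition powmap n w1 w2 w z : R := dens w1 w2 z ^+ n * w z.

Lemma epair_powmap n al w1 w2 w11 w12 w21 w22 : epair al w1 w2 w11 w12 w21 w22 ->
  exists f11 f12 f21 f22, epair al (powmap n.+1 w1 w2 w1) (powmap n.+1 w1 w2 w2)
    f11 f12 f21 f22.
Proof.
move=> ew; have [C1 C2 e0 e1 e2 s1 s2 s11 s12 s21 s22] := ew.
pose V1 z := 2 * (w1 z * w11 z + w2 z * w21 z).
pose V2 z := 2 * (w1 z * w12 z + w2 z * w22 z).
have CV : C1b (dens w1 w2) V1 V2.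
  have := C1bD (C1bM C1 C1) (C1bM C2 C2); congr C1b; apply/funext => z.
  - by rewrite /V1; ring.
  - by rewrite /V2; ring.
have pV : periodic2 (dens w1 w2) by exact: equivariant_sq e0.
have pdot b1 b2 : equivariant al b1 b2 -> periodic2 (fun z => w1 z * b1 z + w2 z * b2 z).
  by move=> eb s t; have := equivariant_dot 0 e0 eb s t; rewrite !addr0.
have pV1 : periodic2 V1 by move=> s t; rewrite /V1 (pdot _ _ e1 s t).
have pV2 : periodic2 V2 by move=> s t; rewrite /V2 (pdot _ _ e2 s t).
have := epair_scale (C1bX n CV) _ _ _ ew.
move=> H; do 4 eexists; apply: H.
- by move=> s t; rewrite pV.
- by move=> s t; rewrite pV pV1.
- by move=> s t; rewrite pV pV2.
Qed.

Lemma kF_odd z : (kF1 \o -%R) z = - kF1 z /\ (kF2 \o -%R) z = - kF2 z.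
Proof.
have e : enorm2 (- z) = enorm2 z by rewrite /enorm2/= !sqrrN.
by rewrite /kF1 /kF2/= e; split; rewrite mulrN mulNr.
Qed.

Lemma cconvN k b y : ikernel k -> bfun b ->
  cconv (fun z => - k z) b y = - cconv k b y.
Proof.
move=> hk hb; have ik := conv_integrable y hk (bfun_meas hb) (bfun_bounded hb).
have := Rintegral_lin (-1) 0 ik ik; rewrite mul0r addr0 mulN1r => <-.
by apply: eq_Rintegral => z _; rewrite mul0r addr0 mulN1r mulNr.
Qed.

Lemma ipDr a b c : sq_int mS a -> sq_int mS b -> sq_int mS c ->
  ip mS a (fun z => b z + c z) = ip mS a b + ip mS a c.
Proof. by move=> sa sb sc; rewrite ipC (ipDl sb sc sa); congr (_ + _); exact: ipC. Qed.

Opaque ip.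

(** Weak form of [- Laplace (kk * f) = f - kg * f]. The polar representation of [a] is paired with
    [f] and each convolution moved to the other side; as the gradient of [kk] is odd, its
    convolution with [f] becomes [kk] convolved with a derivative of [f]. *)
Lemma representation al a1 a2 a11 a12 a21 a22 f1 f2 f11 f12 f21 f22 :
  epair al a1 a2 a11 a12 a21 a22 -> epair al f1 f2 f11 f12 f21 f22 ->
  ip2 f1 f2 a1 a2 =
    dform a11 a12 a21 a22 (cconv kk f11) (cconv kk f12) (cconv kk f21) (cconv kk f22) +
    ip2 a1 a2 (cconv kg f1) (cconv kg f2).
Proof.
move=> ea ef.
have [A1 A2 e0 e1 e2 s1 s2 s11 s12 s21 s22] := ea.
have [F1 F2 g0 g1 g2 t1 t2 t11 t12 t21 t22] := ef.
have [ba1 ba11 ba12 _] := A1; have [ba2 ba21 ba22 _] := A2.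
have [bf1 bf11 bf12 _] := F1; have [bf2 bf21 bf22 _] := F2.
have [c1 c2] := conv_sq_int ikernel_kg ba1 ba2 e0 s1 s2.
have [c11 c21] := conv_sq_int ikernel_kF1 ba11 ba21 e1 s11 s21.
have [c12 c22] := conv_sq_int ikernel_kF2 ba12 ba22 e2 s12 s22.
have E1 : a1 = (fun y => cconv kg a1 y + (cconv kF1 a11 y + cconv kF2 a12 y)).
  by apply/funext => y; exact: polar_representation.
have E2 : a2 = (fun y => cconv kg a2 y + (cconv kF1 a21 y + cconv kF2 a22 y)).
  by apply/funext => y; exact: polar_representation.
have H0 := cconv_adjoint ikernel_kg bf1 bf2 ba1 ba2 g0 e0 t1 t2 s1 s2.
have H1 := cconv_adjoint ikernel_kF1 bf1 bf2 ba11 ba21 g0 e1 t1 t2 s11 s21.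
have H2 := cconv_adjoint ikernel_kF2 bf1 bf2 ba12 ba22 g0 e2 t1 t2 s12 s22.
have kgo : kg \o -%R = kg :> (R * R -> R).
  by apply/funext => z; rewrite /kg /enorm2/= !sqrrN.
have F1o (f f1' f2' : R * R -> R) : C1b f f1' f2' -> cconv (kF1 \o -%R) f = cconv kk f1'.
  move=> C; apply/funext => y; rewrite (cconv_kk1 y C).
  rewrite -(cconvN y ikernel_kF1 (C1b_fun C)); congr (cconv _ f y).
  by apply/funext => z; rewrite (kF_odd z).1.
have F2o (f f1' f2' : R * R -> R) : C1b f f1' f2' -> cconv (kF2 \o -%R) f = cconv kk f2'.
  move=> C; apply/funext => y; rewrite (cconv_kk2 y C).
  rewrite -(cconvN y ikernel_kF2 (C1b_fun C)); congr (cconv _ f y).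
  by apply/funext => z; rewrite (kF_odd z).2.
rewrite kgo in H0.
rewrite (F1o _ _ _ F1) (F1o _ _ _ F2) in H1.
rewrite (F2o _ _ _ F1) (F2o _ _ _ F2) in H2.
have s1s : sq_int mS (fun y => cconv kF1 a11 y + cconv kF2 a12 y) by exact: (sq_intD c11 c12).
have s2s : sq_int mS (fun y => cconv kF1 a21 y + cconv kF2 a22 y) by exact: (sq_intD c21 c22).
have J1 := etrans (congr1 (ip mS f1) E1) (etrans (ipDr t1 c1 s1s)
  (congr1 (+%R _) (ipDr t1 c11 c12))).
have J2 := etrans (congr1 (ip mS f2) E2) (etrans (ipDr t2 c2 s2s)
  (congr1 (+%R _) (ipDr t2 c21 c22))).
have alg (x1 p1 q1 x2 p2 q2 X P Q : R) : x1 + x2 = X -> p1 + p2 = P ->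
    q1 + q2 = Q -> (x1 + (p1 + q1)) + (x2 + (p2 + q2)) = P + Q + X.
  by move=> <- <- <-; ring.
exact: (etrans (f_equal2 +%R J1 J2) (alg _ _ _ _ _ _ _ _ _ H0 H1 H2)).
Qed.

End equivariant_pairs.

(** * Young's inequality *)

Section inequalities.
Context {R : realType}.

(** Young's inequality with exponents [(n + 1) / n] and [n + 1], by induction so that only natural
    powers occur. *)
Lemma young_pow n (A B : R) : 0 <= A -> 0 <= B ->
  n.+1%:R * A ^+ n * B <= n%:R * A ^+ n.+1 + B ^+ n.+1.
Proof.
move=> A0 B0; elim: n => [|n ih]; first by rewrite expr0 mul0r add0r !mul1r expr1.
(* The induction step costs exactly this product, whose factors have the same sign. *)
have key : 0 <= (A ^+ n.+1 - B ^+ n.+1) * (A - B).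
  have [AB|BA] := leP A B.
    by rewrite mulr_le0// subr_le0// lerXn2r.
  by rewrite mulr_ge0// subr_ge0 ?lerXn2r// ltW.
have := ler_wpM2r A0 ih.
rewrite -[n.+2%:R]natr1 -[n.+1%:R]natr1 !exprS in key *.
move: (A ^+ n) (B ^+ n) key => x y; nra.
Qed.

(** Meant for [V = |w y|^2], [V' = |w (y + z)|^2], [D] their scalar product and [k] the kernel at
    [z]. One term separates the two points, the other keeps a power of the kernel and a single
    density at a time. The free scale [t] will be an upper bound for the norm of the kernel in
    L^(n+1). *)
Lemma young_dens n (V V' D k t : R) : 0 <= V -> 0 <= V' -> 0 <= D -> 0 <= k -> 0 < t ->
  D ^+ 2 <= V * V' ->
  V ^+ n * V' ^+ n * (k * D) <= n%:R / n.+1%:R * t * (V ^+ n.+1 * V' ^+ n.+1) +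
    t / (2 * n.+1%:R * t ^+ n.+1) * (k ^+ n.+1 * (V ^+ n.+1 + V' ^+ n.+1)).
Proof.
move=> V0 V'0 D0 k0 t0 DV.
have Dn : D ^+ n.+1 <= (V ^+ n.+1 + V' ^+ n.+1) / 2.
  have a0 : 0 <= V ^+ n.+1 by exact: exprn_ge0.
  have b0 : 0 <= V' ^+ n.+1 by exact: exprn_ge0.
  rewrite -(@ler_pXn2r _ 2)// ?nnegrE ?exprn_ge0 ?divr_ge0 ?addr_ge0//.
  rewrite exprAC; apply: (@le_trans _ _ ((V * V') ^+ n.+1)).
    by apply: lerXn2r; rewrite ?nnegrE ?sqr_ge0 ?mulr_ge0.
  rewrite exprMn; move: (V ^+ n.+1) (V' ^+ n.+1) a0 b0 => a b a0 b0.
  rewrite (_ : ((a + b) / 2) ^+ 2 = a * b + ((a - b) / 2) ^+ 2); last by field.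
  by rewrite lerDl sqr_ge0.
have N0 : 0 < n.+1%:R :> R by rewrite ltr0n.
have := young_pow n (mulr_ge0 V0 V'0) (divr_ge0 (mulr_ge0 k0 D0) (ltW t0)).
rewrite !exprMn exprVn => Y.
have tN : 0 < t ^+ n.+1 by exact: exprn_gt0.
have Y2 := ler_wpM2l (divr_ge0 (ltW t0) (ltW N0)) Y.
have kn0 : 0 <= t / n.+1%:R / t ^+ n.+1 * k ^+ n.+1.
  by rewrite mulr_ge0 ?exprn_ge0// divr_ge0 ?exprn_ge0 ?divr_ge0// ltW.
have Y3 := ler_wpM2l kn0 Dn.
move: Y2 Y3; set a := V ^+ n; set b := V' ^+ n; set a1 := V ^+ n.+1.
set b1 := V' ^+ n.+1; set T := t ^+ n.+1 in tN *; set N := n.+1%:R in N0 *.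
rewrite (_ : t / N * (N * (a * b) * (k * D / t)) = a * b * (k * D)); last first.
  by field; rewrite !lt0r_neq0.
rewrite (_ : t / N / T * k ^+ n.+1 * ((a1 + b1) / 2) =
  t / (2 * N * T) * (k ^+ n.+1 * (a1 + b1))); last first.
  by field; rewrite !lt0r_neq0.
move=> Y2 Y3; apply: (le_trans Y2).
rewrite mulrDr; apply: lerD.
  by rewrite le_eqVlt; apply/orP; left; apply/eqP; rewrite /a1 /b1; field; rewrite !lt0r_neq0.
by apply: le_trans Y3; rewrite le_eqVlt; apply/orP; left; apply/eqP; field; rewrite !lt0r_neq0.
Qed.

End inequalities.

(** * Convolutions of the dual function *)

Section classical_estimates.
Context {R : realType}.
Notation mu := (@lebesgue_measure R).
Notation plane := (measurableTypeR R * measurableTypeR R)%type.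
Local Notation leb2 := (mu \x mu)%E.
Implicit Types (a b w k q : R * R -> R) (y z : R * R).

Lemma abs_Rintegral_le d (T : measurableType d) (m : {measure set T -> \bar R})
    (F : T -> R) : m.-integrable setT (EFin \o F) ->
  ((`|\int[m]_x F x|)%:E <= \int[m]_x (`|F x|)%:E)%E.
Proof.
move=> iF; apply: (@le_trans _ _ (\int[m]_x `|F x|)%:E).
  by rewrite lee_fin; exact: le_normr_Rintegral.
rewrite /Rintegral fineK//; apply: integrable_fin_num => //.
exact: integrable_norm.
Qed.

(** The unit disc fits into a strip of height [2 pi], so a kernel supported in it never meets a
    point of the cylinder twice. *)
Lemma ind01_le_strip z :
  \1_unit01 (enorm2 z) <= \1_(`](- pi)%R, pi] : set R) z.2 :> R.
Proof.
rewrite indic01_01; case: ifP => [/andP[_ h]|_]; last by rewrite indicE.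
rewrite indicE mem_setE/= in_itv/=.
have h2 : z.2 ^+ 2 <= 1 by apply: le_trans h; rewrite lerDr sqr_ge0.
have p2 := pi_ge2 R.
have /andP[l u] : -1 <= z.2 <= 1.
  by rewrite -ler_norml -(expr_le1 (n := 2))// real_normK// num_real.
by rewrite (lt_le_trans _ l) ?(le_trans u)//; lra.
Qed.

Lemma mfun_strip : mfun2 (fun z => \1_(`](- pi)%R, pi] : set R) z.2 : R).
Proof.
apply: (measurableT_comp (measurable_indic _) measurable_snd).
exact: measurable_itv.
Qed.

Lemma strip_ge0 z : 0 <= \1_(`](- pi)%R, pi] : set R) z.2 :> R.
Proof. by rewrite indicE. Qed.

Lemma integral_wt1 : (\int[leb2]_z (wt 1 z)%:E = (2 * pi)%:E)%E.
Proof.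
rewrite integral_wt ?ltr1n//; congr EFin.
by rewrite (_ : 2 - 1 = 1 :> R) ?divr1//; lra.
Qed.

Lemma mfun_dens w1 w2 : mfun2 w1 -> mfun2 w2 -> mfun2 (dens w1 w2).
Proof. by move=> m1 m2; rewrite /mfun2 /dens in m1 m2 *; mfun. Qed.

(** Cauchy-Schwarz with the weight [V^m] on the unit disc. Its mass is at most [2 pi + 1], because
    [V^m <= 1 + V^(m+1)] and the integral of [V^(m+1)] is 1; hence a bound in which [m] does not
    appear. *)
Lemma conv_energy m al w1 w2 k (N2 : R) : mfun2 w1 -> mfun2 w2 ->
  bounded2 w1 -> bounded2 w2 -> equivariant al w1 w2 ->
  (\int[mS]_z (dens w1 w2 z ^+ m.+1)%:E = 1)%E ->
  ikernel k -> (forall z, 0 <= k z) ->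
  (forall z, \1_unit01 (enorm2 z) * k z = k z) ->
  (\int[leb2]_z (k z ^+ 2)%:E <= N2%:E)%E ->
  (\int[mS]_y (cconv k (powmap m w1 w2 w1) y ^+ 2 +
     cconv k (powmap m w1 w2 w2) y ^+ 2)%:E <= ((2 * pi + 1) * N2)%:E)%E.
Proof.
move=> m1 m2 b1 b2 e X1 hk k0 kB kN.
have mk := ikernel_meas hk.
pose V := dens w1 w2; have mV : mfun2 V by exact: mfun_dens.
have V0 z : 0 <= V z by exact: dens_ge0.
pose P z := V z ^+ m.+1; have mP : mfun2 P by rewrite /mfun2 in mV *; mfun.
have P0 z : 0 <= P z by exact: exprn_ge0.
have pP : periodic2 P by move=> s t; rewrite /P /V /dens (equivariant_sq e).
pose B z : R := \1_unit01 (enorm2 z).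
have mB : mfun2 B := mfun_ind01.
have B0 z : 0 <= B z by rewrite /B indicE.
pose K : R := 2 * pi + 1; have K0 : 0 < K by rewrite ltr_wpDl// mulr_ge0// pi_ge0.
have mk2 : mfun2 (fun z => k z ^+ 2) by rewrite /mfun2 in mk *; mfun.
have k20 z : 0 <= k z ^+ 2 by exact: sqr_ge0.
have key w y : mfun2 w -> bounded2 w -> ((cconv k (powmap m w1 w2 w) y ^+ 2)%:E <=
    K%:E * \int[leb2]_z (k z ^+ 2 * (V (y + z) ^+ m * w (y + z) ^+ 2))%:E)%E.
  move=> mw [M M0 wM].
  have mVy := mfun2_shift y mV; have mwy := mfun2_shift y mw; have mPy := mfun2_shift y mP.
  have [M1 M10 w1M] := b1; have [M2 M20 w2M] := b2.
  have bf : bounded2 (powmap m w1 w2 w).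
    exists ((M1 ^+ 2 + M2 ^+ 2) ^+ m * M); first by rewrite mulr_ge0// exprn_ge0// addr_ge0 ?sqr_ge0.
    move=> z; rewrite /powmap normrM normrX ler_pM ?exprn_ge0// ger0_norm//.
    apply: lerXn2r; rewrite ?nnegrE// ?addr_ge0 ?sqr_ge0// /dens.
    by apply: lerD; rewrite -(real_normK (num_real _)); apply: lerXn2r; rewrite ?nnegrE.
  have mf : mfun2 (powmap m w1 w2 w) by rewrite /mfun2 /powmap in mV mw *; mfun.
  have J := @ge0_jensen_sq _ plane R leb2 (fun z => B z * V (y + z) ^+ m)
    (fun z => k z * `|w (y + z)|) K K0 _ _ _ _ _.
  apply: le_trans (le_trans (J _ _ _ _ _) _).
  - rewrite -(real_normK (num_real (cconv _ _ _))) EFin_expe.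
    rewrite lee_sqr; last 2 first.
      by rewrite lee_fin.
      by apply: integral_ge0 => z _; rewrite lee_fin !mulr_ge0 ?exprn_ge0.
    rewrite /cconv.
    apply: (le_trans (abs_Rintegral_le (conv_integrable y hk mf bf))).
    rewrite le_eqVlt; apply/orP; left; apply/eqP; apply: eq_integral => z _.
    rewrite normrM ger0_norm// /powmap normrM (ger0_norm (exprn_ge0 _ _))// -/V; congr EFin.
    by rewrite -{1}kB -/(B z); ring.
  - by rewrite /mfun2 in mB mVy *; mfun.
  - by rewrite /mfun2 in mk mwy *; mfun.
  - by move=> z; rewrite mulr_ge0// exprn_ge0.
  - by move=> z; rewrite mulr_ge0.
  - apply: (@le_trans _ _ (\int[leb2]_z ((wt 1 z)%:E +
        (\1_(`](- pi)%R, pi] : set R) z.2)%:E * (P (y + z))%:E))%E).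
      have ms := mfun_strip; have mw1 := @mfun_wt R 1.
      apply: ge0_le_integral => //.
      + by move=> z _; rewrite lee_fin mulr_ge0// exprn_ge0.
      + by apply/measurable_EFinP; rewrite /mfun2 in mB mVy; mfun.
      + by rewrite /mfun2 in ms mw1 mPy; mfun.
      + move=> z _; rewrite -EFinM -EFinD lee_fin.
        have bs := ind01_le_strip z; have bw := wt1_ge1 z; rewrite -/(B z) in bs bw.
        have V1 : V (y + z) ^+ m <= 1 + P (y + z).
          rewrite /P; have [h|h] := leP (V (y + z)) 1.
            by apply: (@le_trans _ _ 1); [exact: exprn_ile1|rewrite lerDl exprn_ge0].
          by rewrite exprS -[leLHS]add0r lerD// ler_peMl ?exprn_ge0// ltW.
        apply: (le_trans (ler_wpM2l (B0 z) V1)); rewrite mulrDr mulr1.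
        by apply: lerD => //; rewrite ler_wpM2r.
    rewrite ge0_integralD//; last 4 first.
    + by move=> z _; rewrite lee_fin wt_ge0.
    + by apply/measurable_EFinP; exact: mfun_wt.
    + by move=> z _; rewrite mule_ge0// lee_fin ?strip_ge0.
    + by have ms := mfun_strip; rewrite /mfun2 in ms mPy; mfun.
    rewrite integral_wt1 (@ge0_integral_strip _ (fun z => (P z)%:E) y)//.
    + by rewrite X1 -EFinD.
    + exact/measurable_EFinP.
    + by move=> s t; rewrite pP.
  - apply: lee_wpmul2l; first by rewrite lee_fin ltW.
    rewrite le_eqVlt; apply/orP; left; apply/eqP; apply: eq_integral => z _; congr EFin.
    by rewrite exprMn real_normK ?num_real// -[in RHS]kB -/(B z) exprMn (_ : B z ^+ 2 = B z);
      [ring|rewrite /B indicE expr2 -natrM mulnb andbb].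
have E1 y : ((cconv k (powmap m w1 w2 w1) y ^+ 2 + cconv k (powmap m w1 w2 w2) y ^+ 2)%:E <=
    K%:E * \int[leb2]_z (k z ^+ 2 * P (y + z))%:E)%E.
  rewrite EFinD; apply: (le_trans (leeD (key w1 y m1 b1) (key w2 y m2 b2))).
  have p0 w z : 0 <= k z ^+ 2 * (V (y + z) ^+ m * w (y + z) ^+ 2).
    exact: (mulr_ge0 (sqr_ge0 _) (mulr_ge0 (exprn_ge0 _ (V0 _)) (sqr_ge0 _))).
  have i0 w : (0 <= \int[leb2]_z (k z ^+ 2 * (V (y + z) ^+ m * w (y + z) ^+ 2))%:E)%E.
    by apply: integral_ge0 => z _; rewrite lee_fin; exact: p0.
  rewrite -ge0_muleDr// -ge0_integralD//.
  - rewrite le_eqVlt; apply/orP; left; apply/eqP; congr (_ * _)%E.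
    apply: eq_integral => z _; rewrite -EFinD; congr EFin.
    have -> : P (y + z) = V (y + z) ^+ m * (w1 (y + z) ^+ 2 + w2 (y + z) ^+ 2).
      by rewrite /P exprSr.
    by rewrite -mulrDr -mulrDr.
  - by move=> z _; rewrite lee_fin; exact: p0.
  - apply/measurable_EFinP; have mVy := mfun2_shift y mV; have mwy := mfun2_shift y m1.
    by rewrite /mfun2 in mk2 mVy mwy; mfun.
  - by move=> z _; rewrite lee_fin; exact: p0.
  - apply/measurable_EFinP; have mVy := mfun2_shift y mV; have mwy := mfun2_shift y m2.
    by rewrite /mfun2 in mk2 mVy mwy; mfun.
have mf w : mfun2 w -> mfun2 (cconv k (powmap m w1 w2 w)).
  by move=> mw; apply: conv_meas => //; rewrite /mfun2 /powmap in mV mw *; mfun.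
have mI := measurable_integral_conv mk2 mP k20 P0.
apply: (@le_trans _ _ (\int[mS]_y (K%:E * \int[leb2]_z (k z ^+ 2 * P (y + z))%:E))%E).
  apply: ge0_le_integral => //.
  - by move=> y _; rewrite lee_fin addr_ge0 ?sqr_ge0.
  - apply/measurable_EFinP; have f1 := mf _ m1; have f2 := mf _ m2.
    by rewrite /mfun2 in f1 f2; mfun.
  - exact: measurable_funeM.
rewrite ge0_integralZl//; last 2 first.
- by move=> y _; apply: integral_ge0 => z _; rewrite lee_fin mulr_ge0.
- by rewrite lee_fin ltW.
rewrite (ge0_integral_conv mk2 mP)// X1 mule1 EFinM.
by apply: lee_wpmul2l => //; rewrite lee_fin ltW.
Qed.

Lemma ge0_integral_lin2 d (T : measurableType d) (m : {measure set T -> \bar R})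
    (c e : R) (A B : T -> R) : 0 <= c -> 0 <= e ->
  measurable_fun setT A -> measurable_fun setT B ->
  (forall x, 0 <= A x) -> (forall x, 0 <= B x) ->
  (\int[m]_x (c * A x + e * B x)%:E =
   c%:E * \int[m]_x (A x)%:E + e%:E * \int[m]_x (B x)%:E)%E.
Proof.
move=> c0 e0 mA mB A0 B0.
under eq_integral do rewrite EFinD !EFinM.
rewrite ge0_integralD//; last 4 first.
- by move=> x _; rewrite -EFinM lee_fin mulr_ge0.
- by mfun.
- by move=> x _; rewrite -EFinM lee_fin mulr_ge0.
- by mfun.
rewrite !ge0_integralZl//.
all: try (by apply/measurable_EFinP).
all: by move=> x _; rewrite lee_fin.
Qed.

Lemma bfun_powmap m w1 w2 w : bfun w1 -> bfun w2 -> bfun w ->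
  bfun (powmap m w1 w2 w).
Proof. by move=> b1 b2 b; apply: bfunM => //; apply: bfunX; apply: bfunD; exact: bfunX. Qed.

Lemma equivariant_powmap m al w1 w2 : equivariant al w1 w2 ->
  equivariant al (powmap m w1 w2 w1) (powmap m w1 w2 w2).
Proof.
move=> e; apply: equivariant_scale => // s t.
by rewrite /dens (equivariant_sq e).
Qed.

Lemma sq_int_powmap m w1 w2 w : bfun w1 -> bfun w2 -> sq_int mS w ->
  sq_int mS (powmap m w1 w2 w).
Proof.
by move=> b1 b2 s; apply: sq_int_bM => //; apply: bfunX; apply: bfunD; exact: bfunX.
Qed.

Lemma kk_ind z : \1_unit01 (enorm2 z) * kk z = kk z.
Proof. by rewrite /kk /Kf indic01_01; case: ifP; rewrite ?mul1r ?mul0r. Qed.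

Lemma kg_ind z : \1_unit01 (enorm2 z) * kg z = kg z.
Proof. by rewrite /kg indic01_01; case: ifP; rewrite ?mul1r ?mul0r. Qed.

Transparent ip.

Lemma ip2E a1 a2 b1 b2 : sq_int mS a1 -> sq_int mS a2 -> sq_int mS b1 -> sq_int mS b2 ->
  ip2 a1 a2 b1 b2 = \int[mS]_y (a1 y * b1 y + a2 y * b2 y).
Proof.
by move=> s1 s2 t1 t2; rewrite /ip2 /ip (RintegralD measurableT (sq_int_mul s1 t1) (sq_int_mul s2 t2)).
Qed.

Opaque ip.

(** Young's convolution inequality with constant 1: [f] has norm 1 in the dual of L^(2m+2), and the
    matching exponent for [kk] is [m + 1]. Integrating the pointwise inequality gives
    [m / (m+1) * t] from the separated term and [t / (m+1)] from the other. *)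
Lemma pairing_bound m al w1 w2 (t : R) : bfun w1 -> bfun w2 -> equivariant al w1 w2 ->
  sq_int mS w1 -> sq_int mS w2 ->
  (\int[mS]_z (dens w1 w2 z ^+ m.+1)%:E = 1)%E -> 0 < t ->
  (\int[leb2]_z (kk z ^+ m.+1)%:E <= (t ^+ m.+1)%:E)%E ->
  ip2 (powmap m w1 w2 w1) (powmap m w1 w2 w2)
    (cconv kk (powmap m w1 w2 w1)) (cconv kk (powmap m w1 w2 w2)) <= t.
Proof.
move=> b1 b2 e s1 s2 X1 t0 kN.
set f1 := powmap m w1 w2 w1; set f2 := powmap m w1 w2 w2.
have bf1 : bfun f1 by exact: bfun_powmap.
have bf2 : bfun f2 by exact: bfun_powmap.
have ef : equivariant al f1 f2 by exact: equivariant_powmap.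
have sf1 : sq_int mS f1 by exact: sq_int_powmap.
have sf2 : sq_int mS f2 by exact: sq_int_powmap.
have [sh1 sh2] := conv_sq_int ikernel_kk bf1 bf2 ef sf1 sf2.
rewrite (ip2E sf1 sf2 sh1 sh2); set g := (fun y : plane => _).
have ig : mS.-integrable setT (EFin \o g).
  exact: (integrableDr (sq_int_mul sf1 sh1) (sq_int_mul sf2 sh2)).
pose V := dens w1 w2; have mV : mfun2 V by apply: mfun_dens; exact: bfun_meas.
have V0 z : 0 <= V z by exact: dens_ge0.
pose P z := V z ^+ m.+1; have mP : mfun2 P by rewrite /mfun2 in mV *; mfun.
have P0 z : 0 <= P z by exact: exprn_ge0.
have pP : periodic2 P by move=> s u; rewrite /P /V /dens (equivariant_sq e).
pose St z : R := \1_(`](- pi)%R, pi] : set R) z.2.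
have mSt : mfun2 St := mfun_strip.
pose kn z := @kk R z ^+ m.+1.
have mk := @mfun_kk R; have mkn : mfun2 kn by rewrite /mfun2 in mk *; mfun.
have kn0 z : 0 <= kn z by rewrite exprn_ge0 ?kk_ge0.
pose Phi y := (\int[leb2]_z (kn z * P (y + z))%:E)%E.
have mPhi : measurable_fun setT (Phi : plane -> \bar R) by exact: measurable_integral_conv.
have Phi0 y : (0 <= Phi y)%E by apply: integral_ge0 => z _; rewrite lee_fin mulr_ge0.
pose c1 : R := m%:R / m.+1%:R * t; pose T := t ^+ m.+1.
pose c2 : R := t / (2 * m.+1%:R * T).
have T0 : 0 < T by exact: exprn_gt0.
have c10 : 0 <= c1 by rewrite mulr_ge0 ?divr_ge0// ltW.
have c20 : 0 <= c2 by rewrite divr_ge0 ?mulr_ge0 ?ltW.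
pose Bd (y : plane) : \bar R := ((c1 + c2 * T)%:E * (P y)%:E + c2%:E * Phi y)%E.
have mBd : measurable_fun setT Bd.
  apply: emeasurable_funD; apply: measurable_funeM => //; exact/measurable_EFinP.
have Bd0 y : (0 <= Bd y)%E.
  have c0 : 0 <= c1 + c2 * T by rewrite addr_ge0// mulr_ge0// ltW.
  by rewrite /Bd adde_ge0// mule_ge0 ?lee_fin.
have key y : ((`|g y|)%:E <= Bd y)%E.
  have mPy := mfun2_shift y mP; have mVy := mfun2_shift y mV.
  have i1 := conv_integrable y ikernel_kk (bfun_meas bf1) (bfun_bounded bf1).
  have i2 := conv_integrable y ikernel_kk (bfun_meas bf2) (bfun_bounded bf2).
  have ilin := integrableDr (integrableZr_real (f1 y) i1) (integrableZr_real (f2 y) i2).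
  rewrite /g /cconv -(Rintegral_lin _ _ i1 i2).
  apply: (le_trans (abs_Rintegral_le ilin)).
  apply: (@le_trans _ _ (\int[leb2]_z ((c1 * P y) * (St z * P (y + z)) +
      c2 * (P y * kn z + 1 * (kn z * P (y + z))))%:E)%E).
    apply: ge0_le_integral => //.
    - have mf1 := mfun2_shift y (bfun_meas bf1); have mf2 := mfun2_shift y (bfun_meas bf2).
      by rewrite /mfun2 in mf1 mf2 mk; mfun.
    - by rewrite /mfun2 in mSt mPy mkn; mfun.
    - move=> z _; rewrite lee_fin.
      pose D := `|w1 y * w1 (y + z) + w2 y * w2 (y + z)|.
      have DV : D ^+ 2 <= V y * V (y + z).
        rewrite /D real_normK ?num_real// /V /dens -subr_ge0.
        rewrite (_ : _ - _ = (w1 y * w2 (y + z) - w2 y * w1 (y + z)) ^+ 2) ?sqr_ge0//.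
        ring.
      have Y := young_dens m (V0 y) (V0 (y + z)) (normr_ge0 _) (kk_ge0 z) t0 DV.
      rewrite (_ : f1 y * _ + _ = (V y ^+ m * V (y + z) ^+ m * kk z) *
        (w1 y * w1 (y + z) + w2 y * w2 (y + z))); last by rewrite /f1 /f2 /powmap -/V; ring.
      rewrite normrM (ger0_norm (_ : 0 <= V y ^+ m * _ * _)); last first.
        exact: (mulr_ge0 (mulr_ge0 (exprn_ge0 _ (V0 y)) (exprn_ge0 _ (V0 (y + z)))) (kk_ge0 z)).
      (* The indicator of the disc is put in front. In the first term it is bounded by the strip,
         over which [P (y + z)] integrates to 1; in the second it is bounded by 1. *)
      rewrite -/D -kk_ind; set B := \1_unit01 _.
      have B0 : 0 <= B by rewrite /B indicE.
      have B1 : B <= 1 by rewrite /B indicE; case: (_ \in _).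
      have BS : B <= St z by exact: ind01_le_strip.
      rewrite (_ : V y ^+ m * _ * _ * D = B * (V y ^+ m * V (y + z) ^+ m * (kk z * D))); last by ring.
      apply: (le_trans (ler_wpM2l B0 Y)).
      rewrite -/c1 -/T -/c2 -/(kn z) -/(P y) -/(P (y + z)) mulrDr mul1r.
      apply: lerD.
        rewrite (_ : c1 * _ * _ = St z * (c1 * (P y * P (y + z)))); last by ring.
        by apply: ler_wpM2r => //; rewrite mulr_ge0// mulr_ge0.
      rewrite (_ : c2 * (P y * _ + _) = 1 * (c2 * (kn z * (P y + P (y + z))))); last by ring.
      by apply: ler_wpM2r => //; rewrite mulr_ge0// mulr_ge0// addr_ge0.
  have mSP : measurable_fun setT (fun z : plane => St z * P (y + z)).
    by rewrite /mfun2 in mSt mPy; mfun.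
  have mKP : measurable_fun setT (fun z : plane => kn z * P (y + z)).
    by rewrite /mfun2 in mkn mPy; mfun.
  rewrite ge0_integral_lin2//; last 4 first.
  - by rewrite mulr_ge0.
  - by rewrite /mfun2 in mkn; mfun.
  - by move=> z; rewrite mulr_ge0// strip_ge0.
  - by move=> z; rewrite addr_ge0 ?mulr_ge0.
  rewrite ge0_integral_lin2//; last by move=> z; rewrite mulr_ge0.
  rewrite (_ : (\int[leb2]_x (St x * P (y + x))%:E)%E = 1%E); last first.
    rewrite -X1 -(@ge0_integral_strip _ (fun z => (P z)%:E) y)//.
    - exact/measurable_EFinP.
    - by move=> s u; rewrite pP.
  rewrite mule1 mul1e -/(Phi y) /Bd.
  rewrite (_ : (c1 + c2 * T)%:E * (P y)%:E = (c1 * P y)%:E + (c2 * P y * T)%:E)%E; last first.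
    by rewrite -EFinM -EFinD; congr EFin; ring.
  rewrite -addeA; apply: leeD => //.
  rewrite ge0_muleDr//; last by rewrite mule_ge0 ?lee_fin//; apply: integral_ge0 => z _; rewrite lee_fin.
  apply: leeD => //; rewrite muleA -EFinM [in leRHS]EFinM.
  by apply: lee_wpmul2l => //; rewrite lee_fin mulr_ge0.
have mg : measurable_fun setT g by have /integrableP[/measurable_EFinP] := ig.
have main : ((`|\int[mS]_y g y|)%:E <= t%:E)%E.
  apply: (le_trans (abs_Rintegral_le ig)).
  apply: (@le_trans _ _ (\int[mS]_y Bd y)%E).
    by apply: ge0_le_integral => //; mfun.
  rewrite ge0_integralD//; last 4 first.
  - by move=> y _; rewrite -EFinM lee_fin mulr_ge0// addr_ge0// mulr_ge0// ltW.
  - by apply: measurable_funeM; exact/measurable_EFinP.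
  - by move=> y _; rewrite mule_ge0.
  - exact: measurable_funeM.
  rewrite !ge0_integralZl//; last 2 first.
  - by move=> y _; rewrite lee_fin.
  - by rewrite lee_fin addr_ge0// mulr_ge0// ltW.
  rewrite (ge0_integral_conv mkn mP)// X1 !mule1.
  apply: (@le_trans _ _ ((c1 + c2 * T)%:E + c2%:E * T%:E)%E).
    by apply: leeD => //; apply: lee_wpmul2l.
  rewrite -EFinM -EFinD lee_fin /c1 /c2.
  have N0 : 0 < m.+1%:R :> R by rewrite ltr0n.
  rewrite le_eqVlt; apply/orP; left; apply/eqP.
  rewrite -[m.+1%:R]natr1 in N0 *; by field; rewrite !lt0r_neq0.
  exact/measurable_EFinP.
by move: main; rewrite lee_fin; apply: le_trans; exact: ler_norm.
Qed.

End classical_estimates.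

(** * Testing the form with the convolution of the dual function *)

Section classical_inequality.
Context {R : realType}.
Notation mu := (@lebesgue_measure R).
Notation plane := (measurableTypeR R * measurableTypeR R)%type.
Local Notation leb2 := (mu \x mu)%E.
Implicit Types (a b w k q : R * R -> R) (y z : R * R).

Lemma ip2_sq a1 a2 : sq_int mS a1 -> sq_int mS a2 ->
  (ip2 a1 a2 a1 a2)%:E = (\int[mS]_z (a1 z ^+ 2 + a2 z ^+ 2)%:E)%E.
Proof.
move=> s1 s2; rewrite /ip2 EFinD (ipE s1) (ipE s2).
under [RHS]eq_integral do rewrite EFinD.
rewrite ge0_integralD//.
- by move=> z _; rewrite lee_fin sqr_ge0.
- by apply/measurable_EFinP; apply: measurable_funX; exact: s1.1.
- by move=> z _; rewrite lee_fin sqr_ge0.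
- by apply/measurable_EFinP; apply: measurable_funX; exact: s2.1.
Qed.

Lemma ip2_ge0 a1 a2 : 0 <= ip2 a1 a2 a1 a2 :> R.
Proof. by rewrite addr_ge0 ?ip_ge0. Qed.

Lemma ip2DZ a1 a2 b1 b2 (c : R) : sq_int mS a1 -> sq_int mS a2 ->
  sq_int mS b1 -> sq_int mS b2 ->
  ip2 (fun x => a1 x + c * b1 x) (fun x => a2 x + c * b2 x)
      (fun x => a1 x + c * b1 x) (fun x => a2 x + c * b2 x) =
  ip2 a1 a2 a1 a2 + 2 * c * ip2 a1 a2 b1 b2 + c ^+ 2 * ip2 b1 b2 b1 b2.
Proof.
move=> s1 s2 t1 t2.
have E1 := ipDZ c s1 t1; have E2 := ipDZ c s2 t2.
rewrite /ip2 E1 E2; ring.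
Qed.

Lemma ip2_CS a1 a2 b1 b2 : sq_int mS a1 -> sq_int mS a2 ->
  sq_int mS b1 -> sq_int mS b2 ->
  ip2 a1 a2 b1 b2 ^+ 2 <= ip2 a1 a2 a1 a2 * ip2 b1 b2 b1 b2.
Proof.
move=> s1 s2 t1 t2; apply: discriminant; [exact: ip2_ge0..|move=> c].
by rewrite -ip2DZ//; exact: ip2_ge0.
Qed.

Definition qform (lam : R) a1 a2 a11 a12 a21 a22 b1 b2 b11 b12 b21 b22 : R :=
  dform a11 a12 a21 a22 b11 b12 b21 b22 + lam * ip2 a1 a2 b1 b2.

(** Hardy's inequality bounds the angular part of the energy from below, and the axial part is
    nonnegative. *)
Lemma qform_coercive al lam a1 a2 a11 a12 a21 a22 : `|al| <= 1 / 2 ->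
  epair al a1 a2 a11 a12 a21 a22 ->
  (lam + al ^+ 2) * ip2 a1 a2 a1 a2 <= qform lam a1 a2 a11 a12 a21 a22 a1 a2 a11 a12 a21 a22.
Proof.
move=> al12 [C1 C2 e0 e1 e2 s1 s2 s11 s12 s21 s22].
have := hardy_mS al12 (C1b_C1l C1) (C1b_C1l C2) e0 e2.
rewrite -(ip2_sq s1 s2) -(ip2_sq s12 s22) -EFinM lee_fin => h.
have h1 := ip2_ge0 a11 a21.
rewrite /qform /dform mulrDl addrC lerD2r.
by apply: (le_trans h); rewrite lerDr.
Qed.

(** Discriminant of the polynomial [c -> Q(a + c b)], nonnegative by coercivity even when
    [lam < 0]. *)
Lemma qform_CS al lam a1 a2 a11 a12 a21 a22 b1 b2 b11 b12 b21 b22 : `|al| <= 1 / 2 ->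
  0 <= lam + al ^+ 2 ->
  epair al a1 a2 a11 a12 a21 a22 -> epair al b1 b2 b11 b12 b21 b22 ->
  qform lam a1 a2 a11 a12 a21 a22 b1 b2 b11 b12 b21 b22 ^+ 2 <=
  qform lam a1 a2 a11 a12 a21 a22 a1 a2 a11 a12 a21 a22 *
  qform lam b1 b2 b11 b12 b21 b22 b1 b2 b11 b12 b21 b22.
Proof.
move=> al12 lal ea eb.
have q0 a1' a2' a11' a12' a21' a22' : epair al a1' a2' a11' a12' a21' a22' ->
    0 <= qform lam a1' a2' a11' a12' a21' a22' a1' a2' a11' a12' a21' a22'.
  by move=> e; apply: le_trans (qform_coercive lam al12 e); rewrite mulr_ge0// ip2_ge0.
apply: discriminant; [exact: q0 ea|exact: q0 eb|move=> c].
have := q0 _ _ _ _ _ _ (epair_lin c ea eb).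
have [_ _ _ _ _ s1 s2 s11 s12 s21 s22] := ea.
have [_ _ _ _ _ t1 t2 t11 t12 t21 t22] := eb.
have E0 := ip2DZ c s1 s2 t1 t2.
have E1 := ip2DZ c s11 s21 t11 t21.
have E2 := ip2DZ c s12 s22 t12 t22.
rewrite /qform /dform E0 E1 E2.
suff -> : forall x y z x' y' z' x2 y2 z2 : R,
  x + 2 * c * y + c ^+ 2 * z + (x' + 2 * c * y' + c ^+ 2 * z') +
  lam * (x2 + 2 * c * y2 + c ^+ 2 * z2) =
  x + x' + lam * x2 + 2 * c * (y + y' + lam * y2) + c ^+ 2 * (z + z' + lam * z2) by [].
by move=> *; ring.
Qed.

Lemma normr_le_sqrt (x y : R) : x ^+ 2 <= y -> `|x| <= Num.sqrt y.
Proof. by move=> h; rewrite -sqrtr_sqr ler_wsqrtr. Qed.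

(** The bound, in units of [sqrt (Q w)], for [<f, w> - Q(w, h)]: it comes from [w] against [kg * f]
    and from [lam w] against [h], both by Cauchy-Schwarz and coercivity. *)
Definition remainder_c (al lam NK NG : R) : R :=
  (Num.sqrt ((2 * pi + 1) * NG) + `|lam| * Num.sqrt ((2 * pi + 1) * NK)) /
  Num.sqrt (lam + al ^+ 2).

(** The excess of [Q(h)] over [<f, h>]: the product of [h] with [kg * f], and the zeroth-order term
    [lam |h|^2]. *)
Definition remainder_t (lam NK NG : R) : R :=
  Num.sqrt ((2 * pi + 1) * NK * ((2 * pi + 1) * NG)) + `|lam| * ((2 * pi + 1) * NK).

(** The representation formula serves twice. Applied to [w] it gives [Q(w, h)] up to a multiple of
    [sqrt (Q w)]; applied to [h] itself it turns [Q(h)] into [<f, h>] up to a constant, and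
    [pairing_bound] controls that. *)
Lemma classical_unit m al lam t NK NG w1 w2 w11 w12 w21 w22 : `|al| <= 1 / 2 ->
  0 < lam + al ^+ 2 -> 0 < t ->
  (\int[leb2]_z (kk z ^+ m.+2)%:E <= (t ^+ m.+2)%:E)%E ->
  (\int[leb2]_z (kk z ^+ 2)%:E <= NK%:E)%E ->
  (\int[leb2]_z (kg z ^+ 2)%:E <= NG%:E)%E ->
  epair al w1 w2 w11 w12 w21 w22 ->
  (\int[mS]_z (dens w1 w2 z ^+ m.+2)%:E = 1)%E ->
  1 <= Num.sqrt (qform lam w1 w2 w11 w12 w21 w22 w1 w2 w11 w12 w21 w22) *
    (Num.sqrt (t + remainder_t lam NK NG) + remainder_c al lam NK NG).
Proof.
move=> al12 lal t0 kt kN gN ew X1.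
set A := qform _ _ _ _ _ _ _ _ _ _ _ _ _.
set KK := (2 * pi + 1) * NK; set GG := (2 * pi + 1) * NG.
have [f11 [f12 [f21 [f22 ef]]]] := epair_powmap m ew.
set f1 := powmap m.+1 w1 w2 w1 in ef; set f2 := powmap m.+1 w1 w2 w2 in ef.
have eh := epair_cconv (ikernel_kk (R := R)) ef.
have R1 := representation ew ef.
have R2 := representation eh ef.
have [C1 C2 e0 e1 e2 s1 s2 s11 s12 s21 s22] := ew.
have [D1 D2 g0 g1 g2 t1 t2 t11 t12 t21 t22] := ef.
have [H1 H2 h0 h1 h2 u1 u2 u11 u12 u21 u22] := eh.
have bw1 := C1b_fun C1; have bw2 := C1b_fun C2.
have [v1 v2] := conv_sq_int ikernel_kg (C1b_fun D1) (C1b_fun D2) g0 t1 t2.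
have fw : ip2 f1 f2 w1 w2 = 1.
  rewrite (ip2E t1 t2 s1 s2) /Rintegral.
  rewrite (_ : (\int[mS]_y _)%E = 1%E)// -X1; apply: eq_integral => z _; congr EFin.
  by rewrite /f1 /f2 /powmap [in RHS]exprSr [in RHS]/dens; ring.
have hh : ip2 (cconv kk f1) (cconv kk f2) (cconv kk f1) (cconv kk f2) <= KK.
  rewrite -lee_fin (ip2_sq u1 u2).
  exact: (conv_energy (bfun_meas bw1) (bfun_meas bw2) (bfun_bounded bw1)
    (bfun_bounded bw2) e0 X1 (ikernel_kk (R := R)) (@kk_ge0 R) (@kk_ind R) kN).
have gg : ip2 (cconv kg f1) (cconv kg f2) (cconv kg f1) (cconv kg f2) <= GG.
  rewrite -lee_fin (ip2_sq v1 v2).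
  exact: (conv_energy (bfun_meas bw1) (bfun_meas bw2) (bfun_bounded bw1)
    (bfun_bounded bw2) e0 X1 (ikernel_kg (R := R)) (@kg_ge0 R) (@kg_ind R) gN).
have pb := pairing_bound bw1 bw2 e0 s1 s2 X1 t0 kt; rewrite -/f1 -/f2 in pb.
have QCS := qform_CS al12 (ltW lal) ew eh; rewrite -/A in QCS.
have wA := qform_coercive lam al12 ew; rewrite -/A in wA.
have CS1 := ip2_CS u1 u2 v1 v2.
have CS2 := ip2_CS s1 s2 v1 v2.
have CS3 := ip2_CS s1 s2 u1 u2.
have ww0 := ip2_ge0 w1 w2.
have hh0 := ip2_ge0 (cconv kk f1) (cconv kk f2).
have gg0 := ip2_ge0 (cconv kg f1) (cconv kg f2).
move: R1 R2 QCS; rewrite fw /qform.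
move: hh gg pb wA CS1 CS2 CS3 ww0 hh0 gg0.
set hhx := ip2 (cconv kk f1) _ (cconv kk f1) _.
set ggx := ip2 (cconv kg f1) _ (cconv kg f1) _.
set ww := ip2 w1 w2 w1 w2; set fh := ip2 f1 f2 _ _.
set hg := ip2 (cconv kk f1) _ (cconv kg f1) _.
set wg := ip2 w1 w2 (cconv kg f1) _; set wh := ip2 w1 w2 (cconv kk f1) _.
set dwh := dform w11 _ _ _ _ _ _ _; set dhh := dform _ _ _ _ _ _ _ _.
move: hhx ggx ww fh hg wg wh dwh dhh => hhx ggx ww fh hg wg wh dwh dhh.
move=> hh gg pb wA CS1 CS2 CS3 ww0 hh0 gg0 R1 R2 QCS.
have KK0 : 0 <= KK := le_trans hh0 hh.
have GG0 : 0 <= GG := le_trans gg0 gg.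
have A0 : 0 <= A by apply: le_trans wA; rewrite mulr_ge0// ltW.
have wwA : ww <= A / (lam + al ^+ 2) by rewrite ler_pdivlMr// mulrC.
have B1 : `|hg| <= Num.sqrt (KK * GG).
  by apply: normr_le_sqrt; apply: (le_trans CS1); apply: ler_pM.
have B2 : `|wg| <= Num.sqrt A / Num.sqrt (lam + al ^+ 2) * Num.sqrt GG.
  rewrite -sqrtrV ?(ltW lal)// -!sqrtrM ?divr_ge0 ?(ltW lal)//.
  by apply: normr_le_sqrt; apply: (le_trans CS2); apply: ler_pM.
have B3 : `|wh| <= Num.sqrt A / Num.sqrt (lam + al ^+ 2) * Num.sqrt KK.
  rewrite -sqrtrV ?(ltW lal)// -!sqrtrM ?divr_ge0 ?(ltW lal)//.
  by apply: normr_le_sqrt; apply: (le_trans CS3); apply: ler_pM.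
have lamhh : lam * hhx <= `|lam| * KK.
  by apply: (@le_trans _ _ (`|lam| * hhx)); [apply: ler_wpM2r => //; exact: ler_norm|exact: ler_wpM2l].
have hgN : - hg <= `|hg| by rewrite -normrN ler_norm.
have Qhh : dhh + lam * hhx <= t + remainder_t lam NK NG.
  by rewrite /remainder_t -/KK -/GG; lra.
have B4 : `|dwh + lam * wh| <= Num.sqrt A * Num.sqrt (t + remainder_t lam NK NG).
  rewrite -sqrtrM//; apply: normr_le_sqrt; apply: (le_trans QCS).
  exact: ler_wpM2l.
have -> : 1 = (dwh + lam * wh) + (wg - lam * wh) by rewrite R1; ring.
rewrite mulrDr; apply: lerD; first exact: le_trans (ler_norm _) B4.
rewrite /remainder_c -/KK -/GG.
rewrite (_ : Num.sqrt A * _ = Num.sqrt A / Num.sqrt (lam + al ^+ 2) * Num.sqrt GG +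
  `|lam| * (Num.sqrt A / Num.sqrt (lam + al ^+ 2) * Num.sqrt KK)); last by ring.
apply: lerD; first exact: le_trans (ler_norm _) B2.
apply: (le_trans (ler_norm _)); rewrite normrN normrM.
exact: ler_wpM2l.
Qed.

Lemma classical_inequality m al lam t NK NG w1 w2 w11 w12 w21 w22 : `|al| <= 1 / 2 ->
  0 < lam + al ^+ 2 -> 0 < t ->
  (\int[leb2]_z (kk z ^+ m.+2)%:E <= (t ^+ m.+2)%:E)%E ->
  (\int[leb2]_z (kk z ^+ 2)%:E <= NK%:E)%E ->
  (\int[leb2]_z (kg z ^+ 2)%:E <= NG%:E)%E ->
  epair al w1 w2 w11 w12 w21 w22 ->
  forall X : R, (\int[mS]_z (dens w1 w2 z ^+ m.+2)%:E = X%:E)%E ->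
  X `^ m.+2%:R^-1 <=
    qform lam w1 w2 w11 w12 w21 w22 w1 w2 w11 w12 w21 w22 *
    (Num.sqrt (t + remainder_t lam NK NG) + remainder_c al lam NK NG) ^+ 2.
Proof.
move=> al12 lal t0 kt kN gN ew X EX.
have X0 : 0 <= X.
  rewrite -lee_fin -EX; apply: integral_ge0 => z _.
  by rewrite lee_fin exprn_ge0// dens_ge0.
set A := qform _ _ _ _ _ _ _ _ _ _ _ _ _; set C := _ + remainder_c _ _ _ _.
have A0 : 0 <= A.
  by apply: le_trans (qform_coercive lam al12 ew); rewrite mulr_ge0// ?ip2_ge0// ltW.
have N0 : m.+2%:R != 0 :> R by rewrite pnatr_eq0.
have [->|Xn0] := eqVneq X 0.
  by rewrite powR0 ?invr_eq0// mulr_ge0// sqr_ge0.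
have Xp : 0 < X by rewrite lt_neqAle eq_sym Xn0.
(* Both sides are quadratic in the pair; this factor normalises the integral of [|w|^(2 (m + 2))] to
   1. *)
pose s := (X `^ (2 * m.+2%:R)^-1)^-1.
have s0 : 0 < s by rewrite invr_gt0 powR_gt0.
have sX : s ^- 2 = X `^ m.+2%:R^-1.
  rewrite /s -exprVn invrK -powR_mulrn ?powR_ge0// -powRrM; congr (_ `^ _).
  by field.
have s2n : (s ^+ 2) ^+ m.+2 * X = 1.
  rewrite -[s ^+ 2]invrK sX exprVn -powR_mulrn ?powR_ge0// -powRrM mulVf//.
  by rewrite powRr1// mulVf.
have es := epair_scale (C1b_cst s) (fun _ _ => erefl) (fun _ _ => erefl) (fun _ _ => erefl) ew.
have zs a b : (fun z : R * R => 0 * a z + s * b z) = (fun z => s * b z).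
  by apply/funext => z; rewrite mul0r add0r.
rewrite !zs in es.
have X1 : (\int[mS]_z (dens (fun z => s * w1 z) (fun z => s * w2 z) z ^+ m.+2)%:E = 1)%E.
  have md := mfun_dens (bfun_meas (C1b_fun (ep1 ew))) (bfun_meas (C1b_fun (ep2 ew))).
  rewrite (_ : 1%E = (((s ^+ 2) ^+ m.+2)%:E * X%:E)%E); last by rewrite -EFinM s2n.
  rewrite -EX -ge0_integralZl//.
  - apply: eq_integral => z _; rewrite -EFinM -exprMn; congr (_ ^+ _)%:E.
    by rewrite /dens; ring.
  - by apply/measurable_EFinP; exact: (measurable_funX m.+2 md).
  - by move=> z _; rewrite lee_fin exprn_ge0// dens_ge0.
  - by rewrite lee_fin exprn_ge0// sqr_ge0.
have := classical_unit al12 lal t0 kt kN gN es X1; rewrite -/C.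
have ipZ2 a1 a2 : sq_int mS a1 -> sq_int mS a2 ->
    ip2 (fun z => s * a1 z) (fun z => s * a2 z) (fun z => s * a1 z) (fun z => s * a2 z) =
    s ^+ 2 * ip2 a1 a2 a1 a2.
  suff h a : sq_int mS a -> ip mS (fun z => s * a z) (fun z => s * a z) = s ^+ 2 * ip mS a a.
    by move=> s1 s2; rewrite /ip2 (h _ s1) (h _ s2) -mulrDr.
  move=> sa; have za := sq_intZ s sa.
  have h1 := ipZl s sa za; have h3 := ipZl s sa sa.
  transitivity (s * ip mS a (fun z => s * a z)); first exact: h1.
  transitivity (s * ip mS (fun z => s * a z) a); first by congr (_ * _); exact: ipC.
  by transitivity (s * (s * ip mS a a)); [congr (_ * _); exact: h3|rewrite mulrA expr2].
have [_ _ _ _ _ s1 s2 s11 s12 s21 s22] := ew.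
have E0 := ipZ2 _ _ s1 s2; have E1 := ipZ2 _ _ s11 s21; have E2 := ipZ2 _ _ s12 s22.
rewrite {1}/qform /dform E0 E1 E2.
rewrite (_ : _ + lam * _ = s ^+ 2 * A); last by rewrite /A /qform /dform; ring.
rewrite sqrtrM ?sqr_ge0// sqrtr_sqr gtr0_norm// => h.
rewrite -sX -[leLHS]mul1r ler_pdivrMr ?exprn_gt0//.
have h0 : 0 <= Num.sqrt A * C.
  by rewrite -(pmulr_rge0 _ s0) mulrA (le_trans _ h).
have : 1 <= (s * Num.sqrt A * C) ^+ 2 by rewrite expr_ge1// (le_trans _ h).
rewrite !exprMn sqr_sqrtr//.
by have -> : s ^+ 2 * A * C ^+ 2 = A * C ^+ 2 * s ^+ 2 by ring.
Qed.

End classical_inequality.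

(** * Smooth bumps *)

Section smooth_class.
Context {R : realType}.
Notation plane := (R * R)%type.

(** The functions [t^(-m) e^(-1/t)], extended by zero: a family whose derivatives are linear
    combinations of its members. *)
Definition Eb m (t : R) : R := if 0 < t then t^-1 ^+ m * expR (- t^-1) else 0.

Lemma pow_expR_le k (y : R) : 0 <= y -> y ^+ k <= k`!%:R * expR y.
Proof.
move=> y0; case: k => [|k]; first by rewrite expr0 mul1r -(@expR0 R) ler_expR.
have := expR_ge1Dxn k y0; rewrite -ler_pdivrMl ?ltr0n ?fact_gt0//.
by apply: le_trans; rewrite mulrC lerDr.
Qed.

Lemma Eb_ge0 m t : 0 <= Eb m t.
Proof.
rewrite /Eb; case: ifP => // t0; apply: mulr_ge0; last exact: expR_ge0.
by apply: exprn_ge0; rewrite invr_ge0 ltW.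
Qed.

(** From [y^j <= j! e^y] at [y = 1 / t]. The case [k = 0] bounds the functions, [k = 2] makes them
    differentiable at 0. *)
Lemma Eb_le m k (t : R) : Eb m t <= (m + k)`!%:R * `|t| ^+ k.
Proof.
rewrite /Eb; case: ifPn => [t0|_]; last by rewrite mulr_ge0// exprn_ge0.
have y0 : 0 < t^-1 by rewrite invr_gt0.
have := pow_expR_le (m + k) (ltW y0).
rewrite gtr0_norm// expRN exprD => h.
have bt : t^-1 ^+ k * t ^+ k = 1 by rewrite -exprMn mulVf ?expr1n// gt_eqF.
rewrite ler_pdivrMr ?expR_gt0//.
have := ler_wpM2r (exprn_ge0 k (ltW t0)) h; rewrite -mulrA bt mulr1 => /le_trans; apply.
by rewrite mulrAC.
Qed.

Lemma is_derive_exprn n (y : R) :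
  is_derive y (1 : R) (fun y : R => y ^+ n) (n%:R * y ^+ n.-1).
Proof.
elim: n => [|n ih].
  rewrite (_ : (fun y => _) = cst 1); first by apply: is_derive_eq; rewrite mul0r.
  by apply/funext => x; rewrite expr0.
rewrite (_ : (fun y => _) = fun y => y * y ^+ n); last by apply/funext => x; rewrite exprS.
apply: is_derive_eq; rewrite /GRing.scale/= -[n.+1%:R]natr1.
by case: n {ih} => [|n]; rewrite /= ?expr0 ?exprS; ring.
Qed.

Lemma is_derive_Eb m (t : R) :
  is_derive t (1 : R) (Eb m) (Eb m.+2 t - m%:R * Eb m.+1 t).
Proof.
have [t0|t0|t0] := ltrgtP t 0.
- apply: (near_eq_is_derive (f := fun=> 0)).
    near=> x; rewrite /Eb ltNge (_ : x <= 0)//.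
    by apply: ltW; near: x; exact: lt_nbhsl.
  by apply: is_derive_eq; rewrite /Eb !ltNge (ltW t0)/= mulr0 subrr.
- apply: (near_eq_is_derive (f := fun t : R => (t^-1 ^+ m * expR (- t^-1) : R))).
    near=> x; rewrite /Eb (_ : 0 < x)//.
    by near: x; exact: lt_nbhsr.
  have tn0 : t != 0 by rewrite gt_eqF.
  have di : is_derive t (1 : R) (fun x => x^-1) (- t ^- 2).
    by apply: is_derive_eq; [exact: is_deriveV|rewrite /GRing.scale/= mulr1].
  have dP (y : R) : is_derive y (1 : R) (fun y : R => y ^+ m * expR (- y))
      ((m%:R * y ^+ m.-1 - y ^+ m) * expR (- y)).
    case: m => [|n].
      rewrite (_ : (fun y => _) = fun y => expR (- y)); last first.
        by apply/funext => x; rewrite expr0 mul1r.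
      by apply: is_derive_eq; rewrite /GRing.scale/= expr0; ring.
    have dX := is_derive_exprn n.+1 y.
    by apply: is_derive_eq; rewrite /GRing.scale/= !exprS; ring.
  have := @is_derive1_comp R (fun y : R => y ^+ m * expR (- y)) (fun x => x^-1) t _ _ (dP t^-1) di.
  rewrite (_ : (_ * _) * _ = Eb m.+2 t - m%:R * Eb m.+1 t)//.
  rewrite /Eb t0 -exprVn; case: m {dP} => [|n]; rewrite ?expr0 /= !exprS; ring.
- subst t; rewrite {2 3}/Eb ltxx mulr0 subrr.
  have lim0 : (fun h : R => h^-1 *: (Eb m (h *: 1 + 0) - Eb m 0)) @ 0^' --> (0 : R).
    apply/cvgrPdist_le => e e0; near=> h.
    have hn0 : h != 0 by near: h; exact: nbhs_dnbhs_neq.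
    rewrite sub0r normrN /GRing.scale/= mulr1 addr0 {2}/Eb ltxx subr0 normrM normfV.
    rewrite ler_pdivrMl ?normr_gt0// ger0_norm ?Eb_ge0//.
    (* Quadratic flatness at 0 survives the division by [h]. *)
    apply: (le_trans (Eb_le m 2 h)); rewrite expr2 mulrA [leRHS]mulrC ler_wpM2r//.
    rewrite mulrC -ler_pdivlMr ?ltr0n ?fact_gt0//.
    near: h; apply: dnbhs0_le; rewrite divr_gt0// ltr0n fact_gt0//.
  by apply: DeriveDef; [apply/cvg_ex; exists 0|exact/cvg_lim].
Unshelve. all: by end_near. Qed.

Lemma is_derive_along (f : plane -> R) (x v : plane) (df : R) :
  is_derive (0 : R) (1 : R) (fun t : R => f (t *: v + x)) df -> is_derive x v f df.
Proof.
move=> [d <-].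
have E : (fun h : R => h^-1 *: (f (h *: v + x) - f x)) =
    (fun h : R => h^-1 *: (f ((h *: 1 + 0) *: v + x) - f (0 *: v + x))).
  apply/funext => h; rewrite scale0r add0r (_ : h%:A + 0 = h)//.
  by rewrite addr0 /GRing.scale/= mulr1.
by apply: DeriveDef; [rewrite /derivable E|rewrite /derive E].
Qed.

(** A syntactic class of differentiable functions that is stable under every directional derivative:
    smoothness of its members follows by induction on the list of directions. *)
Inductive Sm : (plane -> R) -> Prop :=
| SmL al be ga : Sm (fun x => al * x.1 + be * x.2 + ga)
| SmE m al be ga : Sm (fun x => Eb m (al * x.1 + be * x.2 + ga))
| SmD f g : Sm f -> Sm g -> Sm (fun x => f x + g x)
| SmM f g : Sm f -> Sm g -> Sm (fun x => f x * g x).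

Lemma SmC (c : R) : Sm (fun=> c).
Proof.
have := SmL 0 0 c; congr Sm; apply/funext => x.
by rewrite !mul0r !add0r.
Qed.

Lemma differentiable_lin (al be ga : R) (x : plane) :
  differentiable (fun x : plane => al * x.1 + be * x.2 + ga) x.
Proof.
have d1 : differentiable (fst : plane -> R) x.
  by apply: linear_differentiable => y; exact: cvg_fst.
have d2 : differentiable (snd : plane -> R) x.
  by apply: linear_differentiable => y; exact: cvg_snd.
apply: differentiableD; last exact: differentiable_cst.
apply: differentiableD; apply: differentiableM => //; exact: differentiable_cst.
Qed.

Lemma Sm_differentiable f x : Sm f -> differentiable f x.
Proof.
elim=> [al be ga|m al be ga|{}f g _ df _ dg|{}f g _ df _ dg].
- exact: differentiable_lin.
- apply: (@differentiable_comp _ _ _ _ (fun x : plane => al * x.1 + be * x.2 + ga) (Eb m)).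
    exact: differentiable_lin.
  by apply/derivable1_diffP; have [] := is_derive_Eb m (al * x.1 + be * x.2 + ga).
- exact: differentiableD.
- exact: differentiableM.
Qed.

Lemma is_derive_lin (al be ga : R) (x v : plane) :
  is_derive x v (fun x : plane => al * x.1 + be * x.2 + ga) (al * v.1 + be * v.2).
Proof.
apply: is_derive_along => /=.
by apply: is_derive_eq; rewrite /GRing.scale/=; ring.
Qed.

Lemma is_derive_Eb_lin m (al be ga : R) (x v : plane) :
  is_derive x v (fun x : plane => Eb m (al * x.1 + be * x.2 + ga))
   ((al * v.1 + be * v.2) * (Eb m.+2 (al * x.1 + be * x.2 + ga) -
      m%:R * Eb m.+1 (al * x.1 + be * x.2 + ga))).
Proof.
apply: is_derive_along => /=.
pose l (t : R) := al * (t * v.1 + x.1) + be * (t * v.2 + x.2) + ga.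
have dl : is_derive (0 : R) (1 : R) l (al * v.1 + be * v.2).
  by rewrite /l; apply: is_derive_eq; rewrite /GRing.scale/=; ring.
have l0 : l 0 = al * x.1 + be * x.2 + ga by rewrite /l !mul0r !add0r.
have := @is_derive1_comp R (Eb m) l 0 _ _ (is_derive_Eb m (l 0)) dl.
by rewrite l0 mulrC.
Qed.

Lemma Sm_derive f v : Sm f -> Sm (fun x => 'D_v f x).
Proof.
move=> Sf; elim: Sf v => [al be ga|m al be ga|{}f g Sf df Sg dg|{}f g Sf df Sg dg] v.
- have := SmC (al * v.1 + be * v.2); congr Sm; apply/funext => x.
  by have d := is_derive_lin al be ga x v; rewrite (@derive_val _ _ _ _ _ _ _ d).
- have := SmM (SmC (al * v.1 + be * v.2)) (SmD (SmE m.+2 al be ga)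
    (SmM (SmC (- m%:R)) (SmE m.+1 al be ga))); congr Sm; apply/funext => x.
  by have d := is_derive_Eb_lin m al be ga x v; rewrite (@derive_val _ _ _ _ _ _ _ d) mulNr.
- have := SmD (df v) (dg v); congr Sm; apply/funext => x.
  by rewrite deriveD//; apply: diff_derivable; exact: Sm_differentiable.
- have := SmD (SmM Sf (dg v)) (SmM Sg (df v)); congr Sm; apply/funext => x.
  by rewrite deriveM//; apply: diff_derivable; exact: Sm_differentiable.
Qed.

Lemma Sm_smooth f : Sm f -> smooth f.
Proof.
move=> Sf s x; apply: Sm_differentiable; elim: s => [//|v s ih].
exact: Sm_derive.
Qed.

Lemma is_deriveM_plane (f g : plane -> R) (x v : plane) (df dg : R) :
  is_derive x v f df -> is_derive x v g dg ->
  is_derive x v (fun x => f x * g x) (f x * dg + g x * df).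
Proof. by move=> hf hg; apply: is_derive_eq. Qed.

(** On []-1, 1[] this is [e^(-2 / (1 - t^2))]; the product form stays within [Sm] after composition
    with an affine map. *)
Definition bmp (t : R) : R := Eb 0 (1 + t) * Eb 0 (1 - t).

Lemma bmp_ge0 t : 0 <= bmp t.
Proof. by rewrite mulr_ge0 ?Eb_ge0. Qed.

Lemma bmp_out t : 1 <= `|t| -> bmp t = 0.
Proof.
rewrite /bmp /Eb ler_normr => /orP[h|h].
  by rewrite (ltNge 0 (1 - t)) (_ : 1 - t <= 0) ?mulr0//; lra.
by rewrite (ltNge 0 (1 + t)) (_ : 1 + t <= 0) ?mul0r//; lra.
Qed.

Definition dbmp (t : R) : R := Eb 2 (1 + t) * Eb 0 (1 - t) - Eb 0 (1 + t) * Eb 2 (1 - t).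

Lemma is_derive_bmp (t : R) : is_derive t (1 : R) bmp (dbmp t).
Proof.
have d1 : is_derive t (1 : R) (fun t => 1 + t) 1 by apply: is_derive_eq; ring.
have d2 : is_derive t (1 : R) (fun t => 1 - t) (-1) by apply: is_derive_eq; ring.
have c1 := @is_derive1_comp R (Eb 0) _ t _ _ (is_derive_Eb 0 (1 + t)) d1.
have c2 := @is_derive1_comp R (Eb 0) _ t _ _ (is_derive_Eb 0 (1 - t)) d2.
rewrite mul0r subr0 in c1 c2; rewrite /bmp.
have := @is_deriveM R R^o (Eb 0 \o (fun t => 1 + t)) (Eb 0 \o (fun t => 1 - t)) t 1 _ _ c1 c2.
rewrite (_ : _ *: _ + _ *: _ = dbmp t)//.
by rewrite /GRing.scale/= /dbmp; ring.
Qed.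

Lemma dbmp_out t : 1 <= `|t| -> dbmp t = 0.
Proof.
rewrite /dbmp /Eb ler_normr => /orP[h|h].
  by rewrite !(ltNge 0 (1 - t)) (_ : 1 - t <= 0) ?mulr0 ?subrr//; lra.
by rewrite !(ltNge 0 (1 + t)) (_ : 1 + t <= 0) ?mul0r ?subrr//; lra.
Qed.

Lemma bmp_le1 t : bmp t <= 1.
Proof.
rewrite /bmp -[leRHS]mulr1; apply: ler_pM; rewrite ?Eb_ge0//.
  by have := Eb_le 0 0 (1 + t); rewrite expr0 mulr1.
by have := Eb_le 0 0 (1 - t); rewrite expr0 mulr1.
Qed.

Lemma dbmp_le4 t : `|dbmp t| <= 4.
Proof.
have h m s : `|Eb m s| <= m`!%:R.
  by rewrite ger0_norm ?Eb_ge0//; have := Eb_le m 0 s; rewrite expr0 mulr1 addn0.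
rewrite /dbmp (le_trans (ler_normB _ _))// !normrM.
have a := ler_pM (normr_ge0 _) (normr_ge0 _) (h 2%N (1 + t)) (h 0%N (1 - t)).
have b := ler_pM (normr_ge0 _) (normr_ge0 _) (h 0%N (1 + t)) (h 2%N (1 - t)).
rewrite (_ : 2`! = 2)%N// fact0 mulr1 in a; rewrite (_ : 2`! = 2)%N// fact0 mul1r in b.
by apply: (le_trans (lerD a b)); lra.
Qed.

End smooth_class.

(** * Averaging along rotations and dilations *)

Section mollifier_kernel.
Context {R : realType}.
Notation mu := (@lebesgue_measure R).
Notation plane := (measurableTypeR R * measurableTypeR R)%type.
Local Notation leb2 := (mu \x mu)%E.
Implicit Types (x y z d q : R * R) (K f : R * R -> R).

(** The pair [(q1 z, q2 z)] is the rotation and dilation that carries the point of log-polar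
    coordinates [z] to [(1, 0)]. *)
Definition q1 z x : R := expR (- z.1) * (cos z.2 * x.1 + sin z.2 * x.2).
Definition q2 z x : R := expR (- z.1) * (- sin z.2 * x.1 + cos z.2 * x.2).
Definition qmap z x : R * R := (q1 z x, q2 z x).

(** The profile [K], meant to sit near [(1, 0)], transported to the point of log-polar coordinates
    [z]; the factor [e^(- 2 z.1)] preserves its mass. *)
Definition moll K z x : R := expR (- (2 * z.1)) * K (qmap z x).

Definition avg K f z : R := \int[leb2]_x (f x * moll K z x).

Record cker K : Prop := CKer {
  cker_meas : mfun2 K ;
  cker_cont : forall g1 g2 : R -> R, continuous g1 -> continuous g2 ->
    continuous (fun t => K (g1 t, g2 t)) ;
  cker_bound : exists2 C, 0 <= C & forall q, `|K q| <= C ;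
  cker_supp : forall q, K q != 0 -> `|q.1| <= 2 /\ `|q.2| <= 2 }.

Lemma enorm2_qmap z x : enorm2 (qmap z x) = expR (- (2 * z.1)) * enorm2 x.
Proof.
rewrite /enorm2 /qmap /q1 /q2/= !exprMn -mulrDr -expRM_natl mulrN; congr (_ * _).
rewrite -[RHS]mul1r -(cos2Dsin2 z.2); ring.
Qed.

Definition boxS (B : R) : set R := `[(- B)%R, B]%classic.

Definition boxR (B : R) x : R := \1_(boxS B `*` boxS B) x.

Lemma boxR_ge0 B x : 0 <= boxR B x.
Proof. by rewrite /boxR indicE. Qed.

Lemma measurable_boxS (B : R) : measurable (boxS B : set (measurableTypeR R)).
Proof. exact: measurable_itv. Qed.

Lemma boxRE B x : boxR B x = ((`|x.1| <= B) && (`|x.2| <= B))%:R.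
Proof.
rewrite /boxR indicE; congr (_%:R); congr nat_of_bool.
apply/idP/idP; rewrite inE /boxS/= !in_itv/= -!ler_norml.
  by move=> [-> ->].
by move=> /andP[-> ->].
Qed.

Lemma mfun_boxR B : mfun2 (boxR B).
Proof.
apply: (measurable_indic (_ : measurable (boxS B `*` boxS B : set plane))).
exact: (measurableX (measurable_boxS B) (measurable_boxS B)).
Qed.

Lemma integral_boxR B : (\int[leb2]_x (boxR B x)%:E < +oo)%E.
Proof.
have mI : (mu (boxS B) < +oo)%E.
  by rewrite /boxS lebesgue_measure_itv/=; case: ifP => _; rewrite -?EFinB ltry.
have mX := measurableX (measurable_boxS B) (measurable_boxS B).
have -> : (\int[leb2]_x (boxR B x)%:E = mu (boxS B) * mu (boxS B))%E.
  transitivity (leb2 (boxS B `*` boxS B)); first by rewrite /boxR integral_indic ?setIT.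
  by apply: product_measure1E; exact: measurable_boxS.
by rewrite lte_mul_pinfty// ge0_fin_numE.
Qed.

(** [8 = 2^2 + 2^2] bounds [|q|^2] on the support of [K], and [qmap z] multiplies squared lengths by
    [e^(- 2 z.1)]. *)
Lemma moll_supp K z x B : cker K -> 8 * expR (2 * z.1) <= B ^+ 2 -> 0 <= B ->
  moll K z x != 0 -> boxR B x = 1.
Proof.
move=> hK zB B0; rewrite /moll mulf_eq0 negb_or => /andP[_ /(cker_supp hK)[h1 h2]].
have le4 (r : R) : `|r| <= 2 -> r ^+ 2 <= 4.
  by rewrite ler_norml => /andP[a b]; nra.
have e8 : enorm2 (qmap z x) <= 8.
  by have := le4 _ h1; have := le4 _ h2; rewrite /enorm2/=; lra.
have exB : enorm2 x <= B ^+ 2.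
  apply: le_trans zB; move: e8; rewrite enorm2_qmap expRN mulrC.
  by rewrite ler_pdivrMr ?expR_gt0.
have le1 (r : R) : r ^+ 2 <= enorm2 x -> `|r| <= B.
  move=> h; rewrite -[B]ger0_norm// -ler_sqr ?nnegrE// !real_normK ?num_real//.
  exact: le_trans h exB.
by rewrite boxRE !le1// ?lerDl ?lerDr ?sqr_ge0.
Qed.

Lemma qmap_meas z : measurable_fun setT (qmap z : plane -> plane).
Proof. by rewrite /qmap /q1 /q2; mfun. Qed.

Lemma moll_meas K z : mfun2 K -> mfun2 (moll K z).
Proof.
move=> mK; have mq := qmap_meas z; rewrite /mfun2 /moll.
by apply: measurable_funM; [exact: measurable_cst|exact: (measurableT_comp mK mq)].
Qed.

Definition locint f := forall B : R, ikernel (fun x => boxR B x * f x).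

Lemma locint_meas f : locint f -> mfun2 f.
Proof.
move=> lf; rewrite /mfun2.
have cvgf x : (fun n : nat => boxR n%:R x * f x) @ \oo --> f x.
  apply: cvg_near_cst; exists (Num.trunc (`|x.1| + `|x.2|)).+1 => // n /= nx.
  have xn : `|x.1| + `|x.2| <= n%:R.
    apply: ltW; apply: lt_le_trans (truncnS_gt _) _.
    by rewrite ler_nat.
  rewrite boxRE !(le_trans _ xn) ?mul1r ?lerDl ?lerDr//.
apply: (@measurable_fun_cvg _ _ _ setT (fun n : nat => fun x : plane => boxR n%:R x * f x)) => //.
by move=> n; exact: (ikernel_meas (lf n%:R)).
Qed.

Lemma moll_bound K z x C B : cker K -> (forall q, `|K q| <= C) ->
  8 * expR (2 * z.1) <= B ^+ 2 -> 0 <= B ->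
  `|moll K z x| <= expR (- (2 * z.1)) * C * boxR B x.
Proof.
move=> hK KC zB B0; have [->|n0] := eqVneq (moll K z x) 0.
  rewrite normr0 mulr_ge0 ?boxR_ge0// mulr_ge0 ?expR_ge0//.
  exact: le_trans (normr_ge0 _) (KC 0).
rewrite (moll_supp hK zB B0 n0) mulr1 /moll normrM gtr0_norm ?expR_gt0//.
by rewrite ler_wpM2l ?expR_ge0.
Qed.

Lemma avg_integrable K f z : cker K -> locint f -> ikernel (fun x => f x * moll K z x).
Proof.
move=> hK lf; have [C C0 KC] := cker_bound hK.
pose B := 8 * expR (2 * z.1) + 1.
have B1 : 8 * expR (2 * z.1) <= B ^+ 2.
  have := expR_gt0 (2 * z.1); rewrite /B; nra.
have B0 : 0 <= B by have := expR_gt0 (2 * z.1); rewrite /B; lra.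
have hG : ikernel (fun x => expR (- (2 * z.1)) * C * `|boxR B x * f x|).
  by apply: integrableZr_real; exact: (integrable_norm (lf B)).
apply: (@integrable_le _ plane R leb2 (fun x : plane => f x * moll K z x) _ _ _ hG).
  by apply: measurable_funM; [exact: locint_meas|exact: (moll_meas z (cker_meas hK))].
move=> x; rewrite normrM [in leRHS]normrM (ger0_norm (boxR_ge0 _ _)) mulrA [leRHS]mulrC.
by apply: ler_wpM2l => //; exact: moll_bound.
Qed.

Lemma line_q K y d x : cker K -> continuous (fun t => moll K (line y d t) x).
Proof.
move=> hK.
have c1 : continuous (fun t : R => q1 (line y d t) x).
  move=> t; apply: is_derive_cont; rewrite /q1/=; apply: is_derive_eq.
have c2 : continuous (fun t : R => q2 (line y d t) x).
  move=> t; apply: is_derive_cont; rewrite /q2/=; apply: is_derive_eq.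
have c3 : continuous (fun t : R => expR (- (2 * (line y d t).1))).
  move=> t; apply: is_derive_cont; rewrite /=; apply: is_derive_eq.
by move=> t; apply: (@cvgM R); [exact: c3|exact: (cker_cont hK c1 c2)].
Qed.

(** One box and one bound for all parameters near [t]: the domination needed to differentiate the
    averages under the integral. *)
Lemma moll_line_bound K y d t C : cker K -> 0 <= C -> (forall q, `|K q| <= C) ->
  exists B M, forall (r : R) x, `]t - 1, t + 1[%classic r ->
    `|moll K (line y d r) x| <= M * boxR B x.
Proof.
move=> hK C0 KC; pose m := `|y.1| + (`|t| + 1) * `|d.1|.
have sm (r : R) : `]t - 1, t + 1[%classic r -> `|(line y d r).1| <= m.
  rewrite /= in_itv/= => /andP[a b]; rewrite /m (le_trans (ler_normD _ _))// lerD2l normrM.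
  apply: ler_wpM2r => //; rewrite ler_norml.
  by have := ler_norm t; have := ler_norm (- t); rewrite normrN => ? ?; apply/andP; split; lra.
pose B := 8 * expR (2 * m) + 1.
have B1 : 8 * expR (2 * m) <= B ^+ 2.
  have := expR_gt0 (2 * m); rewrite /B; nra.
have B0 : 0 <= B by have := expR_gt0 (2 * m); rewrite /B; lra.
exists B, (expR (2 * m) * C) => r x /sm; rewrite ler_norml => /andP[a b].
apply: le_trans (moll_bound (B := B) x hK KC _ B0) _.
  by apply: le_trans B1; rewrite ler_pM2l// ler_expR ler_pM2l.
apply: ler_wpM2r; first exact: boxR_ge0.
by apply: ler_wpM2r => //; rewrite ler_expR; lra.
Qed.

Lemma avg_cont K f : cker K -> locint f -> line_continuous (avg K f).
Proof.
move=> hK lf y d t; have [C C0 KC] := cker_bound hK.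
have [B [M MB]] := moll_line_bound y d t hK C0 KC.
have hG : ikernel (fun x => M * `|boxR B x * f x|).
  by apply: integrableZr_real; exact: (integrable_norm (lf B)).
have := @continuity_under_integral R _ plane leb2 (fun r x => f x * moll K (line y d r) x)
  setT measurableT (t - 1) (t + 1) _ _ (fun x => M * `|boxR B x * f x|) hG _.
move=> /(_ _ _ _ t); apply.
- by move=> r _; exact: avg_integrable.
- apply: aeW => x _ r _; apply: (@cvgM R); first exact: cvg_cst.
  exact: line_q.
- move=> r Ir; apply: aeW => x _.
  rewrite normrM [in leRHS]normrM (ger0_norm (boxR_ge0 _ _)) mulrA [leRHS]mulrC.
  by apply: ler_wpM2l => //; exact: MB.
- by rewrite inE/= in_itv/=; apply/andP; split; lra.
Qed.

(* [K] is transported by the flow of [line], with derivatives [K1] and [K2]. *)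
Lemma avg_derive K K1 K2 f y d (t : R) : cker K -> cker K1 -> cker K2 -> locint f ->
  (forall x (r : R), is_derive r (1 : R) (fun r => moll K (line y d r) x)
    (d.1 * moll K1 (line y d r) x + d.2 * moll K2 (line y d r) x)) ->
  is_derive t (1 : R) (fun r => avg K f (line y d r))
    (d.1 * avg K1 f (line y d t) + d.2 * avg K2 f (line y d t)).
Proof.
move=> hK hK1 hK2 lf dm.
have [C1 C10 KC1] := cker_bound hK1; have [C2 C20 KC2] := cker_bound hK2.
have [B1 [M1 MB1]] := moll_line_bound y d t hK1 C10 KC1.
have [B2 [M2 MB2]] := moll_line_bound y d t hK2 C20 KC2.
pose G x := `|d.1| * (M1 * `|boxR B1 x * f x|) + `|d.2| * (M2 * `|boxR B2 x * f x|).
have hG : ikernel G.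
  apply: (integrableDr (f := fun x : plane => `|d.1| * (M1 * `|boxR B1 x * f x|))
    (g := fun x : plane => `|d.2| * (M2 * `|boxR B2 x * f x|)));
    do 2 apply: integrableZr_real; [exact: (integrable_norm (lf B1))|exact: (integrable_norm (lf B2))].
have It : `]t - 1, t + 1[%classic t.
  by rewrite /= in_itv/=; apply/andP; split; lra.
pose g (r : R) x := f x * moll K (line y d r) x.
have dg (r : R) x : is_derive r (1 : R) (g ^~ x)
    (f x * (d.1 * moll K1 (line y d r) x + d.2 * moll K2 (line y d r) x)).
  by have dr := dm x r; apply: is_derive_eq; rewrite /GRing.scale/=; ring.
have bd1 (r : R) x : `]t - 1, t + 1[%classic r ->
    `|f x * moll K1 (line y d r) x| <= M1 * `|boxR B1 x * f x|.
  move=> Ir; rewrite normrM [in leRHS]normrM (ger0_norm (boxR_ge0 _ _)) mulrA [leRHS]mulrC.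
  by apply: ler_wpM2l => //; exact: MB1.
have bd2 (r : R) x : `]t - 1, t + 1[%classic r ->
    `|f x * moll K2 (line y d r) x| <= M2 * `|boxR B2 x * f x|.
  move=> Ir; rewrite normrM [in leRHS]normrM (ger0_norm (boxR_ge0 _ _)) mulrA [leRHS]mulrC.
  by apply: ler_wpM2l => //; exact: MB2.
have intg r : ikernel (g r) by exact: avg_integrable.
have G0 x : 0 <= G x.
  by rewrite addr_ge0// mulr_ge0//; [exact: le_trans (normr_ge0 _) (bd1 t x It)|exact: le_trans (normr_ge0 _) (bd2 t x It)].
have derg r x : `]t - 1, t + 1[%classic r -> setT x -> derivable (g ^~ x) r 1.
  by move=> _ _; have [] := dg r x.
have Gub r x : `]t - 1, t + 1[%classic r -> setT x -> `|partial1of2 g r x| <= G x.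
  move=> Ir _; rewrite partial1of2E (@derive_val _ _ _ _ _ _ _ (dg r x)).
  rewrite mulrDr (le_trans (ler_normD _ _))//; apply: lerD.
    by rewrite mulrCA normrM ler_wpM2l//; exact: bd1.
  by rewrite mulrCA normrM ler_wpM2l//; exact: bd2.
have D1 := @derivable_under_integral R _ plane leb2 g setT measurableT t _ _ It
  (fun r _ => intg r) derg _ G0 hG Gub.
have D2 := @differentiation_under_integral R _ plane leb2 g setT measurableT t _ _ It
  (fun r _ => intg r) derg _ G0 hG Gub.
have i1 := avg_integrable (line y d t) hK1 lf.
have i2 := avg_integrable (line y d t) hK2 lf.
apply: DeriveDef; first exact: D1.
rewrite -derive1E D2 /avg -(Rintegral_lin _ _ i1 i2).
apply: eq_Rintegral => x _.
rewrite partial1of2E (@derive_val _ _ _ _ _ _ _ (dg t x)); ring.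
Qed.

End mollifier_kernel.

(** * The concrete kernel and its test functions *)

Section concrete_kernel.
Context {R : realType}.
Notation mu := (@lebesgue_measure R).
Notation plane := (measurableTypeR R * measurableTypeR R)%type.
Local Notation leb2 := (mu \x mu)%E.
Implicit Types (x y z d q v : R * R) (K f : R * R -> R) (e c : R).

(** Centred at [(1, 0)] with width [e]; for [e <= 1/4] the support stays away from the origin, as
    functions on the punctured plane require. *)
Definition bump2 e (A B : R -> R) q : R := A ((q.1 - 1) / e) * B (q.2 / e).

Lemma cker_bump2 e (A B : R -> R) : 0 < e <= 1 / 4 ->
  continuous A -> continuous B -> (exists2 C, 0 <= C & forall t, `|A t| <= C) ->
  (exists2 C, 0 <= C & forall t, `|B t| <= C) ->
  (forall t, 1 <= `|t| -> A t = 0) -> (forall t, 1 <= `|t| -> B t = 0) ->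
  cker (bump2 e A B).
Proof.
move=> /andP[e0 e1] cA cB [CA CA0 bA] [CB CB0 bB] oA oB.
have mA := continuous_measurable_fun cA; have mB := continuous_measurable_fun cB.
split.
- rewrite /mfun2 /bump2; apply: measurable_funM.
    by apply: (measurableT_comp mA); mfun.
  by apply: (measurableT_comp mB); mfun.
- move=> g1 g2 c1 c2 t; apply: (@cvgM R).
    apply: (@continuous_comp _ _ _ (fun t => (g1 t - 1) / e) A); last exact: cA.
    apply: (@cvgM R); last exact: cvg_cst.
    by apply: (@cvgB _ R^o); [exact: c1|exact: cvg_cst].
  apply: (@continuous_comp _ _ _ (fun t => g2 t / e) B); last exact: cB.
  by apply: (@cvgM R); [exact: c2|exact: cvg_cst].
- exists (CA * CB); first exact: mulr_ge0.
  by move=> q; rewrite normrM; exact: ler_pM.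
- move=> q; rewrite /bump2 mulf_eq0 negb_or => /andP[a b].
  have h (t s : R) : (1 <= `|t / e| -> s = 0) -> s != 0 -> `|t| < e.
    move=> hs; apply: contraNT; rewrite -leNgt => le; rewrite hs// normrM normfV (gtr0_norm e0).
    by rewrite ler_pdivlMr// mul1r.
  have := h _ _ (oA _) a; have := h _ _ (oB _) b.
  rewrite !ltr_norml !ler_norml => /andP[? ?] /andP[? ?].
  by split; apply/andP; split; lra.
Qed.

Lemma ckerD K K' : cker K -> cker K' -> cker (fun q => K q + K' q).
Proof.
move=> [m1 c1 [C1 C10 b1] s1] [m2 c2 [C2 C20 b2] s2]; split.
- by rewrite /mfun2 in m1 m2 *; mfun.
- by move=> g1 g2 h1 h2 t; apply: (@cvgD _ R^o); [exact: c1|exact: c2].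
- exists (C1 + C2); first exact: addr_ge0.
  by move=> q; rewrite (le_trans (ler_normD _ _))// lerD.
- move=> q; have [->|/s1//] := eqVneq (K q) 0.
  by rewrite add0r => /s2.
Qed.

Lemma ckerM K (g : R * R -> R) : mfun2 g ->
  (forall g1 g2 : R -> R, continuous g1 -> continuous g2 -> continuous (fun t => g (g1 t, g2 t))) ->
  (forall q, `|q.1| <= 2 -> `|q.2| <= 2 -> `|g q| <= 2) ->
  cker K -> cker (fun q => g q * K q).
Proof.
move=> mg cg bg [m1 c1 [C1 C10 b1] s1]; split.
- by rewrite /mfun2 in m1 mg *; mfun.
- by move=> g1 g2 h1 h2 t; apply: (@cvgM R); [exact: cg|exact: c1].
- exists (2 * C1); first exact: mulr_ge0.
  move=> q; rewrite normrM; have [->|/s1[s2 s3]] := eqVneq (K q) 0.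
    by rewrite normr0 mulr0 mulr_ge0.
  by apply: ler_pM => //; exact: bg.
- by move=> q; rewrite mulf_eq0 negb_or => /andP[_ /s1].
Qed.

Lemma ckerZ K c : cker K -> cker (fun q => c * K q).
Proof.
move=> [m1 c1 [C1 C10 b1] s1]; split.
- by rewrite /mfun2 in m1 *; mfun.
- by move=> g1 g2 h1 h2 t; apply: (@cvgM R); [exact: cvg_cst|exact: c1].
- exists (`|c| * C1); first exact: mulr_ge0.
  by move=> q; rewrite normrM ler_wpM2l.
- by move=> q; rewrite mulf_eq0 negb_or => /andP[_ /s1].
Qed.

Lemma cker_x1 K : cker K -> cker (fun q => q.1 * K q).
Proof.
by apply: ckerM => //; exact: measurable_fst.
Qed.

Lemma cker_x2 K : cker K -> cker (fun q => q.2 * K q).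
Proof.
by apply: ckerM => //; exact: measurable_snd.
Qed.

Definition ka e c q : R := c * bump2 e bmp bmp q.
Definition ka1 e c q : R := c / e * bump2 e dbmp bmp q.
Definition ka2 e c q : R := c / e * bump2 e bmp dbmp q.
(** Images of [ka] under the infinitesimal dilation and rotation, [- 2 K - q . grad K] and
    [q2 d_1 K - q1 d_2 K]: the transported kernel has them as derivatives in [z.1] and [z.2]. *)
Definition kas e c q : R := -2 * ka e c q + -1 * (q.1 * ka1 e c q + q.2 * ka2 e c q).
Definition kat e c q : R := q.2 * ka1 e c q + -1 * (q.1 * ka2 e c q).

Lemma is_derive_comp1 (A dA : R -> R) (g : R -> R) (t dg : R) :
  (forall s, is_derive s (1 : R) A (dA s)) -> is_derive t (1 : R) g dg ->
  is_derive t (1 : R) (fun t => A (g t)) (dA (g t) * dg).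
Proof. by move=> hA hg; exact: (@is_derive1_comp R A g t _ _ (hA (g t)) hg). Qed.

Lemma continuous_bmp : continuous (@bmp R).
Proof. by move=> t; exact: is_derive_cont (is_derive_bmp t). Qed.

Lemma continuous_dbmp : continuous (@dbmp R).
Proof.
move=> t.
have d1 : is_derive t (1 : R) (fun t => 1 + t) 1 by apply: is_derive_eq; ring.
have d2 : is_derive t (1 : R) (fun t => 1 - t) (-1) by apply: is_derive_eq; ring.
have dp m := is_derive_comp1 (@is_derive_Eb R m) d1.
have dm m := is_derive_comp1 (@is_derive_Eb R m) d2.
have a := dp 2%N; have b := dm 0%N; have a' := dp 0%N; have b' := dm 2%N.
by apply: is_derive_cont; rewrite /dbmp; apply: is_derive_eq.
Qed.

Lemma bounded_bmp : exists2 C : R, 0 <= C & forall t, `|bmp t| <= C.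
Proof. by exists 1 => // t; rewrite ger0_norm ?bmp_ge0 ?bmp_le1. Qed.

Lemma bounded_dbmp : exists2 C : R, 0 <= C & forall t, `|dbmp t| <= C.
Proof. by exists 4 => // t; exact: dbmp_le4. Qed.

Lemma cker_ka e c : 0 < e <= 1 / 4 -> cker (ka e c).
Proof.
move=> he; apply: ckerZ; apply: cker_bump2 => //.
- exact: continuous_bmp.
- exact: continuous_bmp.
- exact: bounded_bmp.
- exact: bounded_bmp.
- exact: bmp_out.
- exact: bmp_out.
Qed.

Lemma cker_ka1 e c : 0 < e <= 1 / 4 -> cker (ka1 e c).
Proof.
move=> he; apply: ckerZ; apply: cker_bump2 => //.
- exact: continuous_dbmp.
- exact: continuous_bmp.
- exact: bounded_dbmp.
- exact: bounded_bmp.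
- exact: dbmp_out.
- exact: bmp_out.
Qed.

Lemma cker_ka2 e c : 0 < e <= 1 / 4 -> cker (ka2 e c).
Proof.
move=> he; apply: ckerZ; apply: cker_bump2 => //.
- exact: continuous_bmp.
- exact: continuous_dbmp.
- exact: bounded_bmp.
- exact: bounded_dbmp.
- exact: bmp_out.
- exact: dbmp_out.
Qed.

Lemma cker_kas e c : 0 < e <= 1 / 4 -> cker (kas e c).
Proof.
move=> he; apply: ckerD; first by apply: ckerZ; exact: cker_ka.
apply: ckerZ; apply: ckerD; first by apply: cker_x1; exact: cker_ka1.
by apply: cker_x2; exact: cker_ka2.
Qed.

Lemma cker_kat e c : 0 < e <= 1 / 4 -> cker (kat e c).
Proof.
move=> he; apply: ckerD; first by apply: cker_x2; exact: cker_ka1.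
by apply: ckerZ; apply: cker_x1; exact: cker_ka2.
Qed.

Lemma is_derive_ka e c (g1 g2 : R -> R) (t d1 d2 : R) : e != 0 ->
  is_derive t (1 : R) g1 d1 -> is_derive t (1 : R) g2 d2 ->
  is_derive t (1 : R) (fun t => ka e c (g1 t, g2 t))
    (ka1 e c (g1 t, g2 t) * d1 + ka2 e c (g1 t, g2 t) * d2).
Proof.
move=> e0 h1 h2.
have l1 : is_derive t (1 : R) (fun t => (g1 t - 1) / e) (d1 / e).
  by apply: is_derive_eq; rewrite /GRing.scale/=; ring.
have l2 : is_derive t (1 : R) (fun t => g2 t / e) (d2 / e).
  by apply: is_derive_eq; rewrite /GRing.scale/=; ring.
have b1 := is_derive_comp1 is_derive_bmp l1.
have b2 := is_derive_comp1 is_derive_bmp l2.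
rewrite /ka /ka1 /ka2 /bump2/=.
by apply: is_derive_eq; rewrite /GRing.scale/=; ring.
Qed.

Lemma is_derive_moll_line e c y d x (r : R) : e != 0 ->
  is_derive r (1 : R) (fun r => moll (ka e c) (line y d r) x)
    (d.1 * moll (kas e c) (line y d r) x + d.2 * moll (kat e c) (line y d r) x).
Proof.
move=> e0.
have d1 : is_derive r (1 : R) (fun r : R => q1 (line y d r) x)
    (- d.1 * q1 (line y d r) x + d.2 * q2 (line y d r) x).
  by rewrite /q1 /q2/=; apply: is_derive_eq; rewrite /GRing.scale/=; ring.
have d2 : is_derive r (1 : R) (fun r : R => q2 (line y d r) x)
    (- d.1 * q2 (line y d r) x - d.2 * q1 (line y d r) x).
  by rewrite /q1 /q2/=; apply: is_derive_eq; rewrite /GRing.scale/=; ring.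
have d3 : is_derive r (1 : R) (fun r : R => expR (- (2 * (line y d r).1)))
    (- (2 * d.1) * expR (- (2 * (line y d r).1))).
  by rewrite /=; apply: is_derive_eq; rewrite /GRing.scale/=; ring.
have dk := is_derive_ka c e0 d1 d2.
rewrite /moll /qmap; apply: is_derive_eq; rewrite /GRing.scale/= /kas /kat /=; ring.
Qed.

Definition dmoll e c z v x : R := expR (- (2 * z.1)) *
  (ka1 e c (qmap z x) * q1 z v + ka2 e c (qmap z x) * q2 z v).

Lemma is_derive_moll_space e c z v x : e != 0 ->
  is_derive x v (moll (ka e c) z : R * R -> R) (dmoll e c z v x).
Proof.
move=> e0; apply: is_derive_along.
have d1 : is_derive (0 : R) (1 : R) (fun t : R => q1 z (t *: v + x)) (q1 z v).
  by rewrite /q1/=; apply: is_derive_eq; rewrite /GRing.scale/=; ring.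
have d2 : is_derive (0 : R) (1 : R) (fun t : R => q2 z (t *: v + x)) (q2 z v).
  by rewrite /q2/=; apply: is_derive_eq; rewrite /GRing.scale/=; ring.
have dk := is_derive_ka c e0 d1 d2.
rewrite /moll /qmap; apply: is_derive_eq.
have x0 : 0 *: v + x = x by rewrite scale0r add0r.
by rewrite !x0 /GRing.scale/= /dmoll /qmap; ring.
Qed.

(** The linear factor converts the Cartesian components of a weak gradient into the radial one,
    along [x], and the angular one, along its perpendicular. *)
Definition tst e c z (al be : R) x : R := (al * x.1 + be * x.2) * moll (ka e c) z x.

Lemma Sm_tst e c z al be : Sm (tst e c z al be).
Proof.
have S1 := SmL al be 0.
have Sb (a b g : R) : Sm (fun x => bmp (a * x.1 + b * x.2 + g)).
  have := SmM (SmE 0 a b (1 + g)) (SmE 0 (- a) (- b) (1 - g)); congr Sm.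
  by apply/funext => x; rewrite /bmp; congr (Eb 0 _ * Eb 0 _); ring.
have := SmM S1 (SmM (SmC (expR (- (2 * z.1)) * c)) (SmM
  (Sb (expR (- z.1) * cos z.2 / e) (expR (- z.1) * sin z.2 / e) (- (1 / e)))
  (Sb (- (expR (- z.1) * sin z.2 / e)) (expR (- z.1) * cos z.2 / e) 0))).
congr Sm; apply/funext => x.
have E1 : expR (- z.1) * cos z.2 / e * x.1 + expR (- z.1) * sin z.2 / e * x.2 - 1 / e =
  (q1 z x - 1) / e by rewrite /q1; ring.
have E2 : - (expR (- z.1) * sin z.2 / e) * x.1 + expR (- z.1) * cos z.2 / e * x.2 + 0 =
  q2 z x / e by rewrite /q2; ring.
by rewrite E1 E2 addr0 /tst /moll /ka /bump2 /qmap /=; ring.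
Qed.

Lemma continuous_q1 z : continuous (q1 z : R * R -> R).
Proof.
move=> x; apply: (@cvgM R); first exact: cvg_cst.
apply: (@cvgD _ R^o); apply: (@cvgM R); try exact: cvg_cst; [exact: cvg_fst|exact: cvg_snd].
Qed.

Lemma moll_ka_supp e c z x : 0 < e <= 1 / 4 -> moll (ka e c) z x != 0 -> 1 / 2 <= q1 z x.
Proof.
move=> /andP[e0 e1]; rewrite /moll /ka /bump2/= mulf_eq0 negb_or => /andP[_].
rewrite mulf_eq0 negb_or => /andP[_]; rewrite mulf_eq0 negb_or => /andP[h _].
have : `|(q1 z x - 1) / e| < 1.
  by rewrite ltNge; apply: contraNN h => h; rewrite bmp_out.
rewrite normrM normfV (gtr0_norm e0) ltr_pdivrMr// mul1r ltr_norml => /andP[h1 _]; lra.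
Qed.

(** The support lies in the intersection of a compact box with the closed half-plane
    [1 / 2 <= q1 z x], which misses the origin. *)
Lemma test_function_tst e c z al be : 0 < e <= 1 / 4 -> test_function (tst e c z al be).
Proof.
move=> he; have hk := cker_ka c he.
pose B := 8 * expR (2 * z.1) + 1.
have B1 : 8 * expR (2 * z.1) <= B ^+ 2.
  have := expR_gt0 (2 * z.1); rewrite /B; nra.
have B0 : 0 <= B by have := expR_gt0 (2 * z.1); rewrite /B; lra.
pose D : set (R * R) := boxS B `*` boxS B.
have cD : compact D by apply: compact_setX; exact: segment_compact.
pose H : set (R * R) := [set x | 1 / 2 <= q1 z x].
have cH : closed H.
  apply: (@closed_comp _ _ (q1 z) [set r : R | 1 / 2 <= r]); last exact: closed_ge.
  by move=> x _; exact: continuous_q1.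
have DH : [set x | tst e c z al be x != 0] `<=` D `&` H.
  move=> x /=; rewrite /tst mulf_eq0 negb_or => /andP[_ h]; split.
    have := moll_supp hk B1 B0 h; rewrite /boxR indicE.
    by case: (boolP (x \in _)) => [|_ /eqP]; rewrite ?inE// eq_sym oner_eq0.
  exact: moll_ka_supp h.
have hD : hausdorff_space (R * R)%type by exact: norm_hausdorff.
have cDH : closed (D `&` H) by apply: closedI => //; exact: compact_closed.
have SDH : support_of (tst e c z al be) `<=` D `&` H.
  by rewrite /support_of; apply: subset_trans (closure_subset DH) _; rewrite -(closure_id _).1.
split.
- exact: Sm_smooth (Sm_tst _ _ _ _ _).
- apply: (subclosed_compact _ cD); first exact: closed_closure.
  by apply: subset_trans SDH _; exact: subIsetl.
- by move=> /SDH[_]; rewrite /H/= /q1/= !mulr0 addr0 mulr0; lra.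
Qed.

Lemma derive_tst e c z al be v x : e != 0 ->
  'D_v (tst e c z al be) x =
  (al * x.1 + be * x.2) * dmoll e c z v x + moll (ka e c) z x * (al * v.1 + be * v.2).
Proof.
move=> e0.
have d1 := is_derive_moll_space c z v x e0.
have d2 := is_derive_lin al be 0 x v.
have := is_deriveM_plane d2 d1 => d3.
transitivity ((al * x.1 + be * x.2 + 0) * dmoll e c z v x +
  moll (ka e c) z x * (al * v.1 + be * v.2)); last by rewrite addr0.
rewrite -(@derive_val _ _ _ _ _ _ _ d3); congr ('D_v _ x).
by apply/funext => u; rewrite /tst addr0.
Qed.

End concrete_kernel.

(** * Averaging the weak magnetic gradient *)

Section weak_identities.
Context {R : realType}.
Notation mu := (@lebesgue_measure R).
Notation plane := (measurableTypeR R * measurableTypeR R)%type.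
Local Notation leb2 := (mu \x mu)%E.
Implicit Types (x y z d q v : R * R) (K f : R * R -> R) (e c : R).

Lemma magnetic_re_im v (b : R * R -> R) (u G : R * R -> R[i]) (phi : R * R -> R) :
  is_magnetic_partial v b u G -> test_function phi ->
  (\int[leb2]_x (complex.Re (G x) * phi x) =
   \int[leb2]_x (- (complex.Re (u x) * 'D_v phi x) - b x * complex.Im (u x) * phi x)) /\
  (\int[leb2]_x (complex.Im (G x) * phi x) =
   \int[leb2]_x (- (complex.Im (u x) * 'D_v phi x) + b x * complex.Re (u x) * phi x)).
Proof.
move=> h /h; rewrite /cintegral => -[h1 h2]; split.
  have -> : \int[leb2]_x (complex.Re (G x) * phi x) =
      \int[leb2]_x complex.Re (G x * (phi x)%:C)%C.
    by apply: eq_Rintegral => x _; case: (G x) => g1 g2 /=; rewrite mulr0 subr0.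
  rewrite h1; apply: eq_Rintegral => x _; case: (u x) => u1 u2 /=; ring.
have -> : \int[leb2]_x (complex.Im (G x) * phi x) =
    \int[leb2]_x complex.Im (G x * (phi x)%:C)%C.
  by apply: eq_Rintegral => x _; case: (G x) => g1 g2 /=; rewrite mulr0 add0r.
rewrite h2; apply: eq_Rintegral => x _; case: (u x) => u1 u2 /=; ring.
Qed.

Definition cbox f := mfun2 f /\ exists C B, forall x, `|f x| <= C * boxR B x.

Lemma cbox_moll K z : cker K -> cbox (moll K z).
Proof.
move=> hK; split; first exact: (moll_meas z (cker_meas hK)).
have [C C0 KC] := cker_bound hK.
pose B := 8 * expR (2 * z.1) + 1.
have B1 : 8 * expR (2 * z.1) <= B ^+ 2.
  have := expR_gt0 (2 * z.1); rewrite /B; nra.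
have B0 : 0 <= B by have := expR_gt0 (2 * z.1); rewrite /B; lra.
by exists (expR (- (2 * z.1)) * C), B => x; exact: moll_bound.
Qed.

Lemma boxR_le (A B : R) x : A <= B -> boxR A x <= boxR B x.
Proof.
move=> AB; rewrite !boxRE; case: (boolP (_ && _)) => [/andP[a b]|_]; last by rewrite ler0n.
by rewrite !(le_trans _ AB).
Qed.

Lemma ler_box (C B B' : R) x : B <= B' -> C * boxR B x <= `|C| * boxR B' x.
Proof.
move=> BB; apply: (@le_trans _ _ (`|C| * boxR B x)).
  by apply: ler_wpM2r; [exact: boxR_ge0|exact: ler_norm].
by apply: ler_wpM2l => //; exact: boxR_le.
Qed.

Lemma cboxD f g : cbox f -> cbox g -> cbox (fun x => f x + g x).
Proof.
move=> [mf [C [B fB]]] [mg [C' [B' gB]]]; split; first by rewrite /mfun2 in mf mg *; mfun.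
exists (`|C| + `|C'|), (Num.max B B') => x.
rewrite (le_trans (ler_normD _ _))// mulrDl; apply: lerD.
  by apply: (le_trans (fB x)); apply: ler_box; rewrite le_max lexx.
by apply: (le_trans (gB x)); apply: ler_box; rewrite le_max lexx orbT.
Qed.

Lemma cboxM f g (M : R -> R) : mfun2 g -> (forall B x, boxR B x = 1 -> `|g x| <= M B) ->
  cbox f -> cbox (fun x => g x * f x).
Proof.
move=> mg bg [mf [C [B fB]]]; split; first by rewrite /mfun2 in mf mg *; mfun.
exists (`|M B| * `|C|), B => x; rewrite normrM.
have [b0|b0] : boxR B x = 0 \/ boxR B x = 1.
- by rewrite boxRE; case: (_ && _); [right|left].
- have f0 : f x = 0 by have := fB x; rewrite b0 mulr0 normr_le0 => /eqP.
  by rewrite f0 normr0 mulr0 b0 mulr0.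
rewrite -mulrA; apply: ler_pM => //.
  by apply: (le_trans (bg B x b0)); exact: ler_norm.
by apply: (le_trans (fB x)); exact: ler_box.
Qed.

Lemma boxR1 B x : boxR B x = 1 -> `|x.1| <= B /\ `|x.2| <= B.
Proof.
rewrite boxRE; case: (boolP (_ && _)) => [/andP[]//|_ /eqP].
by rewrite eq_sym oner_eq0.
Qed.

Lemma cbox_lin f al be : cbox f -> cbox (fun x => (al * x.1 + be * x.2) * f x).
Proof.
apply: (cboxM (M := fun B => `|al| * B + `|be| * B)); first by rewrite /mfun2; mfun.
move=> B x /boxR1[h1 h2]; rewrite (le_trans (ler_normD _ _))// !normrM.
by apply: lerD; rewrite ler_wpM2l.
Qed.

Lemma cboxZ f (k : R) : cbox f -> cbox (fun x => k * f x).
Proof.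
apply: (cboxM (M := fun=> `|k|)); first exact: measurable_cst.
by [].
Qed.

Lemma ikernel_locM f g : locint f -> cbox g -> ikernel (fun x => f x * g x).
Proof.
move=> lf [mg [C [B gB]]].
have hG : ikernel (fun x => C * `|boxR B x * f x|).
  by apply: integrableZr_real; exact: (integrable_norm (lf B)).
apply: (@integrable_le _ plane R leb2 (fun x : plane => f x * g x) _ _ _ hG).
  by apply: measurable_funM; [exact: locint_meas|exact: mg].
move=> x; rewrite normrM [in leRHS]normrM (ger0_norm (boxR_ge0 _ _)) mulrA [leRHS]mulrC.
by apply: ler_wpM2l.
Qed.

Lemma mfun_inv_enorm2 : mfun2 (fun x => (enorm2 x)^-1 : R).
Proof.
rewrite /mfun2 (_ : (fun x : plane => _) =
    (fun x : plane => \1_(`]0, +oo[ : set R) (enorm2 x) * expR (- ln (enorm2 x)))); last first.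
  apply/funext => x; rewrite indicE mem_setE/= in_itv/= andbT.
  have [x0|x0] := ltP 0 (enorm2 x); first by rewrite mul1r expRN lnK.
  have -> : enorm2 x = 0 by apply/eqP; rewrite eq_le x0 enorm2_ge0.
  by rewrite invr0 mul0r.
have m1 := @mfun_enorm2 R; have m2 := @mfun_ln_enorm2 R.
have m3 : measurable_fun setT (fun x : plane => \1_(`]0, +oo[ : set R) (enorm2 x) : R).
  exact: (measurableT_comp (measurable_indic (measurable_itv _)) m1).
by mfun.
Qed.

(** The potential has size [|a| / |x|], so a linear factor makes it bounded. *)
Lemma cbox_pot (a al be : R) (i : bool) f : cbox f ->
  cbox (fun x => (if i then (potential a x).1 else (potential a x).2) *
    ((al * x.1 + be * x.2) * f x)).
Proof.
move=> cf.
rewrite (_ : (fun x => _) = fun x => ((if i then (potential a x).1 else (potential a x).2) *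
    (al * x.1 + be * x.2)) * f x); last by apply/funext => x; rewrite mulrA.
apply: (cboxM (M := fun=> `|a| * (`|al| + `|be|))) => //.
  have m := mfun_inv_enorm2; rewrite /mfun2 /potential/= in m *.
  by case: i; mfun.
move=> B x _.
have key (s r : R) : s ^+ 2 <= enorm2 x -> r ^+ 2 <= enorm2 x -> `|a / enorm2 x * s * r| <= `|a|.
  move=> hs hr; have [->|n0] := eqVneq (enorm2 x) 0.
    by rewrite invr0 mulr0 !mul0r normr0.
  have n0' : 0 < enorm2 x by rewrite lt_neqAle eq_sym n0 enorm2_ge0.
  rewrite -!mulrA normrM ler_piMr// normrM normfV (gtr0_norm n0') ler_pdivrMl// mulr1.
  rewrite -ler_sqr ?nnegrE ?enorm2_ge0// real_normK ?num_real// exprMn expr2.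
  by apply: ler_pM; rewrite ?sqr_ge0.
have h1 : x.1 ^+ 2 <= enorm2 x by rewrite lerDl sqr_ge0.
have h2 : x.2 ^+ 2 <= enorm2 x by rewrite lerDr sqr_ge0.
have h2n : (- x.1) ^+ 2 <= enorm2 x by rewrite sqrrN.
have fin (s : R) : s ^+ 2 <= enorm2 x ->
    `|a / enorm2 x * s * (al * x.1 + be * x.2)| <= `|a| * (`|al| + `|be|).
  move=> hs; rewrite (_ : _ * (_ + _) = al * (a / enorm2 x * s * x.1) + be * (a / enorm2 x * s * x.2)); last by ring.
  rewrite (le_trans (ler_normD _ _))// !normrM mulrDr.
  by apply: lerD; rewrite [leRHS]mulrC; apply: ler_wpM2l => //; rewrite -!normrM; exact: key.
by rewrite /potential/=; case: i; exact: fin.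
Qed.

Variables (a e c : R) (u1 u2 g1 g2 : R * R -> R).
Hypothesis he : 0 < e <= 1 / 4.
Hypotheses (lu1 : locint u1) (lu2 : locint u2) (lg1 : locint g1) (lg2 : locint g2).
Hypothesis id1 : forall phi : R * R -> R, test_function phi ->
  \int[leb2]_x (g1 x * phi x) =
  \int[leb2]_x (- (u1 x * 'D_e1 phi x) - (potential a x).1 * u2 x * phi x).
Hypothesis id2 : forall phi : R * R -> R, test_function phi ->
  \int[leb2]_x (g2 x * phi x) =
  \int[leb2]_x (- (u1 x * 'D_e2 phi x) - (potential a x).2 * u2 x * phi x).

Let e0 : e != 0. Proof. by case/andP: he => h _; rewrite gt_eqF. Qed.

Let dmollE z v x : dmoll e c z v x =
  q1 z v * moll (ka1 e c) z x + q2 z v * moll (ka2 e c) z x.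
Proof. by rewrite /dmoll /moll; ring. Qed.

Let cbox_tst z al be : cbox (tst e c z al be).
Proof. by apply: cbox_lin; apply: cbox_moll; exact: cker_ka. Qed.

Let cbox_dtst z al be v : cbox (fun x => 'D_v (tst e c z al be) x).
Proof.
rewrite (_ : (fun x => _) = fun x => (al * x.1 + be * x.2) *
    (q1 z v * moll (ka1 e c) z x + q2 z v * moll (ka2 e c) z x) +
    (al * v.1 + be * v.2) * moll (ka e c) z x); last first.
  by apply/funext => x; rewrite derive_tst// dmollE; ring.
apply: cboxD; last by apply: cboxZ; apply: cbox_moll; exact: cker_ka.
apply: cbox_lin; apply: cboxD; apply: cboxZ; apply: cbox_moll.
  exact: cker_ka1.
exact: cker_ka2.
Qed.

Let combine z (al be al' be' : R) :
  \int[leb2]_x ((g1 x * (al * x.1 + be * x.2) + g2 x * (al' * x.1 + be' * x.2)) * moll (ka e c) z x) =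
  \int[leb2]_x (u1 x * - ('D_e1 (tst e c z al be) x + 'D_e2 (tst e c z al' be') x) +
    - u2 x * ((potential a x).1 * (al * x.1 + be * x.2) +
      (potential a x).2 * (al' * x.1 + be' * x.2)) * moll (ka e c) z x).
Proof.
have T1 := id1 (test_function_tst c z al be he).
have T2 := id2 (test_function_tst c z al' be' he).
have i1 := ikernel_locM lg1 (cbox_tst z al be).
have i2 := ikernel_locM lg2 (cbox_tst z al' be').
have j1 := ikernel_locM lu1 (cbox_dtst z al be e1).
have j2 := ikernel_locM lu1 (cbox_dtst z al' be' e2).
have cm := cbox_moll z (cker_ka c he).
have k1 := ikernel_locM lu2 (cbox_pot a al be true cm).
have k2 := ikernel_locM lu2 (cbox_pot a al' be' false cm).
have l1 := integrableDr (integrableZr_real (-1) j1) (integrableZr_real (-1) k1).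
have l2 := integrableDr (integrableZr_real (-1) j2) (integrableZr_real (-1) k2).
transitivity (\int[leb2]_x (g1 x * tst e c z al be x + g2 x * tst e c z al' be' x)).
  by apply: eq_Rintegral => x _; rewrite /tst; ring.
rewrite (RintegralD measurableT i1 i2) T1 T2.
transitivity (\int[leb2]_x (-1 * (u1 x * 'D_e1 (tst e c z al be) x) +
    -1 * (u2 x * ((potential a x).1 * ((al * x.1 + be * x.2) * moll (ka e c) z x)))) +
  \int[leb2]_x (-1 * (u1 x * 'D_e2 (tst e c z al' be') x) +
    -1 * (u2 x * ((potential a x).2 * ((al' * x.1 + be' * x.2) * moll (ka e c) z x))))).
  by congr (_ + _); apply: eq_Rintegral => x _; rewrite /tst; ring.
rewrite -(RintegralD measurableT l1 l2).
by apply: eq_Rintegral => x _; rewrite /tst; ring.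
Qed.

(** The potential is orthogonal to [x], so no magnetic term appears; moving the derivative to [x]
    times the kernel produces the dilation derivative [kas]. *)
Lemma avg_radial z :
  avg (ka e c) (fun x => x.1 * g1 x + x.2 * g2 x) z = avg (kas e c) u1 z.
Proof.
have := combine z 1 0 0 1; rewrite /avg => C.
transitivity (\int[leb2]_x ((g1 x * (1 * x.1 + 0 * x.2) + g2 x * (0 * x.1 + 1 * x.2)) * moll (ka e c) z x)).
  by apply: eq_Rintegral => x _; ring.
rewrite C; apply: eq_Rintegral => x _.
rewrite /potential/= !derive_tst//= !dmollE /moll /kas /qmap /q1 /q2/=; ring.
Qed.

(** Against the field [(- x.2, x.1)] the potential is the constant [- a]: the singular potential
    turns into a constant flux term. *)
Lemma avg_angular z :
  avg (ka e c) (fun x => - x.2 * g1 x + x.1 * g2 x) z =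
  avg (kat e c) u1 z + a * avg (ka e c) u2 z.
Proof.
have := combine z 0 (-1) 1 0; rewrite /avg => C.
transitivity (\int[leb2]_x ((g1 x * (0 * x.1 + -1 * x.2) + g2 x * (1 * x.1 + 0 * x.2)) * moll (ka e c) z x)).
  by apply: eq_Rintegral => x _; ring.
have i1 := avg_integrable z (cker_kat c he) lu1.
have i2 := avg_integrable z (cker_ka c he) lu2.
rewrite C -[X in _ = X + _]mul1r -(Rintegral_lin 1 a i1 i2); apply: eq_Rintegral => x _.
have [m0|m0] := eqVneq (moll (ka e c) z x) 0.
  rewrite m0 !mulr0 !addr0 !derive_tst// m0/= !dmollE /moll /kat /qmap /q1 /q2/=; ring.
have n0 : enorm2 x != 0.
  have := moll_ka_supp he m0; apply: contraTneq => n0; rewrite -ltNge.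
  have [x1 x2] : x.1 = 0 /\ x.2 = 0.
    by move: n0; rewrite /enorm2 => /eqP; rewrite paddr_eq0 ?sqr_ge0// !sqrf_eq0 => /andP[/eqP -> /eqP ->].
  by rewrite /q1 x1 x2 !mulr0 addr0 mulr0.
have P : (potential a x).1 * (0 * x.1 + -1 * x.2) + (potential a x).2 * (1 * x.1 + 0 * x.2) = - a.
  by rewrite /potential/=; move: n0; rewrite /enorm2 => n0; field.
rewrite P !derive_tst//= !dmollE /moll /kat /qmap /q1 /q2/=; ring.
Qed.

End weak_identities.

(** * The averages as convolutions on the cylinder *)

Section cylinder_average.
Context {R : realType}.
Notation mu := (@lebesgue_measure R).
Notation plane := (measurableTypeR R * measurableTypeR R)%type.
Local Notation leb2 := (mu \x mu)%E.
Implicit Types (x y z d q v : R * R) (K f b k : R * R -> R) (e c : R).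

Definition strip z : R := \1_(`](- pi)%R, pi] : set R) z.2.

Lemma strip2 z : strip z ^+ 2 = strip z.
Proof. by rewrite /strip indicE expr2 -natrM mulnb andbb. Qed.

Lemma integral_strip (F : plane -> \bar R) y : measurable_fun setT F -> periodic2 F ->
  (\int[leb2]_z ((strip z)%:E * F (y + z)%R) = \int[mS]_z F z)%E.
Proof.
move=> mF pF; rewrite [LHS]integralE [RHS]integralE; congr (_ - _)%E.
- rewrite -(ge0_integral_strip (F := (F^\+)%E) y)//.
  + apply: eq_integral => z _; rewrite !funeposE maxe_pMr ?lee_fin ?strip_ge0//.
    by rewrite mule0.
  + exact: measurable_funepos.
  + by move=> s t; rewrite !funeposE pF.
- rewrite -(ge0_integral_strip (F := (F^\-)%E) y)//.
  + apply: eq_integral => z _; rewrite !funenegE -muleN maxe_pMr ?lee_fin ?strip_ge0//.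
    by rewrite mule0.
  + exact: measurable_funeneg.
  + by move=> s t; rewrite !funenegE pF.
Qed.

(** Rotations and dilations of the plane are translations in log-polar coordinates. *)
Lemma qmap_logpolar y z : qmap y (logpolar (y + z)) = logpolar z.
Proof.
have E1 : expR (y.1 + z.1) = expR y.1 * expR z.1 by rewrite expRD.
have E2 : expR (- y.1) * expR y.1 = 1 by rewrite expRN mulVf// gt_eqF// expR_gt0.
have z2 : z.2 = (y.2 + z.2) - y.2 by rewrite addrAC subrr add0r.
apply: injective_projections; rewrite /= /q1 /q2/= E1.
  transitivity ((expR (- y.1) * expR y.1) * (expR z.1 *
    (cos (y.2 + z.2) * cos y.2 + sin (y.2 + z.2) * sin y.2))); first by ring.
  by rewrite E2 mul1r -cosB -z2.
transitivity ((expR (- y.1) * expR y.1) * (expR z.1 *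
  (sin (y.2 + z.2) * cos y.2 - cos (y.2 + z.2) * sin y.2))); first by ring.
by rewrite E2 mul1r -sinB -z2.
Qed.

(** The profile in log-polar coordinates, with the Jacobian [e^(2 s)] and cut to one period of the
    angle: the convolution kernel of the averages. *)
Definition khat K z : R := strip z * (expR (2 * z.1) * K (logpolar z)).

Lemma khat_meas K : mfun2 K -> mfun2 (khat K).
Proof.
move=> mK; have ms := @mfun_strip R; have ml := @measurable_logpolar R.
have mKl : measurable_fun setT (fun z : plane => K (logpolar z)) by exact: (measurableT_comp mK ml).
rewrite /mfun2 /khat; apply: measurable_funM; first exact: ms.
by apply: measurable_funM => //; mfun.
Qed.

Lemma khat_ge0 K : (forall q, 0 <= K q) -> forall z, 0 <= khat K z.
Proof. by move=> K0 z; rewrite mulr_ge0 ?strip_ge0// mulr_ge0 ?expR_ge0. Qed.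

Lemma integral_khat K : mfun2 K -> (forall q, 0 <= K q) ->
  (\int[leb2]_z (khat K z)%:E = \int[leb2]_q (K q)%:E)%E.
Proof.
move=> mK K0.
have mE : measurable_fun setT (fun q : plane => (K q)%:E) by exact/measurable_EFinP.
have ml := @measurable_logpolar R.
have mKl : measurable_fun setT (fun z : plane => K (logpolar z)) by exact: (measurableT_comp mK ml).
rewrite (ge0_integral_logpolar mE (fun q => K0 q)).
rewrite -(ge0_integral_strip (F := fun z : plane => ((expR z.1 ^+ 2)%:E * (K (logpolar z))%:E)%E) 0).
- apply: eq_integral => z _; rewrite add0r /khat -!EFinM; congr EFin.
  by rewrite -expRM_natl.
- by mfun.
- by move=> z; rewrite mule_ge0// lee_fin ?sqr_ge0.
- by move=> s t; rewrite periodic_logpolar.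
Qed.

Lemma ikernel_khat K : cker K -> ikernel (khat K).
Proof.
move=> hK; have mK := cker_meas hK; have [C C0 KC] := cker_bound hK.
apply/integrableP; split; first by apply/measurable_EFinP; exact: khat_meas.
have mA : mfun2 (fun q => `|K q|) by rewrite /mfun2 in mK *; mfun.
rewrite (_ : (fun x => _) = (fun z => (khat (fun q => `|K q|) z)%:E)); last first.
  apply/funext => z /=; rewrite /khat !normrM (ger0_norm (strip_ge0 z)).
  by rewrite (gtr0_norm (expR_gt0 _)).
rewrite (integral_khat mA)//.
have hB : (\int[leb2]_q (C * boxR 2 q)%:E < +oo)%E.
  under eq_integral do rewrite EFinM.
  rewrite ge0_integralZl//.
  - by rewrite lte_mul_pinfty//; exact: integral_boxR.
  - by apply/measurable_EFinP; exact: mfun_boxR.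
  - by move=> q _; rewrite lee_fin boxR_ge0.
apply: le_lt_trans hB; apply: ge0_le_integral => //.
- exact/measurable_EFinP.
- by apply/measurable_EFinP; apply: measurable_funM => //; exact: mfun_boxR.
- move=> q _; rewrite lee_fin; have [->|/(cker_supp hK)[h1 h2]] := eqVneq (K q) 0.
    by rewrite normr0 mulr_ge0// boxR_ge0.
  by rewrite boxRE h1 h2 mulr1.
Qed.

Lemma avg_cconv K f y : cker K -> locint f ->
  avg K f y = cconv (khat K) (f \o logpolar) y.
Proof.
move=> hK lf; have mK := cker_meas hK; have mf := locint_meas lf.
have mm := moll_meas y mK; have ml := @measurable_logpolar R.
rewrite /avg /cconv /Rintegral; congr fine.
have mF : measurable_fun setT (fun x : plane => (f x * moll K y x)%:E).
  by apply/measurable_EFinP; apply: measurable_funM.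
rewrite (integral_logpolar mF).
rewrite -(integral_strip (F := fun z : plane => ((expR z.1 ^+ 2)%:E *
  (f (logpolar z) * moll K y (logpolar z))%:E)%E) y).
- apply: eq_integral => z _; rewrite -!EFinM; congr EFin.
  rewrite /moll qmap_logpolar /khat /= -expRM_natl mulrDr expRD.
  have E2 : expR (- (2 * y.1)) * expR (2 * y.1) = 1 by rewrite expRN mulVf// gt_eqF// expR_gt0.
  transitivity ((expR (- (2 * y.1)) * expR (2 * y.1)) *
    (strip z * (expR (2 * z.1) * K (logpolar z)) * f (logpolar (y + z)))); first by ring.
  by rewrite E2 mul1r.
- apply: emeasurable_funM; first by mfun.
  exact: (measurableT_comp mF ml).
- by move=> s t; rewrite periodic_logpolar.
Qed.

Lemma cker_sq K : cker K -> (\int[leb2]_z (khat K z ^+ 2)%:E < +oo)%E.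
Proof.
move=> hK; have mK := cker_meas hK; have [C C0 KC] := cker_bound hK.
have mA : mfun2 (fun q => enorm2 q * K q ^+ 2).
  by have m := @mfun_enorm2 R; rewrite /mfun2 in mK *; mfun.
rewrite (_ : (fun z => _) = (fun z => (khat (fun q => enorm2 q * K q ^+ 2) z)%:E)); last first.
  apply/funext => z; congr EFin; rewrite /khat enorm2_logpolar.
  by rewrite !exprMn strip2; ring.
rewrite (integral_khat mA); last by move=> q; rewrite mulr_ge0 ?sqr_ge0 ?enorm2_ge0.
have hB : (\int[leb2]_q (8 * C ^+ 2 * boxR 2 q)%:E < +oo)%E.
  under eq_integral do rewrite EFinM.
  rewrite ge0_integralZl//.
  - by rewrite lte_mul_pinfty ?lee_fin ?mulr_ge0 ?sqr_ge0//; exact: integral_boxR.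
  - by apply/measurable_EFinP; exact: mfun_boxR.
  - by move=> q _; rewrite lee_fin boxR_ge0.
  - by rewrite lee_fin mulr_ge0 ?sqr_ge0.
apply: le_lt_trans hB; apply: ge0_le_integral => //.
- by move=> q _; rewrite lee_fin mulr_ge0 ?sqr_ge0 ?enorm2_ge0.
- exact/measurable_EFinP.
- by apply/measurable_EFinP; apply: measurable_funM => //; exact: mfun_boxR.
- move=> q _; rewrite lee_fin; have [->|/(cker_supp hK)[h1 h2]] := eqVneq (K q) 0.
    by rewrite expr0n/= mulr0 mulr_ge0 ?boxR_ge0// mulr_ge0 ?sqr_ge0.
  have h s : `|s| <= 2 -> s ^+ 2 <= 4 :> R by rewrite ler_norml => /andP[? ?]; nra.
  have n8 : enorm2 q <= 8 by have := h _ h1; have := h _ h2; rewrite /enorm2; lra.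
  rewrite boxRE h1 h2 mulr1; apply: ler_pM; rewrite ?enorm2_ge0 ?sqr_ge0//.
  by rewrite -(real_normK (num_real (K q))); apply: lerXn2r; rewrite ?nnegrE.
Qed.

Section L2_data.
Variables (K b : R * R -> R).
Hypothesis (hK : cker K) (mb : mfun2 b) (pb : periodic2 b) (sb : sq_int mS b).

(** Dominates the integrand of the convolution when [b] is only square integrable on the cylinder.
    Its integral does not depend on [y], so integrability and a uniform bound come together. *)
Let G y z : R := khat K z ^+ 2 + strip z * b (y + z) ^+ 2.

Let G_bound y z : `|khat K z * b (y + z)| <= G y z.
Proof.
have -> : khat K z * b (y + z) = khat K z * (strip z * b (y + z)).
  rewrite /khat -[in LHS]strip2; ring.
apply: (le_trans (mul_le_sq _ _)); rewrite /G.
by rewrite [(strip z * _) ^+ 2]exprMn strip2.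
Qed.

Let mb2 : mfun2 (fun z => b z ^+ 2). Proof. by have m := mb; rewrite /mfun2 in m *; mfun. Qed.

Let mk2 : mfun2 (fun z => khat K z ^+ 2).
Proof. by have m := khat_meas (cker_meas hK); rewrite /mfun2 in m *; mfun. Qed.

Let msb y : mfun2 (fun z => strip z * b (y + z) ^+ 2).
Proof.
have ms := @mfun_strip R; have m := mfun2_shift y mb2.
by rewrite /mfun2 in ms m *; apply: measurable_funM; [exact: ms|exact: m].
Qed.

Let iG y : (\int[leb2]_z (G y z)%:E =
  \int[leb2]_z (khat K z ^+ 2)%:E + \int[mS]_z (b z ^+ 2)%:E)%E.
Proof.
rewrite /G; under eq_integral do rewrite EFinD.
have mE1 : measurable_fun setT (fun z : plane => (khat K z ^+ 2)%:E) by exact/measurable_EFinP.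
have mE2 : measurable_fun setT (fun z : plane => (strip z * b (y + z) ^+ 2)%:E).
  by apply/measurable_EFinP; exact: msb.
have p1 z : setT z -> (0 <= (khat K z ^+ 2)%:E)%E by move=> _; rewrite lee_fin sqr_ge0.
have p2 z : setT z -> (0 <= (strip z * b (y + z) ^+ 2)%:E)%E.
  by move=> _; rewrite lee_fin mulr_ge0 ?sqr_ge0 ?strip_ge0.
rewrite (ge0_integralD leb2 measurableT p1 mE1 p2 mE2).
congr (_ + _)%E; rewrite -(ge0_integral_strip (F := fun z => (b z ^+ 2)%:E) y).
- by apply: eq_integral => z _; rewrite -EFinM.
- exact/measurable_EFinP.
- by move=> z; rewrite lee_fin sqr_ge0.
- by move=> s t; rewrite pb.
Qed.

Let mG y : mfun2 (G y). Proof. by apply: measurable_funD; [exact: mk2|exact: msb]. Qed.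

Let G0 y z : 0 <= G y z.
Proof. by rewrite addr_ge0 ?sqr_ge0// mulr_ge0 ?sqr_ge0 ?strip_ge0. Qed.

Lemma khat_integrable y : ikernel (fun z => khat K z * b (y + z)).
Proof.
apply: (@integrable_le _ plane R leb2 (fun z : plane => khat K z * b (y + z)) (G y)).
- have m := mfun2_shift y mb; have mk := khat_meas (cker_meas hK).
  by apply: measurable_funM.
- exact: G_bound.
apply/integrableP; split; first by apply/measurable_EFinP; exact: mG.
rewrite (_ : (fun x => _) = (fun z => (G y z)%:E)); last first.
  by apply/funext => z /=; rewrite ger0_norm.
by rewrite iG; apply: lte_add_pinfty; [exact: cker_sq|exact: sb.2].
Qed.

Lemma khat_bounded : bounded2 (cconv (khat K) b).
Proof.
have F : (\int[leb2]_z (khat K z ^+ 2)%:E + \int[mS]_z (b z ^+ 2)%:E)%E \is a fin_num.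
  rewrite ge0_fin_numE; first by apply: lte_add_pinfty; [exact: cker_sq|exact: sb.2].
  by apply: adde_ge0; apply: integral_ge0 => z _; rewrite lee_fin sqr_ge0.
exists (fine (\int[leb2]_z (khat K z ^+ 2)%:E + \int[mS]_z (b z ^+ 2)%:E)%E).
  apply: fine_ge0; apply: adde_ge0; apply: integral_ge0 => z _; rewrite lee_fin sqr_ge0//.
move=> y; rewrite -lee_fin fineK// -(iG y) /cconv.
apply: (le_trans (abs_Rintegral_le (khat_integrable y))).
apply: ge0_le_integral => //.
- apply/measurable_EFinP; apply: (measurableT_comp (@normr_measurable _ setT)).
  exact: ikernel_meas (khat_integrable y).
- by apply/measurable_EFinP; exact: mG.
- by move=> z _; rewrite lee_fin; exact: G_bound.
Qed.

End L2_data.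

Lemma abs_Rintegral_le' (F : plane -> R) : mfun2 F ->
  ((`|\int[leb2]_x F x|)%:E <= \int[leb2]_x (`|F x|)%:E)%E.
Proof.
move=> mF; have [->|h] := eqVneq (\int[leb2]_x (`|F x|)%:E)%E +oo%E; first exact: leey.
apply: abs_Rintegral_le; apply/integrableP; split; first exact/measurable_EFinP.
by rewrite lt_neqAle leey andbT.
Qed.

(** Jensen for a kernel of mass at most 1, then translation invariance. No integral of the data is
    assumed finite: where a convolution integral diverges, the bound for it is infinite. *)
Lemma cconv_energy_le k b1 b2 : mfun2 k -> (forall z, 0 <= k z) ->
  (\int[leb2]_z (k z)%:E <= 1%:E)%E -> mfun2 b1 -> mfun2 b2 ->
  periodic2 (fun z => b1 z ^+ 2 + b2 z ^+ 2) ->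
  (\int[mS]_z (cconv k b1 z ^+ 2 + cconv k b2 z ^+ 2)%:E <=
   \int[mS]_z (b1 z ^+ 2 + b2 z ^+ 2)%:E)%E.
Proof.
move=> mk k0 k1 m1 m2 pP; pose P z := b1 z ^+ 2 + b2 z ^+ 2.
have mP : mfun2 P by rewrite /mfun2 /P in m1 m2 *; mfun.
have P0 z : 0 <= P z by rewrite addr_ge0 ?sqr_ge0.
have key b y : mfun2 b -> ((cconv k b y ^+ 2)%:E <= \int[leb2]_z (k z * b (y + z) ^+ 2)%:E)%E.
  move=> mb; have mby := mfun2_shift y mb.
  have mab : mfun2 (fun z => `|b (y + z)|) by rewrite /mfun2 in mby *; apply: (measurableT_comp (@normr_measurable _ setT)).
  have J := ge0_jensen_sq ltr01 mk mab k0 (fun z => normr_ge0 _) k1.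
  apply: le_trans (le_trans J _).
    rewrite -(real_normK (num_real (cconv _ _ _))) EFin_expe lee_sqr; last 2 first.
      by rewrite lee_fin.
      by apply: integral_ge0 => z _; rewrite lee_fin mulr_ge0.
    rewrite /cconv; apply: (le_trans (abs_Rintegral_le' _)).
      by apply: measurable_funM.
    rewrite le_eqVlt; apply/orP; left; apply/eqP; apply: eq_integral => z _.
    by rewrite normrM ger0_norm.
  rewrite mul1e le_eqVlt; apply/orP; left; apply/eqP; apply: eq_integral => z _.
  by rewrite real_normK ?num_real.
have mI := measurable_integral_conv mk mP k0 P0.
apply: (@le_trans _ _ (\int[mS]_y \int[leb2]_z (k z * P (y + z))%:E)%E).
  apply: ge0_le_integral => //.
  - by move=> y _; rewrite lee_fin addr_ge0 ?sqr_ge0.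
  - have c1 := conv_meas mk m1; have c2 := conv_meas mk m2; apply/measurable_EFinP.
    by rewrite /mfun2 in c1 c2; mfun.
  - move=> y _; rewrite EFinD; apply: (le_trans (leeD (key b1 y m1) (key b2 y m2))).
    have mb1 := mfun2_shift y m1; have mb2 := mfun2_shift y m2.
    rewrite -ge0_integralD//.
    + rewrite le_eqVlt; apply/orP; left; apply/eqP; apply: eq_integral => z _.
      by rewrite -EFinD -mulrDr.
    + by move=> z _; rewrite lee_fin mulr_ge0 ?sqr_ge0.
    + by apply/measurable_EFinP; rewrite /mfun2 in mk mb1; mfun.
    + by move=> z _; rewrite lee_fin mulr_ge0 ?sqr_ge0.
    + by apply/measurable_EFinP; rewrite /mfun2 in mk mb2; mfun.
rewrite (ge0_integral_conv mk mP)//.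
rewrite -[leRHS]mul1e; apply: lee_wpmul2r => //.
by apply: integral_ge0 => z _; rewrite lee_fin.
Qed.

End cylinder_average.

(** * Continuity of translations *)

Section translation_continuity.
Context d (T : measurableType d) (R : realType) (m : {measure set T -> \bar R}).
Context (H : Type) (small : R -> H -> Prop) (tau : H -> T -> T).
Context (small_le : forall d d' h, d <= d' -> small d h -> small d' h).
Context (mtau : forall h, measurable_fun setT (tau h)).
Context (ptau : forall h (F : T -> \bar R), measurable_fun setT F ->
  (forall x, 0 <= F x)%E -> (\int[m]_x F (tau h x) = \int[m]_x F x)%E).
Implicit Types f g : T -> R.

(** Continuity of translations in L^1, stated for an abstract family of measure-preserving maps so
    that the line and the plane share the argument. *)
Definition tcont f := forall e, 0 < e -> exists2 del, 0 < del &
  forall h, small del h -> (\int[m]_x (`|f (tau h x) - f x|)%:E <= e%:E)%E.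

Let mdist f g : measurable_fun setT f -> measurable_fun setT g ->
  measurable_fun setT (fun x => (`|f x - g x|)%:E).
Proof. by move=> mf mg; mfun. Qed.

Let mtr f h : measurable_fun setT f -> measurable_fun setT (fun x => f (tau h x)).
Proof. by move=> mf; exact: (measurableT_comp mf (mtau h)). Qed.

Lemma tcontD f g : measurable_fun setT f -> measurable_fun setT g ->
  tcont f -> tcont g -> tcont (fun x => f x + g x).
Proof.
move=> mf mg hf hg e e0; have e20 : 0 < e / 2 by rewrite divr_gt0.
have [d1 d10 h1] := hf _ e20; have [d2 d20 h2] := hg _ e20.
exists (Num.min d1 d2); first by rewrite lt_min d10.
move=> h sh; have mfh := mtr h mf; have mgh := mtr h mg.
apply: (@le_trans _ _ (\int[m]_x ((`|f (tau h x) - f x|)%:E + (`|g (tau h x) - g x|)%:E))%E).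
  apply: ge0_le_integral => //.
  - by apply: mdist; exact: measurable_funD.
  - by apply: emeasurable_funD; exact: mdist.
  - move=> x _; rewrite -EFinD lee_fin (le_trans _ (ler_normD _ _))//.
    by rewrite le_eqVlt; apply/orP; left; apply/eqP; congr (`| _ |); ring.
rewrite ge0_integralD//; try exact: mdist.
rewrite [e](splitr e) EFinD; apply: leeD.
  by apply: h1; apply: small_le sh; rewrite ge_min lexx.
by apply: h2; apply: small_le sh; rewrite ge_min lexx orbT.
Qed.

Lemma tcontZ c f : measurable_fun setT f -> tcont f -> tcont (fun x => c * f x).
Proof.
move=> mf hf e e0; have k0 : 0 < `|c| + 1 by rewrite ltr_wpDl.
have [del d0 h1] := hf _ (divr_gt0 e0 k0); exists del => // h sh.
have mfh := mtr h mf.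
apply: (@le_trans _ _ (`|c|%:E * (e / (`|c| + 1))%:E)%E).
  apply: le_trans (lee_wpmul2l _ (h1 _ sh)); last by rewrite lee_fin.
  rewrite -ge0_integralZl//; last exact: mdist.
  rewrite le_eqVlt; apply/orP; left; apply/eqP; apply: eq_integral => x _.
  by rewrite -EFinM -normrM mulrBr.
rewrite -EFinM lee_fin mulrA ler_pdivrMr// mulrC; apply: ler_wpM2l; first exact: ltW.
by rewrite lerDl.
Qed.

(** A three-epsilon argument: since [tau h] preserves the measure, the distance of [f_ n] to [f] in
    L^1 is the same after translation. *)
Lemma tcont_dominated (f_ : nat -> T -> R) f g :
  (forall n, measurable_fun setT (f_ n)) -> measurable_fun setT f ->
  (forall x, f_ ^~ x @ \oo --> f x) -> m.-integrable setT (EFin \o g) ->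
  (forall n x, `|f_ n x| <= g x) -> (forall n, tcont (f_ n)) -> tcont f.
Proof.
move=> mf_ mf f_f ig f_g tf e e0; have e30 : 0 < e / 3 by rewrite divr_gt0.
have [] := @dominated_convergence _ T R m setT measurableT
  (fun n => EFin \o f_ n) (EFin \o f) (EFin \o g).
- by move=> n; exact/measurable_EFinP.
- exact/measurable_EFinP.
- apply: aeW => x _; apply/fine_cvgP; split; first exact: nearW.
  exact: f_f.
- exact: ig.
- by apply: aeW => x n _ /=; rewrite lee_fin.
move=> _ /fine_cvgP[fin cv] _.
have [n [n1 n2]] : exists n, (\int[m]_x `|(EFin \o f_ n) x - (EFin \o f) x| \is a fin_num)%E /\
    fine (\int[m]_x `|(EFin \o f_ n) x - (EFin \o f) x|)%E < e / 3.
  have h : \forall n \near \oo, (\int[m]_x `|(EFin \o f_ n) x - (EFin \o f) x| \is a fin_num)%E /\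
      fine (\int[m]_x `|(EFin \o f_ n) x - (EFin \o f) x|)%E < e / 3.
    move/cvgrPdist_lt: cv => /(_ _ e30) cv; near=> n; split; first by near: n.
    have := near cv n; rewrite sub0r normrN => cn.
    by apply: le_lt_trans (ler_norm _) _; near: n; move: cv; under eq_near do rewrite sub0r normrN.
  by have [N _ /(_ N (leqnn N))] := h; exists N.
have D : (\int[m]_x (`|f_ n x - f x|)%:E <= (e / 3)%:E)%E.
  by rewrite -(fineK n1) in n2 *; rewrite lee_fin ltW.
have [del d0 hn] := tf n _ e30; exists del => // h sh.
have mfh := mtr h mf; have mfnh := mtr h (mf_ n).
apply: (@le_trans _ _ (\int[m]_x ((`|f_ n (tau h x) - f (tau h x)|)%:E +
    ((`|f_ n (tau h x) - f_ n x|)%:E + (`|f_ n x - f x|)%:E)))%E).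
  apply: ge0_le_integral => //.
  - exact: mdist.
  - by apply: emeasurable_funD; [exact: mdist|apply: emeasurable_funD; exact: mdist].
  - move=> x _; rewrite -!EFinD lee_fin.
    rewrite (_ : f (tau h x) - f x = - (f_ n (tau h x) - f (tau h x)) +
      ((f_ n (tau h x) - f_ n x) + (f_ n x - f x))); last by ring.
    apply: (le_trans (ler_normD _ _)); rewrite normrN lerD2l; exact: ler_normD.
rewrite ge0_integralD//; last 3 first.
- exact: mdist.
- by move=> x _; rewrite -EFinD lee_fin addr_ge0.
- by apply: emeasurable_funD; exact: mdist.
rewrite ge0_integralD//; try exact: mdist.
rewrite (_ : e = e / 3 + (e / 3 + e / 3)); last by field.
rewrite !EFinD; apply: leeD; last by apply: leeD => //; exact: hn.
have := ptau h (mdist (mf_ n) mf) (fun x => normr_ge0 _).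
by rewrite /= => ->.
Unshelve. all: by end_near. Qed.

Lemma tcont_sum n (F : nat -> T -> R) : (forall i, measurable_fun setT (F i)) ->
  (forall i, tcont (F i)) -> tcont (fun x => \sum_(i < n) F i x).
Proof.
move=> mF tF; elim: n => [|n ih].
  move=> e e0; exists 1 => // h _.
  by under eq_integral do rewrite !big_ord0 subrr normr0; rewrite integral0 lee_fin ltW.
rewrite (_ : (fun x => _) = (fun x => \sum_(i < n) F i x + F n x)); last first.
  by apply/funext => x; rewrite big_ord_recr.
by apply: tcontD => //; apply: measurable_sum.
Qed.

Section window.
Variable W : set T.
Hypothesis (mW : measurable W) (Wfin : (m W < +oo)%E).

Let iW : m.-integrable setT (EFin \o (\1_W : T -> R)).
Proof.
apply/integrableP; split; first by apply/measurable_EFinP.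
rewrite (_ : (fun x => _) = (fun x => (\1_W x)%:E)); last first.
  by apply/funext => x /=; rewrite ger0_norm// indicE.
by rewrite integral_indic// setIT.
Qed.

(** The window [W] of finite measure keeps every indicator integrable, so that complements and
    countable disjoint unions pass through linearity and domination by [\1_W]. *)
Lemma tcont_dynkin (G : set (set T)) : @measurable _ T = <<s G >> -> setI_closed G ->
  tcont (\1_W) -> (forall A, G A -> tcont (\1_(A `&` W))) ->
  forall A, measurable A -> tcont (\1_(A `&` W)).
Proof.
move=> GE GI TW GT A; rewrite GE.
apply: (@dynkin_induction _ T G (fun A => tcont (\1_(A `&` W)))) => //.
- by rewrite setTI.
- move=> S mS tS; have mSW : measurable (S `&` W) by exact: measurableI.
  rewrite (_ : \1_(~` S `&` W) = (fun x => \1_W x + -1 * \1_(S `&` W) x)); last first.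
    apply/funext => x; rewrite !indicE !in_setI in_setC.
    by case: (x \in S); case: (x \in W); rewrite /= ?mulr1 ?mulr0 ?subrr ?addr0.
  by apply: tcontD => //; [exact: measurable_funM|exact: tcontZ].
- move=> F mF tF hF.
  have mFW k : measurable (F k `&` W) by exact: measurableI.
  have mU : measurable (\bigcup_k F k) by exact: bigcup_measurable.
  pose f_ n := fun x => \sum_(i < n) (\1_(F i `&` W) x : R).
  have dis x i j : x \in F i -> x \in F j -> i = j.
    by rewrite !inE => Fi Fj; apply: (tF i j I I); exists x.
  have f_le1 n x : f_ n x <= \1_W x /\ 0 <= f_ n x.
    split; last by apply: sumr_ge0 => i _; rewrite indicE.
    have [Wx|Wx] := boolP (x \in W); last first.
      rewrite /f_ big1 ?indicE// => i _; rewrite indicE in_setI (negbTE Wx) andbF//.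
    rewrite [leRHS]indicE Wx /f_.
    have [[i xi]|no] := pselect (exists i : 'I_n, x \in F i).
      rewrite (bigD1 i)//= big1 ?addr0; first by rewrite indicE; case: (_ \in _).
      move=> j ji; rewrite indicE in_setI; case: (boolP (x \in F j)) => //= xj.
      by move: ji; rewrite -(inj_eq val_inj) /= (dis _ _ _ xi xj) eqxx.
    rewrite big1 ?ler01// => j _; rewrite indicE in_setI.
    by case: (boolP (x \in F j)) => //= xj; case: no; exists j.
  apply: (@tcont_dominated f_ _ (\1_W)) => //.
  + by move=> n; apply: measurable_sum => i; exact: measurable_indic.
  + by apply: measurable_indic; exact: measurableI.
  + move=> x; apply: cvg_near_cst.
    have [[i xi]|no] := pselect (exists i, x \in F i).
      exists i.+1 => // n /= ni; rewrite /f_ (bigD1 (Ordinal ni))//= big1 ?addr0.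
        rewrite !indicE !in_setI xi; congr ((_ && _)%:R).
        by rewrite (_ : x \in \bigcup_k F k)//; apply/mem_set; exists i => //; exact: set_mem.
      move=> j ji; rewrite indicE in_setI; case: (boolP (x \in F j)) => //= xj.
      by move: ji; rewrite -(inj_eq val_inj) /= (dis _ _ _ xi xj) eqxx.
    exists 0%N => // n _; rewrite /f_ big1 ?indicE ?in_setI.
      case: (boolP (x \in _)) => // /[!inE] -[k _ xk]; case: no; exists k.
      by rewrite inE.
    by move=> j _; rewrite indicE in_setI; case: (boolP (x \in F j)) => //= xj; case: no; exists j.
  + by move=> n x; have [h1 h2] := f_le1 n x; rewrite ger0_norm.
  + by move=> n; exact: (tcont_sum n (fun i => measurable_indic (mFW i)) hF).
Qed.

Import HBNNSimple.

Lemma tcont_ge0 f : (forall A, measurable A -> tcont (\1_(A `&` W))) ->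
  measurable_fun setT f -> (forall x, 0 <= f x) ->
  m.-integrable setT (EFin \o (fun x => f x * \1_W x)) ->
  tcont (fun x => f x * \1_W x).
Proof.
move=> tA mf f0 ifW.
have mE : measurable_fun setT (EFin \o f) by exact/measurable_EFinP.
pose f_ n := nnsfun_approx measurableT mE n.
have cvf x : (fun n => f_ n x) @ \oo --> f x.
  have := @cvg_nnsfun_approx _ T R setT measurableT (EFin \o f) mE (fun x _ => f0 x) x I.
  by move/fine_cvgP => [_].
have lef n x : f_ n x <= f x.
  have nd : nondecreasing_seq (fun n => f_ n x).
    by move=> i j ij; have /lefP := nd_nnsfun_approx measurableT mE ij; apply.
  have := nondecreasing_cvgn_le nd _ n; rewrite (cvg_lim _ (cvf x))//; apply.
  exact: cvf.
have mf_ n : measurable_fun setT (f_ n) by exact: measurable_funP.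
apply: (@tcont_dominated (fun n x => f_ n x * \1_W x) _ (fun x => f x * \1_W x)) => //.
- by move=> n; apply: measurable_funM.
- exact: measurable_funM.
- by move=> x; apply: (@cvgM R); [exact: cvf|exact: cvg_cst].
- move=> n x; rewrite ger0_norm ?mulr_ge0 ?indicE//.
  by apply: ler_wpM2r => //; exact: lef.
- move=> n; pose s := fset_set (f_ n @` setT).
  rewrite (_ : (fun x => _) = (fun x => \sum_(i < #|`s|)
      (s`_i * \1_((f_ n @^-1` [set s`_i]) `&` W) x))); last first.
    apply/funext => x; rewrite {1}(fimfunEord (f_ n) x) mulr_suml.
    by apply: eq_bigr => i _; rewrite -mulrA !indicE in_setI -natrM mulnb.
  have mp (r : R) : measurable ((f_ n @^-1` [set r]) `&` W).
    by apply: measurableI => //; rewrite -[X in measurable X]setTI; exact: mf_.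
  apply: (@tcont_sum _ (fun i x => s`_i * \1_((f_ n @^-1` [set s`_i]) `&` W) x)).
    by move=> i; apply: measurable_funM => //; exact: measurable_indic.
  move=> i; apply: tcontZ; first exact: measurable_indic.
  by apply: tA; rewrite -[X in measurable X]setTI; exact: mf_.
Qed.

Lemma tcont_integrable f : (forall A, measurable A -> tcont (\1_(A `&` W))) ->
  measurable_fun setT f -> m.-integrable setT (EFin \o (fun x => f x * \1_W x)) ->
  tcont (fun x => f x * \1_W x).
Proof.
move=> tA mf ifW.
have h g : measurable_fun setT g -> (forall x, 0 <= g x) -> (forall x, g x <= `|f x|) ->
    tcont (fun x => g x * \1_W x).
  move=> mg g0 gf; apply: tcont_ge0 => //.
  apply: (@integrable_le _ _ _ _ _ (fun x => `|f x * \1_W x|)); last exact: integrable_norm.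
    exact: measurable_funM.
  by move=> x; rewrite !normrM ger0_norm// ler_wpM2r.
rewrite (_ : (fun x => _) = (fun x => Num.max (f x) 0 * \1_W x + -1 * (Num.max (- f x) 0 * \1_W x))); last first.
  apply/funext => x; have [f0|f0] := leP 0 (f x); have [g0|g0] := leP 0 (- f x).
  - have -> : f x = 0 by lra.
    by ring.
  - by ring.
  - by ring.
  - by lra.
have m1 : measurable_fun setT (fun x => Num.max (f x) 0) by exact: measurable_maxr.
have m2 : measurable_fun setT (fun x => Num.max (- f x) 0).
  by apply: measurable_maxr => //; exact: (measurableT_comp (@oppr_measurable R setT)).
apply: tcontD; [exact: measurable_funM| |apply: h => //|].
- by apply: measurable_funM => //; exact: measurable_funM.
- by move=> x; rewrite le_max lexx orbT.
- by move=> x; rewrite ge_max ler_norm normr_ge0.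
apply: tcontZ; first exact: measurable_funM.
apply: h => //; first by move=> x; rewrite le_max lexx orbT.
by move=> x; rewrite ge_max -normrN ler_norm normr_ge0.
Qed.

End window.

End translation_continuity.

(** * Translations of the line and of the plane *)

Section plane_translation.
Context {R : realType}.
Notation mu := (@lebesgue_measure R).
Notation plane := (measurableTypeR R * measurableTypeR R)%type.
Local Notation leb2 := (mu \x mu)%E.

Definition winS (B : R) : set (measurableTypeR R) := `](- B)%R, B]%classic.

Definition small1 (del h : R) : Prop := `|h| < del.
Definition tau1 (h x : R) : R := x + h.
Definition small2 (del : R) (h : R * R) : Prop := `|h.1| < del /\ `|h.2| < del.
Definition tau2 (h z : R * R) : R * R := z + h.

Local Notation tcont1 := (@tcont _ (measurableTypeR R) R mu R small1 tau1).
Local Notation tcont2 := (@tcont _ plane R leb2 (R * R)%type small2 tau2).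

Let sm1 (d d' h : R) : d <= d' -> small1 d h -> small1 d' h.
Proof. by move=> dd; rewrite /small1 => /lt_le_trans; apply. Qed.

Let sm2 (d d' : R) h : d <= d' -> small2 d h -> small2 d' h.
Proof. by move=> dd [a b]; split; exact: lt_le_trans dd. Qed.

Let mt1 h : measurable_fun setT (tau1 h : measurableTypeR R -> measurableTypeR R).
Proof. by rewrite /tau1; mfun. Qed.

Let mt2 h : measurable_fun setT (tau2 h : plane -> plane).
Proof. exact: measurable_translate2. Qed.

Let pt1 h (F : measurableTypeR R -> \bar R) : measurable_fun setT F -> (forall x, 0 <= F x)%E ->
  (\int[mu]_x F (tau1 h x) = \int[mu]_x F x)%E.
Proof. by move=> mF F0; have := ge0_integral_translate h mF F0; rewrite /tau1. Qed.

Let pt2 h (F : plane -> \bar R) : measurable_fun setT F -> (forall x, 0 <= F x)%E ->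
  (\int[leb2]_x F (tau2 h x) = \int[leb2]_x F x)%E.
Proof. by move=> mF F0; have := ge0_integral_leb2_translate h mF F0; rewrite /tau2. Qed.

Lemma measurable_winS (B : R) : measurable (winS B).
Proof. exact: measurable_itv. Qed.

Lemma mu_winS_lty (B : R) : (mu (winS B) < +oo)%E.
Proof. by rewrite /winS lebesgue_measure_itv/=; case: ifP => _; rewrite -?EFinB ltry. Qed.

Lemma mu_itv_len (a b : R) : a <= b -> mu `[a, b]%classic = (b - a)%:E.
Proof.
rewrite le_eqVlt => /predU1P[->|ab]; rewrite lebesgue_measure_itv/=.
  by rewrite ltxx subrr.
by rewrite lte_fin ab EFinB.
Qed.

Lemma tcont1_itv (a b : R) : tcont1 (\1_(`]a, b]%classic : set R)).
Proof.
move=> e e0; exists (e / 4); first by rewrite divr_gt0.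
move=> h; rewrite /small1 ltr_norml => /andP[h1 h2].
(* The translated and the original indicator differ only within [e / 4] of an endpoint. *)
pose A c : set (measurableTypeR R) := `[c - e / 4, c + e / 4]%classic.
have mA c : measurable (A c) by exact: measurable_itv.
have iA c : (\int[mu]_x (\1_(A c) x : R)%:E = (e / 2)%:E)%E.
  rewrite integral_indic// setIT; transitivity ((c + e / 4 - (c - e / 4))%:E)%E.
    by apply: mu_itv_len; lra.
  by congr EFin; field.
apply: (@le_trans _ _ (\int[mu]_x ((\1_(A a) x)%:E + (\1_(A b) x)%:E))%E).
  apply: ge0_le_integral => //.
  - apply/measurable_EFinP.
    apply: (measurableT_comp (@normr_measurable _ setT)); apply: measurable_funB.
      exact: (measurableT_comp (measurable_indic (measurable_itv _)) (mt1 h)).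
    exact: measurable_indic.
  - by apply: emeasurable_funD; apply/measurable_EFinP.
  - { move=> x _; rewrite -EFinD lee_fin !indicE /tau1 /A !mem_setE/= !in_itv/=.
    case: (boolP (a < x + h <= b)); case: (boolP (a < x <= b));
    case: (boolP (a - e / 4 <= x <= a + e / 4)); case: (boolP (b - e / 4 <= x <= b + e / 4)).
    all: rewrite /= ?subrr ?normr0 ?subr0 ?sub0r ?normrN ?normr1 ?addr0 ?add0r ?ler01 ?lexx ?ler1n ?addr_ge0//.
    all: rewrite ?lerDl ?ler01//.
    all: rewrite ?negb_and -?ltNge -?leNgt => p1 p2 p3 p4.
    all: exfalso; move: p1 p2 p3 p4.
    all: by do ?[case/andP => ? ?|case/orP => ?]; move=> *; lra. }
rewrite ge0_integralD//; last 2 first.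
- by apply/measurable_EFinP; exact: measurable_indic.
- by apply/measurable_EFinP; exact: measurable_indic.
by rewrite !iA -EFinD -splitr.
Qed.

Lemma tcont1_set (B : R) (A : set (measurableTypeR R)) : measurable A -> tcont1 (\1_(A `&` winS B)).
Proof.
apply: (@tcont_dynkin _ (measurableTypeR R) R mu R small1 tau1 sm1 mt1 pt1 (winS B)
  (measurable_winS B) (mu_winS_lty B) (@ocitv R)).
- by [].
- exact: ocitvI.
- exact: tcont1_itv.
- move=> _ [[a b] _ <-]/=.
  rewrite (_ : _ `&` _ = `]Num.max a (- B), Num.min b B]%classic); first exact: tcont1_itv.
  apply/seteqP; split => x; rewrite /winS/= !in_itv/= gt_max le_min.
    by move=> [/andP[-> ->] /andP[-> ->]].
  by move=> /andP[/andP[-> ->] /andP[-> ->]].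
Qed.

Definition winR (B : R) : set plane := winS B `*` winS B.

(** On a rectangle the indicator is a product, whose increment splits into an increment in each
    variable times a bounded mass; rectangles generate the product sigma-algebra. *)
Lemma tcont2_set (B : R) (A : set plane) : measurable A -> tcont2 (\1_(A `&` winR B)).
Proof.
have mW : measurable (winR B) by exact: (measurableX (measurable_winS B) (measurable_winS B)).
have Wf : (leb2 (winR B) < +oo)%E.
  rewrite /winR product_measure1E; try exact: measurable_winS.
  by rewrite lte_mul_pinfty ?mu_winS_lty// ge0_fin_numE// mu_winS_lty.
have key (A1 A2 : set (measurableTypeR R)) : measurable A1 -> measurable A2 ->
    tcont2 (\1_((A1 `*` A2) `&` winR B)).
  move=> m1 m2 e e0.
  have t1 := tcont1_set B m1; have t2 := tcont1_set B m2.
  pose a := \1_(A1 `&` winS B) : measurableTypeR R -> R.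
  pose b := \1_(A2 `&` winS B) : measurableTypeR R -> R.
  have mA1 : measurable (A1 `&` winS B) by apply: measurableI => //; exact: measurable_winS.
  have mA2 : measurable (A2 `&` winS B) by apply: measurableI => //; exact: measurable_winS.
  have ma : measurable_fun setT a by exact: measurable_indic.
  have mb : measurable_fun setT b by exact: measurable_indic.
  pose L : R := fine (mu (winS B)) + 1.
  have fw : mu (winS B) \is a fin_num by rewrite ge0_fin_numE// mu_winS_lty.
  have L0 : 0 < L by rewrite ltr_wpDl// fine_ge0.
  have iL (C : set (measurableTypeR R)) : measurable C -> (\int[mu]_x (\1_(C `&` winS B) x : R)%:E <= L%:E)%E.
    move=> mC; rewrite integral_indic ?setIT//; last by apply: measurableI => //; exact: measurable_winS.
    apply: (@le_trans _ _ (mu (winS B))).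
      apply: le_measure; [apply/mem_set|apply/mem_set|exact: subIsetr].
        by apply: measurableI => //; exact: measurable_winS.
      exact: measurable_winS.
    by rewrite -(fineK fw) lee_fin lerDl.
  have ee : 0 < e / 2 / L by rewrite !divr_gt0.
  have [d1 d10 h1] := t1 _ ee; have [d2 d20 h2] := t2 _ ee.
  exists (Num.min d1 d2); first by rewrite lt_min d10.
  move=> h [s1 s2].
  have h1' := h1 h.1 (sm1 (ltac:(by rewrite ge_min lexx) : Num.min d1 d2 <= d1) s1).
  have h2' := h2 h.2 (sm1 (ltac:(by rewrite ge_min lexx orbT) : Num.min d1 d2 <= d2) s2).
  pose p1 (x : measurableTypeR R) := `|a (tau1 h.1 x) - a x|.
  pose p2 (x : measurableTypeR R) := `|b (tau1 h.2 x) - b x|.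
  have mah : measurable_fun setT (fun x => a (tau1 h.1 x)) by exact: (measurableT_comp ma (mt1 h.1)).
  have mbh : measurable_fun setT (fun x => b (tau1 h.2 x)) by exact: (measurableT_comp mb (mt1 h.2)).
  have mp1 : measurable_fun setT p1 by rewrite /p1; mfun.
  have mp2 : measurable_fun setT p2 by rewrite /p2; mfun.
  have a0 x : 0 <= a x by rewrite /a indicE.
  have b0 x : 0 <= b x by rewrite /b indicE.
  have p10 x : 0 <= p1 x by exact: normr_ge0.
  have p20 x : 0 <= p2 x by exact: normr_ge0.
  have E (z : plane) : \1_((A1 `*` A2) `&` winR B) z = a z.1 * b z.2.
    rewrite /a /b !indicE -natrM mulnb; congr (_%:R); congr nat_of_bool.
    apply/idP/idP; rewrite !inE/=; first by move=> [[? ?] [? ?]]; apply/andP; split; rewrite inE.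
    by move=> /andP[]; rewrite !inE => -[? ?] [? ?].
  apply: (@le_trans _ _ (\int[leb2]_z ((p1 z.1 * b (tau1 h.2 z.2))%:E + (a z.1 * p2 z.2)%:E))%E).
    apply: ge0_le_integral => //.
    - apply/measurable_EFinP; apply: (measurableT_comp (@normr_measurable _ setT)).
      have mi : measurable_fun setT (\1_((A1 `*` A2) `&` winR B) : plane -> R).
        by apply: measurable_indic; apply: measurableI => //; exact: measurableX.
      by apply: measurable_funB => //; exact: (measurableT_comp mi (mt2 h)).
    - by mfun.
    - move=> z _; rewrite -EFinD lee_fin !E /tau2/= -/(tau1 h.1 z.1) -/(tau1 h.2 z.2).
      rewrite (_ : _ - _ = (a (tau1 h.1 z.1) - a z.1) * b (tau1 h.2 z.2) +
        a z.1 * (b (tau1 h.2 z.2) - b z.2)); last by ring.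
      by rewrite (le_trans (ler_normD _ _))// !normrM (ger0_norm (a0 _)) (ger0_norm (b0 _)).
  have prod (P Q : measurableTypeR R -> R) : measurable_fun setT P -> measurable_fun setT Q ->
      (forall x, 0 <= P x) -> (forall x, 0 <= Q x) ->
      (\int[leb2]_z (P z.1 * Q z.2)%:E = \int[mu]_x (P x)%:E * \int[mu]_x (Q x)%:E)%E.
    move=> mP mQ P0 Q0.
    have mPQ : measurable_fun setT (fun z : plane => (P z.1 * Q z.2)%:E) by mfun.
    rewrite (fubini_tonelli1 _ mPQ); last by move=> z; rewrite lee_fin mulr_ge0.
    rewrite -ge0_integralZr//; last 3 first.
    - by mfun.
    - by move=> x _; rewrite lee_fin.
    - by apply: integral_ge0 => x _; rewrite lee_fin.
    apply: eq_integral => x _; rewrite /fubini_F -ge0_integralZl//.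
    - by mfun.
    - by move=> y _; rewrite lee_fin.
    - by rewrite lee_fin.
  rewrite ge0_integralD//; last 4 first.
  - by move=> z _; rewrite lee_fin mulr_ge0.
  - by mfun.
  - by move=> z _; rewrite lee_fin mulr_ge0.
  - by mfun.
  have mE : measurable_fun setT (fun x : measurableTypeR R => (b x)%:E) by mfun.
  rewrite (prod p1 (fun x => b (tau1 h.2 x)))// (prod a p2)//.
  rewrite (pt1 h.2 mE (fun x => b0 x)).
  rewrite (splitr e) EFinD; apply: leeD.
    apply: (@le_trans _ _ ((e / 2 / L)%:E * L%:E)%E).
      apply: lee_pmul => //; try (by apply: integral_ge0 => x _; rewrite lee_fin).
      exact: iL.
    by rewrite -EFinM divfK// gt_eqF.
  rewrite muleC; apply: (@le_trans _ _ ((e / 2 / L)%:E * L%:E)%E).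
    apply: lee_pmul => //; try (by apply: integral_ge0 => x _; rewrite lee_fin).
    exact: iL.
  by rewrite -EFinM divfK// gt_eqF.
apply: (@tcont_dynkin _ plane R leb2 (R * R)%type small2 tau2 sm2 mt2 pt2 (winR B)
  mW Wf [set A1 `*` A2 | A1 in measurable & A2 in measurable]).
- exact: measurable_prod_measurableType.
- move=> _ _ [A1 mA1 [A2 mA2 <-]] [B1 mB1 [B2 mB2 <-]].
  exists (A1 `&` B1); first exact: measurableI.
  by exists (A2 `&` B2); [exact: measurableI|rewrite setXI].
- have := key setT setT measurableT measurableT.
  by rewrite (_ : (setT `*` setT) `&` winR B = winR B)// setXTT setTI.
- by move=> _ [A1 mA1 [A2 mA2 <-]]; exact: key.
Qed.

Lemma tcont2_window (B : R) (f : plane -> R) : measurable_fun setT f ->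
  leb2.-integrable setT (EFin \o (fun z => f z * \1_(winR B) z)) ->
  tcont2 (fun z => f z * \1_(winR B) z).
Proof.
have mW : measurable (winR B) by exact: (measurableX (measurable_winS B) (measurable_winS B)).
have Wf : (leb2 (winR B) < +oo)%E.
  rewrite /winR product_measure1E; try exact: measurable_winS.
  by rewrite lte_mul_pinfty ?mu_winS_lty// ge0_fin_numE// mu_winS_lty.
apply: (@tcont_integrable _ plane R leb2 (R * R)%type small2 tau2 sm2 mt2 pt2 (winR B) mW).
exact: tcont2_set.
Qed.

End plane_translation.

(** * Gauge transformation *)

Section gauge.
Context {R : realType}.
Notation mu := (@lebesgue_measure R).
Notation plane := (measurableTypeR R * measurableTypeR R)%type.
Local Notation leb2 := (mu \x mu)%E.
Implicit Types (x y z d q v w : R * R) (K f b k : R * R -> R) (e c : R).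

Lemma sq_int_locint f : sq_int leb2 f -> locint f.
Proof.
move=> sf B; have sB : sq_int leb2 (boxR B).
  split; first exact: mfun_boxR.
  rewrite (_ : (fun x => _) = (fun x => (boxR B x)%:E)); first exact: integral_boxR.
  by apply/funext => x; rewrite boxRE expr2 -natrM mulnb andbb.
exact: (sq_int_mul sB sf).
Qed.

Lemma cbox_boxR (B : R) : cbox (boxR B).
Proof.
split; first exact: mfun_boxR.
by exists 1, B => x; rewrite mul1r ger0_norm ?boxR_ge0.
Qed.

Lemma locint_lin f g (al be al' be' : R) : locint f -> locint g ->
  locint (fun x => (al * x.1 + be * x.2) * f x + (al' * x.1 + be' * x.2) * g x).
Proof.
move=> lf lg B.
have := integrableDr (ikernel_locM lf (cbox_lin al be (cbox_boxR B)))
  (ikernel_locM lg (cbox_lin al' be' (cbox_boxR B))).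
by congr (integrable _ _ _); apply/funext => x /=; congr EFin; ring.
Qed.

Lemma locint_radial f g : locint f -> locint g -> locint (fun x => x.1 * f x + x.2 * g x).
Proof.
move=> lf lg; have := locint_lin 1 0 0 1 lf lg; congr locint.
by apply/funext => x; ring.
Qed.

Lemma locint_angular f g : locint f -> locint g -> locint (fun x => - x.2 * f x + x.1 * g x).
Proof.
move=> lf lg; have := locint_lin 0 (-1) 1 0 lf lg; congr locint.
by apply/funext => x; ring.
Qed.

Lemma locintN f : locint f -> locint (fun x => - f x).
Proof.
move=> lf B; have := integrableZr_real (-1) (lf B).
by congr (integrable _ _ _); apply/funext => x /=; congr EFin; ring.
Qed.

Lemma avgN K f z : cker K -> locint f -> avg K (fun x => - f x) z = - avg K f z.
Proof.
move=> hK lf; have i := avg_integrable z hK lf.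
have := Rintegral_lin (-1) 0 i i; rewrite mul0r addr0 mulN1r => <-.
by apply: eq_Rintegral => x _; ring.
Qed.

Lemma lfun_avg K f : cker K -> locint f -> lfun (avg K f).
Proof.
move=> hK lf; split; last exact: avg_cont.
rewrite /mfun2 (_ : avg K f = cconv (khat K) (f \o logpolar)); last first.
  by apply/funext => y; exact: avg_cconv.
apply: conv_meas; first exact: khat_meas (cker_meas hK).
exact: (measurableT_comp (locint_meas lf) (@measurable_logpolar R)).
Qed.

Lemma C1l_avg e c f : 0 < e <= 1 / 4 -> locint f ->
  C1l (avg (ka e c) f) (avg (kas e c) f) (avg (kat e c) f).
Proof.
move=> he lf; have e0 : e != 0 by case/andP: he => h _; rewrite gt_eqF.
have h0 := cker_ka c he; have h1 := cker_kas c he; have h2 := cker_kat c he.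
split; try exact: lfun_avg.
move=> y d t; exact: (@avg_derive R _ _ _ f y d t h0 h1 h2 lf (fun x r => is_derive_moll_line c y d x r e0)).
Qed.

Section rotation.
Variables (a : R) (v1 v2 : R * R -> R).

Definition rot1 z : R := cos (a * z.2) * v1 z + sin (a * z.2) * v2 z.
Definition rot2 z : R := cos (a * z.2) * v2 z - sin (a * z.2) * v1 z.

Lemma rot_sq z : rot1 z ^+ 2 + rot2 z ^+ 2 = v1 z ^+ 2 + v2 z ^+ 2.
Proof.
rewrite /rot1 /rot2; have := cos2Dsin2 (a * z.2).
move: (cos _) (sin _) (v1 z) (v2 z) => c s p q h; transitivity ((c ^+ 2 + s ^+ 2) * (p ^+ 2 + q ^+ 2)).
  ring.
by rewrite h mul1r.
Qed.

Lemma rot_equivariant : periodic2 v1 -> periodic2 v2 -> equivariant a rot1 rot2.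
Proof.
move=> p1 p2 s t; rewrite /rot1 /rot2/= p1 p2 (_ : a * (t + 2 * pi) = a * t + 2 * pi * a); last by ring.
rewrite cosD sinD; split; ring.
Qed.

End rotation.

Lemma lfun_cos a : lfun (fun z => cos (a * z.2) : R).
Proof.
split; first by rewrite /mfun2; mfun.
move=> y d t; apply: is_derive_cont; rewrite /=; apply: is_derive_eq.
Qed.

Lemma lfun_sin a : lfun (fun z => sin (a * z.2) : R).
Proof.
split; first by rewrite /mfun2; mfun.
move=> y d t; apply: is_derive_cont; rewrite /=; apply: is_derive_eq.
Qed.

Lemma lfunN a : lfun a -> lfun (fun z => - a z).
Proof.
move=> la; have c : lfun (fun=> -1 : R).
  by split; [exact: measurable_cst|move=> y d t; exact: cvg_cst].
have := lfunM c la; congr lfun; apply/funext => z; ring.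
Qed.

Lemma lfun_rot1 a (v1 v2 : R * R -> R) : lfun v1 -> lfun v2 -> lfun (rot1 a v1 v2).
Proof. by move=> l1 l2; apply: lfunD; apply: lfunM => //; [exact: lfun_cos|exact: lfun_sin]. Qed.

Lemma lfun_rot2 a (v1 v2 : R * R -> R) : lfun v1 -> lfun v2 -> lfun (rot2 a v1 v2).
Proof.
move=> l1 l2; apply: (@lfunD R (fun z => cos (a * z.2) * v2 z) (fun z => - (sin (a * z.2) * v1 z))).
  by apply: lfunM => //; exact: lfun_cos.
by apply: lfunN; apply: lfunM => //; exact: lfun_sin.
Qed.

(* Conjugating by [e^(-i a theta)] turns [d_theta - i a] into [d_theta]. *)
Lemma C1l_rot a (v1 v2 v11 v12 v21 v22 r1 r2 : R * R -> R) :
  C1l v1 v11 v12 -> C1l v2 v21 v22 -> lfun r1 -> lfun r2 ->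
  (forall z, v12 z = r1 z - a * v2 z) -> (forall z, v22 z = r2 z + a * v1 z) ->
  C1l (rot1 a v1 v2) (rot1 a v11 v21) (rot1 a r1 r2) /\
  C1l (rot2 a v1 v2) (rot2 a v11 v21) (rot2 a r1 r2).
Proof.
move=> [l1 l11 l12 d1] [l2 l21 l22 d2] k1 k2 E1 E2.
have dd y d t : is_derive t (1 : R) (fun t => a * (line y d t).2) (a * d.2).
  by rewrite /=; apply: is_derive_eq; rewrite /GRing.scale/=; ring.
have dc y d t : is_derive t (1 : R) (fun t => cos (a * (line y d t).2))
    (- sin (a * (line y d t).2) * (a * d.2)).
  exact: is_derive_comp1 (fun s => is_derive_cos s) (dd y d t).
have ds y d t : is_derive t (1 : R) (fun t => sin (a * (line y d t).2))
    (cos (a * (line y d t).2) * (a * d.2)).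
  exact: is_derive_comp1 (fun s => is_derive_sin s) (dd y d t).
split.
  split; try exact: lfun_rot1.
  move=> y d t; have c := dc y d t; have s := ds y d t; have a1 := d1 y d t; have a2 := d2 y d t.
  rewrite /rot1; apply: is_derive_eq; rewrite /GRing.scale/= -/(line y d t) E1 E2; ring.
split; try exact: lfun_rot2.
move=> y d t; have c := dc y d t; have s := ds y d t; have a1 := d1 y d t; have a2 := d2 y d t.
rewrite /rot2; apply: is_derive_eq; rewrite /GRing.scale/= -/(line y d t) E1 E2; ring.
Qed.

(** A full turn is the identity, so only the flux modulo integers is visible on the cylinder. This
    is what allows [|al| <= 1/2]. *)
Lemma equivariant_shift (al : R) (n : int) (a1 a2 : R * R -> R) :
  equivariant (al + n%:~R) a1 a2 -> equivariant al a1 a2.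
Proof.
have P : 2 * pi * (al + n%:~R) = 2 * pi * al + pi *~ (2 * n) :> R.
  by rewrite mulrDr -[pi *~ _]mulrzl intrM; ring.
have T (x : R) : cos (x + pi *~ (2 * n)) = cos x /\ sin (x + pi *~ (2 * n)) = sin x.
  have N (m : nat) (u : R) : cos (u + pi *+ (2 * m)) = cos u /\ sin (u + pi *+ (2 * m)) = sin u.
    elim: m u => [|m ih] u; first by rewrite muln0 mulr0n addr0.
    have [i1 i2] := ih u.
    by rewrite mulnS mulrnDr addrCA addrC cosD2pi sinD2pi.
  case: n {P} => m.
    have [c s] := N m x; have -> : pi *~ (2 * Posz m) = pi *+ (2 * m) :> R by [].
    by [].
  have [c s] := N m.+1 (x + pi *~ (2 * Negz m)).
  have E : x + pi *~ (2 * Negz m) + pi *+ (2 * m.+1) = x.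
    rewrite -addrA (_ : pi *~ (2 * Negz m) + _ = 0) ?addr0//.
    rewrite -[pi *~ _]mulrzl intrM NegzE mulrNz -[pi *+ _]mulr_natl natrM; ring.
  by rewrite E in c s.
by move=> e s t; have := e s t; rewrite P; have [-> ->] := T (2 * pi * al).
Qed.

End gauge.

(** * Convergence of the averages *)

Section approximate_identity.
Context {R : realType}.
Notation mu := (@lebesgue_measure R).
Notation plane := (measurableTypeR R * measurableTypeR R)%type.
Local Notation leb2 := (mu \x mu)%E.
Implicit Types (x y z : R * R) (f k p : R * R -> R).

Definition band (B : R) z : R := \1_(`](- B)%R, B] : set R) z.1.

Lemma bandE B z : band B z = (- B < z.1 <= B)%R%:R.
Proof. by rewrite /band indicE mem_setE/= in_itv. Qed.

Lemma band_ge0 B z : 0 <= band B z.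
Proof. by rewrite bandE. Qed.

Lemma stripE z : strip z = (- pi < z.2 <= pi)%R%:R :> R.
Proof. by rewrite /strip indicE mem_setE/= in_itv. Qed.

Lemma mfun_band B : mfun2 (band B).
Proof.
rewrite /mfun2 /band.
apply: (measurableT_comp (measurable_indic _) measurable_fst).
exact: measurable_itv.
Qed.

(** The half-height 5 exceeds [pi + 1/2], so a point of the strip moved by less than [1/2] stays
    inside, and is less than [3 pi], so three shifted strips cover the rectangle. *)
Definition rect (B : R) z : R := band B z * \1_(`](- 5)%R, 5] : set R) z.2.

Lemma rectE B z : rect B z = ((- B < z.1 <= B)%R && (- 5 < z.2 <= 5)%R)%:R.
Proof. by rewrite /rect bandE indicE mem_setE/= in_itv/= -natrM mulnb. Qed.

Lemma mfun_rect B : mfun2 (rect B).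
Proof.
rewrite /mfun2 /rect; apply: measurable_funM; first exact: mfun_band.
apply: (measurableT_comp (measurable_indic _) measurable_snd).
exact: measurable_itv.
Qed.

Lemma locint_logpolar_meas f : locint f -> mfun2 (f \o logpolar).
Proof. by move=> lf; exact: (measurableT_comp (locint_meas lf) (@measurable_logpolar R)). Qed.

Lemma band_logpolar_lty f B : locint f ->
  (\int[mS]_z (band B z * `|f (logpolar z)|)%:E < +oo)%E.
Proof.
move=> lf; have ml := locint_logpolar_meas lf; have mf := locint_meas lf.
have /integrableP[_ fin] := lf (expR B).
have mb := @mfun_boxR R (expR B).
pose H x := `|boxR (expR B) x * f x|.
have mH : measurable_fun setT (fun x : plane => (H x)%:E).
  by rewrite /mfun2 in mb mf; apply/measurable_EFinP; rewrite /H; mfun.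
have HE : (\int[leb2]_x (H x)%:E < +oo)%E by [].
rewrite (ge0_integral_logpolar mH (fun x => normr_ge0 _)) in HE.
have mHl : measurable_fun setT (fun z : plane => ((expR z.1 ^+ 2)%:E * (H (logpolar z))%:E)%E).
  apply: emeasurable_funM; first by apply/measurable_EFinP; mfun.
  exact: (measurableT_comp mH (@measurable_logpolar R)).
(* On the band the Jacobian [e^(2 s)] is at least [e^(- 2 B)], and the image of the band lies in the
   box of half-width [e^B]. *)
apply: (@le_lt_trans _ _ ((expR (2 * B))%:E * \int[mS]_z ((expR z.1 ^+ 2)%:E * (H (logpolar z))%:E))%E).
  rewrite -ge0_integralZl//; last first.
    by move=> z _; rewrite mule_ge0// lee_fin ?sqr_ge0 ?normr_ge0.
  apply: ge0_le_integral => //.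
  - by move=> z _; rewrite lee_fin mulr_ge0 ?band_ge0.
  - have mB := mfun_band B; rewrite /mfun2 in mB ml; apply/measurable_EFinP.
    by apply: measurable_funM => //; exact: (measurableT_comp (@normr_measurable _ setT)).
  - exact: measurable_funeM.
  - move=> z _; rewrite -!EFinM lee_fin bandE.
    case: (boolP (- B < z.1 <= B)) => [/andP[z1 z2]|_]; last first.
      by rewrite mul0r; apply: mulr_ge0; [exact: expR_ge0|apply: mulr_ge0; [exact: sqr_ge0|exact: normr_ge0]].
    rewrite mul1r /H.
    have E : expR z.1 <= expR B by rewrite ler_expR.
    have -> : boxR (expR B) (logpolar z) = 1.
      have k (s : R) : `|s| <= 1 -> - expR B <= expR z.1 * s <= expR B.
        move=> s1; rewrite -ler_norml normrM (ger0_norm (expR_ge0 _)) -[leRHS]mulr1.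
        by apply: ler_pM => //; exact: expR_ge0.
      rewrite boxRE /logpolar/=.
      have c1 : `|cos z.2| <= 1 by rewrite ler_norml cos_geN1 cos_le1.
      have s1 : `|sin z.2| <= 1 by rewrite ler_norml sin_geN1 sin_le1.
      by rewrite !ler_norml !k.
    rewrite mul1r mulrA -[leLHS]mul1r; apply: ler_wpM2r; first exact: normr_ge0.
    rewrite -expRM_natl -expRD -[leLHS]expR0 ler_expR -mulrDr mulr_ge0//.
    by rewrite -lerBlDl sub0r ltW.
by rewrite lte_mul_pinfty// lee_fin expR_ge0.
Qed.

(** The rectangle is covered by three strips, each of which contributes the integral over the band
    of the cylinder. *)
Lemma rect_integrable f B : locint f ->
  leb2.-integrable setT (EFin \o (fun z : plane => f (logpolar z) * rect B z)).
Proof.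
move=> lf; have ml := locint_logpolar_meas lf; have mr := mfun_rect B.
have mB := mfun_band B; have ms := @mfun_strip R.
rewrite /mfun2 in ml mr mB ms.
have mal : measurable_fun setT (fun z : plane => `|f (logpolar z)|).
  exact: (measurableT_comp (@normr_measurable _ setT) ml).
pose F z := (band B z * `|f (logpolar z)|)%:E.
have mF : measurable_fun setT (F : plane -> \bar R).
  by apply/measurable_EFinP; exact: measurable_funM.
have F0 z : (0 <= F z)%E by rewrite lee_fin mulr_ge0 ?band_ge0.
have pF : periodic2 F by move=> s t; rewrite /F periodic_logpolar /band.
have sc (c : R * R) : (\int[leb2]_z ((strip (z + c)%R)%:E * F z) = \int[mS]_z F z)%E.
  rewrite -(ge0_integral_strip (F := F) (- c) mF F0 pF).
  pose G z := ((strip z)%:E * F (- c + z)%R)%E.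
  have mG : measurable_fun setT (G : plane -> \bar R).
    apply: emeasurable_funM; first exact/measurable_EFinP.
    by under eq_fun do rewrite addrC; exact: (measurableT_comp mF (measurable_translate2 (- c))).
  rewrite -[RHS](ge0_integral_leb2_translate c mG); last first.
    by move=> z; rewrite mule_ge0// lee_fin strip_ge0.
  by apply: eq_integral => z _; rewrite /G (_ : - c + (z + c) = z)// addrC addrK.
apply/integrableP; split; first by apply/measurable_EFinP; exact: measurable_funM.
pose c : R * R := (0, 2 * pi).
have mst (d : R * R) : measurable_fun setT (fun z : plane => ((strip (z + d)%R)%:E * F z)%E).
  apply: emeasurable_funM => //; apply/measurable_EFinP.
  exact: (measurableT_comp ms (measurable_translate2 d)).
apply: (@le_lt_trans _ _ (\int[leb2]_z ((strip (z + c)%R)%:E * F z + ((strip (z + 0)%R)%:E * F z + (strip (z + - c)%R)%:E * F z)))%E).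
  apply: ge0_le_integral => //.
  - apply: (measurableT_comp (@abse_measurable _ setT)); apply/measurable_EFinP.
    exact: measurable_funM.
  - by do 2 apply: emeasurable_funD => //.
  - move=> z _; rewrite /= -!EFinM -!EFinD lee_fin /F !stripE rectE bandE /c/=.
    rewrite normrM -!mulrDl mulrC.
    case: (boolP (- B < z.1 <= B)) => h1; last by rewrite /= normr0 !mul0r !mulr0.
    rewrite mul1r; apply: ler_wpM2r; first exact: normr_ge0.
    have pi2 := @pi_ge2 R.
    case: (boolP (- 5 < z.2 <= 5)) => h2; last by rewrite /= normr0 !addr_ge0.
    rewrite /= normr1 addr0.
    have [z0|z0] := leP z.2 (- pi).
      have -> : - pi < z.2 + 2 * pi <= pi by lra.
      by rewrite lerDl addr_ge0.
    have [z1|z1] := leP z.2 pi.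
      by rewrite /= addrCA lerDl addr_ge0.
    have -> : - pi < z.2 - 2 * pi <= pi by lra.
    by rewrite addrA lerDr addr_ge0.
have s0 (d : R * R) z : (0 <= (strip (z + d)%R)%:E * F z)%E.
  by rewrite mule_ge0// lee_fin strip_ge0.
rewrite ge0_integralD//; last 2 first.
- by move=> z _; rewrite adde_ge0.
- by apply: emeasurable_funD.
rewrite ge0_integralD//.
have L d : (\int[leb2]_z ((strip (z + d)%R)%:E * F z) < +oo)%E by rewrite sc; exact: band_logpolar_lty.
by apply: lte_add_pinfty; [exact: L|apply: lte_add_pinfty; exact: L].
Qed.

Lemma cconv_periodic k p : periodic2 p -> periodic2 (cconv k p).
Proof.
move=> pp s t; rewrite /cconv; apply: eq_Rintegral => z _; congr (_ * _).
rewrite (_ : (s, t + 2 * pi) + z = (s + z.1, (t + z.2) + 2 * pi)).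
  by rewrite pp.
by apply: injective_projections => //=; rewrite addrAC.
Qed.

(** A kernel of mass 1 lets [p y] itself be written under the integral. If the right-hand side is
    infinite there is nothing to prove. *)
Lemma cconv_error k p y : ikernel k -> (forall z, 0 <= k z) ->
  (\int[leb2]_z (k z)%:E = 1)%E -> mfun2 p ->
  ((`|cconv k p y - p y|)%:E <= \int[leb2]_z (k z * `|p (y + z) - p y|)%:E)%E.
Proof.
move=> ik k0 k1 mp; have mk := ikernel_meas ik; have my := mfun2_shift y mp.
rewrite /mfun2 in mk my.
pose g z := k z * (p (y + z) - p y).
have mg : measurable_fun setT (g : plane -> R) by rewrite /g; mfun.
have EG : (\int[leb2]_z (k z * `|p (y + z) - p y|)%:E = \int[leb2]_z (`|g z|)%:E)%E.
  by apply: eq_integral => z _; rewrite /g normrM ger0_norm.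
rewrite EG; have [->|h] := eqVneq (\int[leb2]_z (`|g z|)%:E)%E +oo%E; first exact: leey.
have ig : ikernel g.
  apply/integrableP; split; first exact/measurable_EFinP.
  by rewrite lt_neqAle leey andbT.
have -> : cconv k p y - p y = \int[leb2]_z g z.
  have R1 : \int[leb2]_z k z = 1 by rewrite /Rintegral k1.
  have L := Rintegral_lin 1 (p y) ig ik; rewrite R1 mulr1 mul1r in L.
  rewrite -[LHS](addrK (p y)) -[in X in X + _ - _](subrK (p y) (cconv k p y)).
  apply/eqP; rewrite addrK subrK subr_eq -L; apply/eqP; apply: eq_Rintegral => z _.
  by rewrite /g; ring.
exact: abs_Rintegral_le.
Qed.

Lemma rect_window B p y z : `|z.1| < 1 / 2 -> `|z.2| < 1 / 2 ->
  strip y * band B y * `|p (y + z) - p y| <=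
  `|p (y + z) * rect (B + 1) (y + z) - p y * rect (B + 1) y|.
Proof.
have p4 : (pi : R) < 4 by have /andP[] := pihalf_02 R; lra.
rewrite !rectE stripE bandE -natrM mulnb.
case: (boolP (_ && _)) => [|_]; last by rewrite mul0r.
move=> /andP[/andP[a b] /andP[c d]]; rewrite mul1r /=.
rewrite !ltr_norml => /andP[e1 e2] /andP[e3 e4].
have -> : - (B + 1) < y.1 + z.1 <= B + 1 by lra.
have -> : - (B + 1) < y.1 <= B + 1 by lra.
have -> : - 5 < y.2 + z.2 <= 5 by lra.
have -> : - 5 < y.2 <= 5 by lra.
by rewrite /= !mulr1 mul1r.
Qed.

Lemma integral_le_window (k0 eta : R) B p z : mfun2 p -> 0 <= k0 ->
  `|z.1| < 1 / 2 -> `|z.2| < 1 / 2 ->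
  (\int[leb2]_y (`|p (y + z) * rect (B + 1) (y + z) - p y * rect (B + 1) y|)%:E <= eta%:E)%E ->
  (\int[leb2]_y (k0 * (strip y * band B y * `|p (y + z) - p y|))%:E <= (eta * k0)%:E)%E.
Proof.
move=> mp k00 z1 z2 h.
have mpz : mfun2 (fun y => p (y + z)) by exact: (measurableT_comp mp (measurable_translate2 z)).
have mr := mfun_rect (B + 1).
have mrz : mfun2 (fun y => rect (B + 1) (y + z)).
  exact: (measurableT_comp mr (measurable_translate2 z)).
have mB := mfun_band B; have ms := @mfun_strip R; rewrite /mfun2 in mp mpz mr mrz mB ms.
have m1 : measurable_fun setT (fun y : plane => (k0 * (strip y * band B y * `|p (y + z) - p y|))%:E).
  apply/measurable_EFinP; apply: measurable_funM; first exact: measurable_cst.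
  apply: measurable_funM; first by apply: measurable_funM; [exact: ms|exact: mB].
  by apply: (measurableT_comp (@normr_measurable _ setT)); apply: measurable_funB.
have m2 : measurable_fun setT (fun y : plane =>
    (`|p (y + z) * rect (B + 1) (y + z) - p y * rect (B + 1) y|)%:E).
  apply/measurable_EFinP; apply: (measurableT_comp (@normr_measurable _ setT)).
  by apply: measurable_funB; apply: measurable_funM.
rewrite mulrC EFinM; apply: le_trans (lee_wpmul2l _ h); last by rewrite lee_fin.
rewrite -(ge0_integralZl leb2 measurableT m2 (fun y _ => normr_ge0 _)); last by rewrite lee_fin.
apply: ge0_le_integral; [exact: measurableT| |exact: m1|exact: measurable_funeM|].
- move=> y _; rewrite lee_fin mulr_ge0//; apply: mulr_ge0; last exact: normr_ge0.
  by rewrite mulr_ge0 ?strip_ge0 ?band_ge0.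
- by move=> y _; rewrite -EFinM lee_fin; apply: ler_wpM2l => //; exact: rect_window.
Qed.

(* The window of radius [B] is enlarged by one, so that continuity of
   translations in [L^1] applies to the cut-off of [f \o logpolar]. *)
Lemma approximate_identity f B (eta : R) : locint f -> 0 < eta ->
  exists2 del, 0 < del & forall k, ikernel k -> (forall z, 0 <= k z) ->
    (\int[leb2]_z (k z)%:E = 1)%E ->
    (forall z, k z != 0 -> `|z.1| < del /\ `|z.2| < del) ->
    (\int[mS]_y (band B y * `|cconv k (f \o logpolar) y - f (logpolar y)|)%:E <= eta%:E)%E.
Proof.
move=> lf eta0; have ml := locint_logpolar_meas lf; pose p := f \o logpolar.
have mp : mfun2 p by [].
pose Fb z := p z * rect (B + 1) z.
pose M : R := Num.max (B + 1) 5.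
have mr := mfun_rect (B + 1).
have mFb : mfun2 Fb by apply: measurable_funM.
have FbE : (fun z => Fb z * \1_(winR M) z) = Fb.
  apply/funext => z; rewrite /Fb rectE; case: (boolP (_ && _)) => h; last by rewrite mulr0 mul0r.
  rewrite indicE (_ : z \in winR M) ?mulr1//; apply/mem_set.
  move: h => /andP[/andP[a b] /andP[c d]]; rewrite /winR /winS/=.
  have m1 : B + 1 <= M by rewrite le_max lexx.
  have m2 : 5 <= M by rewrite le_max lexx orbT.
  by rewrite !in_itv/=; split; apply/andP; split; lra.
have [del d0 hdel] : exists2 del, 0 < del & forall h : R * R, small2 del h ->
    (\int[leb2]_z (`|Fb (z + h) - Fb z|)%:E <= eta%:E)%E.
  have T := @tcont2_window R M Fb mFb; rewrite FbE in T.
  have [del d0 hd] := T (rect_integrable _ lf) eta eta0.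
  by exists del.
exists (Num.min del (1 / 2)); first by rewrite lt_min d0/= divr_gt0.
move=> k ik k0 k1 ks; have mk := ikernel_meas ik.
have mcc := conv_meas mk mp; have mB := mfun_band B; have ms := @mfun_strip R.
pose P y := band B y * `|cconv k p y - p y|.
have mP : measurable_fun setT (fun y : plane => (P y)%:E).
  rewrite /mfun2 in mcc mB mp; apply/measurable_EFinP; rewrite /P.
  apply: measurable_funM; first exact: mB.
  apply: (measurableT_comp (@normr_measurable _ setT)); exact: measurable_funB.
have P0 y : (0 <= (P y)%:E)%E by rewrite lee_fin mulr_ge0 ?band_ge0.
have pp : periodic2 p by move=> s t; rewrite /p/= periodic_logpolar.
have pP : periodic2 (fun y => (P y)%:E).
  by move=> s t; rewrite /P (cconv_periodic _ pp) pp.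
rewrite -(ge0_integral_strip (F := fun y => (P y)%:E) 0 mP P0 pP).
pose H (w : plane * plane) := (k w.2 * ((strip w.1 * band B w.1) * `|p (w.1 + w.2) - p w.1|))%:E.
have mH : measurable_fun setT H.
  apply/measurable_EFinP; rewrite /mfun2 in mk ms mB mp.
  apply: measurable_funM; first exact: (measurableT_comp mk measurable_snd).
  apply: measurable_funM; first apply: measurable_funM.
  - exact: (measurableT_comp ms measurable_fst).
  - exact: (measurableT_comp mB measurable_fst).
  apply: (measurableT_comp (@normr_measurable _ setT)); apply: measurable_funB.
    exact: (measurableT_comp mp measurable_sum2).
  exact: (measurableT_comp mp measurable_fst).
have H0 w : (0 <= H w)%E by rewrite lee_fin !mulr_ge0 ?strip_ge0 ?band_ge0.
have mIy : measurable_fun setT (fun y : plane => \int[leb2]_z H (y, z))%E.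
  rewrite (_ : (fun y => _) = fubini_F leb2s H); last first.
    by apply/funext => y; rewrite /fubini_F integral_leb2s.
  exact: measurable_fun_fubini_tonelli_F.
apply: (@le_trans _ _ (\int[leb2]_y \int[leb2]_z H (y, z))%E).
  apply: ge0_le_integral => //.
  - by move=> y _; rewrite mule_ge0// lee_fin strip_ge0.
  - apply: emeasurable_funM; first exact/measurable_EFinP.
    by rewrite (_ : (fun y => _) = (fun y => (P y)%:E))//; apply/funext => y; rewrite add0r.
  - move=> y _; rewrite add0r.
    apply: (@le_trans _ _ ((strip y * band B y)%:E * \int[leb2]_z (k z * `|p (y + z) - p y|)%:E)%E).
      rewrite -EFinM /P mulrA EFinM; apply: lee_wpmul2l; first by rewrite lee_fin mulr_ge0 ?strip_ge0 ?band_ge0.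
      exact: cconv_error.
    have myz := mfun2_shift y mp.
    rewrite -ge0_integralZl//; last 3 first.
    - apply/measurable_EFinP; rewrite /mfun2 in mk myz; apply: measurable_funM; first exact: mk.
      by apply: (measurableT_comp (@normr_measurable _ setT)); apply: measurable_funB.
    - by move=> z _; rewrite lee_fin mulr_ge0.
    - by rewrite lee_fin mulr_ge0 ?strip_ge0 ?band_ge0.
    rewrite le_eqVlt; apply/orP; left; apply/eqP; apply: eq_integral => z _.
    by rewrite /H/= -EFinM; congr EFin; ring.
have FT := @fubini_tonelli _ _ plane plane R leb2s leb2s H mH H0.
have -> : (\int[leb2]_y \int[leb2]_z H (y, z) = \int[leb2]_z \int[leb2]_y H (y, z))%E.
  rewrite -integral_leb2s -[RHS]integral_leb2s.
  transitivity (\int[leb2s]_y \int[leb2s]_z H (y, z))%E.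
    by apply: eq_integral => y _; rewrite integral_leb2s.
  by rewrite FT; apply: eq_integral => z _; rewrite integral_leb2s.
have mIz : measurable_fun setT (fun z : plane => \int[leb2]_y H (y, z))%E.
  rewrite (_ : (fun y => _) = fubini_G leb2s H); last first.
    by apply/funext => y; rewrite /fubini_G integral_leb2s.
  exact: measurable_fun_fubini_tonelli_G.
apply: (@le_trans _ _ (\int[leb2]_z (eta%:E * (k z)%:E))%E); last first.
  have mkE : measurable_fun setT (fun z : plane => (k z)%:E) by exact/measurable_EFinP.
  have e0 : (0 <= eta%:E)%E by rewrite lee_fin ltW.
  have -> := ge0_integralZl leb2 measurableT mkE (fun z _ => k0 z) e0.
  by rewrite k1 mule1.
apply: ge0_le_integral; [exact: measurableT| |exact: mIz| |].
- by move=> z _; apply: integral_ge0 => y _; exact: H0.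
- by apply: measurable_funeM; exact/measurable_EFinP.
move=> z _; have [kz|kz] := eqVneq (k z) 0.
  have -> : (\int[leb2]_y H (y, z) = 0)%E.
    by apply: integral0_eq => y _; rewrite /H/= kz (mul0r (_ * _)).
  by rewrite kz mule0 lexx.
have [s1 s2] := ks z kz; rewrite !lt_min in s1 s2.
move: s1 s2 => /andP[s1 s1'] /andP[s2 s2'].
exact: (integral_le_window mp (k0 z) s1' s2' (hdel z (conj s1 s2))).
Qed.

End approximate_identity.

(** * Consequences of Fatou's lemma *)

Section fatou_corollaries.
Context d (T : measurableType d) (R : realType) (m : {measure set T -> \bar R}).
Implicit Types (f : T -> R).

(** Fatou's lemma as an eventual strict lower bound, the form that combines with other eventual
    estimates along the sequence. *)
Lemma fatou_lower (f_ : nat -> T -> R) f (b : \bar R) :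
  (forall n, measurable_fun setT (f_ n)) -> measurable_fun setT f ->
  (forall n x, 0 <= f_ n x) -> (forall x, 0 <= f x) ->
  {ae m, forall x, f_ ^~ x @ \oo --> f x} ->
  (b < \int[m]_x (f x)%:E)%E -> \forall n \near \oo, (b < \int[m]_x (f_ n x)%:E)%E.
Proof.
move=> mf_ mf f_0 f0 ae_f bf.
have mE n : measurable_fun setT (fun x => (f_ n x)%:E) by exact/measurable_EFinP.
have F := @fatou _ T R m setT measurableT (fun n x => (f_ n x)%:E) mE
  (fun n x _ => f_0 n x).
have mi : measurable_fun setT (fun x => limn_einf (fun n => (f_ n x)%:E)).
  have := @measurable_fun_limn_esup _ T R setT (fun n x => (- (f_ n x)%:E)%E)
    (fun n => measurableT_comp (@oppe_measurable _ _) (mE n)).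
  by move=> h; rewrite /limn_einf; exact: (measurableT_comp (@oppe_measurable _ _) h).
have E : (\int[m]_x limn_einf (fun n => (f_ n x)%:E) = \int[m]_x (f x)%:E)%E.
  apply: ge0_ae_eq_integral => //.
  - exact/measurable_EFinP.
  - move=> x _; rewrite limn_einf_lim; apply: lime_ge; first exact: is_cvg_einfs.
    by apply: nearW => n; apply: le_ereal_inf_tmp => _ [k _ <-]; rewrite lee_fin.
  - by move=> x _; rewrite lee_fin.
  - move: ae_f; apply: filterS => x cx _.
    have := @cvg_limn_einf_sup R (fun n => (f_ n x)%:E) (f x)%:E.
    by case=> //; apply/fine_cvgP; split; [exact: nearW|exact: cx].
rewrite E limn_einf_lim in F.
have := lt_le_trans bf F; rewrite (cvg_lim _ (@cvg_einfs_sup R _))//.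
move=> /ereal_sup_gt[_ [N _ <-]] bN; exists N => // n /= Nn.
apply: (lt_le_trans bN); apply: ereal_inf_lbound; exists n => //.
Qed.

Lemma fatou_upper (f_ : nat -> T -> R) f (b : \bar R) :
  (forall n, measurable_fun setT (f_ n)) -> measurable_fun setT f ->
  (forall n x, 0 <= f_ n x) -> (forall x, 0 <= f x) ->
  {ae m, forall x, f_ ^~ x @ \oo --> f x} ->
  (\forall n \near \oo, (\int[m]_x (f_ n x)%:E <= b)%E) -> (\int[m]_x (f x)%:E <= b)%E.
Proof.
move=> mf_ mf f_0 f0 ae_f hb; rewrite leNgt; apply/negP => bf.
have [N _ h] := filterI hb (fatou_lower mf_ mf f_0 f0 ae_f bf).
by have [/= h1 h2] := h N (leqnn N); move: (lt_le_trans h2 h1); rewrite ltxx.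
Qed.

(** Summable integrals make the series of the [D n] finite almost everywhere, so its terms tend to 0
    along the whole sequence. *)
Lemma ae_cvg0_summable (D : nat -> T -> R) (C : R) :
  (forall n, measurable_fun setT (D n)) -> (forall n x, 0 <= D n x) ->
  (forall n, (\int[m]_x (D n x)%:E <= (C / (2 ^ n.+1)%:R)%:E)%E) ->
  {ae m, forall x, D ^~ x @ \oo --> 0}.
Proof.
move=> mD D0 iD.
have mE n : measurable_fun setT (fun x => (D n x)%:E) by exact/measurable_EFinP.
have E := @integral_nneseries _ T R m setT measurableT (fun n x => (D n x)%:E) mE
  (fun n x _ => D0 n x).
have C0 : 0 <= C.
  have := le_trans (integral_ge0 _ _) (iD 0%N); rewrite lee_fin => h.
  by have := h (fun x _ => D0 0%N x); rewrite pmulr_lge0// invr_gt0 ltr0n expn_gt0.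
have iS : m.-integrable setT (fun x => \sum_(n <oo) (D n x)%:E)%E.
  have S0 x : (0 <= \sum_(n <oo) (D n x)%:E)%E by apply: nneseries_ge0 => n _ _; rewrite lee_fin.
  apply/integrableP; split.
    have := @ge0_emeasurable_sum _ T R setT (fun n x => (D n x)%:E) predT.
    by apply => // n x _ _; rewrite lee_fin.
  under eq_integral do rewrite gee0_abs//.
  rewrite E; apply: le_lt_trans (ltry C).
  apply: le_trans (epsilon_trick0 predT C0).
  apply: lee_nneseries => n _; last exact: iD.
  by move=> _; apply: integral_ge0 => x _; rewrite lee_fin.
have := integrable_ae measurableT iS; apply: filterS => x /(_ I) fx.
apply: cvg_series_cvg_0.
apply: nondecreasing_is_cvgn.
  by apply: nondecreasing_series => n _ _; exact: D0.
exists (fine (\sum_(n <oo) (D n x)%:E)%E) => _ [n _ <-].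
rewrite -lee_fin fineK// /series/= -sumEFin.
by apply: (@nneseries_lim_ge R (fun n => (D n x)%:E) predT 0%N n) => i _ _; rewrite lee_fin.
Qed.

End fatou_corollaries.

(** * The sequence of mollifiers *)

Section mollification.
Context {R : realType}.
Notation mu := (@lebesgue_measure R).
Notation plane := (measurableTypeR R * measurableTypeR R)%type.
Local Notation leb2 := (mu \x mu)%E.
Implicit Types (x y z : R * R) (f k p : R * R -> R) (e c : R).

(** From [|x1 - 1| < e] and [|x2| < e] the radius lies between [1 - e] and [1 + 2 e], which controls
    [z.1]. The cosine of the angle then exceeds [1/2], and the mean value theorem gives
    [|z.2| / 2 <= |sin z.2|]. *)
Lemma khat_ka_supp e c z : 0 < e <= 1 / 4 -> khat (ka e c) z != 0 ->
  `|z.1| < 3 * e /\ `|z.2| < 3 * e.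
Proof.
move=> /andP[e0 e14]; rewrite /khat mulf_eq0 negb_or => /andP[zs].
rewrite mulf_eq0 negb_or => /andP[_]; rewrite /ka /bump2 mulf_eq0 negb_or => /andP[_].
rewrite mulf_eq0 negb_or => /andP[b1 b2].
have small (t : R) : bmp t != 0 -> `|t| < 1.
  by move=> h; rewrite ltNge; apply/negP => /bmp_out t1; rewrite t1 eqxx in h.
move: zs; rewrite stripE; case: (boolP (_ < _ <= _)) => [/andP[zp1 zp2] _|_]; last by rewrite eqxx.
have dv (t : R) : bmp (t / e) != 0 -> `|t| < e.
  by move=> /small; rewrite normrM normfV (gtr0_norm e0) ltr_pdivrMr// mul1r.
have := dv _ b1; have := dv _ b2; rewrite /logpolar/= => Y1 X1.
have r0 := expR_gt0 z.1; have r1 := expR_ge1Dx z.1; have r2 := expR_ge1Dx (- z.1).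
have cs := cos2Dsin2 z.2; have cle := cos_le1 z.2.
have rE : expR z.1 ^+ 2 = (expR z.1 * cos z.2) ^+ 2 + (expR z.1 * sin z.2) ^+ 2.
  by rewrite !exprMn -mulrDr cs mulr1.
rewrite !ltr_norml in X1 Y1; move: X1 Y1 => /andP[X1 X2] /andP[Y1 Y2].
have rN : expR (- z.1) * expR z.1 = 1 by rewrite expRN mulVf// gt_eqF.
have rl : 1 - e < expR z.1.
  apply: (@lt_le_trans _ _ (expR z.1 * cos z.2)); first by lra.
  by rewrite ler_piMr// ltW.
have ru : expR z.1 < 1 + 2 * e by nra.
have z1 : `|z.1| < 3 * e.
  have : expR (- z.1) < 1 + 2 * e.
    have rn0 := expR_gt0 (- z.1).
    nra.
  by rewrite ltr_norml => h; apply/andP; split; lra.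
split => //.
have c12 : 1 / 2 < cos z.2 by nra.
have key (t : R) : 0 <= t -> t <= pi -> 1 / 2 < cos t -> t / 2 <= sin t.
  move=> t0 tp ct.
  have [|xi] := @MVT_segment R sin cos 0 t t0.
    by apply: continuous_subspaceT => x; exact: continuous_sin.
  rewrite in_itv/= => /andP[x0 xt]; rewrite sin0 !subr0 => ->.
  rewrite mulrC; apply: ler_wpM2r => //.
  apply: (@le_trans _ _ (cos t)); first by lra.
  move: xt; rewrite le_eqVlt => /predU1P[->//|xt]; apply: ltW.
  by rewrite ltr_cos ?in_itv/= ?t0 ?x0 ?tp ?(le_trans (ltW xt)).
have [z20|z20] := leP 0 z.2.
  have := key _ z20 zp2 c12 => h; rewrite ltr_norml; apply/andP; split; nra.
have h : - z.2 / 2 <= sin (- z.2) by apply: key; rewrite ?cosN//; lra.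
rewrite sinN in h; rewrite ltr_norml; apply/andP; split; nra.
Qed.

Lemma ka_mass e : 0 < e <= 1 / 4 ->
  exists2 c, 0 <= c & (\int[leb2]_q (ka e c q)%:E = 1)%E.
Proof.
move=> he; have /andP[e0 e14] := he.
have hK := cker_ka 1 he.
have mb : mfun2 (bump2 e bmp bmp).
  have := cker_meas hK; rewrite /mfun2; congr measurable_fun.
  by apply/funext => q; rewrite /ka mul1r.
have b0 q : 0 <= bump2 e bmp bmp q by rewrite mulr_ge0 ?bmp_ge0.
have mE : measurable_fun setT (fun q : plane => (bump2 e bmp bmp q)%:E) by exact/measurable_EFinP.
have fin : (\int[leb2]_q (bump2 e bmp bmp q)%:E < +oo)%E.
  apply: le_lt_trans (@integral_boxR R 2); apply: ge0_le_integral => //.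
  - by move=> q _; rewrite lee_fin.
  - by apply/measurable_EFinP; exact: mfun_boxR.
  - move=> q _; rewrite lee_fin.
    have [->|h] := eqVneq (bump2 e bmp bmp q) 0; first exact: boxR_ge0.
    have [|h1 h2] := cker_supp hK (q := q); first by rewrite /ka mul1r.
    rewrite boxRE h1 h2 /bump2 -[leRHS]mulr1.
    by apply: ler_pM; rewrite ?bmp_ge0 ?bmp_le1.
have pos : (0 < \int[leb2]_q (bump2 e bmp bmp q)%:E)%E.
  (* For [|t| <= 1/2] both [1 + t] and [1 - t] are at least [1/2], so each factor of the bump is at
     least [e^(-2)]. *)
  pose b0' : R := expR (- 4).
  have bl (t : R) : `|t| <= 1 / 2 -> b0' <= bmp t.
    rewrite ler_norml => /andP[t1 t2]; rewrite /bmp /Eb.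
    have -> : 0 < 1 + t by lra.
    have -> : 0 < 1 - t by lra.
    rewrite !expr0 !mul1r -expRD ler_expR.
    have k (s : R) : 1 / 2 <= s -> s^-1 <= 2.
      by move=> s12; rewrite -[2]invrK lef_pV2 ?posrE; lra.
    have h1 : (1 + t)^-1 <= 2 by apply: k; lra.
    have h2 : (1 - t)^-1 <= 2 by apply: k; lra.
    lra.
  pose B : set plane := `[1 - e / 2, 1 + e / 2]%classic `*` `[- (e / 2), e / 2]%classic.
  have mB : measurable B by apply: measurableX; exact: measurable_itv.
  apply: (@lt_le_trans _ _ (\int[leb2]_q ((b0' ^+ 2)%:E * (\1_B q)%:E))%E).
    rewrite ge0_integralZl//; last 2 first.
    - by apply/measurable_EFinP; exact: measurable_indic.
    - by rewrite lee_fin sqr_ge0.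
    have l1 : mu `[1 - e / 2, 1 + e / 2]%classic = e%:E.
      by rewrite mu_itv_len; [congr EFin; field|lra].
    have l2 : mu `[- (e / 2), e / 2]%classic = e%:E.
      by rewrite mu_itv_len; [congr EFin; field|lra].
    have iB : (\int[leb2]_q (\1_B q)%:E = e%:E * e%:E)%E.
      rewrite integral_indic// setIT -{1}l1 -l2.
      by apply: product_measure1E; exact: measurable_itv.
    rewrite iB -!EFinM lte_fin; apply: mulr_gt0; last exact: mulr_gt0.
    by rewrite exprn_gt0// expR_gt0.
  apply: ge0_le_integral => //.
  - by move=> q _; rewrite -EFinM lee_fin; apply: mulr_ge0; [exact: sqr_ge0|rewrite indicE].
  - by apply: measurable_funeM; apply/measurable_EFinP; exact: measurable_indic.
  - move=> q _; rewrite -EFinM lee_fin indicE.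
    case: (boolP (q \in B)) => [/set_mem[]|_]; last by rewrite mulr0.
    rewrite /= !in_itv/= => /andP[q1 q2] /andP[q3 q4].
    rewrite mulr1 expr2 /bump2; apply: ler_pM; rewrite ?expR_ge0//.
      by apply: bl; rewrite normrM normfV (gtr0_norm e0) ler_pdivrMr// ler_norml; apply/andP; split; lra.
    by apply: bl; rewrite normrM normfV (gtr0_norm e0) ler_pdivrMr// ler_norml; apply/andP; split; lra.
set M := (\int[leb2]_q _)%E in fin pos.
have fM : M \is a fin_num by rewrite ge0_fin_numE// ltW.
exists (fine M)^-1; first by rewrite invr_ge0 fine_ge0// ltW.
have fM0 : 0 < fine M by apply: fine_gt0; rewrite pos.
transitivity (((fine M)^-1)%:E * M)%E; last first.
  by rewrite -[X in (_ * X)%E]fineK// -EFinM mulVf// gt_eqF.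
have c0 : (0 <= ((fine M)^-1)%:E)%E by rewrite lee_fin invr_ge0 ltW.
by rewrite -(ge0_integralZl leb2 measurableT mE (fun q _ => b0 q) c0).
Qed.

(** At step [n] both errors on the band of radius [n] are below [2^(-n-1)]. Summability gives
    convergence almost everywhere on growing bands, and one sequence of kernels serves both
    components. *)
Lemma mollifier_sequence f1 f2 : locint f1 -> locint f2 ->
  exists e_ c_ : nat -> R, (forall n, [/\ 0 < e_ n <= 1 / 4,
    forall z, 0 <= khat (ka (e_ n) (c_ n)) z &
    (\int[leb2]_z (khat (ka (e_ n) (c_ n)) z)%:E = 1)%E]) /\
  {ae mS, forall z, (fun n => cconv (khat (ka (e_ n) (c_ n))) (f1 \o logpolar) z) @ \oo
    --> f1 (logpolar z)} /\
  {ae mS, forall z, (fun n => cconv (khat (ka (e_ n) (c_ n))) (f2 \o logpolar) z) @ \oo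
    --> f2 (logpolar z)}.
Proof.
move=> l1 l2.
pose err n f e c := (\int[mS]_y (band n%:R y *
  `|cconv (khat (ka e c)) (f \o logpolar) y - f (logpolar y)|)%:E <= (1 / (2 ^ n.+1)%:R)%:E)%E.
have step n : exists ec : R * R, [/\ 0 < ec.1 <= 1 / 4,
    forall z, 0 <= khat (ka ec.1 ec.2) z,
    (\int[leb2]_z (khat (ka ec.1 ec.2) z)%:E = 1)%E, err n f1 ec.1 ec.2 & err n f2 ec.1 ec.2].
  have n0 : 0 < 1 / (2 ^ n.+1)%:R :> R by rewrite divr_gt0// ltr0n expn_gt0.
  have [d1 d10 h1] := approximate_identity n%:R l1 n0.
  have [d2 d20 h2] := approximate_identity n%:R l2 n0.
  pose e := Num.min (1 / 4) (Num.min d1 d2 / 3).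
  have m0 : 0 < Num.min d1 d2 by rewrite lt_min d10.
  have e0 : 0 < e by rewrite lt_min !divr_gt0.
  have e14 : e <= 1 / 4 by rewrite ge_min lexx.
  have he : 0 < e <= 1 / 4 by rewrite e0.
  have ed : 3 * e <= Num.min d1 d2.
    by rewrite mulrC -ler_pdivlMr// ge_min lexx orbT.
  have [c c0 mass] := ka_mass he; have hK := cker_ka c he.
  have K0 q : 0 <= ka e c q by apply: mulr_ge0 => //; apply: mulr_ge0; exact: bmp_ge0.
  have k1 : (\int[leb2]_z (khat (ka e c) z)%:E = 1)%E.
    by rewrite (integral_khat (cker_meas hK) K0).
  have k0 := khat_ge0 K0; have ik := ikernel_khat hK.
  exists (e, c); split => //.
  - apply: h1 => // z /(khat_ka_supp he)[z1 z2].
    have d1' : Num.min d1 d2 <= d1 by rewrite ge_min lexx.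
    by split; apply: lt_le_trans (le_trans ed d1').
  - apply: h2 => // z /(khat_ka_supp he)[z1 z2].
    have d2' : Num.min d1 d2 <= d2 by rewrite ge_min lexx orbT.
    by split; apply: lt_le_trans (le_trans ed d2').
have [ec hec] := choice step.
exists (fun n => (ec n).1), (fun n => (ec n).2); split; first by move=> n; have [] := hec n.
have conv f : locint f -> (forall n, err n f (ec n).1 (ec n).2) ->
  {ae mS, forall z, (fun n => cconv (khat (ka (ec n).1 (ec n).2)) (f \o logpolar) z) @ \oo
    --> f (logpolar z)}.
  move=> lf hf; have ml := locint_logpolar_meas lf.
  pose D n (z : plane) := band n%:R z * `|cconv (khat (ka (ec n).1 (ec n).2)) (f \o logpolar) z - f (logpolar z)|.
  have mD n : measurable_fun setT (D n).
    have [he _ _ _ _] := hec n.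
    have mB := @mfun_band R n%:R; have mc := conv_meas (khat_meas (cker_meas (cker_ka (ec n).2 he))) ml.
    rewrite /mfun2 in mB mc ml; apply: measurable_funM; first exact: mB.
    by apply: (measurableT_comp (@normr_measurable _ setT)); exact: measurable_funB.
  have D0 n z : 0 <= D n z by rewrite mulr_ge0 ?band_ge0.
  have := ae_cvg0_summable mD D0 hf; apply: filterS => z cz.
  apply/cvgrPdist_lt => eps eps0; move/cvgrPdist_lt: cz => /(_ _ eps0) cz.
  near=> n; rewrite distrC.
  have bz : band n%:R z = 1.
    rewrite bandE; have : `|z.1| < n%:R.
      by near: n; exact: nbhs_infty_gtr.
    by rewrite ltr_norml => /andP[-> /ltW ->].
  have : `|0 - D n z| < eps by near: n.
  by rewrite sub0r normrN (ger0_norm (D0 _ _)) /D bz mul1r.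
split; apply: conv => // n; by have [] := hec n.
Unshelve. all: by end_near. Qed.

End mollification.

(** * Even exponents *)

Lemma ae_cvg_norm2 d (T : measurableType d) (R : realType) (m : {measure set T -> \bar R})
    (f g : nat -> T -> R) (f0 g0 : T -> R) (n : nat) :
  {ae m, forall x, f ^~ x @ \oo --> f0 x} -> {ae m, forall x, g ^~ x @ \oo --> g0 x} ->
  {ae m, forall x, (fun k => (f k x ^+ 2 + g k x ^+ 2) ^+ n) @ \oo -->
    (f0 x ^+ 2 + g0 x ^+ 2) ^+ n}.
Proof.
have X (u : nat -> R) (l : R) k : u @ \oo --> l -> (fun i => u i ^+ k) @ \oo --> l ^+ k.
  move=> ul; elim: k => [|k ih]; first by under eq_fun do rewrite expr0; exact: cvg_cst.
  by under eq_fun do rewrite exprS; rewrite exprS; exact: cvgM.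
apply: filterS2 => x h1 h2; apply: (X).
by apply: cvgD; exact: (X).
Qed.

Section gauged_approximation.
Context {R : realType}.
Notation mu := (@lebesgue_measure R).
Notation plane := (measurableTypeR R * measurableTypeR R)%type.
Local Notation leb2 := (mu \x mu)%E.
Implicit Types (x y z : R * R) (f k b p w : R * R -> R).

Lemma avg_periodic K f : cker K -> locint f -> periodic2 (avg K f).
Proof.
move=> hK lf; rewrite (_ : avg K f = cconv (khat K) (f \o logpolar)); last first.
  by apply/funext => y; exact: avg_cconv.
by apply: cconv_periodic => s t; rewrite /= periodic_logpolar.
Qed.

Lemma cmod_sq (z : R[i]) : cmod z ^+ 2 = complex.Re z ^+ 2 + complex.Im z ^+ 2.
Proof. by case: z => r i; rewrite /cmod /= sqr_sqrtr// addr_ge0 ?sqr_ge0. Qed.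

Lemma L2_sq_int (u : R * R -> R[i]) : L2 u ->
  sq_int leb2 (fun x => complex.Re (u x)) /\ sq_int leb2 (fun x => complex.Im (u x)).
Proof.
move=> [[m1 m2] fin].
have mE : measurable_fun setT (fun x : plane => (cmod (u x) ^+ 2)%:E).
  apply/measurable_EFinP; under eq_fun do rewrite cmod_sq; mfun.
by split; split => //; apply: le_lt_trans fin; apply: ge0_le_integral => //;
  try (by move=> x _; rewrite lee_fin ?sqr_ge0);
  try (by apply/measurable_EFinP; mfun);
  move=> x _; rewrite lee_fin cmod_sq ?lerDl ?lerDr sqr_ge0.
Qed.

Lemma bounded2_pair b1 b2 w1 w2 : bounded2 b1 -> bounded2 b2 ->
  (forall z, w1 z ^+ 2 + w2 z ^+ 2 = b1 z ^+ 2 + b2 z ^+ 2) -> bounded2 w1 /\ bounded2 w2.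
Proof.
move=> [M1 M10 h1] [M2 M20 h2] E; have M0 : 0 <= M1 + M2 by rewrite addr_ge0.
have key r s z : r ^+ 2 + s ^+ 2 = b1 z ^+ 2 + b2 z ^+ 2 -> `|r| <= M1 + M2.
  move=> e; rewrite -[leRHS]ger0_norm// -ler_sqr ?nnegrE// !real_normK ?num_real//.
  apply: (@le_trans _ _ (M1 ^+ 2 + M2 ^+ 2)).
    apply: (@le_trans _ _ (b1 z ^+ 2 + b2 z ^+ 2)); first by rewrite -e lerDl sqr_ge0.
    by apply: lerD; rewrite -(real_normK (num_real (_ z))) ler_sqr ?nnegrE.
  by rewrite sqrrD -addrA addrCA lerDr mulrn_wge0// mulr_ge0.
by split; exists (M1 + M2) => // z; [exact: key (E z)|apply: key; rewrite addrC; exact: E].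
Qed.

Lemma sq_int_pair b1 b2 w1 w2 : mfun2 w1 -> mfun2 w2 ->
  (\int[mS]_z (b1 z ^+ 2 + b2 z ^+ 2)%:E < +oo)%E ->
  (forall z, w1 z ^+ 2 + w2 z ^+ 2 = b1 z ^+ 2 + b2 z ^+ 2) -> sq_int mS w1 /\ sq_int mS w2.
Proof.
move=> m1 m2 fin E; rewrite /mfun2 in m1 m2.
have mE : measurable_fun setT (fun z : plane => (b1 z ^+ 2 + b2 z ^+ 2)%:E).
  by apply/measurable_EFinP; under eq_fun do rewrite -E; mfun.
by split; split => //; apply: le_lt_trans fin; apply: ge0_le_integral => //;
  try (by move=> x _; rewrite lee_fin ?sqr_ge0);
  try (by apply/measurable_EFinP; mfun);
  move=> x _; rewrite lee_fin -E ?lerDl ?lerDr sqr_ge0.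
Qed.

Section data.
Variables (a al : R) (n0 : int) (u1 u2 g11 g12 g21 g22 : R * R -> R).
Hypothesis aE : a = al + n0%:~R.
Hypotheses (su1 : sq_int leb2 u1) (su2 : sq_int leb2 u2).
Hypotheses (sg11 : sq_int leb2 g11) (sg12 : sq_int leb2 g12).
Hypotheses (sg21 : sq_int leb2 g21) (sg22 : sq_int leb2 g22).
Hypothesis id11 : forall phi : R * R -> R, test_function phi ->
  \int[leb2]_x (g11 x * phi x) =
  \int[leb2]_x (- (u1 x * 'D_e1 phi x) - (potential a x).1 * u2 x * phi x).
Hypothesis id21 : forall phi : R * R -> R, test_function phi ->
  \int[leb2]_x (g21 x * phi x) =
  \int[leb2]_x (- (u1 x * 'D_e2 phi x) - (potential a x).2 * u2 x * phi x).
Hypothesis id12 : forall phi : R * R -> R, test_function phi ->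
  \int[leb2]_x (g12 x * phi x) =
  \int[leb2]_x (- (u2 x * 'D_e1 phi x) + (potential a x).1 * u1 x * phi x).
Hypothesis id22 : forall phi : R * R -> R, test_function phi ->
  \int[leb2]_x (g22 x * phi x) =
  \int[leb2]_x (- (u2 x * 'D_e2 phi x) + (potential a x).2 * u1 x * phi x).

Definition radial g1 g2 x : R := x.1 * g1 x + x.2 * g2 x.
Definition angular g1 g2 x : R := - x.2 * g1 x + x.1 * g2 x.

Let lu1 := sq_int_locint su1.
Let lu2 := sq_int_locint su2.
Let lr1 : locint (radial g11 g21) := locint_radial (sq_int_locint sg11) (sq_int_locint sg21).
Let lr2 : locint (radial g12 g22) := locint_radial (sq_int_locint sg12) (sq_int_locint sg22).
Let lt1 : locint (angular g11 g21) := locint_angular (sq_int_locint sg11) (sq_int_locint sg21).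
Let lt2 : locint (angular g12 g22) := locint_angular (sq_int_locint sg12) (sq_int_locint sg22).

(** Averaged and gauged versions of [u] and of its derivatives. Only squared lengths are recorded,
    because the gauge rotates each pair and the integrals depend on the pairs through these
    alone. *)
Record gauged k w1 w2 w11 w12 w21 w22 : Prop := Gauged {
  ga1 : C1l w1 w11 w12 ; ga2 : C1l w2 w21 w22 ;
  ga_e : equivariant al w1 w2 ; ga_e1 : equivariant al w11 w21 ;
  ga_e2 : equivariant al w12 w22 ;
  ga_sq : forall z, w1 z ^+ 2 + w2 z ^+ 2 =
    cconv k (u1 \o logpolar) z ^+ 2 + cconv k (u2 \o logpolar) z ^+ 2 ;
  ga_sq1 : forall z, w11 z ^+ 2 + w21 z ^+ 2 =
    cconv k (radial g11 g21 \o logpolar) z ^+ 2 + cconv k (radial g12 g22 \o logpolar) z ^+ 2 ;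
  ga_sq2 : forall z, w12 z ^+ 2 + w22 z ^+ 2 =
    cconv k (angular g11 g21 \o logpolar) z ^+ 2 + cconv k (angular g12 g22 \o logpolar) z ^+ 2 }.

Lemma gauged_exists (e c : R) : 0 < e <= 1 / 4 ->
  exists w1 w2 w11 w12 w21 w22, gauged (khat (ka e c)) w1 w2 w11 w12 w21 w22.
Proof.
move=> he; have hK := cker_ka c he; have hKs := cker_kas c he; have hKt := cker_kat c he.
have r1 z : avg (ka e c) (radial g11 g21) z = avg (kas e c) u1 z.
  exact: (avg_radial c he lu1 lu2 (sq_int_locint sg11) (sq_int_locint sg21) id11 id21 z).
have t1 z : avg (ka e c) (angular g11 g21) z = avg (kat e c) u1 z + a * avg (ka e c) u2 z.
  exact: (avg_angular c he lu1 lu2 (sq_int_locint sg11) (sq_int_locint sg21) id11 id21 z).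
(* The second component of [u] is the first one of [- i u], whose second component is [- u1]: the
   averaging identities are reused with [(u2, - u1)] in place of [(u1, u2)]. *)
have id12' (phi : R * R -> R) : test_function phi -> \int[leb2]_x (g12 x * phi x) =
    \int[leb2]_x (- (u2 x * 'D_e1 phi x) - (potential a x).1 * - u1 x * phi x).
  by move=> h; rewrite id12//; apply: eq_Rintegral => x _; rewrite mulrN mulNr opprK.
have id22' (phi : R * R -> R) : test_function phi -> \int[leb2]_x (g22 x * phi x) =
    \int[leb2]_x (- (u2 x * 'D_e2 phi x) - (potential a x).2 * - u1 x * phi x).
  by move=> h; rewrite id22//; apply: eq_Rintegral => x _; rewrite mulrN mulNr opprK.
have r2 z : avg (ka e c) (radial g12 g22) z = avg (kas e c) u2 z.
  exact: (avg_radial c he lu2 (locintN lu1) (sq_int_locint sg12) (sq_int_locint sg22) id12' id22' z).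
have t2 z : avg (ka e c) (angular g12 g22) z = avg (kat e c) u2 z + a * - avg (ka e c) u1 z.
  rewrite -(avgN z hK lu1).
  exact: (avg_angular c he lu2 (locintN lu1) (sq_int_locint sg12) (sq_int_locint sg22) id12' id22' z).
pose v1 := avg (ka e c) u1; pose v2 := avg (ka e c) u2.
pose v11 := avg (kas e c) u1; pose v21 := avg (kas e c) u2.
pose s1 := avg (ka e c) (angular g11 g21); pose s2 := avg (ka e c) (angular g12 g22).
have E1 z : avg (kat e c) u1 z = s1 z - a * v2 z by rewrite /s1 t1 addrK.
have E2 z : avg (kat e c) u2 z = s2 z + a * v1 z by rewrite /s2 t2 mulrN subrK.
have [C1 C2] := C1l_rot (C1l_avg c he lu1) (C1l_avg c he lu2)
  (lfun_avg hK lt1) (lfun_avg hK lt2) E1 E2.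
have eq f1 f2 K : cker K -> locint f1 -> locint f2 ->
    equivariant al (rot1 a (avg K f1) (avg K f2)) (rot2 a (avg K f1) (avg K f2)).
  move=> h l1 l2; apply: (@equivariant_shift R al n0); rewrite -aE.
  by apply: rot_equivariant; exact: avg_periodic.
exists (rot1 a v1 v2), (rot2 a v1 v2), (rot1 a v11 v21), (rot1 a s1 s2),
  (rot2 a v11 v21), (rot2 a s1 s2); split.
- exact: C1.
- exact: C2.
- exact: eq.
- exact: eq.
- exact: eq.
- by move=> z; rewrite rot_sq /v1 /v2 !avg_cconv.
- move=> z; rewrite rot_sq /v11 /v21 -r1 -r2 !avg_cconv//.
- by move=> z; rewrite rot_sq /s1 /s2 !avg_cconv.
Qed.

Let P1 := u1 \o logpolar.
Let P2 := u2 \o logpolar.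
Let R1 := radial g11 g21 \o logpolar.
Let R2 := radial g12 g22 \o logpolar.
Let T1 := angular g11 g21 \o logpolar.
Let T2 := angular g12 g22 \o logpolar.

Let per f : periodic2 (f \o @logpolar R).
Proof. by move=> s t; rewrite /= periodic_logpolar. Qed.

Let perd f h : periodic2 (dens (f \o @logpolar R) (h \o logpolar)).
Proof. by move=> s t; rewrite /dens /= !periodic_logpolar. Qed.

Let mdens w1 w2 : mfun2 w1 -> mfun2 w2 ->
  measurable_fun setT (fun z : plane => (dens w1 w2 z)%:E).
Proof. by move=> h1 h2; rewrite /mfun2 /dens in h1 h2 *; apply/measurable_EFinP; mfun. Qed.

Let mP1 : mfun2 P1 := locint_logpolar_meas lu1.
Let mP2 : mfun2 P2 := locint_logpolar_meas lu2.
Let mR1 : mfun2 R1 := locint_logpolar_meas lr1.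
Let mR2 : mfun2 R2 := locint_logpolar_meas lr2.
Let mT1 : mfun2 T1 := locint_logpolar_meas lt1.
Let mT2 : mfun2 T2 := locint_logpolar_meas lt2.

(** Conformal invariance of the energy: the Jacobian [|x|^2] is absorbed in passing from Cartesian
    to radial and angular components. *)
Lemma gradient_logpolar :
  (\int[mS]_z (dens R1 R2 z)%:E + \int[mS]_z (dens T1 T2 z)%:E =
   \int[leb2]_x (dens g11 g12 x + dens g21 g22 x)%:E)%E.
Proof.
have mg : measurable_fun setT (fun x : plane => (dens g11 g12 x + dens g21 g22 x)%:E).
  have [m1 _] := sg11; have [m2 _] := sg12; have [m3 _] := sg21; have [m4 _] := sg22.
  exact: (emeasurable_funD (mdens m1 m2) (mdens m3 m4)).
rewrite (ge0_integral_logpolar mg); last by move=> x; rewrite lee_fin addr_ge0 ?dens_ge0.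
have D1 z : setT z -> (0 <= (dens R1 R2 z)%:E)%E by move=> _; rewrite lee_fin dens_ge0.
have D2 z : setT z -> (0 <= (dens T1 T2 z)%:E)%E by move=> _; rewrite lee_fin dens_ge0.
rewrite -(ge0_integralD mS measurableT D1 (mdens mR1 mR2) D2 (mdens mT1 mT2)).
apply: eq_integral => z _; rewrite -EFinD -EFinM; congr EFin.
have : expR z.1 ^+ 2 = (logpolar z).1 ^+ 2 + (logpolar z).2 ^+ 2.
  by rewrite /logpolar/= !exprMn -mulrDr cos2Dsin2 mulr1.
move=> ->; rewrite /dens /R1 /R2 /T1 /T2 /radial /angular /=; ring.
Qed.

Lemma energy_lty : (\int[leb2]_x (dens g11 g12 x + dens g21 g22 x)%:E < +oo)%E.
Proof.
have [m1 f1] := sg11; have [m2 f2] := sg12; have [m3 f3] := sg21; have [m4 f4] := sg22.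
have E f h : sq_int leb2 f -> sq_int leb2 h -> (\int[leb2]_x (dens f h x)%:E < +oo)%E.
  move=> [mf ff] [mh fh]; rewrite /dens.
  rewrite (_ : (fun x => _) = (fun x => (f x ^+ 2)%:E + (h x ^+ 2)%:E)%E)//.
  rewrite ge0_integralD//; first exact: lte_add_pinfty.
  - by move=> x _; rewrite lee_fin sqr_ge0.
  - by apply/measurable_EFinP; mfun.
  - by move=> x _; rewrite lee_fin sqr_ge0.
  - by apply/measurable_EFinP; mfun.
rewrite (_ : (fun x => _) = (fun x => (dens g11 g12 x)%:E + (dens g21 g22 x)%:E)%E)//.
rewrite ge0_integralD//; first by apply: lte_add_pinfty; exact: E.
- by move=> x _; rewrite lee_fin dens_ge0.
- exact: mdens.
- by move=> x _; rewrite lee_fin dens_ge0.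
- exact: mdens.
Qed.

(** The inequality holds for the averages, whose angular energy does not exceed that of [u], and
    Fatou's lemma removes the averaging. For [al] nonzero it shows that the mass on the cylinder is
    finite. *)
Lemma hardy_logpolar : `|al| <= 1 / 2 ->
  ((al ^+ 2)%:E * \int[mS]_z (dens P1 P2 z)%:E <= \int[mS]_z (dens T1 T2 z)%:E)%E.
Proof.
move=> al12; have T0 : (0 <= \int[mS]_z (dens T1 T2 z)%:E)%E.
  by apply: integral_ge0 => z _; rewrite lee_fin dens_ge0.
have [->|al0] := eqVneq al 0; first by rewrite expr0n mul0e.
have a20 : 0 < al ^+ 2 by rewrite exprn_even_gt0.
rewrite muleC -lee_pdivlMr//.
have [e_ [c_ [hk [ae1 ae2]]]] := mollifier_sequence lu1 lu2.
pose k n := khat (ka (e_ n) (c_ n)).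
have mk n : mfun2 (k n).
  by have [he _ _] := hk n; exact: khat_meas (cker_meas (cker_ka (c_ n) he)).
apply: (@fatou_upper _ plane R mS (fun n => dens (cconv (k n) P1) (cconv (k n) P2))).
- by move=> n; apply/measurable_EFinP; apply: mdens; exact: conv_meas.
- by apply/measurable_EFinP; exact: mdens.
- by move=> n z; exact: dens_ge0.
- by move=> z; exact: dens_ge0.
- by have := ae_cvg_norm2 1 ae1 ae2; apply.
apply: nearW => n; have [he k0 k1] := hk n.
have [w1 [w2 [w11 [w12 [w21 [w22 ga]]]]]] := gauged_exists (c_ n) he.
rewrite lee_pdivlMr// muleC.
have H := hardy_mS al12 (ga1 ga) (ga2 ga) (ga_e ga) (ga_e2 ga).
apply: le_trans (le_trans H _).
  rewrite le_eqVlt; apply/orP; left; apply/eqP; congr (_ * _)%E.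
  by apply: eq_integral => z _; rewrite /dens -(ga_sq ga).
apply: (@le_trans _ _ (\int[mS]_z (dens (cconv (k n) T1) (cconv (k n) T2) z)%:E)%E).
  rewrite le_eqVlt; apply/orP; left; apply/eqP.
  by apply: eq_integral => z _; rewrite /dens -(ga_sq2 ga).
apply: cconv_energy_le => //.
- by rewrite k1.
- exact: perd.
Qed.

(** Finite mass and finite energy make every average bounded and square integrable, which upgrades
    [C1l] to [C1b]. *)
Lemma gauged_epair (e c : R) w1 w2 w11 w12 w21 w22 : 0 < e <= 1 / 4 ->
  (forall z, 0 <= khat (ka e c) z) -> (\int[leb2]_z (khat (ka e c) z)%:E = 1)%E ->
  (\int[mS]_z (dens P1 P2 z)%:E < +oo)%E ->
  gauged (khat (ka e c)) w1 w2 w11 w12 w21 w22 ->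
  epair al w1 w2 w11 w12 w21 w22.
Proof.
move=> he k0 k1 fP ga; have hK := cker_ka c he; have mk := khat_meas (cker_meas hK).
have fG := energy_lty.
have D0 b1 b2 : (0 <= \int[mS]_z (dens b1 b2 z)%:E)%E.
  by apply: integral_ge0 => z _; rewrite lee_fin dens_ge0.
have fR : (\int[mS]_z (dens R1 R2 z)%:E < +oo)%E.
  by apply: le_lt_trans fG; rewrite -gradient_logpolar leeDl.
have fT : (\int[mS]_z (dens T1 T2 z)%:E < +oo)%E.
  by apply: le_lt_trans fG; rewrite -gradient_logpolar leeDr.
have key f1 f2 b1 b2 : locint f1 -> locint f2 ->
    (\int[mS]_z (dens (f1 \o logpolar) (f2 \o logpolar) z)%:E < +oo)%E ->
    lfun b1 -> lfun b2 ->
    (forall z, b1 z ^+ 2 + b2 z ^+ 2 = cconv (khat (ka e c)) (f1 \o logpolar) z ^+ 2 +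
      cconv (khat (ka e c)) (f2 \o logpolar) z ^+ 2) ->
    (bfun b1 /\ bfun b2) /\ (sq_int mS b1 /\ sq_int mS b2).
  move=> l1 l2 fin lb1 lb2 E; have m1 := locint_logpolar_meas l1; have m2 := locint_logpolar_meas l2.
  have [s1 s2] := sq_int_pair m1 m2 fin (fun z => erefl).
  have B1 := khat_bounded hK m1 (per f1) s1; have B2 := khat_bounded hK m2 (per f2) s2.
  have [b1B b2B] := bounded2_pair B1 B2 E.
  have [mb1 cb1] := lb1; have [mb2 cb2] := lb2; split; first by split; split.
  apply: (sq_int_pair mb1 mb2 _ E); apply: le_lt_trans fin.
  by apply: cconv_energy_le => //; [rewrite k1|exact: perd].
have [C1 C11 C12 d1] := ga1 ga; have [C2 C21 C22 d2] := ga2 ga.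
have [[p1 p2] [q1 q2]] := key _ _ _ _ lu1 lu2 fP C1 C2 (ga_sq ga).
have [[p11 p21] [q11 q21]] := key _ _ _ _ lr1 lr2 fR C11 C21 (ga_sq1 ga).
have [[p12 p22] [q12 q22]] := key _ _ _ _ lt1 lt2 fT C12 C22 (ga_sq2 ga).
split => //; [exact: ga_e ga|exact: ga_e1 ga|exact: ga_e2 ga].
Qed.

Lemma powR_invnK (X : R) n : 0 <= X -> (X `^ n.+1%:R^-1) ^+ n.+1 = X.
Proof.
move=> X0; rewrite -powR_mulrn ?powR_ge0// -powRrM mulVf ?pnatr_eq0//.
by rewrite powRr1.
Qed.

Lemma invn_powRK (Y : R) n : 0 <= Y -> (Y ^+ n.+1) `^ n.+1%:R^-1 = Y.
Proof.
move=> Y0; rewrite -powR_mulrn// -powRrM divff ?pnatr_eq0//.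
by rewrite powRr1.
Qed.

Lemma dens_power_lty m w1 w2 w11 w12 w21 w22 : epair al w1 w2 w11 w12 w21 w22 ->
  (\int[mS]_z (dens w1 w2 z ^+ m.+1)%:E < +oo)%E.
Proof.
move=> ew; have [M1 M10 h1] := bfun_bounded (C1b_fun (ep1 ew)).
have [M2 M20 h2] := bfun_bounded (C1b_fun (ep2 ew)).
have m1 := bfun_meas (C1b_fun (ep1 ew)); have m2 := bfun_meas (C1b_fun (ep2 ew)).
pose M := (M1 ^+ 2 + M2 ^+ 2) ^+ m; have M0 : 0 <= M by rewrite exprn_ge0 ?addr_ge0 ?sqr_ge0.
have md := mdens m1 m2.
have D0 z : setT z -> (0 <= (dens w1 w2 z)%:E)%E by move=> _; rewrite lee_fin dens_ge0.
apply: (@le_lt_trans _ _ (\int[mS]_z (M%:E * (dens w1 w2 z)%:E))%E).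
  apply: ge0_le_integral; [exact: measurableT| | | |].
  - by move=> z _; rewrite lee_fin exprn_ge0 ?dens_ge0.
  - apply/measurable_EFinP; apply: measurable_funX; exact/measurable_EFinP.
  - exact: measurable_funeM.
  - move=> z _; rewrite -EFinM lee_fin exprSr; apply: ler_wpM2r; first exact: dens_ge0.
    rewrite /M lerXn2r ?nnegrE ?dens_ge0 ?addr_ge0 ?sqr_ge0// /dens.
    by apply: lerD; rewrite -(real_normK (num_real (_ z))) ler_sqr ?nnegrE.
have Me : (0 <= M%:E)%E by rewrite lee_fin.
rewrite (ge0_integralZl mS measurableT md D0 Me).
have E : (\int[mS]_z (dens w1 w2 z)%:E = (ip2 w1 w2 w1 w2)%:E)%E.
  exact: (esym (ip2_sq (ep_s1 ew) (ep_s2 ew))).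
by rewrite E -EFinM ltry.
Qed.

Lemma magnetic_inequality m (lam t NK NG : R) : `|al| <= 1 / 2 ->
  0 < lam + al ^+ 2 -> 0 < t ->
  (\int[leb2]_z (kk z ^+ m.+2)%:E <= (t ^+ m.+2)%:E)%E ->
  (\int[leb2]_z (kk z ^+ 2)%:E <= NK%:E)%E ->
  (\int[leb2]_z (kg z ^+ 2)%:E <= NG%:E)%E ->
  ((\int[mS]_z (dens P1 P2 z ^+ m.+2)%:E) `^ m.+2%:R^-1 <=
   ((Num.sqrt (t + remainder_t lam NK NG) + remainder_c al lam NK NG) ^+ 2)%:E *
   (\int[mS]_z (dens R1 R2 z)%:E + \int[mS]_z (dens T1 T2 z)%:E +
    lam%:E * \int[mS]_z (dens P1 P2 z)%:E))%E.
Proof.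
move=> al12 lal t0 kt kN gN.
have N0 (F : R * R -> R) n N : (\int[leb2]_z (F z ^+ n.*2)%:E <= N%:E)%E -> 0 <= N.
  move=> h; rewrite -lee_fin; apply: le_trans h; apply: integral_ge0 => z _.
  by rewrite lee_fin -mul2n exprM exprn_ge0 ?sqr_ge0.
have NK0 : 0 <= NK := N0 _ 1%N _ kN.
have NG0 : 0 <= NG := N0 _ 1%N _ gN.
have p0 : 0 <= 2 * pi + 1 :> R by have := @pi_ge2 R; lra.
set C := _ ^+ 2.
have C0 : 0 < C.
  have rt : 0 <= remainder_t lam NK NG.
    by apply: addr_ge0; [exact: sqrtr_ge0|apply: mulr_ge0 => //; exact: mulr_ge0].
  have rc : 0 <= remainder_c al lam NK NG.
    apply: divr_ge0; last exact: sqrtr_ge0.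
    by apply: addr_ge0; [exact: sqrtr_ge0|apply: mulr_ge0 => //; exact: sqrtr_ge0].
  by apply: exprn_gt0; apply: ltr_pwDl => //; rewrite sqrtr_gt0 ltr_wpDr.
have D0 b1 b2 : (0 <= \int[mS]_z (dens b1 b2 z)%:E)%E.
  by apply: integral_ge0 => z _; rewrite lee_fin dens_ge0.
have H := hardy_logpolar al12.
have GE := gradient_logpolar; have fG := energy_lty.
have fT : (\int[mS]_z (dens T1 T2 z)%:E < +oo)%E.
  by apply: le_lt_trans fG; rewrite -GE leeDr.
have fR : (\int[mS]_z (dens R1 R2 z)%:E < +oo)%E.
  by apply: le_lt_trans fG; rewrite -GE leeDl.
(* Infinite mass: Hardy's inequality and the finite energy force [al = 0], hence [lam > 0], and the
   right-hand side is infinite. *)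
have [BE|BE] := eqVneq (\int[mS]_z (dens P1 P2 z)%:E)%E +oo%E.
  have a0 : al = 0.
    apply/eqP; apply: contraTT fT => a0; rewrite -leNgt; apply: le_trans H.
    by rewrite BE gt0_muley// lte_fin exprn_even_gt0.
  have l0 : 0 < lam by move: lal; rewrite a0 expr0n addr0.
  rewrite BE gt0_muley ?lte_fin// addey ?gt0_muley ?lte_fin ?leey//.
  by rewrite -ltNye (@lt_le_trans _ _ 0%E)// adde_ge0.
have fP : (\int[mS]_z (dens P1 P2 z)%:E < +oo)%E by rewrite lt_neqAle BE leey.
have PE : (\int[mS]_z (dens P1 P2 z)%:E = (fine (\int[mS]_z (dens P1 P2 z)%:E))%:E)%E.
  by rewrite fineK// ge0_fin_numE.
have RE : (\int[mS]_z (dens R1 R2 z)%:E = (fine (\int[mS]_z (dens R1 R2 z)%:E))%:E)%E.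
  by rewrite fineK// ge0_fin_numE.
have TE : (\int[mS]_z (dens T1 T2 z)%:E = (fine (\int[mS]_z (dens T1 T2 z)%:E))%:E)%E.
  by rewrite fineK// ge0_fin_numE.
move: PE RE TE H; move: (fine _) (fine _) (fine _) => AT AR B PE RE TE.
rewrite PE RE TE -EFinM lee_fin => H.
have B0 : 0 <= B by rewrite -lee_fin -PE.
have AR0 : 0 <= AR by rewrite -lee_fin -RE.
have -> : (C%:E * (AR%:E + AT%:E + lam%:E * B%:E) = (C * (AR + AT + lam * B))%:E)%E by [].
(* [eta] is a slack: along the sequence the mass of the averages is eventually between [B - eta] and
   [B], by Fatou and by Jensen, which costs [|lam| * eta] whatever the sign of [lam]. *)
pose A := AR + AT; pose Y eta := C * (A + lam * B + `|lam| * eta).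
have Q0 : 0 <= A + lam * B by rewrite /A; nra.
have Y0 eta : 0 < eta -> 0 <= Y eta.
  by move=> e0; apply: mulr_ge0; rewrite ?(ltW C0)// addr_ge0// mulr_ge0// ltW.
have [e_ [c_ [hk [ae1 ae2]]]] := mollifier_sequence lu1 lu2.
pose k n := khat (ka (e_ n) (c_ n)).
have mk n : mfun2 (k n).
  by have [he _ _] := hk n; exact: khat_meas (cker_meas (cker_ka (c_ n) he)).
have ae m' := ae_cvg_norm2 m' ae1 ae2.
have mD n : measurable_fun setT (dens (cconv (k n) P1) (cconv (k n) P2) : plane -> R).
  by apply/measurable_EFinP; apply: mdens; exact: conv_meas.
have mDP : measurable_fun setT (dens P1 P2 : plane -> R) by apply/measurable_EFinP; exact: mdens.
have key eta : 0 < eta -> (\int[mS]_z (dens P1 P2 z ^+ m.+2)%:E <= (Y eta ^+ m.+2)%:E)%E.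
  move=> eta0.
  have low : \forall n \near \oo,
      ((B - eta)%:E < \int[mS]_z (dens (cconv (k n) P1) (cconv (k n) P2) z)%:E)%E.
    apply: (@fatou_lower _ plane R mS (fun n => dens (cconv (k n) P1) (cconv (k n) P2)) (dens P1 P2)).
    - exact: mD.
    - exact: mDP.
    - by move=> n z; exact: dens_ge0.
    - by move=> z; exact: dens_ge0.
    - exact: (ae 1%N).
    - by rewrite PE lte_fin ltrBlDr ltrDl.
  apply: (@fatou_upper _ plane R mS (fun n z => dens (cconv (k n) P1) (cconv (k n) P2) z ^+ m.+2)
    (fun z => dens P1 P2 z ^+ m.+2)).
  - by move=> n; apply: measurable_funX; exact: mD.
  - by apply: measurable_funX; exact: mDP.
  - by move=> n z; rewrite exprn_ge0 ?dens_ge0.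
  - by move=> z; rewrite exprn_ge0 ?dens_ge0.
  - exact: (ae m.+2).
  move: low; apply: filterS => n low; have [he k0 k1] := hk n.
  have [w1 [w2 [w11 [w12 [w21 [w22 ga]]]]]] := gauged_exists (c_ n) he.
  have ew := gauged_epair he k0 k1 fP ga.
  have W z : dens w1 w2 z = dens (cconv (k n) P1) (cconv (k n) P2) z by exact: ga_sq ga z.
  have IE : (\int[mS]_z (dens (cconv (k n) P1) (cconv (k n) P2) z)%:E =
      (ip2 w1 w2 w1 w2)%:E)%E.
    rewrite (ip2_sq (ep_s1 ew) (ep_s2 ew)).
    by apply: eq_integral => z _; rewrite -W.
  have ener b1 b2 f1 f2 : sq_int mS b1 -> sq_int mS b2 ->
      mfun2 (f1 \o logpolar) -> mfun2 (f2 \o logpolar) ->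
      (forall z, b1 z ^+ 2 + b2 z ^+ 2 = dens (cconv (k n) (f1 \o logpolar)) (cconv (k n) (f2 \o logpolar)) z) ->
      ((ip2 b1 b2 b1 b2)%:E <= \int[mS]_z (dens (f1 \o logpolar) (f2 \o logpolar) z)%:E)%E.
    move=> s1 s2 q1 q2 E; rewrite (ip2_sq s1 s2).
    apply: (@le_trans _ _ (\int[mS]_z (dens (cconv (k n) (f1 \o logpolar)) (cconv (k n) (f2 \o logpolar)) z)%:E)%E).
      by rewrite le_eqVlt; apply/orP; left; apply/eqP; apply: eq_integral => z _; rewrite E.
    by apply: cconv_energy_le => //; [rewrite k1|exact: perd].
  have V1 := ener _ _ _ _ (ep_s1 ew) (ep_s2 ew) mP1 mP2 (ga_sq ga).
  have V2 := ener _ _ _ _ (ep_s11 ew) (ep_s21 ew) mR1 mR2 (ga_sq1 ga).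
  have V3 := ener _ _ _ _ (ep_s12 ew) (ep_s22 ew) mT1 mT2 (ga_sq2 ga).
  rewrite -/P1 -/P2 PE lee_fin in V1; rewrite -/R1 -/R2 RE lee_fin in V2.
  rewrite -/T1 -/T2 TE lee_fin in V3; rewrite IE lte_fin in low.
  have XE : (\int[mS]_z (dens w1 w2 z ^+ m.+2)%:E =
      (fine (\int[mS]_z (dens w1 w2 z ^+ m.+2)%:E))%:E)%E.
    rewrite fineK// ge0_fin_numE; first exact: dens_power_lty ew.
    by apply: integral_ge0 => z _; rewrite lee_fin exprn_ge0 ?dens_ge0.
  have X0 : 0 <= fine (\int[mS]_z (dens w1 w2 z ^+ m.+2)%:E)%E.
    by apply: fine_ge0; apply: integral_ge0 => z _; rewrite lee_fin exprn_ge0 ?dens_ge0.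
  have CI := classical_inequality al12 lal t0 kt kN gN ew XE.
  rewrite (_ : (\int[mS]_z _)%E = (\int[mS]_z (dens w1 w2 z ^+ m.+2)%:E)%E); last first.
    by apply: eq_integral => z _; rewrite W.
  move: XE X0 CI; move: (fine _) => X XE X0 CI; rewrite XE lee_fin -(powR_invnK m.+1 X0).
  apply: lerXn2r; rewrite ?nnegrE ?powR_ge0 ?Y0//; apply: (le_trans CI).
  rewrite /Y -/C mulrC; apply: ler_wpM2l; first exact: ltW.
  rewrite /qform /dform /A.
  apply: (@le_trans _ _ (AR + AT + lam * ip2 w1 w2 w1 w2)).
    by rewrite lerD2r; exact: lerD.
  rewrite -[leRHS]addrA lerD2l; move: (ip2 w1 w2 w1 w2) low V1 => V low V1.
  rewrite -lerBlDl -mulrBr; apply: (le_trans (ler_norm _)); rewrite normrM.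
  apply: ler_wpM2l; first exact: normr_ge0.
  rewrite ler_norml; apply/andP; split; first by rewrite lerBrDr addrC ltW.
  by rewrite lerBlDr (le_trans V1)// lerDr ltW.
have I0 : (0 <= \int[mS]_z (dens P1 P2 z ^+ m.+2)%:E)%E.
  by apply: integral_ge0 => z _; rewrite lee_fin exprn_ge0 ?dens_ge0.
have XE : (\int[mS]_z (dens P1 P2 z ^+ m.+2)%:E =
      (fine (\int[mS]_z (dens P1 P2 z ^+ m.+2)%:E))%:E)%E.
  by rewrite fineK// ge0_fin_numE//; apply: le_lt_trans (key 1 ltr01) (ltry _).
move: XE I0 key; move: (fine _) => X XE; rewrite XE lee_fin => X0 key.
rewrite poweR_EFin lee_fin; apply/ler_addgt0Pr => eps eps0.
have d0 : 0 < C * `|lam| + 1 by rewrite ltr_wpDl// mulr_ge0// ltW.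
have eta0 : 0 < eps / (C * `|lam| + 1) by rewrite divr_gt0.
have := key _ eta0; rewrite lee_fin => h.
have Ye := Y0 _ eta0.
have h2 : X `^ m.+2%:R^-1 <= (Y (eps / (C * `|lam| + 1)) ^+ m.+2) `^ m.+2%:R^-1.
  by apply: ge0_ler_powR; rewrite ?nnegrE ?invr_ge0 ?ler0n ?exprn_ge0.
rewrite invn_powRK// in h2; apply: (le_trans h2).
rewrite /Y -/A mulrDr lerD2l mulrA mulrCA -[leRHS]mulr1; apply: ler_wpM2l; first exact: ltW.
by rewrite ler_pdivrMr// mul1r lerDl.
Qed.

End data.

End gauged_approximation.

(** * Lower bound *)

Section constants.
Context {R : realType}.
Notation mu := (@lebesgue_measure R).
Notation plane := (measurableTypeR R * measurableTypeR R)%type.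
Local Notation leb2 := (mu \x mu)%E.

Lemma nearest_integer (a lambda : R) :
  - inf (range (fun n : int => (n%:~R - a) ^+ 2)) < lambda ->
  exists (n0 : int) (al : R), [/\ a = al + n0%:~R, `|al| <= 1 / 2 & 0 < lambda + al ^+ 2].
Proof.
move=> hl; pose n0 := Num.floor (a + 1 / 2); exists n0, (a - n0%:~R); split.
- by rewrite subrK.
- have := floor_le_tmp (a + 1 / 2); have := floorD1_gt (a + 1 / 2); rewrite -/n0 intrD.
  by move=> h1 h2; rewrite ler_norml; apply/andP; split; lra.
have h : inf (range (fun n : int => (n%:~R - a) ^+ 2)) <= (n0%:~R - a) ^+ 2.
  apply: ge_inf; last by exists n0.
  by exists 0 => _ [n _ <-]; exact: sqr_ge0.
have -> : (a - n0%:~R) ^+ 2 = (n0%:~R - a) ^+ 2 by ring.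
lra.
Qed.

Lemma kkX_integral n (c : R) : 0 < c -> c < 2 ->
  (\int[leb2]_z (kk z ^+ n.+1)%:E <=
   ((n.+1%:R / (2 * pi * expR 1 * c)) ^+ n.+1 * (2 * pi / (2 - c)))%:E)%E.
Proof.
move=> c0 c2; have mk := @mfun_kk R; have mw := @mfun_wt R c.
have mwE : measurable_fun setT (fun z : plane => (wt c z)%:E) by exact/measurable_EFinP.
have p0 := pi_gt0 R; have e0 := expR_gt0 (1 : R).
have K0 : (0 <= ((n.+1%:R / (2 * pi * expR 1 * c)) ^+ n.+1)%:E)%E.
  by rewrite lee_fin exprn_ge0// divr_ge0// !mulr_ge0 ?ltW.
rewrite EFinM -(integral_wt c2).
rewrite -(ge0_integralZl leb2 measurableT mwE (fun z _ => wt_ge0 c z) K0).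
apply: ge0_le_integral; [exact: measurableT| | | |].
- by move=> z _; rewrite lee_fin exprn_ge0 ?kk_ge0.
- by apply/measurable_EFinP; exact: measurable_funX.
- exact: measurable_funeM.
- by move=> z _; rewrite -EFinM lee_fin; exact: kkX_le.
Qed.

Lemma kg2_integral : (\int[leb2]_z (kg z ^+ 2)%:E <= (2 / pi)%:E)%E.
Proof.
have mk := @mfun_kg R; have mw := @mfun_wt R 1; have p0 := pi_gt0 R.
have mwE : measurable_fun setT (fun z : plane => (wt 1 z)%:E) by exact/measurable_EFinP.
have K0 : (0 <= (pi ^- 2)%:E :> \bar R)%E by rewrite lee_fin invr_ge0 sqr_ge0.
have -> : 2 / pi = pi ^- 2 * (2 * pi) :> R.
  by move: (pi : R) p0 => P P0; field; rewrite gt_eqF.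
rewrite EFinM -integral_wt1.
rewrite -(ge0_integralZl leb2 measurableT mwE (fun z _ => wt_ge0 1 z) K0).
apply: ge0_le_integral; [exact: measurableT| | | |].
- by move=> z _; rewrite lee_fin sqr_ge0.
- by apply/measurable_EFinP; exact: measurable_funX.
- exact: measurable_funeM.
- move=> z _; rewrite -EFinM lee_fin /kg expr_div_n mulrC; apply: ler_wpM2l.
    by rewrite invr_ge0 sqr_ge0.
  apply: le_trans (wt1_ge1 z); rewrite indic01_01; case: ifP => _.
    by rewrite expr1n.
  by rewrite expr0n.
Qed.

Lemma sq_sum_le (x y eps : R) : 0 < eps ->
  (x + y) ^+ 2 <= (1 + eps) * x ^+ 2 + (1 + eps^-1) * y ^+ 2.
Proof.
move=> e0; rewrite -subr_ge0.
have -> : (1 + eps) * x ^+ 2 + (1 + eps^-1) * y ^+ 2 - (x + y) ^+ 2 =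
    eps * (x - y / eps) ^+ 2.
  by field; rewrite gt_eqF.
by rewrite mulr_ge0 ?sqr_ge0 ?ltW.
Qed.

(* The optimal [t] at exponent [n] is asymptotic to [n / (4 * pi * e)]. *)
Lemma even_constant (al lam tau : R) : (4 * pi * expR 1)^-1 < tau ->
  exists NK NG : R, [/\ (\int[leb2]_z (kk z ^+ 2)%:E <= NK%:E)%E,
    (\int[leb2]_z (kg z ^+ 2)%:E <= NG%:E)%E &
    exists N0 : nat, forall m, (N0 <= m)%N -> exists t : R,
    [/\ 0 < t, (\int[leb2]_z (kk z ^+ m.+2)%:E <= (t ^+ m.+2)%:E)%E,
      0 < (Num.sqrt (t + remainder_t lam NK NG) + remainder_c al lam NK NG) ^+ 2 &
      (Num.sqrt (t + remainder_t lam NK NG) + remainder_c al lam NK NG) ^+ 2 <= tau * m.+2%:R]].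
Proof.
set t0 := _^-1 => tt; have p0 := pi_gt0 R; have e0 := expR_gt0 (1 : R).
have t00 : 0 < t0 by rewrite invr_gt0 !mulr_gt0.
have l2 : 1 < 2 :> R by lra.
exists ((2%:R / (2 * pi * expR 1 * 1)) ^+ 2 * (2 * pi / (2 - 1))), (2 / pi); split; [exact: (kkX_integral 1 ltr01 l2)|exact: kg2_integral|].
set NK := _ * _; set rt := remainder_t _ _ _; set rc := remainder_c _ _ _ _.
have NK0 : 0 <= NK.
  by apply: mulr_ge0; [exact: sqr_ge0|apply: divr_ge0; lra].
have rt0 : 0 <= rt.
  by apply: addr_ge0; [exact: sqrtr_ge0|apply: mulr_ge0 => //; apply: mulr_ge0 => //; lra].
pose ta := (t0 + tau) / 2; have ta0 : t0 < ta by rewrite /ta; lra.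
have tat : ta < tau by rewrite /ta; lra.
have tap : 0 < ta by lra.
(* Since [t0 < ta], this [c] lies below 2 and [r = (t0 + ta) / (2 t0)] still exceeds 1: for large
   [N] the gain [r^N] absorbs the factor [2 pi / (2 - c)]. *)
pose c := 1 + t0 / ta.
have q1 : t0 / ta < 1 by rewrite ltr_pdivrMr// mul1r.
have q0 : 0 < t0 / ta by rewrite divr_gt0.
have c0 : 0 < c by rewrite /c; lra.
have c2 : c < 2 by rewrite /c; lra.
pose r := 2 * pi * expR 1 * c * ta.
have r1 : 1 < r.
  have -> : r = (t0 + ta) / (2 * t0).
    rewrite /r /c /t0; move: (pi : R) (expR 1) p0 e0 => P E P0 E0.
    by field; rewrite !gt_eqF.
  by rewrite ltr_pdivlMr ?mulr_gt0//; lra.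
have lr : 0 < ln r by exact: ln_gt0.
(* Chosen so that [(1 + eps) * ta] is the midpoint of [ta] and [tau]; the remaining gap, multiplied
   by [N], absorbs the bounded remainders. *)
pose eps := (tau - ta) / (2 * ta).
have eps0 : 0 < eps by apply: divr_gt0; [rewrite subr_gt0|exact: mulr_gt0].
pose gap := tau - (1 + eps) * ta.
have gap0 : 0 < gap.
  have -> : gap = (tau - ta) / 2 by rewrite /gap /eps; field; rewrite gt_eqF.
  by rewrite divr_gt0// subr_gt0.
pose B1 := (2 * pi / (2 - c)) / ln r.
pose B2 := ((1 + eps) * rt + (1 + eps^-1) * rc ^+ 2) / gap.
have [N0 N0B] : exists N0 : nat, forall m, (N0 <= m)%N -> B1 <= m%:R /\ B2 <= m%:R.
  exists (maxn (Num.truncn B1).+1 (Num.truncn B2).+1) => m; rewrite geq_max => /andP[h1 h2].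
  split; apply: ltW; apply: lt_le_trans (truncnS_gt _) _; by rewrite ler_nat.
exists N0 => m /N0B[mB1 mB2]; pose N : R := m.+2%:R.
have mN : m%:R <= N by rewrite ler_nat -addn2 leq_addr.
have N0' : 0 < N by rewrite ltr0n.
exists (ta * N); split; first by rewrite mulr_gt0.
- apply: (le_trans (kkX_integral m.+1 c0 c2)); rewrite lee_fin.
  have -> : ta * N = N / (2 * pi * expR 1 * c) * r.
    rewrite /r; move: (pi : R) (expR 1) p0 e0 => P E P0 E0.
    by field; rewrite !gt_eqF.
  rewrite [leRHS]exprMn; apply: ler_wpM2l.
    by rewrite exprn_ge0// divr_ge0 ?ler0n// !mulr_ge0 ?ltW.
  have -> : r ^+ m.+2 = expR (N * ln r) by rewrite expRM_natl lnK// posrE (lt_trans ltr01).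
  apply: le_trans (expR_ge1Dx _); rewrite -[leLHS](divfK (lt0r_neq0 lr)) -/B1.
  have : B1 * ln r <= N * ln r by rewrite ler_pM2r// (le_trans mB1).
  lra.
- have rc0 : 0 <= rc.
    apply: divr_ge0; last exact: sqrtr_ge0.
    by apply: addr_ge0; [exact: sqrtr_ge0|apply: mulr_ge0 => //; exact: sqrtr_ge0].
  by apply: exprn_gt0; apply: ltr_pwDl => //; rewrite sqrtr_gt0 ltr_wpDr// mulr_gt0.
- have h : Num.sqrt (ta * N + rt) ^+ 2 = ta * N + rt by rewrite sqr_sqrtr// addr_ge0// mulr_ge0 ?ltW.
  apply: (le_trans (sq_sum_le _ _ eps0)); rewrite h.
  have : B2 * gap <= N * gap by rewrite ler_pM2r// (le_trans mB2).
  rewrite /B2 divfK ?gt_eqF// /gap => k.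
  have -> : (1 + eps) * (ta * N + rt) + (1 + eps^-1) * rc ^+ 2 =
    (1 + eps) * ta * N + ((1 + eps) * rt + (1 + eps^-1) * rc ^+ 2) by ring.
  have -> : tau * N = (1 + eps) * ta * N + N * (tau - (1 + eps) * ta) by ring.
  by rewrite lerD2l.
Qed.

(** According to whether [V] is below or above [S], one of the two terms dominates by itself. At the
    level of integrals this costs a factor 2, which the power [2 / p] brings back to 1 in the
    limit. *)
Lemma power_interpolation (V S r : R) N : 0 <= V -> 0 < S -> 0 <= r -> r <= 1 ->
  V `^ (N.+1%:R + r) <= S `^ r * V ^+ N.+1 + S `^ (r - 1) * V ^+ N.+2.
Proof.
move=> V0 S0 r0 r1; move: V0; rewrite le_eqVlt => /predU1P[<-|V0].
  rewrite powR0 ?gt_eqF ?ltr_wpDr ?ltr0n// !expr0n !mulr0 addr0//.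
have W n (s : R) : V ^+ n * V `^ s = V `^ (n%:R + s).
  rewrite -powR_mulrn ?(ltW V0)// [RHS]powRD//.
  by rewrite (gt_eqF V0) implybT.
have [VS|SV] := leP V S.
  rewrite -W mulrC; apply: (@le_trans _ _ (S `^ r * V ^+ N.+1)).
    apply: ler_wpM2r; first by rewrite exprn_ge0 ?ltW.
    by apply: ge0_ler_powR => //; rewrite nnegrE ltW.
  by rewrite lerDl mulr_ge0 ?powR_ge0 ?exprn_ge0 ?ltW.
have -> : N.+1%:R + r = N.+2%:R + (r - 1) by rewrite -!natr1; ring.
rewrite -W mulrC; apply: (@le_trans _ _ (S `^ (r - 1) * V ^+ N.+2)).
  apply: ler_wpM2r; first by rewrite exprn_ge0 ?ltW.
  rewrite -[r - 1]opprB !powRN lef_pV2 ?posrE ?powR_gt0//.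
  by apply: ge0_ler_powR; rewrite ?nnegrE ?subr_ge0 ?(ltW V0) ?(ltW S0)// ltW.
by rewrite lerDr mulr_ge0 ?powR_ge0 ?exprn_ge0 ?ltW.
Qed.

Lemma root_le_power (X : \bar R) (S : R) n : (0 <= X)%E -> 0 <= S ->
  (X `^ n.+1%:R^-1 <= S%:E)%E -> (X <= (S ^+ n.+1)%:E)%E.
Proof.
case: X => [X||]//; last first.
  by move=> _ S0; rewrite poweRyr ?invr_eq0 ?pnatr_eq0.
rewrite !lee_fin => X0 S0 h.
by rewrite -(powR_invnK n X0); apply: lerXn2r; rewrite ?nnegrE ?powR_ge0.
Qed.

End constants.

Section lower_bound.
Context {R : realType}.
Notation mu := (@lebesgue_measure R).
Notation plane := (measurableTypeR R * measurableTypeR R)%type.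
Local Notation leb2 := (mu \x mu)%E.

Lemma weighted_logpolar (F : R * R -> R) : mfun2 F -> (forall x, 0 <= F x) ->
  (\int[leb2]_x (F x / enorm2 x)%:E = \int[mS]_z (F (logpolar z))%:E)%E.
Proof.
move=> mF F0; have mi := @mfun_inv_enorm2 R; rewrite /mfun2 in mF mi.
have m : measurable_fun setT (fun x : plane => (F x / enorm2 x)%:E).
  by apply/measurable_EFinP; exact: measurable_funM.
rewrite (ge0_integral_logpolar m); last by move=> x; rewrite lee_fin divr_ge0 ?enorm2_ge0.
apply: eq_integral => z _; rewrite -EFinM enorm2_logpolar expRM_natl mulrCA mulfV ?mulr1//.
by rewrite gt_eqF// exprn_gt0// expR_gt0.
Qed.

Lemma even_inequality (a al lam : R) (n0 : int) (u G1 G2 : R * R -> R[i]) m (t NK NG : R) :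
  a = al + n0%:~R -> L2 u -> L2 G1 -> L2 G2 -> is_magnetic_gradient a u G1 G2 ->
  `|al| <= 1 / 2 -> 0 < lam + al ^+ 2 -> 0 < t ->
  (\int[leb2]_z (kk z ^+ m.+2)%:E <= (t ^+ m.+2)%:E)%E ->
  (\int[leb2]_z (kk z ^+ 2)%:E <= NK%:E)%E ->
  (\int[leb2]_z (kg z ^+ 2)%:E <= NG%:E)%E ->
  ((\int[leb2]_x ((cmod (u x) ^+ 2) ^+ m.+2 / enorm2 x)%:E) `^ m.+2%:R^-1 <=
   ((Num.sqrt (t + remainder_t lam NK NG) + remainder_c al lam NK NG) ^+ 2)%:E *
   (\int[leb2]_x (cmod (G1 x) ^+ 2 + cmod (G2 x) ^+ 2)%:E +
    lam%:E * \int[leb2]_x (cmod (u x) ^+ 2 / enorm2 x)%:E))%E.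
Proof.
move=> aE Lu LG1 LG2 [id1 id2] al12 lal t0 kt kN gN.
have [su1 su2] := L2_sq_int Lu; have [s11 s12] := L2_sq_int LG1; have [s21 s22] := L2_sq_int LG2.
have I := magnetic_inequality aE su1 su2 s11 s12 s21 s22
  (fun phi h => (magnetic_re_im id1 h).1) (fun phi h => (magnetic_re_im id2 h).1)
  (fun phi h => (magnetic_re_im id1 h).2) (fun phi h => (magnetic_re_im id2 h).2)
  al12 lal t0 kt kN gN.
have mu2 : mfun2 (fun x => cmod (u x) ^+ 2).
  by have [m1 m2] := Lu.1; rewrite /mfun2; under eq_fun do rewrite cmod_sq; mfun.
have E0 : (\int[leb2]_x (cmod (G1 x) ^+ 2 + cmod (G2 x) ^+ 2)%:E =
    \int[leb2]_x (dens (fun x => complex.Re (G1 x)) (fun x => complex.Im (G1 x)) x +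
      dens (fun x => complex.Re (G2 x)) (fun x => complex.Im (G2 x)) x)%:E)%E.
  by apply: eq_integral => x _; rewrite !cmod_sq.
have E1 n : (\int[leb2]_x ((cmod (u x) ^+ 2) ^+ n / enorm2 x)%:E =
    \int[mS]_z (dens ((fun x => complex.Re (u x)) \o logpolar)
      ((fun x => complex.Im (u x)) \o logpolar) z ^+ n)%:E)%E.
  rewrite (@weighted_logpolar (fun x => (cmod (u x) ^+ 2) ^+ n)).
  - by apply: eq_integral => z _; rewrite cmod_sq.
  - exact: measurable_funX.
  - by move=> x; rewrite exprn_ge0 ?sqr_ge0.
rewrite E0 -(gradient_logpolar s11 s12 s21 s22) E1.
have E2 : (\int[leb2]_x (cmod (u x) ^+ 2 / enorm2 x)%:E = \int[mS]_z (dens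
    ((fun x => complex.Re (u x)) \o logpolar) ((fun x => complex.Im (u x)) \o logpolar) z)%:E)%E.
  exact: (E1 1%N).
rewrite E2; exact: I.
Qed.

Lemma interpolated_integral (u : R * R -> R[i]) N (S p : R) : cmeasurable u -> 0 < S ->
  2 * N.+1%:R <= p -> p <= 2 * N.+2%:R ->
  (\int[leb2]_x ((cmod (u x) ^+ 2) ^+ N.+1 / enorm2 x)%:E <= (S ^+ N.+1)%:E)%E ->
  (\int[leb2]_x ((cmod (u x) ^+ 2) ^+ N.+2 / enorm2 x)%:E <= (S ^+ N.+2)%:E)%E ->
  (\int[leb2]_x (cmod (u x) `^ p / enorm2 x)%:E <= (2 * S `^ (p / 2))%:E)%E.
Proof.
move=> [mr mi] S0 p1 p2 I1 I2; pose r := p / 2 - N.+1%:R.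
have r0 : 0 <= r by rewrite /r; lra.
have r1 : r <= 1 by rewrite /r; move: p2; rewrite -[N.+2%:R]natr1; lra.
have mw := @mfun_inv_enorm2 R; rewrite /mfun2 in mw.
have mu2 : measurable_fun setT (fun x : plane => cmod (u x) ^+ 2).
  by under eq_fun do rewrite cmod_sq; mfun.
have c0 x : 0 <= cmod (u x) by case: (u x) => ? ?; exact: sqrtr_ge0.
have VE x : cmod (u x) `^ p = (cmod (u x) ^+ 2) `^ (N.+1%:R + r).
  rewrite -powR_mulrn// -powRrM; congr (_ `^ _); by rewrite /r; field.
pose F n (x : plane) := (cmod (u x) ^+ 2) ^+ n / enorm2 x.
have mF n : measurable_fun setT (fun x => (F n x)%:E).
  by apply/measurable_EFinP; apply: measurable_funM => //; exact: measurable_funX.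
have F0 n y : setT y -> (0 <= (F n y)%:E)%E.
  by move=> _; rewrite lee_fin divr_ge0 ?enorm2_ge0// exprn_ge0 ?sqr_ge0.
have A0 : (0 <= (S `^ r)%:E)%E by rewrite lee_fin powR_ge0.
have B0 : (0 <= (S `^ (r - 1))%:E)%E by rewrite lee_fin powR_ge0.
apply: (@le_trans _ _ (\int[leb2]_x ((S `^ r)%:E * (F N.+1 x)%:E + (S `^ (r - 1))%:E * (F N.+2 x)%:E))%E).
  apply: ge0_le_integral; [exact: measurableT| | | |].
  - by move=> x _; rewrite lee_fin divr_ge0 ?enorm2_ge0// powR_ge0.
  - apply/measurable_EFinP; apply: measurable_funM => //.
    under eq_fun do rewrite VE.
    exact: (measurableT_comp (measurable_powR _) mu2).
  - by apply: emeasurable_funD; apply: measurable_funeM.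
  - move=> x _; rewrite -!EFinM -EFinD lee_fin VE /F (mulrA (S `^ r)) (mulrA (S `^ (r - 1))) -mulrDl.
    apply: ler_wpM2r; first by rewrite invr_ge0 enorm2_ge0.
    by apply: power_interpolation; rewrite ?sqr_ge0.
rewrite ge0_integralD; last 5 first.
- exact: measurableT.
- by move=> x xT; apply: mule_ge0 => //; exact: F0.
- exact: measurable_funeM.
- by move=> x xT; apply: mule_ge0 => //; exact: F0.
- exact: measurable_funeM.
rewrite (ge0_integralZl leb2 measurableT (mF N.+1) (F0 N.+1) A0).
rewrite (ge0_integralZl leb2 measurableT (mF N.+2) (F0 N.+2) B0).
apply: (le_trans (leeD (lee_wpmul2l A0 I1) (lee_wpmul2l B0 I2))).
have E n (s : R) : S `^ s * S ^+ n = S `^ (s + n%:R).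
  rewrite -powR_mulrn ?(ltW S0)// [RHS]powRD//.
  by rewrite (gt_eqF S0) implybT.
rewrite -!EFinM -EFinD lee_fin !E.
have -> : r + N.+1%:R = p / 2 by rewrite /r; ring.
have -> : r - 1 + N.+2%:R = p / 2 by rewrite /r -[N.+2%:R]natr1; ring.
by rewrite -mulr2n mulr_natl.
Qed.

Lemma eventually_admissible (a lambda L : R) :
  - inf (range (fun n : int => (n%:~R - a) ^+ 2)) < lambda ->
  0 < L -> L < 8 * pi * expR 1 ->
  \forall p \near +oo, interpolation_constants a lambda p (L / p).
Proof.
move=> hl L0 L8; have [n0 [al [aE al12 lal]]] := nearest_integer hl.
have pp := pi_gt0 R; have e0 := expR_gt0 (1 : R).
(* [t0] is the limiting slope of the even constants; [L < 8 pi e] means [t0 < 2 / L], and [tau] is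
   the midpoint. *)
pose t0 : R := (4 * pi * expR 1)^-1; pose tau := (t0 + 2 / L) / 2.
have t0L : t0 < 2 / L.
  rewrite /t0 ltr_pdivlMr// mulrC ltr_pdivrMr ?mulr_gt0//.
  by move: (pi : R) (expR 1) L8 pp e0 => P E L8 P0 E0; nra.
have tt : t0 < tau by rewrite /tau; lra.
have tL : tau < 2 / L by rewrite /tau; lra.
have t00 : 0 < t0 by rewrite invr_gt0 !mulr_gt0.
have tau0 : 0 < tau by lra.
have [NK [NG [kN gN [N0 hN]]]] := even_constant al lambda tt.
(* The spare factor [rho > 1] pays for passing from [p] to the next even exponent and for the factor
   [2^(2 / p)] of the interpolation. *)
pose rho := 2 / (L * tau).
have rho1 : 1 < rho.
  have Lt0 : 0 < L * tau by exact: mulr_gt0.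
  rewrite /rho (ltr_pdivlMr _ _ Lt0) mul1r mulrC.
  by rewrite -ltr_pdivlMr.
have lr : 0 < ln rho by exact: ln_gt0.
near=> p.
have p4 : 4 <= p by near: p; apply: nbhs_pinfty_ge; exact: num_real.
have pN : 2 * N0.+3%:R <= p by near: p; apply: nbhs_pinfty_ge; exact: num_real.
have pr : 4 / ln rho <= p by near: p; apply: nbhs_pinfty_ge; exact: num_real.
have p0 : 0 < p by lra.
move=> u G1 G2 [Lu _] LG1 LG2 mg.
set Q := (_ + _)%E.
(* With [n = m + 2] the exponent [p] lies between the consecutive even exponents [2 (m + 2)] and
   [2 (m + 3)]. *)
pose n := Num.truncn (p / 2).
have /andP[n1 n2] : n%:R <= p / 2 < n.+1%:R by apply: truncn_itv; lra.
have nN : (N0.+2 < n.+1)%N.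
  rewrite -(@ltr_nat R); apply: le_lt_trans n2; move: pN; rewrite -[N0.+3%:R]natr1; lra.
have [m nE] : exists m, n = m.+2 by case: (n) nN => [|[|m]]//; exists m.
have mN : (N0 <= m)%N by move: nN; rewrite nE !ltnS.
rewrite nE in n1 n2.
have c0 x : 0 <= cmod (u x) by case: (u x) => ? ?; exact: sqrtr_ge0.
have X0 k : (0 <= \int[leb2]_x ((cmod (u x) ^+ 2) ^+ k / enorm2 x)%:E)%E.
  by apply: integral_ge0 => x _; rewrite lee_fin divr_ge0 ?enorm2_ge0// exprn_ge0 ?sqr_ge0.
have ev k : (N0 <= k)%N -> exists C : R, [/\ 0 < C, C <= tau * k.+2%:R &
    ((\int[leb2]_x ((cmod (u x) ^+ 2) ^+ k.+2 / enorm2 x)%:E) `^ k.+2%:R^-1 <= C%:E * Q)%E].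
  move=> /hN[t [t1 kt C0 Ct]]; eexists; split; [exact: C0|exact: Ct|].
  exact: even_inequality aE Lu LG1 LG2 mg al12 lal t1 kt kN gN.
have [C1 [C10 C1t E1]] := ev m mN.
have [C2 [C20 C2t E2]] := ev m.+1 (leq_trans mN (leqnSn m)).
have [->|Qy] := eqVneq Q +oo%E; first exact: leey.
have I0 : (0 <= \int[leb2]_x (cmod (u x) `^ p / enorm2 x)%:E)%E.
  by apply: integral_ge0 => x _; rewrite lee_fin divr_ge0 ?enorm2_ge0// powR_ge0.
have Q0 : (0 <= Q)%E.
  by have := le_trans (poweR_ge0 _ _) E1; rewrite pmule_rge0.
have QE : Q = (fine Q)%:E by rewrite fineK// ge0_fin_numE// lt_neqAle Qy leey.
move: Q0 E1 E2; rewrite QE; move: (fine Q) => q; rewrite lee_fin => q0 E1 E2.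
(* [L / p] together with the factor of the interpolation. As [m + 3 <= p / 2 + 1], the claim [Mt]
   reduces to [2^(2/p) * (1 + 2/p) <= rho], and both factors are at most [e^(2/p)]. *)
pose M := L / p * 2 `^ (2 / p).
have M0 : 0 < M by rewrite mulr_gt0 ?divr_gt0// powR_gt0.
have Mt : M * (tau * m.+3%:R) <= 1.
  have mp : m.+3%:R <= p / 2 + 1 by rewrite -[m.+3%:R]natr1 lerD2r.
  have x2 : 2 `^ (2 / p) <= expR (2 / p).
    rewrite /powR pnatr_eq0/= ler_expR ler_piMr ?divr_ge0 ?(ltW p0)//.
    have := @le_ln1Dx R 1; rewrite (_ : 1 + 1 = 2 :> R); last by ring.
    by apply; clear; lra.
  have x1 : 1 + 2 / p <= expR (2 / p) := expR_ge1Dx _.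
  have x3 : expR (2 / p) * expR (2 / p) <= rho.
    rewrite -expRD -[leRHS]lnK ?posrE ?(lt_trans ltr01)// ler_expR.
    have -> : 2 / p + 2 / p = 4 / p by rewrite -mulrDl -natrD.
    by rewrite ler_pdivrMr// mulrC -ler_pdivrMr.
  have x4 : 2 `^ (2 / p) * (1 + 2 / p) <= rho.
    apply: le_trans x3; apply: ler_pM; rewrite ?powR_ge0//.
    by rewrite addr_ge0// divr_ge0// ltW.
  apply: (@le_trans _ _ (M * (tau * (p / 2 + 1)))).
    by apply: ler_wpM2l; [exact: ltW|apply: ler_wpM2l => //; exact: ltW].
  have -> : M * (tau * (p / 2 + 1)) = (2 `^ (2 / p) * (1 + 2 / p)) / rho.
    by rewrite /M /rho; field; rewrite !gt_eqF.
  by rewrite ler_pdivrMr ?mul1r// (lt_trans ltr01).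
rewrite -/Q.
have main (eta : R) : 0 < eta ->
    ((L / p)%:E * (\int[leb2]_x (cmod (u x) `^ p / enorm2 x)%:E) `^ (2 / p) <= (q + M * eta)%:E)%E.
  (* The interpolation needs a positive scale, and [q] may be 0; [eta] is removed at the end. *)
  move=> eta0; pose S := tau * m.+3%:R * q + eta.
  have S0 : 0 < S.
    by apply: ltr_wpDl => //; apply: mulr_ge0 => //; apply: mulr_ge0; [exact: ltW|exact: ler0n].
  have big (C : R) k : 0 <= C -> C <= tau * k%:R -> (k <= m.+3)%N -> (C%:E * q%:E <= S%:E)%E.
    move=> C0 Ck km; rewrite -EFinM lee_fin; apply: (@le_trans _ _ (tau * m.+3%:R * q)); last by rewrite lerDl ltW.
    apply: ler_wpM2r => //; apply: (le_trans Ck); apply: ler_wpM2l; first exact: ltW.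
    by rewrite ler_nat.
  have I1 := root_le_power (X0 m.+2) (ltW S0) (le_trans E1 (big _ _ (ltW C10) C1t (leqnSn _))).
  have I2 := root_le_power (X0 m.+3) (ltW S0) (le_trans E2 (big _ _ (ltW C20) C2t (leqnn _))).
  have p1 : 2 * m.+2%:R <= p by rewrite mulrC -ler_pdivlMr.
  have p2 : p <= 2 * m.+3%:R by rewrite mulrC -ler_pdivrMr// ltW.
  have I := interpolated_integral Lu.1 S0 p1 p2 I1 I2.
  have IE : (\int[leb2]_x (cmod (u x) `^ p / enorm2 x)%:E =
      (fine (\int[leb2]_x (cmod (u x) `^ p / enorm2 x)%:E))%:E)%E.
    by rewrite fineK// ge0_fin_numE//; apply: le_lt_trans I (ltry _).
  move: I I0; rewrite IE; move: (fine _) => X; rewrite !lee_fin => XS X00.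
  apply: (@le_trans _ _ (L / p * (2 * S `^ (p / 2)) `^ (2 / p))).
    apply: ler_wpM2l; first by rewrite divr_ge0 ?ltW.
    by apply: ge0_ler_powR; rewrite ?nnegrE ?divr_ge0 ?mulr_ge0 ?powR_ge0 ?(ltW p0).
  rewrite powRM ?powR_ge0// -powRrM (_ : p / 2 * (2 / p) = 1); last by field; rewrite gt_eqF.
  rewrite powRr1 ?(ltW S0)// mulrA -/M /S mulrDr lerD2r mulrA.
  by rewrite -[leRHS]mul1r; apply: ler_wpM2r.
apply/lee_addgt0Pr => eps eps0.
have := main (eps / M) (divr_gt0 eps0 M0).
by rewrite mulrCA mulfV ?gt_eqF// mulr1 EFinD.
Unshelve. all: by end_near. Qed.

End lower_bound.

(** * Upper bound *)

Section continuous_plane.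
Context {R : realType}.
Notation mu := (@lebesgue_measure R).
Notation plane := (measurableTypeR R * measurableTypeR R)%type.
Local Notation leb2 := (mu \x mu)%E.
Implicit Types (x y z : R * R) (f g : R * R -> R).

Lemma continuous_slice1 f (b : R) : continuous f -> continuous (fun s : R => f (s, b)).
Proof.
move=> cf s; have h : (fun r : R => (r, b)) @ s --> (s, b).
  exact: (cvg_pair (F := nbhs s) (G := nbhs s) (H := nbhs b) cvg_id (cvg_cst b)).
exact: (cvg_comp _ _ h (cf (s, b))).
Qed.

Lemma continuous_slice2 f (b : R) : continuous f -> continuous (fun s : R => f (b, s)).
Proof.
move=> cf s; have h : (fun r : R => (b, r)) @ s --> (b, s).
  exact: (cvg_pair (F := nbhs s) (G := nbhs b) (H := nbhs s) (cvg_cst b) cvg_id).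
exact: (cvg_comp _ _ h (cf (b, s))).
Qed.

(** The sigma-algebra is the product one. Rounding the first variable down to a grid of mesh
    [1 / (n + 1)] leaves countably many continuous slices, hence a measurable function, and
    continuity recovers [f] in the limit. *)
Lemma mfun2_continuous f : continuous f -> mfun2 f.
Proof.
move=> cf; rewrite /mfun2.
pose a n (r : R) : R := (Num.floor (n.+1%:R * r))%:~R / n.+1%:R.
apply: (@measurable_fun_cvg _ _ _ setT (fun n (x : plane) => f (a n x.1, x.2))).
- move=> n _ A mA; rewrite setTI.
  have -> : (fun x : plane => f (a n x.1, x.2)) @^-1` A =
      \bigcup_(k : int) ((fun x : plane => x.1) @^-1` `[k%:~R / n.+1%:R, (k + 1)%:~R / n.+1%:R[%classic `&`
        (fun x : plane => x.2) @^-1` ((fun s => f (k%:~R / n.+1%:R, s)) @^-1` A)).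
    have n0 : 0 < n.+1%:R :> R by rewrite ltr0n.
    have fl (k : int) (r : R) : (k%:~R / n.+1%:R <= r < (k + 1)%:~R / n.+1%:R) =
        (Num.floor (n.+1%:R * r) == k).
      rewrite ler_pdivrMr// ltr_pdivlMr// [r * _]mulrC; apply/idP/eqP; first exact: floor_def.
      by move=> <-; rewrite floor_le_tmp floorD1_gt.
    apply/seteqP; split => x /=.
      move=> Ax; exists (Num.floor (n.+1%:R * x.1)) => //; split => //=.
      by rewrite in_itv/= fl.
    by move=> [k _ [/=]]; rewrite in_itv/= fl => /eqP <-.
  apply: countable_bigcupT_measurable => // k; apply: measurableI.
    rewrite -[X in measurable X]setTI; apply: measurable_fst => //; exact: measurable_itv.
  rewrite -[X in measurable X]setTI; apply: measurable_snd => //.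
  rewrite -[X in measurable X]setTI; apply: continuous_measurable_fun => //.
  exact: continuous_slice2.
move=> [x1 x2] _ /=.
suff h : (fun n => (a n x1, x2)) @ \oo --> (x1, x2) by exact: (cvg_comp _ _ h (cf (x1, x2))).
suff h : a n x1 @[n --> \oo] --> x1.
  exact: (cvg_pair (F := \oo) (G := nbhs x1) (H := nbhs x2) h (cvg_cst x2)).
apply/cvgrPdist_le => e e0; near=> n.
have n0 : 0 < n.+1%:R :> R by rewrite ltr0n.
have := floor_le_tmp (n.+1%:R * x1); have := floorD1_gt (n.+1%:R * x1).
rewrite intrD => h1 h2; rewrite /a.
have -> : x1 - (Num.floor (n.+1%:R * x1))%:~R / n.+1%:R =
    (n.+1%:R * x1 - (Num.floor (n.+1%:R * x1))%:~R) / n.+1%:R.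
  by move: (n.+1%:R : R) n0 => N N0; field; rewrite gt_eqF.
rewrite ger0_norm; last by apply: divr_ge0; [rewrite subr_ge0|exact: ltW].
apply: (@le_trans _ _ (n.+1%:R^-1)).
  rewrite -[leRHS]mul1r; apply: ler_wpM2r; first by rewrite invr_ge0 ltW.
  by lra.
near: n; have := near_infty_natSinv_lt (PosNum e0); apply: filterS => n /ltW.
by [].
Unshelve. all: by end_near. Qed.

Lemma continuous_locint f : continuous f -> locint f.
Proof.
move=> cf B; have mf := mfun2_continuous cf; have mb := @mfun_boxR R B.
pose D : set (R * R) := boxS B `*` boxS B.
have cD : compact D by apply: compact_setX; exact: segment_compact.
have [M [_ /(_ (M + 1))]] : bounded_set (f @` D).
  by apply: compact_bounded; apply: continuous_compact => //; exact: continuous_subspaceT.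
rewrite ltrDl ltr01 => /(_ isT) bM.
apply: (@integrable_le _ plane R leb2 (fun x : plane => boxR B x * f x) (fun x => (M + 1) * boxR B x)).
- by rewrite /mfun2 in mf mb; exact: measurable_funM.
- move=> x; rewrite normrM (ger0_norm (boxR_ge0 _ _)) mulrC /boxR indicE.
  case: (boolP (x \in _)) => [/set_mem Dx|_]; last by rewrite !mulr0.
  by rewrite !mulr1; apply: bM; exists x.
- apply: integrableZr_real; apply/integrableP; split; first exact/measurable_EFinP.
  rewrite (_ : (fun x => _) = (fun x => (boxR B x)%:E)); first exact: integral_boxR.
  by apply/funext => x /=; rewrite ger0_norm ?boxR_ge0.
Qed.

Lemma Rintegral_translate2 (F : plane -> R) (c : R * R) : mfun2 F ->
  \int[leb2]_z F (z + c) = \int[leb2]_z F z.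
Proof.
move=> mF; rewrite /Rintegral; congr fine; rewrite integralE [RHS]integralE.
have mE : measurable_fun setT (fun z : plane => (F z)%:E) by exact/measurable_EFinP.
congr (_ - _)%E.
  rewrite -(ge0_integral_leb2_translate c (measurable_funepos mE)); last exact: funepos_ge0.
  by apply: eq_integral => z _; rewrite !funeposE.
rewrite -(ge0_integral_leb2_translate c (measurable_funeneg mE)); last exact: funeneg_ge0.
by apply: eq_integral => z _; rewrite !funenegE.
Qed.

Lemma is_derive_shift1 f c (t b : R) : derivable f ((t, b) + c) (1, 0) ->
  is_derive t (1 : R) (fun s : R => f ((s, b) + c)) ('D_(1, 0) f ((t, b) + c)).
Proof.
move=> df.
have E : (fun h : R => h^-1 *: (f ((h *: 1 + t, b) + c) - f ((t, b) + c))) =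
    (fun h : R => h^-1 *: (f (h *: (1, 0) + ((t, b) + c)) - f ((t, b) + c))).
  apply/funext => h; congr (_ *: (f _ - _)).
  by apply: injective_projections; rewrite /= /GRing.scale/= ?mulr0 ?add0r// addrA.
by apply: DeriveDef; [rewrite /derivable E|rewrite /derive E].
Qed.

Lemma is_derive_shift2 f c (t b : R) : derivable f ((b, t) + c) (0, 1) ->
  is_derive t (1 : R) (fun s : R => f ((b, s) + c)) ('D_(0, 1) f ((b, t) + c)).
Proof.
move=> df.
have E : (fun h : R => h^-1 *: (f ((b, h *: 1 + t) + c) - f ((b, t) + c))) =
    (fun h : R => h^-1 *: (f (h *: (0, 1) + ((b, t) + c)) - f ((b, t) + c))).
  apply/funext => h; congr (_ *: (f _ - _)).
  by apply: injective_projections; rewrite /= /GRing.scale/= ?mulr0 ?add0r// addrA.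
by apply: DeriveDef; [rewrite /derivable E|rewrite /derive E].
Qed.

End continuous_plane.

(** * The truncated logarithm *)

Section truncated_kernel.
Context {R : realType}.
Notation mu := (@lebesgue_measure R).
Notation plane := (measurableTypeR R * measurableTypeR R)%type.
Local Notation leb2 := (mu \x mu)%E.
Implicit Types (x y z : R * R) (f g : R * R -> R).
Variable d : R.
Hypotheses (d0 : 0 < d) (d1 : d < 1).

(** The kernel with [|z|^2] replaced by [|z|^2 + d^2]: the logarithm is levelled off at scale [d]
    without a corner, and the calculus of the profile [Kf] carries over. *)
Definition bub z : R := Kf (enorm2 z + d ^+ 2).
Definition bub1 z : R := 2 * z.1 * dKf (enorm2 z + d ^+ 2).
Definition bub2 z : R := 2 * z.2 * dKf (enorm2 z + d ^+ 2).

Let mz (G : R -> R) : measurable_fun setT G -> mfun2 (fun z => G (enorm2 z + d ^+ 2)).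
Proof.
move=> mG; have m3 := @mfun_enorm2 R; rewrite /mfun2.
by apply: (measurableT_comp mG); mfun.
Qed.

Lemma measurable_Kf : measurable_fun setT (@Kf R).
Proof.
have mi : measurable_fun setT (\1_unit01 : R -> R) by apply: measurable_indic; exact: measurable_unit01.
by have ml := @measurable_ln R; rewrite /Kf; mfun.
Qed.

Lemma measurable_dKf : measurable_fun setT (@dKf R).
Proof.
have mi : measurable_fun setT (\1_unit01 : R -> R) by apply: measurable_indic; exact: measurable_unit01.
by have ml := @measurable_ln R; rewrite /dKf; mfun.
Qed.

Lemma mfun_bub : mfun2 bub. Proof. exact: (mz measurable_Kf). Qed.

Lemma mfun_bub1 : mfun2 bub1.
Proof. by have m := mz measurable_dKf; rewrite /mfun2 /bub1 in m *; mfun. Qed.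

Lemma mfun_bub2 : mfun2 bub2.
Proof. by have m := mz measurable_dKf; rewrite /mfun2 /bub2 in m *; mfun. Qed.

Let t0 z : 0 < enorm2 z + d ^+ 2.
Proof. by rewrite ltr_wpDl ?enorm2_ge0// exprn_gt0. Qed.

Lemma box1 z : enorm2 z + d ^+ 2 <= 1 -> boxR 1 z = 1.
Proof.
move=> h; rewrite boxRE.
have k (r : R) : r ^+ 2 <= enorm2 z -> `|r| <= 1.
  move=> rz; rewrite -[leRHS](ger0_norm ler01) -ler_sqr ?nnegrE// !real_normK ?num_real// expr1n.
  by have := sqr_ge0 d; lra.
by rewrite !k// /enorm2 ?lerDl ?lerDr sqr_ge0.
Qed.

(* [Kf] is nonincreasing. *)
Lemma bub_le_kk z : z != 0 -> 0 <= bub z <= kk z.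
Proof.
move=> z0; rewrite /bub /kk /Kf !indic01_01 t0/=.
have T0 : 0 < enorm2 z.
  rewrite lt_neqAle enorm2_ge0 andbT eq_sym; apply: contra z0.
  rewrite /enorm2 paddr_eq0 ?sqr_ge0// !sqrf_eq0 => /andP[/eqP h1 /eqP h2].
  by apply/eqP; apply: injective_projections.
have dd := sqr_ge0 d; have p0 := pi_gt0 R.
case: (leP (enorm2 z + d ^+ 2) 1) => h; last first.
  by rewrite mul0r lexx/=; have := kk_ge0 z; rewrite /kk /Kf indic01_01 T0.
have T1 : enorm2 z <= 1 by lra.
rewrite T0 T1 /= !mul1r; set T := enorm2 z in T0 T1 h *; set t := T + d ^+ 2 in h *.
have tt0 : 0 < t by exact: t0.
have lnle (s : R) : 0 < s -> ln s <= s - 1.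
  move=> s0; have := @le_ln1Dx R (s - 1); rewrite addrCA subrr addr0.
  by apply; rewrite ltrBrDl subrr.
apply/andP; split.
  by apply: divr_ge0; [have := lnle _ tt0; lra|rewrite mulr_ge0 ?pi_ge0].
apply: ler_wpM2r; first by rewrite invr_ge0 mulr_ge0// ltW.
have q0 : 0 < T / t by rewrite divr_gt0.
have := lnle _ q0; rewrite ln_div ?posrE// => l1.
have : T / t - 1 <= T - t.
  have -> : T / t - 1 = (T - t) / t by field; rewrite gt_eqF.
  rewrite ler_pdivrMr// -subr_ge0.
  have -> : (T - t) * t - (T - t) = (t - T) * (1 - t) by ring.
  by apply: mulr_ge0; [rewrite /t addrAC subrr add0r|rewrite subr_ge0].
lra.
Qed.

Lemma bub_bound z : `|bub z| <= - ln (d ^+ 2) / (4 * pi) * boxR 1 z.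
Proof.
rewrite /bub /Kf indic01_01 t0/=; have p0 := pi_gt0 R.
case: (leP (enorm2 z + d ^+ 2) 1) => h; last first.
  rewrite mul0r normr0 mulr_ge0 ?boxR_ge0// divr_ge0 ?mulr_ge0 ?pi_ge0//.
  by rewrite oppr_ge0 ln_le0// expr_le1// ltW.
rewrite (box1 h) mul1r mulr1.
have := @le_ln1Dx R (enorm2 z + d ^+ 2 - 1); rewrite addrCA subrr addr0 => l1.
have l2 : ln (enorm2 z + d ^+ 2) <= enorm2 z + d ^+ 2 - 1 by apply: l1; have := t0 z; lra.
rewrite ger0_norm; last by apply: divr_ge0; [lra|rewrite mulr_ge0 ?pi_ge0].
apply: ler_wpM2r; first by rewrite invr_ge0 mulr_ge0// ltW.
have : ln (d ^+ 2) <= ln (enorm2 z + d ^+ 2).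
  by rewrite ler_ln ?posrE ?exprn_gt0// lerDr enorm2_ge0.
lra.
Qed.

Lemma dKf_sq (t : R) : 0 < t -> dKf t ^+ 2 <= (t <= 1)%R%:R * (t ^- 2 / (16 * pi ^+ 2)).
Proof.
move=> tp; rewrite /dKf indic01_01 tp/=; have p0 := pi_gt0 R.
case: (leP t 1) => h; last by rewrite mul0r expr0n mul0r.
rewrite !mul1r expRN lnK ?posrE// expr_div_n exprMn.
rewrite (_ : 4 ^+ 2 = 16 :> R); last by ring.
apply: ler_wpM2r; first by rewrite invr_ge0 mulr_ge0 ?sqr_ge0.
have i1 : 1 <= t^-1 by rewrite invf_ge1.
rewrite -exprVn -[leLHS]sqrrN opprB; apply: lerXn2r; rewrite ?nnegrE; lra.
Qed.

Lemma bubi_sq z r : r ^+ 2 <= enorm2 z ->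
  `|2 * r * dKf (enorm2 z + d ^+ 2)| <= d ^- 2 * boxR 1 z.
Proof.
move=> rz; have ht := t0 z; rewrite /dKf indic01_01 ht/=; have p2 := @pi_ge2 R.
have db := sqr_ge0 d; have dd0 : 0 < d ^+ 2 by exact: exprn_gt0.
case: (leP (enorm2 z + d ^+ 2) 1) => h; last first.
  by rewrite mul0r mulr0 normr0 mulr_ge0 ?boxR_ge0 ?invr_ge0.
rewrite (box1 h) mul1r mulr1 expRN lnK ?posrE//.
have r1 : `|r| <= 1.
  rewrite -[leRHS](ger0_norm ler01) -ler_sqr ?nnegrE// !real_normK ?num_real// expr1n; lra.
set t := _ + _ in h ht *.
have i1 : 1 <= t^-1 by rewrite invf_ge1.
have i2 : t^-1 <= d ^- 2 by rewrite lef_pV2 ?posrE// lerDr enorm2_ge0.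
rewrite 2!normrM (ger0_norm (_ : 0 <= 2))// [ `|_ / _| ]normrM (ler0_norm (_ : 1 - t^-1 <= 0)); last by lra.
have q0 : 0 <= (4 * pi)^-1 :> R by rewrite invr_ge0; lra.
rewrite (ger0_norm q0).
have q : (4 * pi)^-1 <= 8^-1 :> R by rewrite lef_pV2 ?posrE; lra.
apply: (@le_trans _ _ (2 * 1 * (d ^- 2 * 8^-1))); last by nra.
apply: ler_pM; [exact: mulr_ge0|apply: mulr_ge0 => //; lra|exact: ler_wpM2l|].
by apply: ler_pM => //; lra.
Qed.

Lemma cbox_bub : cbox bub.
Proof. by split; [exact: mfun_bub|exists (- ln (d ^+ 2) / (4 * pi)), 1; exact: bub_bound]. Qed.

Lemma cbox_bub1 : cbox bub1.
Proof.
split; [exact: mfun_bub1|exists (d ^- 2), 1 => z].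
by apply: bubi_sq; rewrite lerDl sqr_ge0.
Qed.

Lemma cbox_bub2 : cbox bub2.
Proof.
split; [exact: mfun_bub2|exists (d ^- 2), 1 => z].
by apply: bubi_sq; rewrite lerDr sqr_ge0.
Qed.

(** With [b^2 = y^2 + d^2 > 0] every horizontal line avoids the singularity of the profile, so
    [ibp1] applies on each of them. *)
Lemma weak_bub1 f f1 : continuous f -> continuous f1 ->
  (forall t b : R, is_derive t (1 : R) (fun s : R => f (s, b)) (f1 (t, b))) ->
  \int[leb2]_z (f1 z * bub z + f z * bub1 z) = 0.
Proof.
move=> cf cf1 df.
have i1 := ikernel_locM (continuous_locint cf1) cbox_bub.
have i2 := ikernel_locM (continuous_locint cf) cbox_bub1.
rewrite /Rintegral -(integral21_prod_meas1 (integrableDr i1 i2)).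
rewrite (_ : fubini_G _ _ = cst 0%E) ?integral0//; apply/funext => y; rewrite /fubini_G/=.
pose b := Num.sqrt (y ^+ 2 + d ^+ 2).
have b2 : b ^+ 2 = y ^+ 2 + d ^+ 2 by rewrite sqr_sqrtr// addr_ge0 ?sqr_ge0.
have b0 : b != 0.
  by rewrite -sqrf_eq0 b2 gt_eqF// ltr_wpDl ?sqr_ge0// exprn_gt0.
rewrite -[RHS](ibp1 b0 (phi := fun s : R => f (s, y)) (phi' := fun s : R => f1 (s, y)))//.
- apply: eq_integral => x _; rewrite /bub /bub1 /enorm2/= b2 addrA.
  by congr EFin; ring.
- exact: continuous_slice1.
Qed.

Lemma weak_bub2 f f2 : continuous f -> continuous f2 ->
  (forall t b : R, is_derive t (1 : R) (fun s : R => f (b, s)) (f2 (b, t))) ->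
  \int[leb2]_z (f2 z * bub z + f z * bub2 z) = 0.
Proof.
move=> cf cf1 df.
have i1 := ikernel_locM (continuous_locint cf1) cbox_bub.
have i2 := ikernel_locM (continuous_locint cf) cbox_bub2.
rewrite /Rintegral -(integral12_prod_meas1 (integrableDr i1 i2)).
rewrite (_ : fubini_F _ _ = cst 0%E) ?integral0//; apply/funext => x; rewrite /fubini_F/=.
pose b := Num.sqrt (x ^+ 2 + d ^+ 2).
have b2 : b ^+ 2 = x ^+ 2 + d ^+ 2 by rewrite sqr_sqrtr// addr_ge0 ?sqr_ge0.
have b0 : b != 0.
  by rewrite -sqrf_eq0 b2 gt_eqF// ltr_wpDl ?sqr_ge0// exprn_gt0.
rewrite -[RHS](ibp1 b0 (phi := fun s : R => f (x, s)) (phi' := fun s : R => f2 (x, s)))//.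
- apply: eq_integral => y _; rewrite /bub /bub2 /enorm2/= b2.
  rewrite (_ : y ^+ 2 + (x ^+ 2 + d ^+ 2) = x ^+ 2 + y ^+ 2 + d ^+ 2); last by ring.
  by congr EFin; ring.
- exact: continuous_slice2.
Qed.

Definition annulus z : R := (d ^+ 2 < enorm2 z <= 1)%R%:R.

(* [|grad bub|^2 <= 1 / (4 pi^2 |z|^2)] away from the core [|z| <= d]. *)
Lemma bub_gradient z : bub1 z ^+ 2 + bub2 z ^+ 2 <=
  (4 * pi ^+ 2)^-1 * (annulus z / enorm2 z + d ^- 2 * boxR d z).
Proof.
have ht := t0 z; have p0 := pi_gt0 R; have dd0 : 0 < d ^+ 2 by exact: exprn_gt0.
have T0 := enorm2_ge0 z.
have -> : bub1 z ^+ 2 + bub2 z ^+ 2 = 4 * enorm2 z * dKf (enorm2 z + d ^+ 2) ^+ 2.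
  by rewrite /bub1 /bub2 /enorm2; ring.
apply: (le_trans (ler_wpM2l _ (dKf_sq ht))); first by rewrite mulr_ge0.
have X : 0 <= annulus z / enorm2 z + d ^- 2 * boxR d z.
  by rewrite addr_ge0 ?divr_ge0// ?mulr_ge0 ?boxR_ge0 ?invr_ge0 ?ltW.
case: (leP (enorm2 z + d ^+ 2) 1) => h; last first.
  by rewrite mul0r mulr0 mulr_ge0// invr_ge0 mulr_ge0 ?sqr_ge0.
rewrite mul1r (_ : 4 * enorm2 z * _ = (4 * pi ^+ 2)^-1 * (enorm2 z * (enorm2 z + d ^+ 2) ^- 2)); last first.
  move: (pi : R) p0 (enorm2 z + d ^+ 2) ht => P P0 t tp; field.
  by rewrite !gt_eqF.
apply: ler_wpM2l; first by rewrite invr_ge0 mulr_ge0 ?sqr_ge0.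
rewrite /annulus; have [Td|Td] := ltP (d ^+ 2) (enorm2 z).
  have T1 : enorm2 z <= 1 by lra.
  have Tp : 0 < enorm2 z by lra.
  rewrite T1 /= mul1r; apply: (@le_trans _ _ (enorm2 z)^-1); last first.
    by rewrite lerDl mulr_ge0 ?boxR_ge0 ?invr_ge0 ?ltW.
  rewrite ler_pdivrMr ?exprn_gt0// -ler_pdivrMl ?invr_gt0// invrK -expr2.
  by apply: lerXn2r; rewrite ?nnegrE; lra.
have -> : boxR d z = 1.
  have k (r : R) : r ^+ 2 <= enorm2 z -> `|r| <= d.
    move=> rz; rewrite -[leRHS](gtr0_norm d0) -ler_sqr ?nnegrE// !real_normK ?num_real//; lra.
  by rewrite boxRE !k// /enorm2 ?lerDl ?lerDr sqr_ge0.
rewrite /= mul0r add0r mulr1 ler_pdivrMr ?exprn_gt0// -ler_pdivrMl ?invr_gt0// invrK.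
nra.
Qed.

Lemma integral_boxR_val (r : R) : 0 <= r ->
  (\int[leb2]_z (boxR r z)%:E = (2 * r * (2 * r))%:E)%E.
Proof.
move=> r0; have l : mu (boxS r) = (2 * r)%:E.
  by rewrite /boxS mu_itv_len; [congr EFin; ring|lra].
have mX := measurableX (measurable_boxS r) (measurable_boxS r).
rewrite /boxR integral_indic// setIT EFinM -{1}l -l.
by apply: product_measure1E; exact: measurable_boxS.
Qed.

Lemma mfun_annulus : mfun2 annulus.
Proof.
have -> : annulus = (fun z => \1_(`](d ^+ 2), 1]%classic : set R) (enorm2 z)).
  by apply/funext => z; rewrite /annulus indicE mem_setE/= in_itv.
have m3 := @mfun_enorm2 R; rewrite /mfun2.
by apply: (measurableT_comp (measurable_indic _) m3); exact: measurable_itv.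
Qed.

Lemma integral_annulus :
  (\int[leb2]_z (annulus z / enorm2 z)%:E = (2 * pi * - ln d)%:E)%E.
Proof.
have a0 z : 0 <= annulus z by rewrite /annulus.
rewrite (weighted_logpolar mfun_annulus a0).
pose I : set (measurableTypeR R) := `](ln d), 0]%classic.
have mI : measurable I by exact: measurable_itv.
have E z : annulus (logpolar z) = \1_(I `*` setT) z.
  rewrite /annulus enorm2_logpolar indicE; congr (nat_of_bool _)%:R.
  have -> : d ^+ 2 = expR (2 * ln d) by rewrite expRM_natl lnK.
  rewrite ltr_expR -[X in _ <= X]expR0 ler_expR; apply/idP/idP.
    move=> /andP[h1 h2]; apply/mem_set; split => //=; rewrite /I/= in_itv/=; lra.
  move=> /set_mem[/= + _]; rewrite /I/= in_itv/= => /andP[h1 h2]; lra.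
transitivity (\int[mS]_z (\1_(I `*` (setT : set (measurableTypeR R))) z)%:E)%E.
  by apply: eq_integral => z _; rewrite E.
have mX : measurable (I `*` (setT : set (measurableTypeR R))) by exact: measurableX.
rewrite integral_indic// setIT.
transitivity (mu I * muT setT)%E; first by apply: product_measure1E.
rewrite muT_setT /I lebesgue_measure_itv/= lte_fin ln_lt0 ?d0// -EFinM.
by congr EFin; ring.
Qed.

(** The annulus between [d] and 1 contributes the logarithm, and the core, of area at most [4 d^2]
    with gradient squared of order [d^(-2)], only a constant. *)
Lemma bub_energy :
  (\int[leb2]_z (bub1 z ^+ 2 + bub2 z ^+ 2)%:E <= ((- ln d) / (2 * pi) + pi ^- 2)%:E)%E.
Proof.
have p0 := pi_gt0 R; have mi := @mfun_inv_enorm2 R; have ma := mfun_annulus.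
have mb := @mfun_boxR R d; have m1 := mfun_bub1; have m2 := mfun_bub2.
rewrite /mfun2 in mi ma mb m1 m2.
have mA : measurable_fun setT (fun z : plane => (annulus z / enorm2 z)%:E).
  by apply/measurable_EFinP; exact: measurable_funM.
have mB : measurable_fun setT (fun z : plane => (boxR d z)%:E) by exact/measurable_EFinP.
have A0 z : setT z -> (0 <= (annulus z / enorm2 z)%:E)%E.
  by move=> _; rewrite lee_fin divr_ge0 ?enorm2_ge0// /annulus.
have B0 z : setT z -> (0 <= (boxR d z)%:E)%E by move=> _; rewrite lee_fin boxR_ge0.
have c0 : (0 <= ((4 * pi ^+ 2)^-1)%:E :> \bar R)%E by rewrite lee_fin invr_ge0 mulr_ge0 ?sqr_ge0.
have e0 : (0 <= (d ^- 2)%:E)%E by rewrite lee_fin invr_ge0 sqr_ge0.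
have mdB := measurable_funeM (d ^- 2)%:E mB.
have dB0 z : setT z -> (0 <= (d ^- 2)%:E * (boxR d z)%:E)%E by move=> h; rewrite mule_ge0 ?B0.
apply: (@le_trans _ _ (\int[leb2]_z (((4 * pi ^+ 2)^-1)%:E *
    ((annulus z / enorm2 z)%:E + (d ^- 2)%:E * (boxR d z)%:E)))%E).
  apply: ge0_le_integral; [exact: measurableT| | | |].
  - by move=> z _; rewrite lee_fin addr_ge0 ?sqr_ge0.
  - by apply/measurable_EFinP; mfun.
  - by apply: measurable_funeM; exact: emeasurable_funD.
  - by move=> z _; exact: bub_gradient.
have mS' := emeasurable_funD mA mdB.
have S0 z : setT z -> (0 <= (annulus z / enorm2 z)%:E + (d ^- 2)%:E * (boxR d z)%:E)%E.
  by move=> h; rewrite adde_ge0 ?A0 ?dB0.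
rewrite (ge0_integralZl leb2 measurableT mS' S0 c0).
rewrite (ge0_integralD leb2 measurableT A0 mA dB0 mdB).
rewrite (ge0_integralZl leb2 measurableT mB B0 e0) integral_annulus integral_boxR_val ?(ltW d0)//.
rewrite le_eqVlt; apply/orP; left; apply/eqP; congr EFin.
by move: (pi : R) p0 => P P0; field; rewrite !gt_eqF.
Qed.

(** Log-polar coordinates leave out the origin, where [kk] is 0 by convention and the comparison
    with [bub] fails. *)
Lemma bub_mass NK : (\int[leb2]_z (kk z ^+ 2)%:E <= NK%:E)%E ->
  (\int[leb2]_z (bub z ^+ 2)%:E <= NK%:E)%E.
Proof.
move=> h; apply: le_trans h; have mk := @mfun_kk R; have mb := mfun_bub.
have q f : mfun2 f -> measurable_fun setT (fun z : plane => (f z ^+ 2)%:E).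
  by move=> mf; apply/measurable_EFinP; exact: measurable_funX.
have q0 f (z : plane) : (0 <= (f z ^+ 2)%:E :> \bar R)%E by rewrite lee_fin sqr_ge0.
rewrite (ge0_integral_logpolar (q _ mb) (q0 _)) (ge0_integral_logpolar (q _ mk) (q0 _)).
have ml f : mfun2 f -> measurable_fun setT (fun z : plane => ((expR z.1 ^+ 2)%:E * (f (logpolar z) ^+ 2)%:E)%E).
  move=> mf; apply: emeasurable_funM; first by apply/measurable_EFinP; mfun.
  exact: (measurableT_comp (q _ mf) (@measurable_logpolar R)).
apply: ge0_le_integral; [exact: measurableT| |exact: ml|exact: ml|].
- by move=> z _; rewrite mule_ge0// lee_fin sqr_ge0.
- move=> z _; apply: lee_wpmul2l; first by rewrite lee_fin sqr_ge0.
  have /andP[h1 h2] : 0 <= bub (logpolar z) <= kk (logpolar z).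
    apply: bub_le_kk; apply/eqP => E; have := enorm2_logpolar z.
    by rewrite E /enorm2/= expr0n addr0 => /eqP; rewrite lt_eqF// expR_gt0.
  by rewrite lee_fin; apply: lerXn2r; rewrite ?nnegrE// (le_trans h1).
Qed.

(** On the small box [|z|^2 + d^2 <= 2 d^2]; the profile exceeds [(- 1 - ln t) / (4 pi)], and
    [ln 2 <= 1] leaves only an additive loss. *)
Lemma bub_low z : d <= 1 / 2 -> boxR (d / 2) z = 1 -> (- ln d - 1) / (2 * pi) <= bub z.
Proof.
move=> d12; rewrite boxRE; case: (boolP (_ && _)) => [/andP[z1 z2] _|_ /eqP]; last by rewrite eq_sym oner_eq0.
have p0 := pi_gt0 R; have ht := t0 z.
have k (r : R) : `|r| <= d / 2 -> r ^+ 2 <= d ^+ 2 / 4.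
  move=> h; rewrite -real_normK ?num_real// (_ : d ^+ 2 / 4 = (d / 2) ^+ 2); last by field.
  by apply: lerXn2r; rewrite ?nnegrE// (le_trans _ h).
have h1 := k _ z1; have h2 := k _ z2.
have td : enorm2 z + d ^+ 2 <= 2 * d ^+ 2 by rewrite /enorm2; have := sqr_ge0 d; lra.
have d2 : d ^+ 2 <= 1 / 4 by have := d0; nra.
rewrite /bub /Kf indic01_01 ht/=.
case: (leP (enorm2 z + d ^+ 2) 1) => h; last by lra.
rewrite mul1r; set t := _ + _ in ht td h *.
have : ln t <= ln 2 + 2 * ln d.
  have -> : ln 2 + 2 * ln d = ln (2 * d ^+ 2).
    by rewrite lnM ?posrE ?exprn_gt0// expr2 lnM ?posrE//; ring.
  by rewrite ler_ln ?posrE// mulr_gt0// exprn_gt0.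
have l2 : ln 2 <= 1 :> R.
  have := @le_ln1Dx R 1; rewrite (_ : 1 + 1 = 2 :> R); last by ring.
  by apply; lra.
move=> lt; rewrite (_ : (- ln d - 1) / (2 * pi) = (- (2 * ln d) - 2) / (4 * pi)); last first.
  by move: (pi : R) p0 => P P0; field; rewrite gt_eqF.
apply: ler_wpM2r; first by rewrite invr_ge0 mulr_ge0// ltW.
lra.
Qed.

End truncated_kernel.

(** * The truncated logarithm as a competitor *)

Section test_function_energy.
Context {R : realType}.
Notation mu := (@lebesgue_measure R).
Notation plane := (measurableTypeR R * measurableTypeR R)%type.
Local Notation leb2 := (mu \x mu)%E.
Implicit Types (x y z : R * R) (f g : R * R -> R).

Lemma real_magnetic_partial (v : R * R) (b w f : R * R -> R) :
  (forall phi : R * R -> R, test_function phi ->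
    \int[leb2]_x (w x * phi x) = \int[leb2]_x (- (f x * 'D_v phi x))) ->
  is_magnetic_partial v b (fun x => (f x)%:C%C) (fun x => (w x +i* (b x * f x))%C).
Proof.
move=> h phi tphi; rewrite /cintegral; congr (_ +i* _)%C.
  transitivity (\int[leb2]_x (w x * phi x)).
    by apply: eq_Rintegral => x _ /=; ring.
  rewrite h//; apply: eq_Rintegral => x _ /=; ring.
by apply: eq_Rintegral => x _ /=; ring.
Qed.

(** The translated function lives within distance 1 of this point, hence at distance at least 1 from
    the singularity of the potential and of the weight. *)
Definition cc : R * R := (2, 0).

Lemma cbox_shift f : cbox f -> (exists C, forall z, `|f z| <= C * boxR 1 z) ->
  cbox (fun x => f (x - cc)).
Proof.
move=> [mf _] [C bf]; split; first exact: (measurableT_comp mf (measurable_translate2 (- cc))).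
exists C, 3 => x; apply: (le_trans (bf _)); have C0 : 0 <= C.
  have := le_trans (normr_ge0 _) (bf (0, 0)).
  by rewrite boxRE /= normr0 ler01 mulr1.
apply: ler_wpM2l => //; rewrite !boxRE /cc/= subr0 !ler_norml ler_nat.
by case: (boolP (_ && _)) => // /andP[/andP[h1 h2] /andP[h3 h4]];
  rewrite (_ : (_ && _) = true)//; apply/andP; split; apply/andP; split; lra.
Qed.

Variable d : R.
Hypotheses (d0 : 0 < d) (d12 : d <= 1 / 2).

Let d1 : d < 1. Proof. by have := d12; lra. Qed.

Let bx z := bub d (z - cc).
Let bx1 z := bub1 d (z - cc).
Let bx2 z := bub2 d (z - cc).

Let cb : cbox bx.
Proof. by apply: (cbox_shift (cbox_bub d0 d1)); exists (- ln (d ^+ 2) / (4 * pi)); exact: bub_bound. Qed.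

Let cb1 : cbox bx1.
Proof.
apply: (cbox_shift (cbox_bub1 d0)); exists (d ^- 2) => z.
by apply: bubi_sq => //; rewrite lerDl sqr_ge0.
Qed.

Let cb2 : cbox bx2.
Proof.
apply: (cbox_shift (cbox_bub2 d0)); exists (d ^- 2) => z.
by apply: bubi_sq => //; rewrite lerDr sqr_ge0.
Qed.

Let weak_by_parts (v : R * R) (w : R * R -> R) : cbox w ->
  (forall phi, smooth phi -> \int[leb2]_x ('D_v phi x * bx x + phi x * w x) = 0) ->
  forall phi : R * R -> R, test_function phi ->
    \int[leb2]_x (w x * phi x) = \int[leb2]_x (- (bx x * 'D_v phi x)).
Proof.
move=> cw h phi [sm _ _].
have cphi : continuous phi by move=> x; exact: differentiable_continuous (sm [::] x).
have cDphi : continuous (fun x => 'D_v phi x).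
  by move=> x; exact: differentiable_continuous (sm [:: v] x).
have i1 := ikernel_locM (continuous_locint cDphi) cb.
have i2 := ikernel_locM (continuous_locint cphi) cw.
have A := Rintegral_lin 1 1 i1 i2; have B := Rintegral_lin (-1) 0 i1 i1.
have C := h phi sm; rewrite mul0r addr0 mulN1r in B.
have A' : 0 = \int[leb2]_x ('D_v phi x * bx x) + \int[leb2]_x (phi x * w x).
  rewrite -C -[X in _ = X + _]mul1r -[X in _ = _ + X]mul1r -A.
  by apply: eq_Rintegral => x _; rewrite !mul1r.
transitivity (\int[leb2]_x (phi x * w x)); first by apply: eq_Rintegral => x _; rewrite mulrC.
transitivity (- \int[leb2]_x ('D_v phi x * bx x)).
  by apply/eqP; rewrite -addr_eq0 addrC -A'.
by rewrite -B; apply: eq_Rintegral => x _; ring.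
Qed.

Let translate_continuous f : continuous f -> continuous (fun z => f (z + cc)).
Proof.
move=> cf z; have h : (fun x : R * R => x + cc) @ z --> z + cc.
  by apply: cvgD; [exact: cvg_id|exact: cvg_cst].
exact: (cvg_comp _ _ h (cf (z + cc))).
Qed.

Let sub_add x : x - cc + cc = x. Proof. exact: subrK. Qed.

Lemma bub_weak1 phi : smooth phi ->
  \int[leb2]_x ('D_e1 phi x * bx x + phi x * bx1 x) = 0.
Proof.
move=> sm.
have cphi : continuous phi by move=> x; exact: differentiable_continuous (sm [::] x).
have cDphi : continuous (fun x => 'D_e1 phi x).
  by move=> x; exact: differentiable_continuous (sm [:: e1] x).
have W := weak_bub1 d0 d1 (translate_continuous cphi) (translate_continuous cDphi)
  (fun t b => is_derive_shift1 (diff_derivable (sm [::] ((t, b) + cc)))).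
rewrite -[RHS]W -[RHS](Rintegral_translate2 (- cc)).
  by apply: eq_Rintegral => x _; rewrite sub_add.
have m1 := mfun2_continuous (translate_continuous cphi).
have m2 := mfun2_continuous (translate_continuous cDphi).
have m3 := mfun_bub d; have m4 := mfun_bub1 d; rewrite /mfun2 in m1 m2 m3 m4.
by rewrite /mfun2; apply: measurable_funD; apply: measurable_funM.
Qed.

Lemma bub_weak2 phi : smooth phi ->
  \int[leb2]_x ('D_e2 phi x * bx x + phi x * bx2 x) = 0.
Proof.
move=> sm.
have cphi : continuous phi by move=> x; exact: differentiable_continuous (sm [::] x).
have cDphi : continuous (fun x => 'D_e2 phi x).
  by move=> x; exact: differentiable_continuous (sm [:: e2] x).
have W := weak_bub2 d0 d1 (translate_continuous cphi) (translate_continuous cDphi)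
  (fun t b => is_derive_shift2 (diff_derivable (sm [::] ((b, t) + cc)))).
rewrite -[RHS]W -[RHS](Rintegral_translate2 (- cc)).
  by apply: eq_Rintegral => x _; rewrite sub_add.
have m1 := mfun2_continuous (translate_continuous cphi).
have m2 := mfun2_continuous (translate_continuous cDphi).
have m3 := mfun_bub d; have m4 := mfun_bub2 d; rewrite /mfun2 in m1 m2 m3 m4.
by rewrite /mfun2; apply: measurable_funD; apply: measurable_funM.
Qed.

Variable a : R.

Definition ub x : R[i] := (bub d (x - cc))%:C%C.
Definition ub1 x : R[i] := (bub1 d (x - cc) +i* ((potential a x).1 * bub d (x - cc)))%C.
Definition ub2 x : R[i] := (bub2 d (x - cc) +i* ((potential a x).2 * bub d (x - cc)))%C.

Lemma ub_magnetic_gradient : is_magnetic_gradient a ub ub1 ub2.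
Proof.
split; apply: real_magnetic_partial; apply: weak_by_parts => //; first exact: bub_weak1.
exact: bub_weak2.
Qed.

Lemma bub_far x : bx x != 0 -> 1 <= enorm2 x.
Proof.
move=> b; have [C bC] : exists C, forall z, `|bub d z| <= C * boxR 1 z.
  by exists (- ln (d ^+ 2) / (4 * pi)); exact: bub_bound.
have : boxR 1 (x - cc) != 0.
  apply: contra b => /eqP h; have := bC (x - cc); rewrite h mulr0 normr_le0; exact.
rewrite boxRE /cc/=; case: (boolP (_ && _)) => [/andP[+ _] _|_ /eqP//].
rewrite ler_norml /enorm2 => /andP[h1 h2]; have := sqr_ge0 x.2; nra.
Qed.

Let weight x : bx x ^+ 2 / enorm2 x <= bx x ^+ 2.
Proof.
have [->|b] := eqVneq (bx x) 0; first by rewrite expr0n mul0r.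
have h := bub_far b; rewrite ler_pdivrMr; last by lra.
by rewrite ler_peMr// sqr_ge0.
Qed.

Let cmod_ub x : cmod (ub x) ^+ 2 = bx x ^+ 2.
Proof. by rewrite cmod_sq /= expr0n addr0. Qed.

Let cmod_grad x : cmod (ub1 x) ^+ 2 + cmod (ub2 x) ^+ 2 =
  bx1 x ^+ 2 + bx2 x ^+ 2 + a ^+ 2 * (bx x ^+ 2 / enorm2 x).
Proof.
rewrite !cmod_sq /= -/(bx x) -/(bx1 x) -/(bx2 x).
have [->|b] := eqVneq (bx x) 0; first by rewrite !mulr0 !expr0n mul0r mulr0 !addr0.
have e0 : enorm2 x != 0 by rewrite gt_eqF// (lt_le_trans ltr01)// bub_far.
have -> : bx1 x ^+ 2 + (a / enorm2 x * x.2 * bx x) ^+ 2 +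
    (bx2 x ^+ 2 + (a / enorm2 x * - x.1 * bx x) ^+ 2) =
    bx1 x ^+ 2 + bx2 x ^+ 2 + a ^+ 2 * (bx x ^+ 2 * ((x.1 ^+ 2 + x.2 ^+ 2) / enorm2 x ^+ 2)).
  by rewrite !exprMn !exprVn sqrrN; ring.
by congr (_ + _ * (_ * _)); rewrite -/(enorm2 x) expr2 invfM mulrA mulfV// mul1r.
Qed.

Let tr (F : R * R -> R) : mfun2 F -> (forall z, 0 <= F z) ->
  (\int[leb2]_x (F (x - cc))%:E = \int[leb2]_z (F z)%:E)%E.
Proof.
move=> mF F0; have mE : measurable_fun setT (fun z : plane => (F z)%:E) by exact/measurable_EFinP.
exact: (ge0_integral_leb2_translate (- cc) mE (fun z => F0 z)).
Qed.

Let mbx : mfun2 bx := cb.1.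
Let mbx1 : mfun2 bx1 := cb1.1.
Let mbx2 : mfun2 bx2 := cb2.1.

Let msq f : mfun2 f -> measurable_fun setT (fun x : plane => (f x ^+ 2)%:E).
Proof. by move=> mf; apply/measurable_EFinP; exact: measurable_funX. Qed.

Let mwt : measurable_fun setT (fun x : plane => (bx x ^+ 2 / enorm2 x)%:E).
Proof.
have mi := @mfun_inv_enorm2 R; apply/measurable_EFinP; apply: measurable_funM => //.
exact: measurable_funX mbx.
Qed.

Let w0 x : setT x -> (0 <= (bx x ^+ 2 / enorm2 x)%:E)%E.
Proof. by move=> _; rewrite lee_fin divr_ge0 ?sqr_ge0 ?enorm2_ge0. Qed.

Variable NK : R.
Hypothesis kN : (\int[leb2]_z (kk z ^+ 2)%:E <= NK%:E)%E.

Let wle : (\int[leb2]_x (bx x ^+ 2 / enorm2 x)%:E <= NK%:E)%E.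
Proof.
apply: le_trans (bub_mass d0 kN).
rewrite -(tr (F := fun z => bub d z ^+ 2)); last 2 first.
- exact: measurable_funX (mfun_bub d).
- by move=> z; exact: sqr_ge0.
apply: ge0_le_integral; [exact: measurableT|exact: w0|exact: mwt|exact: msq|].
by move=> x _; rewrite lee_fin; exact: weight.
Qed.

Let grad_le : (\int[leb2]_x (bx1 x ^+ 2 + bx2 x ^+ 2)%:E <= ((- ln d) / (2 * pi) + pi ^- 2)%:E)%E.
Proof.
rewrite (tr (F := fun z => bub1 d z ^+ 2 + bub2 d z ^+ 2)).
- exact: bub_energy.
- apply: measurable_funD; apply: measurable_funX; [exact: mfun_bub1|exact: mfun_bub2].
- by move=> z; rewrite addr_ge0 ?sqr_ge0.
Qed.

Let mgr : measurable_fun setT (fun x : plane => (bx1 x ^+ 2 + bx2 x ^+ 2)%:E).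
Proof. by apply/measurable_EFinP; apply: measurable_funD; apply: measurable_funX. Qed.

(** The function is real, so the potential enters only through [|A|^2 = a^2 / |x|^2] and merely adds
    [a^2] to the coefficient of the weighted mass. *)
Lemma ub_energy : (\int[leb2]_x (cmod (ub1 x) ^+ 2 + cmod (ub2 x) ^+ 2)%:E =
  \int[leb2]_x (bx1 x ^+ 2 + bx2 x ^+ 2)%:E +
  (a ^+ 2)%:E * \int[leb2]_x (bx x ^+ 2 / enorm2 x)%:E)%E.
Proof.
have a0 : (0 <= (a ^+ 2)%:E)%E by rewrite lee_fin sqr_ge0.
rewrite -(ge0_integralZl leb2 measurableT mwt w0 a0).
have g0 x : setT x -> (0 <= (bx1 x ^+ 2 + bx2 x ^+ 2)%:E)%E.
  by move=> _; rewrite lee_fin addr_ge0 ?sqr_ge0.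
have aw0 x : setT x -> (0 <= (a ^+ 2)%:E * (bx x ^+ 2 / enorm2 x)%:E)%E.
  by move=> h; rewrite mule_ge0 ?w0.
rewrite -(ge0_integralD leb2 measurableT g0 mgr aw0 (measurable_funeM _ mwt)).
by apply: eq_integral => x _; rewrite cmod_grad.
Qed.

Lemma ub_rhs (lam : R) :
  (\int[leb2]_x (cmod (ub1 x) ^+ 2 + cmod (ub2 x) ^+ 2)%:E +
   lam%:E * \int[leb2]_x (cmod (ub x) ^+ 2 / enorm2 x)%:E <=
   ((- ln d) / (2 * pi) + pi ^- 2 + `|a ^+ 2 + lam| * NK)%:E)%E.
Proof.
have -> : (\int[leb2]_x (cmod (ub x) ^+ 2 / enorm2 x)%:E = \int[leb2]_x (bx x ^+ 2 / enorm2 x)%:E)%E.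
  by apply: eq_integral => x _; rewrite cmod_ub.
rewrite ub_energy.
have W0 : (0 <= \int[leb2]_x (bx x ^+ 2 / enorm2 x)%:E)%E by apply: integral_ge0; exact: w0.
have G0 : (0 <= \int[leb2]_x (bx1 x ^+ 2 + bx2 x ^+ 2)%:E)%E.
  by apply: integral_ge0 => x _; rewrite lee_fin addr_ge0 ?sqr_ge0.
move: W0 G0 wle grad_le; case: (\int[leb2]_x (bx x ^+ 2 / enorm2 x)%:E)%E => [W||]//.
case: (\int[leb2]_x (bx1 x ^+ 2 + bx2 x ^+ 2)%:E)%E => [G||]//.
rewrite !lee_fin => W0 G0 WN GL.
rewrite -addrA -mulrDl; apply: lerD => //.
apply: (@le_trans _ _ (`|a ^+ 2 + lam| * W)); first by rewrite ler_wpM2r// ler_norm.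
by rewrite ler_wpM2l.
Qed.

Lemma ub_H_A : [/\ H_A a ub, L2 ub1 & L2 ub2].
Proof.
have mp i : mfun2 (fun x => (if i then (potential a x).1 else (potential a x).2) * bx x).
  have mi := @mfun_inv_enorm2 R; have mb := mbx; rewrite /mfun2 in mi mb; rewrite /mfun2 /potential.
  by case: i => /=; mfun.
have L0 : L2 ub.
  split; first by split => /=; [exact: mbx|exact: measurable_cst].
  apply: (@le_lt_trans _ _ (\int[leb2]_z (bub d z ^+ 2)%:E)%E).
    rewrite -(tr (F := fun z => bub d z ^+ 2)); last 2 first.
    - exact: measurable_funX (mfun_bub d).
    - by move=> z; exact: sqr_ge0.
    by rewrite le_eqVlt; apply/orP; left; apply/eqP; apply: eq_integral => x _; rewrite cmod_ub.
  exact: le_lt_trans (bub_mass d0 kN) (ltry _).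
have E : (\int[leb2]_x (cmod (ub1 x) ^+ 2 + cmod (ub2 x) ^+ 2)%:E < +oo)%E.
  have := ub_rhs 0; rewrite mul0e adde0 => /le_lt_trans; apply; exact: ltry.
have M1 : cmeasurable ub1 by split; [exact: mbx1|exact: (mp true)].
have M2 : cmeasurable ub2 by split; [exact: mbx2|exact: (mp false)].
have mc G : cmeasurable G -> measurable_fun setT (fun x : plane => cmod (G x) ^+ 2).
  by move=> [m1 m2]; under eq_fun do rewrite cmod_sq; mfun.
have L1 : L2 ub1.
  split => //; apply: le_lt_trans E; apply: ge0_le_integral; [exact: measurableT| | | |].
  - by move=> x _; rewrite lee_fin sqr_ge0.
  - by apply/measurable_EFinP; exact: mc.
  - by apply/measurable_EFinP; apply: measurable_funD; exact: mc.
  - by move=> x _; rewrite lee_fin lerDl sqr_ge0.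
have L2' : L2 ub2.
  split => //; apply: le_lt_trans E; apply: ge0_le_integral; [exact: measurableT| | | |].
  - by move=> x _; rewrite lee_fin sqr_ge0.
  - by apply/measurable_EFinP; exact: mc.
  - by apply/measurable_EFinP; apply: measurable_funD; exact: mc.
  - by move=> x _; rewrite lee_fin lerDr sqr_ge0.
split => //; split => //; exists ub1, ub2; split => //; exact: ub_magnetic_gradient.
Qed.

Let K := (- ln d - 1) / (2 * pi).

(** The box of side [d] around [cc] has area [d^2]; there the function is at least [K] and [|x|^2]
    at most 9. *)
Lemma ub_lower (p : R) : 0 <= p -> 1 <= - ln d ->
  ((K `^ p * (d ^+ 2 / 9))%:E <= \int[leb2]_x (cmod (ub x) `^ p / enorm2 x)%:E)%E.
Proof.
move=> p0 dl; have pp := pi_gt0 R; have d20 : 0 <= d / 2 by rewrite divr_ge0// ltW.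
have K0 : 0 <= K by rewrite /K divr_ge0 ?subr_ge0// mulr_ge0// ltW.
have mb := @mfun_boxR R (d / 2); have mi := @mfun_inv_enorm2 R.
have mbE : measurable_fun setT (fun z : plane => (boxR (d / 2) z)%:E) by exact/measurable_EFinP.
have c0 : (0 <= (K `^ p / 9)%:E)%E by rewrite lee_fin divr_ge0 ?powR_ge0.
have -> : ((K `^ p * (d ^+ 2 / 9))%:E = \int[leb2]_x ((K `^ p / 9)%:E * (boxR (d / 2) (x - cc))%:E))%E.
  have mbs : measurable_fun setT (fun x : plane => (boxR (d / 2) (x - cc))%:E).
    exact: (measurableT_comp mbE (measurable_translate2 (- cc))).
  rewrite (ge0_integralZl leb2 measurableT mbs (fun x _ => boxR_ge0 _ _) c0).
  rewrite (tr mb (boxR_ge0 _)) (integral_boxR_val d20) -EFinM; congr EFin; by field.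
have cE x : cmod (ub x) = `|bx x|.
  by rewrite /cmod /= expr0n addr0 sqrtr_sqr.
apply: ge0_le_integral; [exact: measurableT| | | |].
- by move=> x _; rewrite -EFinM lee_fin mulr_ge0 ?boxR_ge0// divr_ge0 ?powR_ge0.
- apply: measurable_funeM.
  exact: (measurableT_comp mbE (measurable_translate2 (- cc))).
- apply/measurable_EFinP; apply: measurable_funM => //.
  under eq_fun do rewrite cE.
  apply: (measurableT_comp (measurable_powR p)).
  exact: (measurableT_comp (@normr_measurable _ setT) mbx).
- move=> x _; rewrite -EFinM lee_fin cE.
  have [|b] := boolP (boxR (d / 2) (x - cc) == 1); last first.
    have -> : boxR (d / 2) (x - cc) = 0.
      by move: b; rewrite boxRE; case: (_ && _) => //; rewrite eqxx.
    by rewrite mulr0 divr_ge0 ?powR_ge0 ?enorm2_ge0.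
  move=> /eqP b1; rewrite b1 mulr1; have h := bub_low d0 d12 b1.
  move: b1; rewrite boxRE; case: (boolP (_ && _)) => [|_ /eqP]; last by rewrite eq_sym oner_eq0.
  rewrite /cc/= subr0 !ler_norml => /andP[/andP[x1 x2] /andP[x3 x4]] _.
  have d12' := d12.
  have e1 : 0 < enorm2 x by rewrite /enorm2; have := sqr_ge0 x.2; nra.
  have e9 : enorm2 x <= 9 by rewrite /enorm2; nra.
  apply: ler_pM; rewrite ?powR_ge0 ?invr_ge0//.
    apply: ge0_ler_powR; rewrite ?nnegrE//.
    by apply: (le_trans h); exact: ler_norm.
  by rewrite lef_pV2 ?posrE.
Qed.

Lemma admissible_le (lam p C : R) : 0 < p -> 1 <= - ln d -> 0 <= C ->
  interpolation_constants a lam p C ->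
  C * ((- ln d - 1) / (2 * pi)) ^+ 2 * (d ^+ 2 / 9) `^ (2 / p) <=
  (- ln d) / (2 * pi) + pi ^- 2 + `|a ^+ 2 + lam| * NK.
Proof.
move=> p0 dl C0 hC; have [hu h1 h2] := ub_H_A.
have H := le_trans (hC _ _ _ hu h1 h2 ub_magnetic_gradient) (ub_rhs lam).
have low := ub_lower (ltW p0) dl; have pp := pi_gt0 R.
have K0 : 0 <= K by rewrite /K divr_ge0 ?subr_ge0// mulr_ge0// ltW.
have X0 : 0 <= K `^ p * (d ^+ 2 / 9) by rewrite mulr_ge0 ?powR_ge0 ?divr_ge0 ?sqr_ge0.
have low2 : (((K `^ p * (d ^+ 2 / 9)) `^ (2 / p))%:E <=
    (\int[leb2]_x (cmod (ub x) `^ p / enorm2 x)%:E) `^ (2 / p))%E.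
  have r0 : 0 <= 2 / p by rewrite divr_ge0 ?ltW.
  have := gt0_ler_poweR r0 _ _ low; rewrite poweR_EFin; apply.
    by rewrite in_itv/= lee_fin X0 leey.
  by rewrite in_itv/= leey andbT; apply: le_trans low; rewrite lee_fin.
have := le_trans (lee_wpmul2l (ltac:(by rewrite lee_fin) : (0 <= C%:E)%E) low2) H.
rewrite -EFinM lee_fin powRM ?powR_ge0 ?divr_ge0 ?sqr_ge0//.
rewrite -powRrM (_ : p * (2 / p) = 2); last by rewrite mulrC divfK// gt_eqF.
by rewrite powR_mulrn// mulrA.
Qed.

End test_function_energy.

(** * The limit *)

Section asymptotics.
Context {R : realType}.
Implicit Types (a lambda p C U : R).

Lemma optimal_bound a lambda U : 8 * pi * expR 1 < U ->
  \forall p \near +oo, forall C, interpolation_constants a lambda p C -> C <= U / p.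
Proof.
move=> hU; have pp := pi_gt0 R; have e0 := expR_gt0 (1 : R); have p2 := @pi_ge2 R.
have l12 : 1 < 2 :> R by lra.
have kN := kkX_integral 1 (@ltr01 R) l12.
(* [D] gathers the bounded part of the energy, so that for [d = e^(-l)] the whole is at most
   [(l + D) / (2 pi)]. *)
set NK := _ * _ in kN; pose D := 2 * pi * (pi ^- 2 + `|a ^+ 2 + lambda| * NK).
have P0 : 0 < 8 * pi * expR 1 :> R by rewrite !mulr_gt0.
have U0 : 0 < U by lra.
(* [U = 8 pi e r^2]: one factor [r > 1] absorbs [e^q], the other the ratio of [l (l + D)] to
   [(l - 1)^2]. *)
pose r := Num.sqrt (U / (8 * pi * expR 1)).
have r2 : r ^+ 2 = U / (8 * pi * expR 1) by rewrite sqr_sqrtr// divr_ge0// ltW.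
have r1 : 1 < r.
  have r0 : 0 <= r by exact: sqrtr_ge0.
  by rewrite -(@ltr_pXn2r _ 2)// ?nnegrE// expr1n r2 ltr_pdivlMr// mul1r.
have lr : 0 < ln r by exact: ln_gt0.
near=> p.
have p8 : 8 <= p by near: p; apply: nbhs_pinfty_ge; exact: num_real.
have pr : 4 * (ln 9 / (2 * ln r)) <= p by near: p; apply: nbhs_pinfty_ge; exact: num_real.
have pD : 4 * ((2 * r + D) / (r - 1)) <= p by near: p; apply: nbhs_pinfty_ge; exact: num_real.
move=> C hC; have p0 : 0 < p by lra.
have [C0|C0] := leP 0 C; last by rewrite (le_trans (ltW C0))// divr_ge0// ltW.
pose l := p / 4; have l2 : 2 <= l by rewrite /l; lra.
have pl : p = 4 * l by rewrite /l; field.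
have lnd : ln (expR (- l)) = - l by rewrite expRK.
have d12 : expR (- l) <= 1 / 2 :> R.
  rewrite expRN div1r lef_pV2 ?posrE ?expR_gt0//.
  by apply: le_trans (expR_ge1Dx _); lra.
have := admissible_le (expR_gt0 _) d12 kN p0 _ C0 hC.
rewrite lnd opprK => H; have {}H := H (ltac:(lra)).
(* With [p = 4 l], [(d^2 / 9)^(2 / p)] is [e^(-1)] times [e^(-q)]: the scale yields the factor [e],
   and the 9 a correction that tends to 1. *)
pose q := ln 9 / (2 * l).
have e9 : (expR (- l) ^+ 2 / 9) `^ (2 / p) = expR (- (1 + q)).
  have -> : expR (- l) ^+ 2 / 9 = expR (- (2 * l) - ln 9) :> R.
    by rewrite expRD [expR (- ln 9)]expRN lnK ?posrE// -expRM_natl mulrN.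
  rewrite -expRM; congr expR; rewrite pl /q; field.
  by rewrite gt_eqF//; lra.
have q0 : expR q <= r.
  rewrite -[leRHS]lnK ?posrE ?(lt_trans ltr01)// ler_expR /q.
  have l0 : 0 < 2 * l by lra.
  rewrite ler_pdivrMr//; move: pr; rewrite pl ler_pM2l//.
  by rewrite ler_pdivrMr ?mulr_gt0//; lra.
have X0 : 0 < (l - 1) ^+ 2 by rewrite exprn_gt0//; lra.
have lX : l * (l + D) <= r * (l - 1) ^+ 2.
  have rm : 0 < r - 1 by lra.
  move: pD; rewrite pl ler_pM2l// ler_pdivrMr// => pD.
  have : l * (2 * r + D) <= l * (l * (r - 1)) by apply: ler_wpM2l => //; lra.
  lra.
rewrite ler_pdivlMr// -(ler_pM2r X0).
rewrite e9 expRN in H.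
have H2 : C * (l - 1) ^+ 2 <= 2 * pi * (l + D) * expR (1 + q).
  have -> : C * (l - 1) ^+ 2 = (C * ((l - 1) / (2 * pi)) ^+ 2 / expR (1 + q)) *
      ((2 * pi) ^+ 2 * expR (1 + q)).
    move: (expR (1 + q)) (expR_gt0 (1 + q)) (pi : R) pp => E E0 P PP; field.
    by rewrite !gt_eqF.
  have -> : 2 * pi * (l + D) * expR (1 + q) =
      (l / (2 * pi) + pi ^- 2 + `|a ^+ 2 + lambda| * NK) * ((2 * pi) ^+ 2 * expR (1 + q)).
    rewrite /D; move: (expR (1 + q)) (`|_| * NK) (pi : R) pp => E B P PP; field.
    by rewrite !gt_eqF.
  by apply: ler_wpM2r => //; rewrite mulr_ge0 ?sqr_ge0 ?expR_ge0.
have D0 : 0 <= D.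
  rewrite /D mulr_ge0 ?mulr_ge0 ?pi_ge0// addr_ge0 ?invr_ge0 ?sqr_ge0// mulr_ge0//.
  rewrite -lee_fin; apply: le_trans kN; apply: integral_ge0 => z _.
  by rewrite lee_fin sqr_ge0.
have -> : U * (l - 1) ^+ 2 = 8 * pi * expR 1 * r * (r * (l - 1) ^+ 2).
  have -> : U = 8 * pi * expR 1 * r ^+ 2 by rewrite r2 mulrCA mulfV ?mulr1// gt_eqF.
  by ring.
apply: (@le_trans _ _ (8 * pi * expR 1 * r * (l * (l + D)))); last first.
  by apply: ler_wpM2l => //; rewrite mulr_ge0 ?(ltW P0)//; lra.
have -> : C * p * (l - 1) ^+ 2 = (C * (l - 1) ^+ 2) * (4 * l) by rewrite pl; ring.
apply: (@le_trans _ _ (2 * pi * (l + D) * expR (1 + q) * (4 * l))).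
  by apply: ler_wpM2r => //; lra.
have -> : 2 * pi * (l + D) * expR (1 + q) * (4 * l) = 8 * pi * expR 1 * (l * (l + D)) * expR q.
  by rewrite expRD; ring.
have -> : 8 * pi * expR 1 * r * (l * (l + D)) = 8 * pi * expR 1 * (l * (l + D)) * r by ring.
apply: ler_wpM2l => //; rewrite mulr_ge0 ?(ltW P0)// mulr_ge0 ?addr_ge0//; lra.
Unshelve. all: by end_near. Qed.

Lemma squeeze_mu_opt a lambda l :
  (forall L, 0 < L -> L < l -> \forall p \near +oo, interpolation_constants a lambda p (L / p)) ->
  (forall U, l < U -> \forall p \near +oo,
    forall C, interpolation_constants a lambda p C -> C <= U / p) ->
  0 < l -> (p%:E * mu_opt a lambda p)%E @[p --> +oo] --> l%:E.
Proof.
move=> low up l0.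
have lo L : 0 < L -> L < l -> \forall p \near +oo, (L%:E <= p%:E * mu_opt a lambda p)%E.
  move=> L0 Ll; have h := low L L0 Ll; near=> p.
  have p0 : 0 < p by near: p; apply: nbhs_pinfty_gt; exact: num_real.
  have hp : interpolation_constants a lambda p (L / p) by near: p.
  have -> : L%:E = (p%:E * (L / p)%:E)%E by rewrite -EFinM mulrC divfK// gt_eqF.
  apply: lee_wpmul2l; first by rewrite lee_fin ltW.
  by apply: ereal_sup_ubound; exists (L / p).
have hi U : l < U -> \forall p \near +oo, (p%:E * mu_opt a lambda p <= U%:E)%E.
  move=> lU; have h := up U lU; near=> p.
  have p0 : 0 < p by near: p; apply: nbhs_pinfty_gt; exact: num_real.
  have hp : forall C, interpolation_constants a lambda p C -> C <= U / p by near: p.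
  have -> : U%:E = (p%:E * (U / p)%:E)%E by rewrite -EFinM mulrC divfK// gt_eqF.
  apply: lee_wpmul2l; first by rewrite lee_fin ltW.
  by apply: ge_ereal_sup => _ [C hC <-]; rewrite lee_fin; exact: hp.
apply/fine_cvgP; split.
  have h1 := lo (l / 2) (ltac:(lra)) (ltac:(lra)).
  have h2 := hi (l + 1) (ltac:(lra)).
  near=> p.
  have q1 : ((l / 2)%:E <= p%:E * mu_opt a lambda p)%E by near: p.
  have q2 : (p%:E * mu_opt a lambda p <= (l + 1)%:E)%E by near: p.
  by move: q1 q2; case: (p%:E * mu_opt a lambda p)%E.
apply/cvgrPdist_le => e e0.
pose L := l - Num.min e (l / 2).
have L0 : 0 < L by rewrite /L subr_gt0 gt_min; apply/orP; right; lra.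
have Ll : L < l by rewrite /L ltrBlDr ltrDl lt_min e0 divr_gt0.
have Le : l - e <= L by rewrite /L lerB// ge_min lexx.
have lU : l < l + e by rewrite ltrDl.
have h1 := lo L L0 Ll; have h2 := hi (l + e) lU.
near=> p.
have q1 : (L%:E <= p%:E * mu_opt a lambda p)%E by near: p.
have q2 : (p%:E * mu_opt a lambda p <= (l + e)%:E)%E by near: p.
move: q1 q2; rewrite /=; case: (p%:E * mu_opt a lambda p)%E => [x||]//.
rewrite !lee_fin /= => q1 q2; rewrite ler_norml; apply/andP; split; lra.
Unshelve. all: by end_near. Qed.

End asymptotics.

Theorem corollary1p4 (R : realType) (a lambda : R)
  (hlambda : - inf (range (fun n : int => (n%:~R - a) ^+ 2)) < lambda) :
  (p%:E * mu_opt a lambda p)%E @[p --> +oo] --> (8 * pi * expR 1)%:E.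
Proof.
apply: squeeze_mu_opt.
- by move=> L L0 Ll; exact: eventually_admissible.
- by move=> U lU; exact: optimal_bound.
- by rewrite !mulr_gt0 ?pi_gt0 ?expR_gt0.
Qed.
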